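(* If $d_1\geq 4$ and $2|d_1$ or $3|d_1$ then there is a definable open set $U\subseteq \mathbb{C}^g\times \mathcal{H}_g$ containing $\mathcal{X}^D(\mathfrak{F}^D_g)$ such that $\Phi^D\restriction U$ is definable in $\mathbb{R}_{an,exp}$.
   Context: $D=diag(d_1,\dots,d_g)$ is a polarization type (positive integers $d_1|\cdots|d_g$). $\mathcal{H}_g=\{\tau\in Sym(g,\mathbb{C}): Im(\tau)\text{ positive definite}\}$, with $Sp(2g,\mathbb{R})$ acting by $\begin{pmatrix}\alpha&\beta\\ \gamma&\delta\end{pmatrix}\cdot\tau=(\alpha\tau+\beta)(\gamma\tau+\delta)^{-1}$. For $(z,\tau)\in\mathbb{C}^g\times\mathcal{H}_g$, $\vartheta(z,\tau)=\sum_{k\in\mathbb{Z}^g}\exp\bigl(\pi i({}^t k\tau k+2\,{}^t k z)\bigr)$ and $\vartheta\begin{bmatrix} a\\ b\end{bmatrix}(z,\tau)=\exp\bigl(\pi i({}^t a\tau a+2\,{}^t a(z+b))\bigr)\vartheta(z+\tau a+b,\tau)$. With $c_0,\dots,c_N$ representatives of the cosets of $\mathbb{Z}^g$ in $D^{-1}\mathbb{Z}^g$, $\varphi^D(z,\tau)=\bigl(\vartheta\begin{bmatrix} c_0\\ 0\end{bmatrix}(z,\tau):\cdots:\vartheta\begin{bmatrix} c_N\\ 0\end{bmatrix}(z,\tau)\bigr)\in\mathbb{P}^N(\mathbb{C})$, and $\Phi^D(z,\tau)=(\varphi^D(z,\tau),\varphi^D(0,\tau))\in\mathbb{P}^N(\mathbb{C})\times\mathbb{P}^N(\mathbb{C})$.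 Let $G_D=\{M\in Sp(2g,\mathbb{Q}): \begin{pmatrix}I&0\\0&D\end{pmatrix}^{-1}M\begin{pmatrix}I&0\\0&D\end{pmatrix}\in M_{2g}(\mathbb{Z})\}$, and $G_D(D)_0$ the set of $\begin{pmatrix}\alpha&\beta\\ \gamma&\delta\end{pmatrix}\in G_D$ with $\alpha=I_g+Da$, $\beta=DbD$, $\gamma=c$, $\delta=I_g+dD$ for some $a,b,c,d\in M_g(\mathbb{Z})$, and such that the diagonal entries of $D^{-1}\alpha\,{}^t\beta D^{-1}$ and of $\gamma\,{}^t\delta$ are even integers; it is a finite index subgroup of $Sp(2g,\mathbb{Z})$. The Siegel fundamental set $\mathfrak{F}_g$ is the set of $\tau\in Sym(g,\mathbb{C})$ with $Im(\tau)$ Minkowski reduced, $|Re(\tau_{i,j})|\leq 1/2$, and $|\det(\gamma\tau+\delta)|\geq 1$ for all $\begin{pmatrix}\alpha&\beta\\ \gamma&\delta\end{pmatrix}\in Sp(2g,\mathbb{Z})$; $\mathfrak{F}^D_g$ is a fixed Siegel fundamental set for $G_D(D)_0$, i.e. $\bigcup_i\gamma_i\cdot\mathfrak{F}_g$ for left coset representatives $\gamma_i$ of $G_D(D)_0$ in $Sp(2g,\mathbb{Z})$. With columns $\tau_{(i)},D_{(j)}$, $\bar E^D_\tau=\{\sum_i t_i\tau_{(i)}+\sum_j s_jD_{(j)}:0\leq t_i,s_j\leq 1\}$ and $\mathcal{X}^D(V)=\{(z,\tau)\in\mathbb{C}^g\times\mathcal{H}_g:\tau\in V,\ z\in\bar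 E^D_\tau\}$. $\mathbb{R}_{an,exp}$ is the real field expanded by the real exponential and all restricted analytic functions. *)

(* Defs.v *)
From HB Require Import structures.
From mathcomp Require Import all_boot all_order all_algebra.
From mathcomp Require Import all_classical all_reals all_analysis.
From mathcomp Require Import complex.

Set Implicit Arguments.
Unset Strict Implicit.
Unset Printing Implicit Defensive.

Import Order.TTheory GRing.Theory Num.Theory.
Import numFieldNormedType.Exports.

Local Open Scope classical_set_scope.
Local Open Scope ring_scope.
Local Open Scope complex_scope.

(* Sum of an absolutely summable real family over an arbitrary index type.
   [fine] makes it total, so the value only means something under [summable]. *)
Definition sumR (R : realType) (I : choiceType) (f : I -> R) : R :=
  fine (\esum_(i in setT) (Num.max (f i) 0)%:E)
  - fine (\esum_(i in setT) (Num.max (- f i) 0)%:E).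

Definition sumC (R : realType) (I : choiceType) (f : I -> R[i]) : R[i] :=
  sumR (fun i => complex.Re (f i)) +i* sumR (fun i => complex.Im (f i)).

Definition real_analytic_at (R : realType) (m : nat) (f : 'rV[R]_m -> R)
    (p : 'rV[R]_m) : Prop :=
  exists (r : R) (a : {ffun 'I_m -> nat} -> R), 0 < r /\
    forall x : 'rV[R]_m, (forall i, `|x ord0 i - p ord0 i| < r) ->
      let mono (k : {ffun 'I_m -> nat}) :=
        a k * \prod_(i < m) (x ord0 i - p ord0 i) ^+ k i in
      summable setT (fun k => (mono k)%:E) /\ f x = sumR mono.

Definition in_unit_cube (R : realType) (m : nat) (x : 'rV[R]_m) : Prop :=
  forall i, -1 <= x ord0 i <= 1.

Definition restricted_analytic (R : realType) (m : nat)
    (f : 'rV[R]_m -> R) : Prop :=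
  exists (O : set 'rV[R]_m) (F : 'rV[R]_m -> R),
    [/\ open O,
        (forall x, in_unit_cube x -> O x),
        (forall x, O x -> real_analytic_at F x),
        (forall x, in_unit_cube x -> f x = F x) &
        (forall x, ~ in_unit_cube x -> f x = 0)].

(* [Cst] makes all reals available as parameters. *)
Inductive term (R : realType) : Type :=
| Var of nat
| Cst of R
| Add of term R & term R
| Opp of term R
| Mul of term R & term R
| Exp of term R
| An (m : nat) (f : 'rV[R]_m -> R) of restricted_analytic f & ('I_m -> term R).

Inductive formula (R : realType) : Type :=
| FEq of term R & term R
| FLt of term R & term R
| FNot of formula R
| FAnd of formula R & formula R
| FExists of nat & formula R.

Fixpoint eval (R : realType) (e : nat -> R) (t : term R) : R :=
  match t with
  | Var k => e k
  | Cst c => c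
  | Add t1 t2 => eval e t1 + eval e t2
  | Opp t1 => - eval e t1
  | Mul t1 t2 => eval e t1 * eval e t2
  | Exp t1 => expR (eval e t1)
  | An m f _ ts => f (\row_(i < m) eval e (ts i))
  end.

Fixpoint holds (R : realType) (e : nat -> R) (phi : formula R) : Prop :=
  match phi with
  | FEq t1 t2 => eval e t1 = eval e t2
  | FLt t1 t2 => eval e t1 < eval e t2
  | FNot phi1 => ~ holds e phi1
  | FAnd phi1 phi2 => holds e phi1 /\ holds e phi2
  | FExists k phi1 =>
      exists x : R, holds (fun j => if j == k then x else e j) phi1
  end.

Definition env_of (R : realType) (n : nat) (x : 'rV[R]_n) (k : nat) : R :=
  if insub k is Some i then x ord0 i else 0.

Definition definable (R : realType) (n : nat) (A : set 'rV[R]_n) : Prop :=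
  exists phi : formula R, forall x, A x <-> holds (env_of x) phi.

Definition realify (R : realType) (m n : nat) (A : 'M[R[i]]_(m, n)) :
    'rV[R]_(m * n + m * n) :=
  row_mx (mxvec (map_mx (@complex.Re R) A)) (mxvec (map_mx (@complex.Im R) A)).

Definition realify_pt (R : realType) (g : nat)
    (u : 'cV[R[i]]_g * 'M[R[i]]_g) :
    'rV[R]_((g * 1 + g * 1) + (g * g + g * g)) :=
  row_mx (realify u.1) (realify u.2).

Definition definable_pts (R : realType) (g : nat)
    (U : set ('cV[R[i]]_g * 'M[R[i]]_g)) : Prop :=
  definable [set realify_pt u | u in U].

Definition open_in (R : realType) (g : nat)
    (X U : set ('cV[R[i]]_g * 'M[R[i]]_g)) : Prop :=
  exists O : set 'rV[R]_((g * 1 + g * 1) + (g * g + g * g)),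
    open O /\ U = X `&` [set u | O (realify_pt u)].

(* The point (v_0 : ... : v_N), as the set of its homogeneous coordinate
   vectors. It is a point of P^N(C) only when v is nonzero. *)
Definition proj_pt (R : realType) (N : nat) (v : 'rV[R[i]]_N.+1) :
    set 'rV[R[i]]_N.+1 :=
  [set w | exists2 c : R[i], c != 0 & w = c *: v].

Definition proj_space (R : realType) (N : nat) : set (set 'rV[R[i]]_N.+1) :=
  [set L | exists2 v, v != 0 & L = proj_pt v].

(* P^N(C) is a definable manifold through its standard affine charts: the i-th
   chart sends a point having a nonzero i-th coordinate to its unique
   homogeneous coordinate vector w with w_i = 1 (the constant coordinate is
   kept). F restricts to a definable map from U to P^N(C) x P^N(C) when it maps
   U there and its graph read in each product chart is definable. *)
Definition definable_map_to_PP (R : realType) (g N : nat)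
    (U : set ('cV[R[i]]_g * 'M[R[i]]_g))
    (F : 'cV[R[i]]_g * 'M[R[i]]_g ->
         set 'rV[R[i]]_N.+1 * set 'rV[R[i]]_N.+1) : Prop :=
  (forall u, U u -> proj_space (F u).1 /\ proj_space (F u).2) /\
  forall i j : 'I_N.+1,
    definable [set y | exists u w w',
      [/\ U u,
          (F u).1 w /\ w ord0 i = 1,
          (F u).2 w' /\ w' ord0 j = 1 &
          y = row_mx (realify_pt u) (row_mx (realify w) (realify w'))]].

Definition symmetric_mx (K : Type) (g : nat) (A : 'M[K]_g) : Prop := A^T = A.

Definition posdef (R : realType) (g : nat) (Y : 'M[R]_g) : Prop :=
  symmetric_mx Y /\
  forall x : 'cV[R]_g, x != 0 -> 0 < (x^T *m Y *m x) ord0 ord0.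

Definition siegel_space (R : realType) (g : nat) : set 'M[R[i]]_g :=
  [set tau | symmetric_mx tau /\ posdef (map_mx (@complex.Im R) tau)].

Definition Jmx (K : pzRingType) (g : nat) : 'M[K]_(g + g) :=
  block_mx 0 1%:M (- 1%:M) 0.

Definition Sp (K : pzRingType) (g : nat) : set 'M[K]_(g + g) :=
  [set M | M *m Jmx K g *m M^T = Jmx K g].

Definition SpZ (g : nat) : set 'M[rat]_(g + g) :=
  [set M | @Sp rat g M /\ M \is a mxOver (@Num.int rat)].

Definition mxC (R : realType) (m n : nat) (A : 'M[R]_(m, n)) :
  'M[R[i]]_(m, n) := map_mx (real_complex R) A.

Definition siegel_act (R : realType) (g : nat) (M : 'M[R]_(g + g))
    (tau : 'M[R[i]]_g) : 'M[R[i]]_g :=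
  (mxC (ulsubmx M) *m tau + mxC (ursubmx M)) *m
  invmx (mxC (dlsubmx M) *m tau + mxC (drsubmx M)).

Definition minkowski_reduced (R : realType) (g : nat) (Y : 'M[R]_g) : Prop :=
  [/\ posdef Y,
      (forall (k : 'I_g) (a : 'cV[int]_g),
         \big[gcdn/0%N]_(j < g | (k <= j)%N) `|a j ord0|%N = 1%N ->
         Y k k <= ((map_mx intr a)^T *m Y *m map_mx intr a) ord0 ord0) &
      (forall k l : 'I_g, l = k.+1 :> nat -> 0 <= Y k l)].

Definition siegel_fund (R : realType) (g : nat) : set 'M[R[i]]_g :=
  [set tau | [/\ symmetric_mx tau,
      minkowski_reduced (map_mx (@complex.Im R) tau),
      (forall i j, `|complex.Re (tau i j)| <= 2^-1) &
      (forall M : 'M[rat]_(g + g), SpZ M ->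
         1 <= `|\det (mxC (map_mx ratr (dlsubmx M)) *m tau
                      + mxC (map_mx ratr (drsubmx M)))|)]].

Definition polarization_type (g : nat) (d : 'I_g -> nat) : Prop :=
  (forall i, (0 < d i)%N) /\
  (forall i j : 'I_g, (i <= j)%N -> (d i %| d j)%N).

Definition Dmx (K : pzRingType) (g : nat) (d : 'I_g -> nat) : 'M[K]_g :=
  diag_mx (\row_i (d i)%:R).

Definition GD (g : nat) (d : 'I_g -> nat) : set 'M[rat]_(g + g) :=
  let B := block_mx 1%:M 0 0 (Dmx rat d) in
  [set M | @Sp rat g M /\
           invmx B *m M *m B \is a mxOver (@Num.int rat)].

Definition even_int (x : rat) : Prop := exists n : int, x = (2 * n)%:~R.

Definition GDD0 (g : nat) (d : 'I_g -> nat) : set 'M[rat]_(g + g) :=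
  let D := Dmx rat d in
  [set M | [/\ GD d M,
    (exists a b c e : 'M[int]_g,
       M = block_mx (1%:M + D *m map_mx intr a) (D *m map_mx intr b *m D)
                    (map_mx intr c) (1%:M + map_mx intr e *m D)),
    (forall i, even_int
       ((invmx D *m ulsubmx M *m (ursubmx M)^T *m invmx D) i i)) &
    (forall i, even_int ((dlsubmx M *m (drsubmx M)^T) i i))]].

(* The name "left coset" is used in the literature both for x H and for H x
   (the orbits of left multiplication by H); the union of the translates of
   [siegel_fund] by the x_i is a fundamental set for H when the cosets are the
   H x_i. Both conventions are covered. *)
Definition coset_reps (g m : nat) (G H : set 'M[rat]_g)
    (x : 'I_m -> 'M[rat]_g) : Prop :=
  (forall i, G (x i)) /\
  ((forall M, G M -> exists! i, exists2 h, H h & M = x i *m h) \/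
   (forall M, G M -> exists! i, exists2 h, H h & M = h *m x i)).

Definition siegel_fund_for (R : realType) (g : nat) (d : 'I_g -> nat)
    (F : set 'M[R[i]]_g) : Prop :=
  exists (m : nat) (x : 'I_m -> 'M[rat]_(g + g)),
    coset_reps (@SpZ g) (GDD0 d) x /\
    F = \bigcup_(i in [set: 'I_m])
          (siegel_act (map_mx ratr (x i)) @` @siegel_fund R g).

Definition Ebar (R : realType) (g : nat) (d : 'I_g -> nat)
    (tau : 'M[R[i]]_g) : set 'cV[R[i]]_g :=
  [set z | exists t s : 'I_g -> R,
     [/\ (forall i, 0 <= t i <= 1), (forall j, 0 <= s j <= 1) &
         z = \sum_i (t i)%:C *: col i tau
             + \sum_j (s j)%:C *: col j (Dmx R[i] d)]].

Definition pts_space (R : realType) (g : nat) :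
    set ('cV[R[i]]_g * 'M[R[i]]_g) :=
  [set u | siegel_space u.2].

Definition XD (R : realType) (g : nat) (d : 'I_g -> nat)
    (V : set 'M[R[i]]_g) : set ('cV[R[i]]_g * 'M[R[i]]_g) :=
  [set u | [/\ pts_space u, V u.2 & Ebar d u.2 u.1]].

Definition cexp (R : realType) (z : R[i]) : R[i] :=
  (expR (complex.Re z))%:C * (cos (complex.Im z) +i* sin (complex.Im z)).

Definition epi (R : realType) (w : R[i]) : R[i] := cexp ((0 +i* pi) * w).

Definition theta (R : realType) (g : nat) (z : 'cV[R[i]]_g)
    (tau : 'M[R[i]]_g) : R[i] :=
  sumC (fun k : 'cV[int]_g =>
    let kC : 'cV[R[i]]_g := map_mx intr k in
    epi ((kC^T *m tau *m kC) ord0 ord0 + 2 * (kC^T *m z) ord0 ord0)).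

Definition theta_char (R : realType) (g : nat) (a b : 'cV[R]_g)
    (z : 'cV[R[i]]_g) (tau : 'M[R[i]]_g) : R[i] :=
  epi (((mxC a)^T *m tau *m mxC a) ord0 ord0
       + 2 * ((mxC a)^T *m (z + mxC b)) ord0 ord0)
  * theta (z + tau *m mxC a + mxC b) tau.

Definition char_reps (R : realType) (g N : nat) (d : 'I_g -> nat)
    (c : 'I_N.+1 -> 'cV[R]_g) : Prop :=
  let DinvZ := [set invmx (Dmx R d) *m map_mx intr k | k in [set: 'cV[int]_g]] in
  (forall i, DinvZ (c i)) /\
  (forall x, DinvZ x ->
     exists! i, exists k : 'cV[int]_g, x - c i = map_mx intr k).

Definition phiD (R : realType) (g N : nat) (c : 'I_N.+1 -> 'cV[R]_g)
    (z : 'cV[R[i]]_g) (tau : 'M[R[i]]_g) : set 'rV[R[i]]_N.+1 :=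
  proj_pt (\row_i theta_char (c i) 0 z tau).

Definition PhiD (R : realType) (g N : nat) (c : 'I_N.+1 -> 'cV[R]_g)
    (u : 'cV[R[i]]_g * 'M[R[i]]_g) :
    set 'rV[R[i]]_N.+1 * set 'rV[R[i]]_N.+1 :=
  (phiD c u.1 u.2, phiD c 0 u.2).

(* Main.v *)
Require Import Defs.
From mathcomp Require Import all_boot all_order all_algebra.
From mathcomp Require Import all_classical all_reals all_analysis.
From mathcomp Require Import complex ring lra zify.

Set Implicit Arguments.
Unset Strict Implicit.
Unset Printing Implicit Defensive.

Import Order.TTheory GRing.Theory Num.Theory.
Import numFieldNormedType.Exports.

Local Open Scope classical_set_scope.
Local Open Scope ring_scope.
Local Open Scope complex_scope.

(** The fundamental set is a finite union of translates of [siegel_fund] by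
    integral symplectic matrices, so after a rational symplectic change of
    variables tau may be assumed to lie in [siegel_fund]; Minkowski reduction
    theory then provides a finite list of rational matrices V, one of which makes
    tV Im(tau) V strongly diagonally dominant with diagonal bounded below.  Under a
    rational symplectic matrix the vector of theta functions is transformed, up to
    a nonzero factor, into a vector of theta series with Schwartz-Bruhat
    coefficients: the group is generated by translations, linear changes of
    coordinates and the inversion, the latter being handled by Poisson summation
    one coordinate at a time.  On the diagonally dominant region, cut into finitely
    many cells by Re(tau) and Re(z), such a theta series times a monomial is a
    convergent power series in finitely many bounded variables which are products
    of a real exponential and a cosine or sine of a small argument; hence it is
    definable in R_an,exp.  The theta functions with characteristics in (1/n)Z^g,
    n >= 2, have no common zero, because theta(x + (n-1)a, s) theta((n-1)(x - a), (n-1)s)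
    is a combination of them at (nx, ns) for every a, and does not vanish identically in a. *)

(** Three obstacles shape the argument. The automorphy factor is never computed: it cancels in
    projective space as soon as it does not depend on the characteristic, so Poisson summation is
    needed only up to a nonzero constant and no integral appears. Schwartz-Bruhat coefficients make
    this uniform: they are stable under every rational generator, at the price of a larger level.
    Restricted analytic functions live on a real cube. A complex variable of modulus at most rho has
    both parts in [-rho, rho], and the whole square of such parts contains points of larger modulus,
    where the series may diverge. A small argument replaces the square by a thin rectangle; this is
    what forces the cells. Finally exp(2 pi i z_j) and its inverse are both unbounded. Since z = tau
    p + r with bounded real p and r, a fixed power of the diagonal variable compensates either of
    them, provided the diagonal of Im(tau) controls its off-diagonal entries. Minkowski reduction
    alone is too weak for that, whence the further rational changes of basis, chosen from a finite
    list because Gram-Schmidt coefficients of reduced forms are bounded in terms of the genus. *)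

Notation nrm := (@Normc.normc _).

(** * Absolutely summable families *)
Section Sums.
Variable R : realType.
Local Notation C := R[i].

Lemma nrm_ge0 (x : C) : 0 <= nrm x.
Proof. by case: x => a b /=; exact: sqrtr_ge0. Qed.
Lemma nrmM (x y : C) : nrm (x * y) = nrm x * nrm y.
Proof. exact: Normc.normcM. Qed.
Lemma nrm0 : nrm (0 : C) = 0. Proof. exact: Normc.normc0. Qed.
Lemma nrm1 : nrm (1 : C) = 1. Proof. exact: Normc.normc1. Qed.
Lemma nrmN (x : C) : nrm (- x) = nrm x. Proof. exact: normcN. Qed.
Lemma nrmV (x : C) : nrm x^-1 = (nrm x)^-1. Proof. exact: Normc.normcV. Qed.
Lemma nrmD (x y : C) : nrm (x + y) <= nrm x + nrm y. Proof. exact: le_normcD. Qed.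
Lemma nrmB (x y : C) : nrm (x - y) <= nrm x + nrm y.
Proof. by rewrite -(nrmN y); exact: nrmD. Qed.
Lemma nrmBC (x y : C) : nrm (x - y) = nrm (y - x).
Proof. by rewrite -nrmN opprB. Qed.
Lemma nrm_eq0 (x : C) : (nrm x == 0) = (x == 0).
Proof. by apply/eqP/eqP => [/Normc.eq0_normc|->]//; exact: nrm0. Qed.
Lemma nrm_gt0 (x : C) : (0 < nrm x) = (x != 0).
Proof. by rewrite lt_neqAle nrm_ge0 andbT eq_sym nrm_eq0. Qed.
Lemma nrmX (x : C) n : nrm (x ^+ n) = nrm x ^+ n.
Proof. by elim: n => [|n IH]; rewrite ?expr0 ?nrm1// !exprS nrmM IH. Qed.
Lemma nrm_real (x : R) : nrm (x%:C) = `|x|.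
Proof. by rewrite /= expr0n addr0 sqrtr_sqr. Qed.
Lemma nrm_Re (x : C) : `|complex.Re x| <= nrm x.
Proof. by case: x => a b /=; rewrite -sqrtr_sqr ler_wsqrtr// lerDl sqr_ge0. Qed.
Lemma nrm_Im (x : C) : `|complex.Im x| <= nrm x.
Proof. by case: x => a b /=; rewrite -[leLHS]sqrtr_sqr ler_wsqrtr// lerDr sqr_ge0. Qed.
Lemma nrm_le_ReIm (x : C) : nrm x <= `|complex.Re x| + `|complex.Im x|.
Proof.
case: x => a b; rewrite [leLHS](_ : _ = nrm (a%:C + 'i%C * b%:C)); last first.
  by congr nrm; simpc.
apply: (le_trans (nrmD _ _)); rewrite nrmM !nrm_real/=.
by rewrite expr0n expr1n add0r sqrtr1 mul1r.
Qed.
Lemma Re_sum (I : Type) (s : seq I) (P : pred I) (f : I -> C) :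
  complex.Re (\sum_(i <- s | P i) f i) = \sum_(i <- s | P i) complex.Re (f i).
Proof. by elim/big_rec2: _ => [|i y x _ h]//; rewrite -h; case: (f i); case: x {h}. Qed.
Lemma Im_sum (I : Type) (s : seq I) (P : pred I) (f : I -> C) :
  complex.Im (\sum_(i <- s | P i) f i) = \sum_(i <- s | P i) complex.Im (f i).
Proof. by elim/big_rec2: _ => [|i y x _ h]//; rewrite -h; case: (f i); case: x {h}. Qed.
Lemma ReD (x y : C) : complex.Re (x + y) = complex.Re x + complex.Re y.
Proof. by case: x; case: y. Qed.
Lemma ImD (x y : C) : complex.Im (x + y) = complex.Im x + complex.Im y.
Proof. by case: x; case: y. Qed.
Lemma ReN (x : C) : complex.Re (- x) = - complex.Re x. Proof. by case: x. Qed.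
Lemma ImN (x : C) : complex.Im (- x) = - complex.Im x. Proof. by case: x. Qed.
Lemma ReM (x y : C) :
  complex.Re (x * y) = complex.Re x * complex.Re y - complex.Im x * complex.Im y.
Proof. by case: x; case: y. Qed.
Lemma ImM (x y : C) :
  complex.Im (x * y) = complex.Re x * complex.Im y + complex.Im x * complex.Re y.
Proof. by case: x; case: y. Qed.
Lemma complex_ext (x y : C) :
  complex.Re x = complex.Re y -> complex.Im x = complex.Im y -> x = y.
Proof. by case: x => a b; case: y => c d /= -> ->. Qed.

(** Summability is kept as a bound on all finite sums without repetition: such bounds pass through
    reindexing and products without entering the extended reals. *)
Definition fbound (I : eqType) (u : I -> R) (M : R) : Prop :=
  forall s : seq I, uniq s -> \sum_(i <- s) u i <= M.
Definition asum (I : choiceType) (f : I -> C) : Prop :=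
  exists M, fbound (fun i => nrm (f i)) M.
Definition rsum (I : choiceType) (u : I -> R) : Prop :=
  exists M, fbound (fun i => `|u i|) M.
Definition tsum (I : choiceType) (u : I -> R) : R := fine (\esum_(i in setT) (u i)%:E).

Section one.
Variable I : choiceType.
Implicit Types (u v : I -> R) (f g : I -> C).

Lemma esum_le_fbound u M : fbound u M -> (\esum_(i in setT) (u i)%:E <= M%:E)%E.
Proof.
move=> h; apply: ge_ereal_sup => _ /= [A [finA _] <-].
by rewrite fsbig_finite//= sumEFin lee_fin h.
Qed.
Lemma esum_ge_seq u (s : seq I) : uniq s ->
  ((\sum_(i <- s) u i)%:E <= \esum_(i in setT) (u i)%:E)%E.
Proof.
move=> us; apply: esum_ge; exists [set` s]; first by split.
by rewrite -fsbig_seq// sumEFin.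
Qed.
Lemma fbound_ge0 u M : fbound u M -> 0 <= M.
Proof. by move=> /(_ [::] isT); rewrite big_nil. Qed.
Lemma esum_tsum u M : fbound u M -> (forall i, 0 <= u i) ->
  (\esum_(i in setT) (u i)%:E)%E = (tsum u)%:E.
Proof.
move=> h u0; rewrite /tsum fineK// ge0_fin_numE; last first.
  by apply: esum_ge0 => i _; rewrite lee_fin.
by apply: le_lt_trans (esum_le_fbound h) _; rewrite ltry.
Qed.
Lemma tsum_le u M : (forall i, 0 <= u i) -> fbound u M -> tsum u <= M.
Proof. by move=> u0 h; rewrite -lee_fin -(esum_tsum h u0) esum_le_fbound. Qed.
Lemma seq_le_tsum u M (s : seq I) : fbound u M -> (forall i, 0 <= u i) -> uniq s ->
  \sum_(i <- s) u i <= tsum u.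
Proof. by move=> h u0 us; rewrite -lee_fin -(esum_tsum h u0) esum_ge_seq. Qed.
Lemma tsum_fbound u M : fbound u M -> (forall i, 0 <= u i) -> fbound u (tsum u).
Proof. by move=> h u0 s us; exact: seq_le_tsum h u0 us. Qed.
Lemma tsum_ge0 u : (forall i, 0 <= u i) -> 0 <= tsum u.
Proof. by move=> u0; rewrite fine_ge0// esum_ge0// => i _; rewrite lee_fin. Qed.
Lemma tsum_approx u M e : fbound u M -> (forall i, 0 <= u i) -> 0 < e ->
  exists2 s : seq I, uniq s & tsum u - e < \sum_(i <- s) u i.
Proof.
move=> h u0 e0.
have : ((tsum u - e)%:E < \esum_(i in setT) (u i)%:E)%E.
  by rewrite (esum_tsum h u0) lte_fin ltrBlDr ltrDl.
move=> /ereal_sup_gt[_ [A [finA _] <-]]; rewrite fsbig_finite//= sumEFin lte_fin => hA.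
by exists (finmap.enum_fset (fset_set A)).
Qed.
Lemma fboundW u v M : (forall i, u i <= v i) -> fbound v M -> fbound u M.
Proof. by move=> uv h s us; apply: le_trans (h s us); apply: ler_sum. Qed.
Lemma fboundD u v M M' : fbound u M -> fbound v M' -> fbound (fun i => u i + v i) (M + M').
Proof. by move=> h h' s us; rewrite big_split lerD// ?h ?h'. Qed.
Lemma fboundZ c u M : 0 <= c -> fbound u M -> fbound (fun i => c * u i) (c * M).
Proof. by move=> c0 h s us; rewrite -mulr_sumr ler_wpM2l// h. Qed.
Lemma tsum_add u v M M' : fbound u M -> fbound v M' ->
  (forall i, 0 <= u i) -> (forall i, 0 <= v i) ->
  tsum (fun i => u i + v i) = tsum u + tsum v.
Proof.
move=> hu hv u0 v0; apply: EFin_inj; rewrite EFinD -(esum_tsum hu)// -(esum_tsum hv)//.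
rewrite -esumD//; try by move=> i _; rewrite lee_fin.
by rewrite -(esum_tsum (fboundD hu hv))// => i; rewrite addr_ge0.
Qed.
Lemma tsumZ_le c u M : 0 <= c -> fbound u M -> (forall i, 0 <= u i) ->
  tsum (fun i => c * u i) <= c * tsum u.
Proof.
move=> c0 h u0; apply: tsum_le; first by move=> i; rewrite mulr_ge0.
exact: fboundZ (tsum_fbound h u0).
Qed.
(** The inequality of [tsumZ_le], used for c and for its inverse. *)
Lemma tsumZ c u M : 0 <= c -> fbound u M -> (forall i, 0 <= u i) ->
  tsum (fun i => c * u i) = c * tsum u.
Proof.
move=> c0 h u0; apply/le_anti; rewrite (tsumZ_le c0 h u0)/=.
have [->|cn0] := eqVneq c 0.
  by rewrite mul0r tsum_ge0// => i; rewrite mul0r.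
have cp : 0 < c by rewrite lt_neqAle eq_sym cn0.
rewrite mulrC -ler_pdivlMr// mulrC.
rewrite [leLHS](_ : _ = tsum (fun i => c^-1 * (c * u i))); last first.
  by congr (fine _); apply: eq_esum => i _; rewrite mulrA mulVf// mul1r.
apply: (@tsumZ_le _ _ (c * M)) => [||i]; first by rewrite invr_ge0.
- exact: fboundZ.
- by rewrite mulr_ge0.
Qed.
Lemma le_tsum u v M : (forall i, 0 <= u i) -> (forall i, u i <= v i) -> fbound v M ->
  tsum u <= tsum v.
Proof.
move=> u0 uv h; apply: tsum_le => //.
by apply: fboundW (uv) (tsum_fbound h _) => i; apply: le_trans (uv i).
Qed.

Definition pos u i := Num.max (u i) 0.
Lemma pos_ge0 u i : 0 <= pos u i. Proof. by rewrite /pos le_max lexx orbT. Qed.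
Lemma pos_le u i : pos u i <= `|u i|.
Proof. by rewrite /pos ge_max ler_norm normr_ge0. Qed.
Lemma pos_sub u i : pos u i - pos (fun i => - u i) i = u i.
Proof.
rewrite /pos; case: (leP (u i) 0) => h; case: (leP (- u i) 0) => h'; lra.
Qed.

Lemma sumR_tsum u : sumR u = tsum (pos u) - tsum (pos (fun i => - u i)).
Proof. by []. Qed.

Lemma eq_tsum u v : u =1 v -> tsum u = tsum v.
Proof. by move=> h; congr (fine _); apply: eq_esum => i _; rewrite h. Qed.

(** The value does not depend on how the family is written as a difference: with w = u - v one has
    [pos (-w) + u = pos w + v], and [tsum] is additive. Linearity of [sumR] is thereby reduced to
    nonnegative families. *)
Lemma sumR_sub u v M M' : fbound u M -> fbound v M' ->
  (forall i, 0 <= u i) -> (forall i, 0 <= v i) ->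
  sumR (fun i => u i - v i) = tsum u - tsum v.
Proof.
move=> hu hv u0 v0; rewrite sumR_tsum; set w := fun i => u i - v i.
have hp : fbound (pos w) M.
  by apply: fboundW hu => i; rewrite /pos /w ge_max u0 andbT gerBl.
have hn : fbound (pos (fun i => - w i)) M'.
  by apply: fboundW hv => i; rewrite /pos /w ge_max v0 andbT opprB gerBl.
have := tsum_add hp hv (pos_ge0 w) v0.
have := tsum_add hn hu (pos_ge0 _) u0.
rewrite (@eq_tsum (fun i => pos (fun i => - w i) i + u i) (fun i => pos w i + v i)).
  by move=> -> ?; lra.
by move=> i; have := pos_sub w i; rewrite /w; lra.
Qed.

Lemma rsum_pos u : rsum u -> exists M, fbound (pos u) M /\ fbound (pos (fun i => - u i)) M.
Proof.
move=> [M h]; exists M; split; apply: fboundW h => i; first exact: pos_le.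
by rewrite -normrN; exact: pos_le.
Qed.

Lemma eq_sumR u v : u =1 v -> sumR u = sumR v.
Proof. by move=> /funext ->. Qed.
Lemma eq_sumC f g : f =1 g -> sumC f = sumC g.
Proof. by move=> /funext ->. Qed.

Lemma sumR_ge0 u : (forall i, 0 <= u i) -> rsum u -> sumR u = tsum u.
Proof.
move=> u0 [M h]; rewrite -[RHS]subr0 -(_ : tsum (fun _ : I => 0) = 0); last first.
  by rewrite /tsum esum1.
rewrite -(@sumR_sub _ _ M 0)//.
- by apply: eq_sumR => i; rewrite subr0.
- by apply: fboundW h => i; exact: ler_norm.
- by move=> s _; rewrite big1.
Qed.

Lemma rsumW u v : (forall i, `|u i| <= `|v i|) -> rsum v -> rsum u.
Proof. by move=> uv [M h]; exists M; apply: fboundW h. Qed.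
Lemma rsumD u v : rsum u -> rsum v -> rsum (fun i => u i + v i).
Proof.
move=> [M h] [M' h']; exists (M + M'); apply: fboundW (fboundD h h') => i.
exact: ler_normD.
Qed.
Lemma rsumN u : rsum u -> rsum (fun i => - u i).
Proof. by apply: rsumW => i; rewrite normrN. Qed.
Lemma rsumZ c u : rsum u -> rsum (fun i => c * u i).
Proof.
move=> [M h]; exists (`|c| * M); have := fboundZ (normr_ge0 c) h.
by apply: fboundW => i; rewrite normrM.
Qed.

Lemma sumRD u v : rsum u -> rsum v -> sumR (fun i => u i + v i) = sumR u + sumR v.
Proof.
move=> /rsum_pos[M [h1 h2]] /rsum_pos[M' [h3 h4]].
rewrite (@eq_sumR _ (fun i => (pos u i + pos v i) -
   (pos (fun i => - u i) i + pos (fun i => - v i) i))); last first.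
  by move=> i; rewrite -[in LHS](pos_sub u) -[in LHS](pos_sub v); ring.
rewrite (sumR_sub (fboundD h1 h3) (fboundD h2 h4)); last 2 first.
- by move=> i; rewrite addr_ge0// pos_ge0.
- by move=> i; rewrite addr_ge0// pos_ge0.
rewrite (tsum_add h1 h3)//; try exact: pos_ge0.
rewrite (tsum_add h2 h4)//; try exact: pos_ge0.
by rewrite !sumR_tsum; ring.
Qed.
Lemma sumRN u : sumR (fun i => - u i) = - sumR u.
Proof.
rewrite !sumR_tsum opprB; congr (_ - _); apply: eq_tsum => i.
by rewrite /pos opprK.
Qed.
Lemma sumRZ c u : rsum u -> sumR (fun i => c * u i) = c * sumR u.
Proof.
move=> hu; have [M [h1 h2]] := rsum_pos hu.
wlog c0 : c / 0 <= c.
  move=> W; case: (leP 0 c) => [|/ltW c0]; first exact: W.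
  rewrite -[c]opprK; set c' := - c.
  rewrite (@eq_sumR _ (fun i => - (c' * u i))); last by move=> i; rewrite mulNr.
  by rewrite sumRN W ?mulNr// oppr_ge0.
rewrite (@eq_sumR _ (fun i => c * pos u i - c * pos (fun i => - u i) i)); last first.
  by move=> i; rewrite -mulrBr pos_sub.
rewrite (sumR_sub (fboundZ c0 h1) (fboundZ c0 h2)); try by move=> i; rewrite mulr_ge0// pos_ge0.
rewrite (tsumZ c0 h1)//; last exact: pos_ge0.
rewrite (tsumZ c0 h2)//; last exact: pos_ge0.
by rewrite !sumR_tsum; ring.
Qed.
Lemma le_sumR u v : (forall i, u i <= v i) -> rsum u -> rsum v -> sumR u <= sumR v.
Proof.
move=> uv hu hv; rewrite -subr_ge0 -sumRN -sumRD//; last exact: rsumN.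
rewrite sumR_ge0//; first by apply: tsum_ge0 => i; rewrite subr_ge0.
- by move=> i; rewrite subr_ge0.
- by apply: rsumD => //; exact: rsumN.
Qed.

Lemma asum_Re f : asum f -> rsum (fun i => complex.Re (f i)).
Proof. by move=> [M h]; exists M; apply: fboundW h => i; exact: nrm_Re. Qed.
Lemma asum_Im f : asum f -> rsum (fun i => complex.Im (f i)).
Proof. by move=> [M h]; exists M; apply: fboundW h => i; exact: nrm_Im. Qed.
Lemma asum_nrm f : asum f -> rsum (fun i => nrm (f i)).
Proof. by move=> [M h]; exists M; apply: fboundW h => i; rewrite ger0_norm ?nrm_ge0. Qed.
Lemma asumW f (u : I -> R) : (forall i, nrm (f i) <= u i) -> rsum u -> asum f.
Proof.
move=> fu [M h]; exists M; apply: fboundW h => i.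
by apply: le_trans (fu i) (ler_norm _).
Qed.
Lemma asumWC f g : (forall i, nrm (f i) <= nrm (g i)) -> asum g -> asum f.
Proof. by move=> fg /asum_nrm; exact: asumW. Qed.
Lemma asumD f g : asum f -> asum g -> asum (fun i => f i + g i).
Proof. by move=> /asum_nrm hf /asum_nrm hg; apply: asumW (rsumD hf hg) => i; exact: nrmD. Qed.
Lemma asumZ c f : asum f -> asum (fun i => c * f i).
Proof. by move=> /asum_nrm hf; apply: asumW (rsumZ (nrm c) hf) => i; rewrite nrmM. Qed.
Lemma asumN f : asum f -> asum (fun i => - f i).
Proof. by apply: asumWC => i; rewrite nrmN. Qed.

Lemma sumCD f g : asum f -> asum g -> sumC (fun i => f i + g i) = sumC f + sumC g.
Proof.
move=> hf hg; rewrite /sumC; apply: complex_ext; rewrite /=.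
  by rewrite -sumRD; [apply: eq_sumR => i; rewrite ReD|exact: asum_Re|exact: asum_Re].
by rewrite -sumRD; [apply: eq_sumR => i; rewrite ImD|exact: asum_Im|exact: asum_Im].
Qed.
Lemma sumCZ c f : asum f -> sumC (fun i => c * f i) = c * sumC f.
Proof.
move=> hf; have hr := asum_Re hf; have hi := asum_Im hf.
apply: complex_ext; rewrite ?ReM ?ImM /=.
  rewrite -!sumRZ// -sumRN -sumRD; try exact: rsumZ.
    by apply: eq_sumR => i; rewrite ReM.
  by apply: rsumN; exact: rsumZ.
rewrite -!sumRZ// -sumRD; try exact: rsumZ.
by apply: eq_sumR => i; rewrite ImM.
Qed.
Lemma sumCN f : asum f -> sumC (fun i => - f i) = - sumC f.
Proof.
move=> hf; rewrite -mulN1r -sumCZ//; apply: eq_sumC => i.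
by rewrite mulN1r.
Qed.
Lemma sumCB f g : asum f -> asum g -> sumC (fun i => f i - g i) = sumC f - sumC g.
Proof. by move=> hf hg; rewrite sumCD ?sumCN//; exact: asumN. Qed.
Lemma sumC0 : sumC (fun _ : I => 0 : C) = 0.
Proof.
have a0 : asum (fun _ : I => 0 : C) by exists 0 => s _; rewrite big1// => i _; rewrite nrm0.
by rewrite -[RHS](mul0r (sumC (fun _ : I => 0 : C))) -sumCZ//; apply: eq_sumC => i; rewrite mul0r.
Qed.

(** Multiplication by the conjugate of the sum turns its squared modulus into the real part of a
    sum, which can be bounded term by term. *)
Lemma nrm_sumC f : asum f -> nrm (sumC f) <= tsum (fun i => nrm (f i)).
Proof.
move=> hf; have [->|s0] := eqVneq (sumC f) 0; first by rewrite nrm0 tsum_ge0// => i; exact: nrm_ge0.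
have n0 : 0 < nrm (sumC f) by rewrite nrm_gt0.
rewrite -(ler_pM2l n0).
have [M hM] := hf.
rewrite -(tsumZ (ltW n0) hM); last by move=> i; exact: nrm_ge0.
set c := (sumC f)^*%C.
have ncc x : nrm (x^*%C : C) = nrm x by case: x => a b /=; rewrite sqrrN.
have E : nrm (sumC f) * nrm (sumC f) = complex.Re (sumC (fun i => c * f i)).
  rewrite sumCZ// /c; case: (sumC f) => a b /=.
  by rewrite -expr2 sqr_sqrtr ?addr_ge0 ?sqr_ge0// !expr2; ring.
have hc := asumZ c hf.
rewrite E /= -(sumR_ge0 (u := fun i => nrm (sumC f) * nrm (f i))).
- apply: le_sumR => [i||].
  + by rewrite (le_trans (ler_norm _))// (le_trans (nrm_Re _))// nrmM ncc.
  + exact: asum_Re hc.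
  + by apply: rsumZ; exact: asum_nrm.
- by move=> i; rewrite mulr_ge0 ?nrm_ge0.
- by apply: rsumZ; exact: asum_nrm.
Qed.
Lemma nrm_sumC_le f u M : (forall i, nrm (f i) <= u i) -> fbound u M -> nrm (sumC f) <= M.
Proof.
move=> fu h; have h' : fbound (fun i => nrm (f i)) M by exact: fboundW fu h.
apply: le_trans (nrm_sumC _) _; first by exists M.
by apply: tsum_le => // i; exact: nrm_ge0.
Qed.

End one.

(** * Reindexing and double sums *)

Section two.
Variables I J : choiceType.

(** Off the image of [phi] the family vanishes; so a sum over a large type, such as all real
    vectors, becomes a sum over the lattice that carries it. *)
Lemma tsum_inj (phi : J -> I) (u : I -> R) : injective phi ->
  (forall i, u i != 0 -> exists j, i = phi j) -> (forall i, 0 <= u i) ->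
  tsum u = tsum (fun j => u (phi j)).
Proof.
move=> inj sup u0; rewrite /tsum -(esum_image setT phi (fun i => (u i)%:E)); last first.
  by move=> x y _ _; exact: inj.
rewrite [in RHS]esum_mkcond; congr (fine _); apply: eq_esum => i _.
case: ifPn => // h; apply/eqP; rewrite eqe; apply: contraNT h => /sup[j ->].
by rewrite inE; exists j.
Qed.
Lemma fbound_inj (phi : J -> I) (u : I -> R) M : injective phi -> fbound u M ->
  fbound (fun j => u (phi j)) M.
Proof.
move=> inj h s us; have := h (map phi s); rewrite map_inj_uniq// big_map.
exact.
Qed.
Lemma asum_inj (phi : J -> I) (f : I -> C) : injective phi -> asum f ->
  asum (fun j => f (phi j)).
Proof. by move=> inj [M h]; exists M; exact: fbound_inj h. Qed.

Lemma sumR_inj (phi : J -> I) (u : I -> R) : injective phi ->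
  (forall i, u i != 0 -> exists j, i = phi j) -> sumR u = sumR (fun j => u (phi j)).
Proof.
move=> inj sup; rewrite !sumR_tsum (tsum_inj (phi := phi))//; last 2 first.
- move=> i h; apply: sup; apply: contra h => /eqP h; rewrite /pos h.
  by rewrite maxxx.
- exact: pos_ge0.
congr (_ - _); rewrite (tsum_inj (phi := phi))//; last exact: pos_ge0.
move=> i h; apply: sup; apply: contra h => /eqP h; rewrite /pos h oppr0.
by rewrite maxxx.
Qed.
Lemma sumC_inj (phi : J -> I) (f : I -> C) : injective phi ->
  (forall i, f i != 0 -> exists j, i = phi j) -> sumC f = sumC (fun j => f (phi j)).
Proof.
move=> inj sup; rewrite /sumC; apply: complex_ext => /=.
  by apply: sumR_inj => // i h; apply: sup; apply: contra h => /eqP ->.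
by apply: sumR_inj => // i h; apply: sup; apply: contra h => /eqP ->.
Qed.

Lemma fbound_slice (u : I * J -> R) M i : fbound u M -> fbound (fun j => u (i, j)) M.
Proof.
move=> h s us; have := h [seq (i, j) | j <- s].
by rewrite map_inj_uniq ?big_map => [|x y [->]]//; exact.
Qed.
Lemma esum_pair (u : I * J -> R) : (forall p, 0 <= u p) ->
  (\esum_(i in setT) \esum_(j in setT) (u (i, j))%:E = \esum_(p in setT) (u p)%:E)%E.
Proof.
move=> u0; rewrite (esum_esum (a := fun i j => (u (i, j))%:E)); last by move=> *; rewrite lee_fin.
rewrite (_ : _ `*`` _ = setT); last by apply/seteqP; split=> // -[].
by apply: eq_esum => -[i j].
Qed.
Lemma fbound_outer (u : I * J -> R) M : (forall p, 0 <= u p) -> fbound u M ->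
  fbound (fun i => tsum (fun j => u (i, j))) M.
Proof.
move=> u0 h s us; rewrite -lee_fin -sumEFin.
rewrite (eq_bigr (fun i => \esum_(j in setT) (u (i, j))%:E)%E); last first.
  by move=> i _; rewrite (esum_tsum (fbound_slice i h)).
apply: (@le_trans _ _ (\esum_(i in setT) \esum_(j in setT) (u (i, j))%:E)%E).
  by apply: esum_ge; exists [set` s]; [split|rewrite -fsbig_seq].
by rewrite esum_pair// esum_le_fbound.
Qed.
Lemma tsum_pair (u : I * J -> R) M : (forall p, 0 <= u p) -> fbound u M ->
  tsum u = tsum (fun i => tsum (fun j => u (i, j))).
Proof.
move=> u0 h; rewrite {1}/tsum -esum_pair//; congr (fine _); apply: eq_esum => i _.
by rewrite (esum_tsum (fbound_slice i h)).
Qed.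
(** Tonelli's theorem as a summability test: [esum_pair] holds in the extended reals, before any
    finiteness is known. *)
Lemma fbound_pair (u : I * J -> R) M : (forall p, 0 <= u p) ->
  (forall i, exists M, fbound (fun j => u (i, j)) M) ->
  fbound (fun i => tsum (fun j => u (i, j))) M -> fbound u M.
Proof.
move=> u0 hs ho s us; rewrite -lee_fin.
apply: (le_trans (esum_ge_seq _ us)); rewrite -esum_pair//.
rewrite (eq_esum (b := fun i => (tsum (fun j => u (i, j)))%:E)); last first.
  by move=> i _; have [K hK] := hs i; rewrite (esum_tsum hK).
exact: esum_le_fbound.
Qed.

Lemma asum_slice (f : I * J -> C) i : asum f -> asum (fun j => f (i, j)).
Proof. by move=> [M h]; exists M; exact: fbound_slice h. Qed.
Lemma asum_outer (f : I * J -> C) : asum f -> asum (fun i => sumC (fun j => f (i, j))).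
Proof.
move=> [M h]; exists M; apply: fboundW (fbound_outer _ h) => [i|p]; last exact: nrm_ge0.
by apply: nrm_sumC; exists M; exact: fbound_slice h.
Qed.
Lemma sumR_pair (u : I * J -> R) : rsum u -> sumR u = sumR (fun i => sumR (fun j => u (i, j))).
Proof.
move=> /rsum_pos[M [h1 h2]]; rewrite sumR_tsum.
rewrite (tsum_pair (pos_ge0 u) h1) (tsum_pair (pos_ge0 _) h2).
rewrite -(sumR_sub (fbound_outer (pos_ge0 u) h1) (fbound_outer (pos_ge0 _) h2))//.
- by move=> i; apply: tsum_ge0 => j; exact: pos_ge0.
- by move=> i; apply: tsum_ge0 => j; exact: pos_ge0.
Qed.
Lemma sumC_pair (f : I * J -> C) : asum f -> sumC f = sumC (fun i => sumC (fun j => f (i, j))).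
Proof.
move=> hf; rewrite {1}/sumC (sumR_pair (asum_Re hf)) (sumR_pair (asum_Im hf)).
exact: complex_ext.
Qed.
Lemma fbound_mul (u : I -> R) (v : J -> R) M M' :
  (forall i, 0 <= u i) -> (forall j, 0 <= v j) ->
  fbound u M -> fbound v M' -> fbound (fun p => u p.1 * v p.2) (M * M').
Proof.
move=> u0 v0 hu hv; apply: fbound_pair => //=; first by move=> p; rewrite mulr_ge0.
- by move=> i; exists (u i * M'); exact: fboundZ.
- apply: (@fboundW _ _ (fun i => M' * u i)).
    by move=> i; rewrite (tsumZ (u0 i) hv v0) mulrC ler_wpM2r// tsum_le.
  by rewrite mulrC; apply: fboundZ => //; exact: fbound_ge0 hv.
Qed.
Lemma asum_mul (f : I -> C) (g : J -> C) : asum f -> asum g -> asum (fun p => f p.1 * g p.2).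
Proof.
move=> [M h] [M' h']; exists (M * M').
apply: fboundW (fbound_mul _ _ h h') => [p|i|j]; rewrite ?nrm_ge0//.
by rewrite nrmM.
Qed.
Lemma sumC_mul (f : I -> C) (g : J -> C) : asum f -> asum g ->
  sumC f * sumC g = sumC (fun p : I * J => f p.1 * g p.2).
Proof.
move=> hf hg; rewrite sumC_pair; last exact: asum_mul.
rewrite mulrC -sumCZ//; apply: eq_sumC => i /=.
by rewrite mulrC -sumCZ.
Qed.
End two.

(** [phi] has to be onto the support of [f] only, so [psi] may take arbitrary values elsewhere. *)
Lemma asum_inj_sup (I J : choiceType) (phi : J -> I) (psi : I -> J) (f : I -> C) :
  cancel phi psi -> (forall i, f i != 0 -> phi (psi i) = i) ->
  asum (fun j => f (phi j)) -> asum f.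
Proof.
move=> c1 c2 [M h]; exists M => s us.
rewrite (bigID (fun i => f i != 0))/= [X in _ + X]big1 ?addr0; last first.
  by move=> i /negPn/eqP ->; rewrite nrm0.
rewrite -big_filter; set t := [seq i <- s | f i != 0].
have ut : uniq (map psi t).
  rewrite map_inj_in_uniq ?filter_uniq// => x y.
  rewrite !mem_filter => /andP[/c2 hx _] /andP[/c2 hy _] e.
  by rewrite -hx -hy e.
have := h _ ut; rewrite big_map; apply: le_trans; rewrite le_eqVlt; apply/orP; left; apply/eqP.
by apply: eq_big_seq => i; rewrite mem_filter => /andP[/c2 ->].
Qed.

Lemma sumC_swap (I J : choiceType) (f : I -> J -> C) : asum (fun p : I * J => f p.1 p.2) ->
  sumC (fun i => sumC (fun j => f i j)) = sumC (fun j => sumC (fun i => f i j)).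
Proof.
move=> hf; rewrite -(sumC_pair (f := fun p => f p.1 p.2))//.
rewrite (sumC_inj (phi := fun p : J * I => (p.2, p.1))); last 2 first.
- by move=> [a b] [c d] [-> ->].
- by move=> [i j] _; exists (j, i).
rewrite sumC_pair//=.
by apply: (asum_inj (phi := fun p : J * I => (p.2, p.1)) _ hf) => -[a b] [c d] [-> ->].
Qed.

(** * Finite sums and dominated convergence *)

Section three.
Variable I : choiceType.
Lemma tsum_finite (s : seq I) (u : I -> R) : uniq s -> (forall i, 0 <= u i) ->
  (forall i, i \notin s -> u i = 0) -> tsum u = \sum_(i <- s) u i.
Proof.
move=> us u0 h; rewrite /tsum.
rewrite (_ : (\esum_(i in setT) (u i)%:E)%E = \esum_(i in [set` s]) (u i)%:E)%E; last first.
  rewrite [RHS]esum_mkcond; apply: eq_esum => i _; case: ifPn => //.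
  by move=> /negP; rewrite inE => /negP /h ->.
rewrite esum_fset//; last by move=> i _; rewrite lee_fin.
by rewrite -fsbig_seq// sumEFin.
Qed.
Lemma sumR_finite (s : seq I) (u : I -> R) : uniq s ->
  (forall i, i \notin s -> u i = 0) -> sumR u = \sum_(i <- s) u i.
Proof.
move=> us h; rewrite sumR_tsum !(tsum_finite us)//; try exact: pos_ge0.
- by rewrite -sumrB; apply: eq_bigr => i _; rewrite pos_sub.
- by move=> i /h; rewrite /pos => ->; rewrite oppr0 maxxx.
- by move=> i /h; rewrite /pos => ->; rewrite maxxx.
Qed.
Lemma sumC_finite (s : seq I) (f : I -> C) : uniq s ->
  (forall i, i \notin s -> f i = 0) -> sumC f = \sum_(i <- s) f i.
Proof.
move=> us h; apply: complex_ext; rewrite ?Re_sum ?Im_sum /=.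
  by apply: sumR_finite => // i /h ->.
by apply: sumR_finite => // i /h ->.
Qed.
Lemma asum_finite (s : seq I) (f : I -> C) : uniq s ->
  (forall i, i \notin s -> f i = 0) -> asum f.
Proof.
move=> us h; exists (\sum_(i <- s) nrm (f i)) => t ut.
rewrite (bigID (mem s))/= [X in _ + X]big1 ?addr0; last by move=> i /h ->; rewrite nrm0.
rewrite -big_filter [leRHS](bigID (mem t))/= -[X in _ <= X + _]big_filter.
rewrite (perm_big [seq i <- s | i \in t]) /=; last first.
  by apply: uniq_perm; rewrite ?filter_uniq// => i; rewrite !mem_filter andbC.
by rewrite lerDl sumr_ge0// => i _; exact: nrm_ge0.
Qed.

Definition limC (u : nat -> C) (l : C) : Prop :=
  forall e : R, 0 < e -> exists N, forall n, (N <= n)%N -> nrm (u n - l) < e.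

(** A finite set carries the dominating sum [G = 2 g] up to e/2; on it finitely many limits are
    taken, and the tail is bounded uniformly in n. The factor 2 is there because [G] dominates the
    differences with the limit. *)
Lemma tannery (f : nat -> I -> C) (l : I -> C) (g : I -> R) :
  (forall n i, nrm (f n i) <= g i) -> rsum g ->
  (forall i, limC (fun n => f n i) (l i)) -> limC (fun n => sumC (f n)) (sumC l).
Proof.
move=> fg hg fl.
have g0 i : 0 <= g i by exact: le_trans (nrm_ge0 _) (fg 0%N i).
have lg i : nrm (l i) <= g i.
  rewrite leNgt; apply/negP => h.
  have [|N /(_ N (leqnn _))] := fl i (nrm (l i) - g i); first by rewrite subr_gt0.
  have := nrmD (l i - f N i) (f N i); rewrite subrK nrmBC.
  by have := fg N i; lra.
have al : asum l by exact: asumW lg hg.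
have af n : asum (f n) by exact: asumW (fg n) hg.
pose h n i := f n i - l i; pose G i := 2 * g i.
have hG n i : nrm (h n i) <= G i.
  by apply: le_trans (nrmB _ _) _; have := fg n i; have := lg i; rewrite /G; lra.
have [M hM] : rsum G by exact: rsumZ.
have G0 i : 0 <= G i by rewrite mulr_ge0.
have {}hM : fbound G M by apply: fboundW hM => i; exact: ler_norm.
move=> e e0.
have e2 : 0 < e / 2 by rewrite divr_gt0.
have [s us hs] := tsum_approx hM G0 e2.
have fin : exists N, forall n, (N <= n)%N -> \sum_(i <- s) nrm (h n i) <= e / 2.
  pose d := e / 2 / (size s).+1%:R.
  have d0 : 0 < d by rewrite !divr_gt0.
  have [N hN] : exists N, forall n, (N <= n)%N -> forall i, i \in s -> nrm (h n i) < d.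
    elim: (s) => [|i t [N IH]]; first by exists 0%N.
    have [N' hN'] := fl i d d0; exists (maxn N N') => n.
    rewrite geq_max => /andP[h1 h2] j; rewrite inE => /orP[/eqP ->|]; last exact: IH.
    exact: hN'.
  exists N => n Nn; rewrite big_seq.
  apply: (@le_trans _ _ (\sum_(i <- s | i \in s) d)).
    by apply: ler_sum => i si; apply/ltW/hN.
  rewrite -big_seq big_const_seq count_predT iter_addr addr0 -[leLHS]mulr_natr /d mulrAC.
  rewrite ler_pdivrMr// ler_wpM2l ?ler_nat// ltW// divr_gt0//.
have [N hN] := fin; exists N => n Nn.
rewrite -sumCB//.
apply: le_lt_trans (nrm_sumC _) _; first exact: asumD (af n) (asumN al).
(* [b] is the difference on the finite set, [c] the majorant of its tail. *)
pose b i := if i \in s then nrm (h n i) else 0.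
pose c i := if i \in s then 0 else G i.
have b0 i : 0 <= b i by rewrite /b; case: ifP => // _; exact: nrm_ge0.
have c0 i : 0 <= c i by rewrite /c; case: ifP.
have cM : fbound c M by apply: fboundW hM => i; rewrite /c; case: ifP.
have bM : fbound b M.
  by apply: fboundW hM => i; rewrite /b; case: ifP.
apply: (@le_lt_trans _ _ (tsum b + tsum c)).
  rewrite -(tsum_add bM cM)//; apply: (le_tsum (M := M + M)) => [i|i|].
  - exact: nrm_ge0.
  - by rewrite /b /c; case: ifP => _; rewrite ?addr0 ?add0r ?hG.
  - exact: fboundD.
rewrite (tsum_finite us b0); last by move=> i /negbTE; rewrite /b => ->.
have : tsum (fun i => (if i \in s then G i else 0) + c i) = tsum G.
  by apply: eq_tsum => i; rewrite /c; case: ifP; rewrite ?addr0 ?add0r.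
rewrite (@tsum_add _ _ _ M M)//; last 2 first.
- by apply: fboundW hM => i; case: ifP.
- by move=> i; case: ifP.
rewrite (tsum_finite us); last 2 first.
- by move=> i; case: ifP.
- by move=> i /negbTE ->.
have -> : \sum_(i <- s) b i = \sum_(i <- s) nrm (h n i).
  by apply: eq_big_seq => i; rewrite /b => ->.
rewrite (eq_big_seq G); last by move=> i ->.
by have := hN n Nn; lra.
Qed.
End three.

Lemma limC_unique u l l' : limC u l -> limC u l' -> l = l'.
Proof.
move=> h h'; apply/eqP; rewrite -subr_eq0 -nrm_eq0; apply/eqP/le_anti; rewrite nrm_ge0 andbT.
apply/ler_addgt0Pr => e e0; rewrite add0r.
have [N hN] := h _ (divr_gt0 e0 (ltr0n _ 2)); have [N' hN'] := h' _ (divr_gt0 e0 (ltr0n _ 2)).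
have := hN _ (leq_maxl N N'); have := hN' _ (leq_maxr N N').
have := nrmB (u (maxn N N') - l') (u (maxn N N') - l).
by rewrite (_ : _ - _ - _ = l - l'); [lra|ring].
Qed.
Lemma limC_ext u v l : u =1 v -> limC u l -> limC v l.
Proof. by move=> /funext ->. Qed.
Lemma limC_cst l : limC (fun _ => l) l.
Proof. by move=> e e0; exists 0%N => n _; rewrite subrr nrm0. Qed.
Lemma limCD u v l l' : limC u l -> limC v l' -> limC (fun n => u n + v n) (l + l').
Proof.
move=> h h' e e0.
have [N hN] := h _ (divr_gt0 e0 (ltr0n _ 2)); have [N' hN'] := h' _ (divr_gt0 e0 (ltr0n _ 2)).
exists (maxn N N') => n; rewrite geq_max => /andP[/hN h1 /hN' h2].
rewrite (_ : _ - _ = (u n - l) + (v n - l')); last by ring.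
by apply: le_lt_trans (nrmD _ _) _; lra.
Qed.
Lemma limCZ c u l : limC u l -> limC (fun n => c * u n) (c * l).
Proof.
move=> h e e0; have n0 : 0 < nrm c + 1 by rewrite ltr_wpDl ?nrm_ge0.
have [N hN] := h _ (divr_gt0 e0 n0); exists N => n /hN.
rewrite -mulrBr nrmM ltr_pdivlMr// => hh.
apply: le_lt_trans hh; rewrite mulrC ler_wpM2l ?nrm_ge0// lerDl//.
Qed.
Lemma limC_bound0 u (a : R) : (forall n, nrm (u n) <= a / n.+1%:R) -> limC u 0.
Proof.
move=> h e e0; have a0 : 0 <= a by have := h 0%N; rewrite divr1; apply: le_trans; exact: nrm_ge0.
exists (Num.truncn (a / e)) => n hn; rewrite subr0.
apply: le_lt_trans (h n) _; rewrite ltr_pdivrMr// mulrC -ltr_pdivrMr//.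
apply: lt_le_trans (truncnS_gt _) _; by rewrite ler_nat.
Qed.
End Sums.

(** * Definable functions *)
Section Definability.
Variable R : realType.
Local Notation C := R[i].

Fixpoint ren_t (rho : nat -> nat) (t : term R) : term R :=
  match t with
  | Var k => @Var R (rho k)
  | Cst c => Cst c
  | Add t1 t2 => Add (ren_t rho t1) (ren_t rho t2)
  | Opp t1 => Opp (ren_t rho t1)
  | Mul t1 t2 => Mul (ren_t rho t1) (ren_t rho t2)
  | Exp t1 => Exp (ren_t rho t1)
  | An m f h ts => An h (fun i => ren_t rho (ts i))
  end.

Fixpoint ren_f (rho : nat -> nat) (phi : formula R) : formula R :=
  match phi with
  | FEq t1 t2 => FEq (ren_t rho t1) (ren_t rho t2)
  | FLt t1 t2 => FLt (ren_t rho t1) (ren_t rho t2)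
  | FNot p => FNot (ren_f rho p)
  | FAnd p q => FAnd (ren_f rho p) (ren_f rho q)
  | FExists k p => FExists (rho k) (ren_f rho p)
  end.

Lemma eval_ren rho (t : term R) e : Defs.eval e (ren_t rho t) = Defs.eval (fun k => e (rho k)) t.
Proof.
elim: t => //= [t1 -> t2 ->|t ->|t1 -> t2 ->|t ->|m f h ts IH]//.
by congr f; apply/matrixP => i j; rewrite !mxE IH.
Qed.

(** Bound variables are renamed too; injectivity is what prevents a quantifier from overwriting
    another variable. *)
Lemma holds_ren rho (phi : formula R) e : injective rho ->
  holds e (ren_f rho phi) <-> holds (fun k => e (rho k)) phi.
Proof.
move=> inj; elim: phi e => //= [t1 t2|t1 t2|p IH|p IHp q IHq|k p IH] e.
- by rewrite !eval_ren.
- by rewrite !eval_ren.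
- by rewrite IH.
- by rewrite IHp IHq.
- have E x : (fun j => (fun j0 => if j0 == rho k then x else e j0) (rho j)) =
             (fun j => if j == k then x else e (rho j)).
    by apply: funext => j; rewrite inj_eq.
  by split=> -[x hx]; exists x; move: hx; rewrite IH E.
Qed.

(** Binds the variables n, ..., n+m-1, those of the coordinates that [row_mx] appends to a point of
    dimension n. *)
Fixpoint exs (n m : nat) (phi : formula R) : formula R :=
  if m is m'.+1 then FExists (n + m')%N (exs n m' phi) else phi.

Lemma holds_exs n m phi e : holds e (exs n m phi) <->
  exists y : nat -> R, holds (fun j => if (n <= j < n + m)%N then y (j - n)%N else e j) phi.
Proof.
elim: m e => [|m IH] e /=.
  rewrite addn0; have E (y : nat -> R) :
    (fun j => if (n <= j < n)%N then y (j - n)%N else e j) = e.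
    by apply: funext => j; case: ifP => // /andP[h1 h2]; lia.
  split=> [h|[y]]; last by rewrite E.
  by exists (fun _ => 0); move: h; rewrite -{1}(E (fun _ => 0)).
split=> [[x /IH[y hy]]|[y hy]].
  exists (fun j => if j == m then x else y j).
  move: hy; congr holds; apply: funext => j.
  case: (ltngtP j (n + m)) => h.
  - have e1 : (j < n + m.+1)%N by lia.
    have e2 : (j == n + m)%N = false by apply/eqP; lia.
    case: (leqP n j) => h' /=; rewrite ?h ?e1 ?e2//.
    have e3 : (j - n == m)%N = false by apply/eqP; lia.
    by rewrite e3.
  - rewrite !ifF//; try (apply/negbTE; rewrite negb_and -!leqNgt; apply/orP; right; lia).
    apply/eqP; lia.
  - have e1 : (n + m < n + m.+1)%N by lia.
    by rewrite h leq_addr /= ?eqxx ?e1 addKn ?eqxx.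
exists (y m); apply/IH; exists y; move: hy; congr holds; apply: funext => j.
case: (ltngtP j (n + m)) => h.
- have e1 : (j < n + m.+1)%N by lia.
  by case: (leqP n j) => h' /=; rewrite ?h ?e1.
- have e1 : (j < n + m.+1)%N = false by lia.
  by rewrite e1 ?andbF.
- have e1 : (n + m < n + m.+1)%N by lia.
  by rewrite h leq_addr /= ?eqxx ?e1 addKn.
Qed.

Lemma env_of_ge n (x : 'rV[R]_n) k : (n <= k)%N -> env_of x k = 0.
Proof. by move=> h; rewrite /env_of insubF// ltnNge h. Qed.
Lemma env_of_ord n (x : 'rV[R]_n) (i : 'I_n) : env_of x i = x ord0 i.
Proof. by rewrite /env_of insubT//= => lt; congr (x _ _); apply: val_inj. Qed.
Lemma env_of_row n m (x : 'rV[R]_n) (y : 'rV[R]_m) k :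
  env_of (row_mx x y) k = if (k < n)%N then env_of x k else env_of y (k - n)%N.
Proof.
case: ltnP => h.
  have -> : k = lshift m (Ordinal h) :> nat by [].
  by rewrite env_of_ord row_mxEl -env_of_ord.
case: (ltnP (k - n) m) => h'; last by rewrite !env_of_ge//; lia.
have E : k = rshift n (Ordinal h') :> nat by rewrite /= subnKC.
by rewrite {1}E env_of_ord row_mxEr -env_of_ord.
Qed.

Definition row_of m (y : nat -> R) : 'rV[R]_m := \row_i y i.

Lemma definable_ext n (A B : set 'rV[R]_n) : (forall x, A x <-> B x) ->
  definable A -> definable B.
Proof. by move=> h [phi hp]; exists phi => x; rewrite -h. Qed.

Lemma definable_proj n m (A : set 'rV[R]_(n + m)) : definable A ->
  definable [set x : 'rV[R]_n | exists y : 'rV[R]_m, A (row_mx x y)].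
Proof.
move=> [phi h]; exists (exs n m phi) => x; rewrite holds_exs.
have E (y : nat -> R) : env_of (row_mx x (row_of m y)) =
   (fun j => if (n <= j < n + m)%N then y (j - n)%N else env_of x j).
  apply: funext => j; rewrite env_of_row; case: (ltnP j n) => h1 //=.
  case: (ltnP j (n + m)) => h2; last by rewrite !env_of_ge//; lia.
  have h3 : (j - n < m)%N by lia.
  have -> : (j - n)%N = Ordinal h3 by [].
  by rewrite env_of_ord mxE.
split=> [[y /h hy]|[y hy]].
  exists (env_of y); rewrite -E; move: hy; congr (holds (env_of (row_mx _ _)) _).
  by apply/rowP => i; rewrite mxE env_of_ord.
by exists (row_of m y); apply/h; rewrite E.
Qed.

(** The graph is definable, the value being the last coordinate. Only total functions occur, so
    partial operations come with a default value. *)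
Definition DF n (f : 'rV[R]_n -> R) : Prop :=
  definable [set w : 'rV[R]_(n + 1) | w ord0 (rshift n ord0) = f (lsubmx w)].

Lemma definableI n (A B : set 'rV[R]_n) : definable A -> definable B ->
  definable [set x | A x /\ B x].
Proof. by move=> [p hp] [q hq]; exists (FAnd p q) => x /=; rewrite hp hq. Qed.
Lemma definableN n (A : set 'rV[R]_n) : definable A -> definable [set x | ~ A x].
Proof. by move=> [p hp]; exists (FNot p) => x /=; rewrite hp. Qed.
Lemma definableT n : definable [set _ : 'rV[R]_n | True].
Proof. by exists (FEq (Cst 0) (Cst 0)) => x. Qed.
Lemma definableU n (A B : set 'rV[R]_n) : definable A -> definable B ->
  definable [set x | A x \/ B x].
Proof.
move=> hA hB; apply: definable_ext (definableN (definableI (definableN hA) (definableN hB))) => x /=.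
by split=> [/not_andP[/contrapT|/contrapT]|[?|?] []]; auto.
Qed.
Lemma definable_forall n (I : finType) (A : I -> set 'rV[R]_n) :
  (forall i, definable (A i)) -> definable [set x | forall i, A i x].
Proof.
move=> h; suff : forall s : seq I, definable [set x | forall i, i \in s -> A i x].
  by move=> /(_ (enum I)); apply: definable_ext => x /=; split=> H i; [apply: H; rewrite mem_enum|].
elim=> [|i s IH]; first by apply: definable_ext (definableT n).
apply: definable_ext (definableI (h i) IH) => x /=; split=> [[h1 h2] j|H].
  by rewrite inE => /orP[/eqP ->|/h2].
by split=> [|j hj]; apply: H; rewrite inE ?eqxx// hj orbT.
Qed.
Lemma definable_exists n (I : finType) (A : I -> set 'rV[R]_n) :
  (forall i, definable (A i)) -> definable [set x | exists i, A i x].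
Proof.
move=> h; apply: definable_ext (definableN (definable_forall (fun i => definableN (h i)))) => x /=.
by split=> [/existsNP[i /contrapT]|[i hi]]; [exists i|move=> /(_ i)].
Qed.

(** The preimage is a projection of the set of pairs (x, y) with y in A and each y_i on the graph of
    [F i]. *)
Lemma definable_preim n m (F : 'I_m -> 'rV[R]_n -> R) (A : set 'rV[R]_m) :
  (forall i, DF (F i)) -> definable A -> definable [set x | A (\row_i F i x)].
Proof.
move=> hF [phi hA].
have h1 : definable [set w : 'rV[R]_(n + m) | A (rsubmx w)].
  exists (ren_f (addn n) phi) => w; rewrite /= hA holds_ren; last exact: addnI.
  suff -> : (fun k => env_of w (n + k)) = env_of (rsubmx w) by [].
  apply: funext => k; rewrite -{1}(hsubmxK w) env_of_row ltnNge leq_addr/=.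
  by rewrite addKn.
have h2 i : definable [set w : 'rV[R]_(n + m) | rsubmx w ord0 i = F i (lsubmx w)].
  have [psi hp] := hF i.
  (* The graph of [F i] has its value in variable n, which is moved to n+i. Later variables are
     pushed beyond n+m to keep [rho] injective; both environments are 0 there. *)
  pose rho k := if (k < n)%N then k else if k == n then (n + i)%N else (k + m)%N.
  have irho : injective rho.
    move=> a b; rewrite /rho; have := ltn_ord i.
    case: (ltnP a n) => ha; case: (ltnP b n) => hb; try case: eqP => ?; try case: eqP => ?; lia.
  exists (ren_f rho psi) => w; rewrite /= holds_ren//.
  have := hp (row_mx (lsubmx w) (const_mx (rsubmx w ord0 i))).
  rewrite /= row_mxEr row_mxKl [const_mx _ _ _]mxE => ->.
  suff -> : env_of (row_mx (lsubmx w) (const_mx (rsubmx w ord0 i)) : 'rV_(n + 1)) =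
            (fun k => env_of w (rho k)) by [].
  apply: funext => k; rewrite env_of_row /rho; case: ltnP => hk.
    by rewrite -{2}(hsubmxK w) env_of_row hk.
  case: eqP => [->|hkn].
    rewrite subnn (env_of_ord (const_mx (rsubmx w ord0 i) : 'rV[R]_1) ord0) mxE.
    rewrite -{2}(hsubmxK w) env_of_row ltnNge leq_addr/= addKn env_of_ord//.
  by rewrite !env_of_ge//; lia.
have := definable_proj (definableI (definable_forall h2) h1).
apply: definable_ext => x /=; split=> [[y []]|hx].
  rewrite row_mxKr => H; suff -> : y = \row_i F i x by [].
  by apply/rowP => i; have := H i; rewrite row_mxKl mxE.
by exists (\row_i F i x); split=> [i|]; rewrite row_mxKr ?mxE ?row_mxKl.
Qed.

Lemma DF_coord n (i : 'I_n) : DF (fun x : 'rV[R]_n => x ord0 i).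
Proof.
exists (FEq (@Var R n) (@Var R i)) => w /=.
have -> : env_of w n = w ord0 (rshift n ord0).
  by rewrite -env_of_ord /= addn0.
have -> : env_of w i = lsubmx w ord0 i; last by [].
by rewrite mxE -env_of_ord.
Qed.

Lemma DF_basic n (f : 'rV[R]_n -> R) (t : term R) :
  (forall w : 'rV[R]_(n + 1), Defs.eval (env_of w) t = f (lsubmx w)) -> DF f.
Proof.
move=> h; exists (FEq (@Var R n) t) => w /=; rewrite h.
suff -> : env_of w n = w ord0 (rshift n ord0) by [].
by rewrite -env_of_ord /= addn0.
Qed.
Lemma env_lsub n (w : 'rV[R]_(n + 1)) (i : 'I_n) : env_of w i = lsubmx w ord0 i.
Proof. by rewrite mxE -env_of_ord. Qed.

Lemma DF_cst n c : DF (fun _ : 'rV[R]_n => c).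
Proof. exact: (@DF_basic _ _ (Cst c)). Qed.

Lemma DF_lift n (h : 'rV[R]_n -> R) : DF h -> DF (fun w : 'rV[R]_(n + 1) => h (lsubmx w)).
Proof.
move=> hh.
have := @definable_preim (n + 1 + 1) (n + 1) (fun i w => match fintype.split i with
   inl i => w ord0 (lshift 1 (lshift 1 i)) | inr _ => w ord0 (rshift (n + 1) ord0) end) _ _ hh.
move=> H; apply: definable_ext (H _); last first.
  by move=> i; case: (fintype.split i) => j; exact: DF_coord.
move=> w /=; set X := (\row_i _).
have -> : X = row_mx (lsubmx (lsubmx w)) (const_mx (w ord0 (rshift (n + 1) ord0))).
  by apply/rowP => i; rewrite !mxE; case: split_ordP => j _; rewrite !mxE.
by rewrite row_mxEr row_mxKl mxE.
Qed.

Lemma DF_comp n m (f : 'rV[R]_m -> R) (F : 'I_m -> 'rV[R]_n -> R) :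
  DF f -> (forall i, DF (F i)) -> DF (fun x => f (\row_i F i x)).
Proof.
move=> hf hF.
have := @definable_preim (n + 1) (m + 1) (fun i w => match fintype.split i with
   inl i => F i (lsubmx w) | inr _ => w ord0 (rshift n ord0) end) _ _ hf.
move=> H; apply: definable_ext (H _); last first.
  by move=> i; case: (fintype.split i) => j; [exact: DF_lift|exact: DF_coord].
move=> w /=; set X := (\row_i _).
have -> : X = row_mx (\row_i F i (lsubmx w)) (const_mx (w ord0 (rshift n ord0))).
  by apply/rowP => i; rewrite !mxE; case: split_ordP => j _; rewrite !mxE.
by rewrite row_mxEr row_mxKl mxE.
Qed.

Lemma DF_ext n (f g : 'rV[R]_n -> R) : f =1 g -> DF f -> DF g.
Proof. by move=> /funext ->. Qed.

Definition sel2 n (f g : 'rV[R]_n -> R) (i : 'I_2) := if i == ord0 then f else g.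
Lemma DF_sel2 n (f g : 'rV[R]_n -> R) i : DF f -> DF g -> DF (sel2 f g i).
Proof. by rewrite /sel2; case: ifP. Qed.
Definition o1 : 'I_2 := ord_max.

Lemma DFD n (f g : 'rV[R]_n -> R) : DF f -> DF g -> DF (fun x => f x + g x).
Proof.
move=> hf hg; have h2 : DF (fun x : 'rV[R]_2 => x ord0 ord0 + x ord0 o1).
  apply: (@DF_basic _ _ (Add (@Var R 0) (@Var R 1))) => w /=.
  by rewrite -!env_lsub.
apply: DF_ext (DF_comp h2 (fun i => DF_sel2 i hf hg)) => x.
by rewrite !mxE.
Qed.
Lemma DFM n (f g : 'rV[R]_n -> R) : DF f -> DF g -> DF (fun x => f x * g x).
Proof.
move=> hf hg; have h2 : DF (fun x : 'rV[R]_2 => x ord0 ord0 * x ord0 o1).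
  apply: (@DF_basic _ _ (Mul (@Var R 0) (@Var R 1))) => w /=.
  by rewrite -!env_lsub.
apply: DF_ext (DF_comp h2 (fun i => DF_sel2 i hf hg)) => x.
by rewrite !mxE.
Qed.
Lemma DFexp n (f : 'rV[R]_n -> R) : DF f -> DF (fun x => expR (f x)).
Proof.
move=> hf; have h2 : DF (fun x : 'rV[R]_1 => expR (x ord0 ord0)).
  apply: (@DF_basic _ _ (Exp (@Var R 0))) => w /=.
  by rewrite -!env_lsub.
apply: DF_ext (DF_comp h2 (fun=> hf)) => x.
by rewrite !mxE.
Qed.
Lemma DFN n (f : 'rV[R]_n -> R) : DF f -> DF (fun x => - f x).
Proof. by move=> hf; apply: DF_ext (DFM (DF_cst n (-1)) hf) => x; rewrite mulN1r. Qed.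
Lemma DFB n (f g : 'rV[R]_n -> R) : DF f -> DF g -> DF (fun x => f x - g x).
Proof. by move=> hf hg; exact: DFD hf (DFN hg). Qed.
Lemma DF_an n m (f : 'rV[R]_m -> R) (F : 'I_m -> 'rV[R]_n -> R) : restricted_analytic f ->
  (forall i, DF (F i)) -> DF (fun x => f (\row_i F i x)).
Proof.
move=> hf; apply: DF_comp.
apply: (@DF_basic _ _ (An hf (fun i => @Var R i))) => w /=.
by congr f; apply/rowP => i; rewrite mxE -env_lsub.
Qed.

Lemma definable_eq n (f g : 'rV[R]_n -> R) : DF f -> DF g -> definable [set x | f x = g x].
Proof.
move=> hf hg.
have h2 : definable [set x : 'rV[R]_2 | x ord0 ord0 = x ord0 o1].
  exists (FEq (@Var R (@ord0 1)) (@Var R o1)) => x.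
  change ((x ord0 ord0 = x ord0 o1) <-> (env_of x (ord0 : 'I_2) = env_of x o1)).
  by rewrite !env_of_ord.
apply: definable_ext (definable_preim (fun i => DF_sel2 i hf hg) h2) => x /=.
by rewrite !mxE.
Qed.
Lemma definable_lt n (f g : 'rV[R]_n -> R) : DF f -> DF g -> definable [set x | f x < g x].
Proof.
move=> hf hg.
have h2 : definable [set x : 'rV[R]_2 | x ord0 ord0 < x ord0 o1].
  exists (FLt (@Var R (@ord0 1)) (@Var R o1)) => x.
  change ((x ord0 ord0 < x ord0 o1) <-> (env_of x (ord0 : 'I_2) < env_of x o1)).
  by rewrite !env_of_ord.
apply: definable_ext (definable_preim (fun i => DF_sel2 i hf hg) h2) => x /=.
by rewrite !mxE.
Qed.
Lemma definable_le n (f g : 'rV[R]_n -> R) : DF f -> DF g -> definable [set x | f x <= g x].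
Proof.
move=> hf hg; apply: definable_ext (definableN (definable_lt hg hf)) => x /=.
by rewrite leNgt; split=> /negP.
Qed.

Lemma DF_graph n (f : 'rV[R]_n -> R) (Q : 'rV[R]_n -> R -> Prop) :
  (forall x y, Q x y <-> y = f x) ->
  definable [set w : 'rV[R]_(n + 1) | Q (lsubmx w) (w ord0 (rshift n ord0))] -> DF f.
Proof. by move=> h; apply: definable_ext => w /=; rewrite h. Qed.

Lemma definable_lift n (A : set 'rV[R]_n) m : definable A ->
  definable [set w : 'rV[R]_(n + m) | A (lsubmx w)].
Proof.
move=> hA; apply: definable_ext (definable_preim (F := fun i (w : 'rV[R]_(n + m)) => w ord0 (lshift m i)) _ hA).
  by move=> w /=; suff -> : \row_i w ord0 (lshift m i) = lsubmx w by []; apply/rowP => i; rewrite !mxE.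
by move=> i; exact: DF_coord.
Qed.

Lemma DF_if n (P : set 'rV[R]_n) (f g : 'rV[R]_n -> R) : definable P -> DF f -> DF g ->
  DF (fun x => if `[< P x >] then f x else g x).
Proof.
move=> hP hf hg.
apply: (@DF_graph _ _ (fun x y => (P x /\ y = f x) \/ (~ P x /\ y = g x))).
  move=> x y; case: asboolP => Px; split; auto; first by case=> -[].
  by case=> -[].
apply: definableU; apply: definableI => //.
- exact: definable_lift.
- by apply: definableN; exact: definable_lift.
Qed.
(** The second disjunct of the graph is the convention that the inverse of 0 is 0. *)
Lemma DFV n (f : 'rV[R]_n -> R) : DF f -> DF (fun x => (f x)^-1).
Proof.
move=> hf.
apply: (@DF_graph _ _ (fun x y => (f x * y = 1) \/ (f x = 0 /\ y = 0))).
  move=> x y; split=> [[h|[h ->]]|->]; last 1 first.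
  - have [->|h] := eqVneq (f x) 0; first by right; rewrite invr0.
    by left; rewrite divff.
  - have f0 : f x != 0 by apply: contra_eq_neq h => ->; rewrite mul0r eq_sym oner_neq0.
    by rewrite -[LHS](mulKf f0) h mulr1.
  - by rewrite h invr0.
apply: definableU; [|apply: definableI]; apply: definable_eq; do ?exact: DF_cst.
- by apply: DFM; [exact: DF_lift|exact: DF_coord].
- exact: DF_lift.
- exact: DF_coord.
Qed.
Lemma DF_max n (f g : 'rV[R]_n -> R) : DF f -> DF g -> DF (fun x => Num.max (f x) (g x)).
Proof.
move=> hf hg; apply: DF_ext (DF_if (definable_lt hf hg) hg hf) => x.
by rewrite /Num.max/=; case: asboolP => /= h; case: ifP => //; rewrite ?h//; move: h => /negP/negbTE ->.
Qed.
Lemma DF_abs n (f : 'rV[R]_n -> R) : DF f -> DF (fun x => `|f x|).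
Proof.
move=> hf; apply: DF_ext (DF_max hf (DFN hf)) => x.
by have [h|h] := leP 0 (f x); [rewrite ger0_norm// max_l|rewrite ltr0_norm// max_r]; lra.
Qed.
Lemma DF_sum n (I : Type) (s : seq I) (P : pred I) (F : I -> 'rV[R]_n -> R) :
  (forall i, DF (F i)) -> DF (fun x => \sum_(i <- s | P i) F i x).
Proof.
move=> hF; elim: s => [|i s IH].
  by apply: DF_ext (DF_cst n 0) => x; rewrite big_nil.
apply: (@DF_ext _ (fun x => (if P i then F i x else 0) + \sum_(j <- s | P j) F j x)).
  by move=> x; rewrite big_cons; case: ifP => //; rewrite add0r.
by apply: DFD => //; case: (P i) => //; exact: DF_cst.
Qed.

(** * Complex-valued and matrix-valued definable functions *)

Definition DC n (f : 'rV[R]_n -> C) : Prop :=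
  DF (fun x => complex.Re (f x)) /\ DF (fun x => complex.Im (f x)).
Lemma DC_ext n (f g : 'rV[R]_n -> C) : f =1 g -> DC f -> DC g.
Proof. by move=> /funext ->. Qed.
Lemma DC_cst n c : DC (fun _ : 'rV[R]_n => c). Proof. by split; exact: DF_cst. Qed.
Lemma DCD n (f g : 'rV[R]_n -> C) : DC f -> DC g -> DC (fun x => f x + g x).
Proof.
move=> [h1 h2] [h3 h4]; split.
  by apply: DF_ext (DFD h1 h3) => x; rewrite ReD.
by apply: DF_ext (DFD h2 h4) => x; rewrite ImD.
Qed.
Lemma DCM n (f g : 'rV[R]_n -> C) : DC f -> DC g -> DC (fun x => f x * g x).
Proof.
move=> [h1 h2] [h3 h4]; split.
  by apply: DF_ext (DFB (DFM h1 h3) (DFM h2 h4)) => x; rewrite ReM.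
by apply: DF_ext (DFD (DFM h1 h4) (DFM h2 h3)) => x; rewrite ImM.
Qed.
Lemma DC_mk n (f g : 'rV[R]_n -> R) : DF f -> DF g -> DC (fun x => f x +i* g x).
Proof. by []. Qed.
Lemma DCN n (f : 'rV[R]_n -> C) : DC f -> DC (fun x => - f x).
Proof. by move=> h; apply: DC_ext (DCM (DC_cst n (-1)) h) => x; rewrite mulN1r. Qed.
Lemma DCV n (f : 'rV[R]_n -> C) : DC f -> DC (fun x => (f x)^-1).
Proof.
move=> [h1 h2].
pose N x := (complex.Re (f x) ^+ 2 + complex.Im (f x) ^+ 2)^-1.
have hN : DF N by apply: DFV; apply: DFD; apply: DFM.
apply: (@DC_ext _ (fun x => (complex.Re (f x) * N x) +i* (- (complex.Im (f x)) * N x))).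
  by move=> x; rewrite /N; case: (f x) => a b; rewrite {2}/GRing.inv/= /N mulNr.
by split; apply: DFM => //; exact: DFN.
Qed.
Lemma DC_sum n (I : Type) (s : seq I) (P : pred I) (F : I -> 'rV[R]_n -> C) :
  (forall i, DC (F i)) -> DC (fun x => \sum_(i <- s | P i) F i x).
Proof.
move=> hF; split.
  by apply: (DF_ext _ (DF_sum s P (fun i => (hF i).1))) => x; rewrite Re_sum.
by apply: (DF_ext _ (DF_sum s P (fun i => (hF i).2))) => x; rewrite Im_sum.
Qed.
Lemma DC_prod n (I : Type) (s : seq I) (P : pred I) (F : I -> 'rV[R]_n -> C) :
  (forall i, DC (F i)) -> DC (fun x => \prod_(i <- s | P i) F i x).
Proof.
move=> hF; elim: s => [|i s IH].
  by apply: DC_ext (DC_cst n 1) => x; rewrite big_nil.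
apply: (@DC_ext _ (fun x => (if P i then F i x else 1) * \prod_(j <- s | P j) F j x)).
  by move=> x; rewrite big_cons; case: ifP => //; rewrite mul1r.
by apply: DCM => //; case: (P i) => //; exact: DC_cst.
Qed.
Lemma definable_eqC n (f g : 'rV[R]_n -> C) : DC f -> DC g -> definable [set x | f x = g x].
Proof.
move=> [h1 h2] [h3 h4]; apply: definable_ext (definableI (definable_eq h1 h3) (definable_eq h2 h4)) => x /=.
by split=> [[]|->//]; exact: complex_ext.
Qed.

Definition DM n p q (A : 'rV[R]_n -> 'M[C]_(p, q)) : Prop := forall i j, DC (fun x => A x i j).
Lemma DM_mul n p q r (A : 'rV[R]_n -> 'M[C]_(p, q)) (B : 'rV[R]_n -> 'M[C]_(q, r)) :
  DM A -> DM B -> DM (fun x => A x *m B x).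
Proof.
move=> hA hB i j; apply: (@DC_ext _ (fun x => \sum_k A x i k * B x k j)).
  by move=> x; rewrite mxE.
by apply: DC_sum => k; exact: DCM.
Qed.
Lemma DM_add n p q (A B : 'rV[R]_n -> 'M[C]_(p, q)) : DM A -> DM B -> DM (fun x => A x + B x).
Proof. by move=> hA hB i j; apply: DC_ext (DCD (hA i j) (hB i j)) => x; rewrite mxE. Qed.
Lemma DM_cst n p q (A : 'M[C]_(p, q)) : DM (fun _ : 'rV[R]_n => A).
Proof. by move=> i j; exact: DC_cst. Qed.
Lemma DM_tr n p q (A : 'rV[R]_n -> 'M[C]_(p, q)) : DM A -> DM (fun x => (A x)^T).
Proof. by move=> hA i j; apply: DC_ext (hA j i) => x; rewrite mxE. Qed.
Lemma DM_scale n p q (c : 'rV[R]_n -> C) (A : 'rV[R]_n -> 'M[C]_(p, q)) : DC c -> DM A ->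
  DM (fun x => c x *: A x).
Proof. by move=> hc hA i j; apply: DC_ext (DCM hc (hA i j)) => x; rewrite mxE. Qed.
Lemma DC_det n p (A : 'rV[R]_n -> 'M[C]_p) : DM A -> DC (fun x => \det (A x)).
Proof.
move=> hA; apply: DC_sum => s; apply: DCM; first exact: DC_cst.
by apply: DC_prod => i; exact: hA.
Qed.
Lemma DM_adj n p (A : 'rV[R]_n -> 'M[C]_p) : DM A -> DM (fun x => \adj (A x)).
Proof.
move=> hA i j; apply: (@DC_ext _ (fun x => (-1) ^+ (j + i) * \det (row' j (col' i (A x))))).
  by move=> x; rewrite mxE.
apply: DCM; first exact: DC_cst.
by apply: DC_det => k l; apply: DC_ext (hA (lift j k) (lift i l)) => x; rewrite !mxE.
Qed.

End Definability.

(** * Power series *)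
Section PowerSeries.
Variable R : realType.
Local Notation C := R[i].

Lemma fbound_inj_sup (I J : eqType) (phi : J -> I) (psi : I -> J) (u : I -> R) M :
  (forall i, u i != 0 -> phi (psi i) = i) ->
  fbound (fun j => u (phi j)) M -> fbound u M.
Proof.
move=> c2 h s us.
rewrite (bigID (fun i => u i != 0))/= [X in _ + X]big1 ?addr0; last first.
  by move=> i /negPn/eqP ->.
rewrite -big_filter; set t := [seq i <- s | u i != 0].
have ut : uniq (map psi t).
  rewrite map_inj_in_uniq ?filter_uniq// => x y.
  rewrite !mem_filter => /andP[/c2 hx _] /andP[/c2 hy _] e.
  by rewrite -hx -hy e.
have := h _ ut; rewrite big_map; apply: le_trans; rewrite le_eqVlt; apply/orP; left; apply/eqP.
by apply: eq_big_seq => i; rewrite mem_filter => /andP[/c2 ->].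
Qed.

Lemma fbound_finType (I : finType) (u : I -> R) : (forall i, 0 <= u i) ->
  fbound u (\sum_i u i).
Proof.
move=> u0 s us; rewrite [leRHS](bigID (mem s))/=.
rewrite big_uniq//= lerDl sumr_ge0//.
Qed.

Lemma sumC_finType (I : finType) (f : I -> C) : sumC f = \sum_i f i.
Proof.
rewrite (@sumC_finite _ _ (index_enum I))//; first by rewrite index_enum_uniq.
by move=> i; rewrite mem_index_enum.
Qed.

Section ps.
Variable m : nat.
Local Notation E := {ffun 'I_m -> nat}.
Implicit Types (p x h : 'rV[R]_m) (k : E) (f g : 'rV[R]_m -> C).

Definition mono k h : R := \prod_(i < m) h ord0 i ^+ k i.
Definition rpow (r : R) k : R := \prod_(i < m) r ^+ k i.
Definition near_pt p r x := forall i, `|x ord0 i - p ord0 i| < r.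

(** [B] bounds the weighted l1 norm of the Taylor coefficients at p on the polydisc of radius r.
    This norm is submultiplicative and complete, so expansions and their bounds are obtained
    together. *)
Definition ps p r f B := exists a : E -> C,
  fbound (fun k => nrm (a k) * rpow r k) B /\
  forall x, near_pt p r x -> f x = sumC (fun k => a k * (mono k (x - p))%:C).

Lemma rpow_ge0 r k : 0 <= r -> 0 <= rpow r k.
Proof. by move=> r0; apply: prodr_ge0 => i _; rewrite exprn_ge0. Qed.
Lemma mono_le p r x k : near_pt p r x -> `|mono k (x - p)| <= rpow r k.
Proof.
move=> hx; rewrite /mono /rpow normr_prod; apply: ler_prod => i _.
rewrite normr_ge0/= normrX lerXn2r ?nnegrE//; last by have := hx i; rewrite !mxE => /ltW.
by apply: le_trans (ltW (hx i)).
Qed.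

Section collapse.
Variables (I : choiceType) (a : I -> C) (e : I -> E).
(** Terms with equal exponents are grouped. The index type is arbitrary and [e] need not be
    injective, so that products and infinite sums of series are instances. *)
Lemma collapse p r f B : 0 < r ->
  fbound (fun i => nrm (a i) * rpow r (e i)) B ->
  (forall x, near_pt p r x -> f x = sumC (fun i => a i * (mono (e i) (x - p))%:C)) ->
  ps p r f B.
Proof.
move=> r0 hB hf.
have r0' := ltW r0.
pose A k := sumC (fun i => if e i == k then a i else 0).
pose u (q : E * I) : R := if e q.2 == q.1 then nrm (a q.2) * rpow r q.1 else 0.
have u0 q : 0 <= u q by rewrite /u; case: ifP => // _; rewrite mulr_ge0 ?nrm_ge0 ?rpow_ge0.
have hu : fbound u B.
  apply: (@fbound_inj_sup _ _ (fun i => (e i, i)) snd).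
    by move=> [k i]; rewrite /u /=; case: ifP => [/eqP ->//|_]; rewrite eqxx.
  by apply: fboundW hB => i; rewrite /u eqxx.
have kA k : asum (fun i => if e i == k then a i else 0).
  have [M hM] : exists M, fbound (fun i => u (k, i)) M by exists B; exact: fbound_slice hu.
  exists (M / rpow r k) => s us.
  have rk : 0 < rpow r k by apply: prodr_gt0 => i _; rewrite exprn_gt0.
  rewrite ler_pdivlMr// mulr_suml; apply: le_trans (hM s us); apply: ler_sum => i _.
  by rewrite /u /=; case: eqP => //; rewrite nrm0 mul0r.
exists A; split.
  apply: fboundW (fbound_outer u0 hu) => k.
  have [M hM] := kA k.
  apply: (@le_trans _ _ (tsum (fun i => rpow r k * nrm (if e i == k then a i else 0)))).
    rewrite (tsumZ (rpow_ge0 k r0') hM); last by move=> i; exact: nrm_ge0.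
    by rewrite mulrC ler_wpM2l ?rpow_ge0// nrm_sumC.
  rewrite le_eqVlt; apply/orP; left; apply/eqP; apply: eq_tsum => i; rewrite /u /=.
  by case: eqP => _; rewrite ?nrm0 ?mulr0// mulrC.
move=> x hx; rewrite hf//.
pose F (q : E * I) : C := if e q.2 == q.1 then a q.2 * (mono q.1 (x - p))%:C else 0.
have aF : asum F.
  exists B; apply: fboundW hu => q; rewrite /F /u; case: ifP => _; rewrite ?nrm0//.
  by rewrite nrmM nrm_real ler_wpM2l ?nrm_ge0// mono_le.
rewrite -[LHS](_ : sumC F = _); last first.
  rewrite (@sumC_inj _ _ _ (fun i => (e i, i))); last 2 first.
  - by move=> i j [].
  - by move=> [k i]; rewrite /F /=; case: ifP => [/eqP <- _|_]; [exists i|rewrite eqxx].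
  by apply: eq_sumC => i; rewrite /F eqxx.
rewrite sumC_pair//; apply: eq_sumC => k; rewrite /A mulrC -sumCZ//.
by apply: eq_sumC => i; rewrite /F /=; case: eqP; rewrite ?mulr0// mulrC.
Qed.
End collapse.

Lemma ps_asum p r (a : E -> C) B x : near_pt p r x ->
  fbound (fun k => nrm (a k) * rpow r k) B -> asum (fun k => a k * (mono k (x - p))%:C).
Proof.
move=> hx h; exists B; apply: fboundW h => k.
by rewrite nrmM nrm_real ler_wpM2l ?nrm_ge0// mono_le.
Qed.

Definition e0 : E := [ffun=> 0%N].
Definition e1 (i : 'I_m) : E := [ffun j => (j == i : nat)].
Lemma mono0 h : mono e0 h = 1.
Proof. by rewrite /mono big1// => i _; rewrite ffunE. Qed.
Lemma rpow0 r : rpow r e0 = 1.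
Proof. by rewrite /rpow big1// => i _; rewrite ffunE. Qed.
Lemma mono1 i h : mono (e1 i) h = h ord0 i.
Proof.
rewrite /mono (bigD1 i)//= big1 ?mulr1 ?ffunE ?eqxx//.
by move=> j /negbTE ji; rewrite ffunE ji.
Qed.
Lemma rpow1 i r : rpow r (e1 i) = r.
Proof.
rewrite /rpow (bigD1 i)//= big1 ?mulr1 ?ffunE ?eqxx//.
by move=> j /negbTE ji; rewrite ffunE ji.
Qed.
Definition eadd k k' : E := [ffun i => (k i + k' i)%N].
Lemma monoD k k' h : mono (eadd k k') h = mono k h * mono k' h.
Proof. by rewrite /mono -big_split; apply: eq_bigr => i _; rewrite ffunE exprD. Qed.
Lemma rpowD k k' r : rpow r (eadd k k') = rpow r k * rpow r k'.
Proof. by rewrite /rpow -big_split; apply: eq_bigr => i _; rewrite ffunE exprD. Qed.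

Lemma ps_cst p r (c : C) : 0 < r -> ps p r (fun _ => c) (nrm c).
Proof.
move=> r0; apply: (@collapse _ (fun _ : unit => c) (fun=> e0)) => // [|x hx].
  have := @fbound_finType _ (fun _ : unit => nrm c * rpow r e0).
  rewrite big_const card_unit /= addr0 rpow0 mulr1; apply=> _; exact: nrm_ge0.
by rewrite sumC_finType big_const card_unit /= addr0 mono0 mulr1.
Qed.
(** x_i = p_i + (x_i - p_i), the two terms being indexed by [bool]. *)
Lemma ps_coord p r i : 0 < r -> ps p r (fun x => (x ord0 i)%:C) (`|p ord0 i| + r).
Proof.
move=> r0.
apply: (@collapse _ (fun b : bool => if b then (p ord0 i)%:C else 1)
                    (fun b : bool => if b then e0 else e1 i)) => // [|x hx].
  have := @fbound_finType _ (fun b : bool => nrm (if b then (p ord0 i)%:C else 1) *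
     rpow r (if b then e0 else e1 i)).
  rewrite big_bool rpow0 rpow1 nrm_real nrm1 mulr1 mul1r; apply=> b.
  by rewrite mulr_ge0 ?nrm_ge0// rpow_ge0 ?ltW.
rewrite sumC_finType big_bool mono0 mono1 mulr1 mul1r !mxE.
by apply: complex_ext => /=; lra.
Qed.
Lemma ps_mul p r f g B B' : 0 < r -> ps p r f B -> ps p r g B' ->
  ps p r (fun x => f x * g x) (B * B').
Proof.
move=> r0 [a [ha hf]] [b [hb hg]].
apply: (@collapse _ (fun q : E * E => a q.1 * b q.2) (fun q => eadd q.1 q.2)) => // [|x hx].
  apply: fboundW (fbound_mul _ _ ha hb) => [q|k|k].
  - by rewrite nrmM rpowD le_eqVlt; apply/orP; left; apply/eqP; ring.
  - by rewrite mulr_ge0 ?nrm_ge0// rpow_ge0 ?ltW.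
  - by rewrite mulr_ge0 ?nrm_ge0// rpow_ge0 ?ltW.
rewrite hf// hg// sumC_mul; [|exact: ps_asum hx ha|exact: ps_asum hx hb].
by apply: eq_sumC => q; rewrite monoD rmorphM/=; ring.
Qed.
(** Weierstrass' theorem for the norm of [ps]: summable norms make the double family of coefficients
    summable. *)
Lemma ps_sum (K : choiceType) p r (f : 'rV[R]_m -> C) (F : K -> 'rV[R]_m -> C) (B : K -> R) M :
  0 < r -> (forall n, ps p r (F n) (B n)) -> fbound B M ->
  (forall x, near_pt p r x -> f x = sumC (fun n => F n x)) -> ps p r f M.
Proof.
move=> r0 hF hM hf.
have [a ha] := choice hF.
have pos q : 0 <= nrm (a q.1 q.2) * rpow r q.2 by rewrite mulr_ge0 ?nrm_ge0// rpow_ge0 ?ltW.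
have bd : fbound (fun q : K * E => nrm (a q.1 q.2) * rpow r q.2) M.
  apply: fbound_pair => //= [n|]; first by exists (B n); exact: (ha n).1.
  apply: fboundW hM => n; apply: tsum_le; last exact: (ha n).1.
  by move=> k; exact: (pos (n, k)).
apply: (@collapse _ (fun q : K * E => a q.1 q.2) snd) => // x hx.
rewrite hf// sumC_pair; last first.
  exists M; apply: fboundW bd => q; rewrite nrmM nrm_real ler_wpM2l ?nrm_ge0//.
  exact: mono_le.
by apply: eq_sumC => n; rewrite (ha n).2.
Qed.
Lemma ps_ext p r f g B : (forall x, near_pt p r x -> f x = g x) -> ps p r f B -> ps p r g B.
Proof. by move=> fg [a [ha hf]]; exists a; split=> // x hx; rewrite -fg// hf. Qed.
Lemma ps_le p r f B B' : B <= B' -> ps p r f B -> ps p r f B'.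
Proof.
by move=> BB [a [ha hf]]; exists a; split=> // s us; apply: le_trans BB; exact: ha.
Qed.
Lemma ps_add p r f g B B' : 0 < r -> ps p r f B -> ps p r g B' ->
  ps p r (fun x => f x + g x) (B + B').
Proof.
move=> r0 hf hg.
have B0 : 0 <= B by case: hf => a [/fbound_ge0].
have B0' : 0 <= B' by case: hg => a [/fbound_ge0].
apply: (@ps_sum bool _ _ _ (fun b : bool => if b then f else g)
   (fun b : bool => if b then B else B')) => //.
- by case.
- have := @fbound_finType _ (fun b : bool => if b then B else B').
  by rewrite big_bool; apply; case.
- by move=> x hx; rewrite sumC_finType big_bool.
Qed.
Lemma ps_exp p r f B n : 0 < r -> ps p r f B -> ps p r (fun x => f x ^+ n) (B ^+ n).
Proof.
move=> r0 hf; elim: n => [|n IH].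
  by have := ps_cst p 1 r0; rewrite nrm1.
by rewrite exprS; apply: ps_ext (ps_mul r0 hf IH) => x _; rewrite exprS.
Qed.
Lemma ps_prod p r (I : Type) (s : seq I) (F : I -> 'rV[R]_m -> C) (B : I -> R) : 0 < r ->
  (forall i, ps p r (F i) (B i)) ->
  ps p r (fun x => \prod_(i <- s) F i x) (\prod_(i <- s) B i).
Proof.
move=> r0 hF; elim: s => [|i s IH].
  rewrite big_nil; apply: (@ps_ext _ _ (fun _ => 1)); first by move=> x _; rewrite big_nil.
  by have := ps_cst p 1 r0; rewrite nrm1.
rewrite big_cons; apply: ps_ext (ps_mul r0 (hF i) IH) => x _; rewrite big_cons.
by [].
Qed.

Lemma ps_analytic p r f B : 0 < r -> ps p r f B ->
  real_analytic_at (fun x => complex.Re (f x)) p /\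
  real_analytic_at (fun x => complex.Im (f x)) p.
Proof.
move=> r0 [a [ha hf]].
have S (b : E -> R) x : near_pt p r x -> (forall k, `|b k| <= nrm (a k)) ->
    summable setT (fun k => (b k * mono k (x - p))%:E).
  move=> hx hb; rewrite /summable.
  apply: (@le_lt_trans _ _ B%:E); last by rewrite ltry.
  have := @esum_le_fbound _ _ (fun k => `|b k * mono k (x - p)|) B; apply.
  apply: fboundW ha => k; rewrite normrM ler_pM//.
  exact: mono_le.
have M k x : \prod_(i < m) (x ord0 i - p ord0 i) ^+ k i = mono k (x - p).
  by apply: eq_bigr => i _; rewrite !mxE.
split.
  exists r, (fun k => complex.Re (a k)); split=> // x hx.
  have -> : (fun k => complex.Re (a k) * \prod_(i < m) (x ord0 i - p ord0 i) ^+ k i) =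
     (fun k => complex.Re (a k) * mono k (x - p)) by apply: funext => k; rewrite M.
  split; first by apply: S => // k; exact: nrm_Re.
  by rewrite hf//; apply: eq_sumR => k; rewrite ReM /= mulr0 subr0.
exists r, (fun k => complex.Im (a k)); split=> // x hx.
have -> : (fun k => complex.Im (a k) * \prod_(i < m) (x ord0 i - p ord0 i) ^+ k i) =
   (fun k => complex.Im (a k) * mono k (x - p)) by apply: funext => k; rewrite M.
split; first by apply: S => // k; exact: nrm_Im.
by rewrite hf//; apply: eq_sumR => k; rewrite ImM /= mulr0 add0r.
Qed.

Definition cube_restr (f : 'rV[R]_m -> R) (x : 'rV[R]_m) : R :=
  if `[< in_unit_cube x >] then f x else 0.

Lemma open_coord (A : 'I_m -> set R) : (forall i, open (A i)) ->
  open [set x : 'rV[R]_m | forall i, A i (x ord0 i)].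
Proof.
move=> oA; rewrite openE => x hx.
apply: (@filter_forall _ _ (fun i => [set y : 'rV[R]_m | A i (y ord0 i)]) (nbhs x)) => i.
have := @coord_continuous R 1 m ord0 i x (A i); apply.
exact: open_nbhs_nbhs.
Qed.

(** The open cube of half-width 1 + s is the neighbourhood of the unit cube on which the function is
    analytic. *)
Lemma ps_restricted f s : 0 < s ->
  (forall p, (forall i, `|p ord0 i| <= 1 + s) -> exists r B, 0 < r /\ ps p r f B) ->
  restricted_analytic (cube_restr (fun x => complex.Re (f x))) /\
  restricted_analytic (cube_restr (fun x => complex.Im (f x))).
Proof.
move=> s0 hf.
pose O : set 'rV[R]_m := [set x | forall i, (`]-(1 + s), (1 + s)[)%classic (x ord0 i)].
have oO : open O by apply: (@open_coord (fun=> `]-(1 + s), (1 + s)[%classic)) => i; exact: interval_open.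
have cO x : in_unit_cube x -> O x.
  by move=> hx i /=; rewrite in_itv /=; have /andP[h1 h2] := hx i; apply/andP; split; lra.
have aO x : O x -> exists r B, 0 < r /\ ps x r f B.
  by move=> hx; apply: hf => i; have := hx i; rewrite /= in_itv /= -ltr_norml => /ltW.
split.
  exists O, (fun x => complex.Re (f x)); split=> // [x /aO[r [B [r0 h]]]|x hx|x hx].
  - by have [] := ps_analytic r0 h.
  - by rewrite /cube_restr; case: asboolP.
  - by rewrite /cube_restr; case: asboolP.
exists O, (fun x => complex.Im (f x)); split=> // [x /aO[r [B [r0 h]]]|x hx|x hx].
- by have [] := ps_analytic r0 h.
- by rewrite /cube_restr; case: asboolP.
- by rewrite /cube_restr; case: asboolP.
Qed.
End ps.

(** * A convergent series in complex variables, read on a real cube *)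

Section core.
Variables (v : nat) (K : choiceType) (b : K -> C) (mu : K -> 'I_v -> nat).
Variables (rho : 'I_v -> R) (beta delta b0 M : R).
Hypothesis rho_ge0 : forall j, 0 <= rho j.
Hypothesis b0_ge0 : 0 <= b0.
Hypothesis b_le : forall n, nrm (b n) <= b0.
Hypothesis d0 : 0 <= delta.
Hypothesis db : 1 + delta < beta.
Hypothesis hM : fbound (fun n => \prod_j (rho j * beta) ^+ mu n j) M.

(** A complex number with real part in [-rho, rho] and imaginary part in [-rho delta, rho delta], in
    coordinates of the unit cube. A small [delta] keeps its norm near rho on a neighbourhood of the
    whole cube. *)
Definition core_var (j : 'I_v) (x : 'rV[R]_(v + v)) : C :=
  (rho j)%:C * ((x ord0 (lshift v j))%:C + ((delta%:C * 'i%C) * (x ord0 (rshift v j))%:C)).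
Definition core_sum (x : 'rV[R]_(v + v)) : C :=
  sumC (fun n => b n * \prod_j core_var j x ^+ mu n j).

Lemma core_restricted :
  restricted_analytic (cube_restr (fun x => complex.Re (core_sum x))) /\
  restricted_analytic (cube_restr (fun x => complex.Im (core_sum x))).
Proof.
(* Chosen so that (1 + 2s)(1 + delta) = beta: for a centre with coordinates at most 1 + s and radius
   s, the norm of [core_var j] is at most rho_j beta, which is where the series is known to
   converge. *)
pose s := (beta / (1 + delta) - 1) / 2.
have d1 : 0 < 1 + delta by rewrite ltr_pwDl.
have s0 : 0 < s by rewrite divr_gt0// subr_gt0 ltr_pdivlMr// mul1r.
have sE : (1 + 2 * s) * (1 + delta) = beta.
  rewrite /s [2 * _]mulrC divfK ?pnatr_eq0// addrC subrK divfK//.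
  by rewrite gt_eqF.
apply: (ps_restricted s0) => p hp; exists s, (b0 * M); split=> //.
have hX j : ps p s (core_var j) (rho j * beta).
  have h1 := ps_coord p (lshift v j) s0; have h2 := ps_coord p (rshift v j) s0.
  have h3 := ps_mul s0 (ps_cst p (delta%:C * 'i%C) s0) h2.
  have h4 := ps_mul s0 (ps_cst p (rho j)%:C s0) (ps_add s0 h1 h3).
  apply: ps_le h4; rewrite nrm_real nrmM nrm_real (ger0_norm (rho_ge0 j)) ler_wpM2l// (ger0_norm d0).
  rewrite (_ : nrm ('i%C : C) = 1) ?mulr1; last by rewrite /= expr0n expr1n add0r sqrtr1.
  rewrite -sE; have := hp (lshift v j); have := hp (rshift v j) => q1 q2.
  have : delta * (`|p ord0 (rshift v j)| + s) <= delta * (1 + 2 * s).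
    by rewrite ler_wpM2l//; lra.
  by lra.
have hM' : fbound (fun n => b0 * \prod_j (rho j * beta) ^+ mu n j) (b0 * M).
  by apply: fboundZ.
apply: (ps_sum s0 _ hM') => // n.
have h5 := ps_prod (index_enum 'I_v) s0 (fun j => ps_exp (mu n j) s0 (hX j)).
apply: ps_le (ps_mul s0 (ps_cst p (b n) s0) h5); rewrite ler_wpM2r//.
apply: prodr_ge0 => j _; rewrite exprn_ge0// mulr_ge0//.
by apply: le_trans (ltW db); exact: ltW.
Qed.
End core.
End PowerSeries.

(** * The exponential and Fourier coefficients *)
Section Exponential.
Variable R : realType.
Local Notation C := R[i].

Lemma natC n : (n%:R : C) = (n%:R : R)%:C.
Proof. by rewrite rmorph_nat. Qed.
Lemma intC (n : int) : (n%:~R : C) = (n%:~R : R)%:C.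
Proof. by rewrite rmorph_int. Qed.
Lemma cexpD (x y : C) : cexp (x + y) = cexp x * cexp y.
Proof.
rewrite /cexp ReD ImD expRD cosD sinD.
by apply: complex_ext; rewrite !(ReM, ImM) /=; ring.
Qed.
Lemma nrm_cexp (x : C) : nrm (cexp x) = expR (complex.Re x).
Proof.
rewrite /cexp nrmM nrm_real ger0_norm ?expR_ge0//= cos2Dsin2 sqrtr1.
by rewrite mulr1.
Qed.
Lemma cexp0 : cexp (0 : C) = 1.
Proof. by rewrite /cexp /= expR0 cos0 sin0 mul1r. Qed.
Lemma cexp_neq0 (x : C) : cexp x != 0.
Proof. by rewrite -nrm_gt0 nrm_cexp expR_gt0. Qed.
Lemma cexp_real (x : R) : cexp (x%:C) = (expR x)%:C.
Proof. by rewrite /cexp /= cos0 sin0 mulr1. Qed.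
Lemma epiD (x y : C) : epi (x + y) = epi x * epi y.
Proof. by rewrite /epi mulrDr cexpD. Qed.
Lemma epi0 : epi (0 : C) = 1. Proof. by rewrite /epi mulr0 cexp0. Qed.
Lemma epi_neq0 (x : C) : epi x != 0. Proof. exact: cexp_neq0. Qed.
Lemma nrm_epi (x : C) : nrm (epi x) = expR (- pi * complex.Im x).
Proof. by rewrite nrm_cexp ReM /= mul0r add0r mulNr. Qed.
Lemma epiN (x : C) : epi (- x) = (epi x)^-1.
Proof.
apply: (mulIf (epi_neq0 x)); rewrite -epiD addNr epi0 mulVf//.
exact: epi_neq0.
Qed.
Lemma epi_sum (I : Type) (s : seq I) (P : pred I) (f : I -> C) :
  epi (\sum_(i <- s | P i) f i) = \prod_(i <- s | P i) epi (f i).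
Proof. by elim/big_rec2: _ => [|i y x _ h]; rewrite ?epi0// epiD h. Qed.
Lemma epiMn (x : C) (n : nat) : epi (n%:R * x) = epi x ^+ n.
Proof.
elim: n => [|n IH]; first by rewrite mul0r epi0.
by rewrite exprS -IH -epiD -natr1 mulrDl mul1r addrC.
Qed.
Lemma epi_real (x : R) : epi (x%:C) = cos (pi * x) +i* sin (pi * x).
Proof.
rewrite /epi; have -> : (0 +i* pi) * x%:C = 0 +i* (pi * x).
  by apply: complex_ext; rewrite !(ReM, ImM) /=; ring.
by rewrite /cexp /= expR0; apply: complex_ext; rewrite !(ReM, ImM) /=; ring.
Qed.
Lemma epi2 : epi (2 : C) = 1.
Proof.
by rewrite natC epi_real mulr_natr cos2pi sin2pi.
Qed.
Lemma epi_int (n : int) : epi (2 * n%:~R : C) = 1.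
Proof.
case: n => n; first by rewrite -pmulrn mulrC epiMn epi2 expr1n.
by rewrite NegzE mulrNz mulrN epiN -pmulrn mulrC epiMn epi2 expr1n invr1.
Qed.

Lemma fbound_nat (u : nat -> R) M : (forall n, 0 <= u n) ->
  (forall N, \sum_(n < N) u n <= M) -> fbound u M.
Proof.
move=> u0 h s us; pose N := (\max_(n <- s) n).+1.
apply: le_trans (h N); rewrite -(big_mkord predT).
rewrite [leRHS](bigID (mem s))/= -[X in _ <= X + _]big_filter.
rewrite (perm_big [seq n <- index_iota 0 N | n \in s]); last first.
  apply: uniq_perm => //; first by rewrite filter_uniq// iota_uniq.
  move=> n; rewrite mem_filter mem_index_iota /=; apply/idP/idP => [ns|/andP[]//].
  by rewrite ns /N ltnS leq_bigmax_seq.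
by rewrite lerDl sumr_ge0.
Qed.

Lemma limC_cvg (u : nat -> R) (l : R) : u @ \oo --> l -> limC (fun n => (u n)%:C) (l%:C).
Proof.
move=> /cvgrPdist_lt h e e0; have [N _ hN] := h e e0; exists N => n Nn.
by rewrite -rmorphB nrm_real distrC; exact: hN.
Qed.

(** Partial sums are sums of truncated families, so dominated convergence identifies the unordered
    sum with the limit of the series. *)
Lemma sumC_nat (u : nat -> R) (l : R) : rsum u -> series u @ \oo --> l ->
  sumC (fun n => (u n)%:C) = l%:C.
Proof.
move=> hu /limC_cvg hl; apply: (limC_unique _ hl).
apply: (@limC_ext _ (fun N => sumC (fun n => if (n < N)%N then (u n)%:C else 0))).
  move=> N; rewrite (@sumC_finite _ _ (index_iota 0 N)); last 2 first.
  - exact: iota_uniq.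
  - by move=> n; rewrite mem_index_iota /= => /negbTE ->.
  rewrite /series /= rmorph_sum /=; apply: eq_big_seq => n.
  by rewrite mem_index_iota => /andP[_ ->].
apply: (@tannery _ _ _ _ (fun n => `|u n|)).
- by move=> n i; case: ifP => _; rewrite ?nrm0// nrm_real.
- by apply: rsumW hu => i; rewrite normr_id.
- by move=> i e e0; exists i.+1 => n hn; rewrite hn subrr nrm0.
Qed.

Lemma fbound_exp (x : R) : 0 <= x -> fbound (fun n : nat => x ^+ n / n`!%:R) (expR x).
Proof.
move=> x0; have u0 n : 0 <= x ^+ n / n`!%:R by rewrite divr_ge0// exprn_ge0.
apply: fbound_nat => // N.
have nd : nondecreasing_seq (series (exp_coeff x)).
  by apply/nondecreasing_seqP => n; rewrite /series /= big_nat_recr//= lerDl; exact: u0.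
have := nondecreasing_cvgn_le nd (@is_cvg_series_exp_coeff R x) N.
by rewrite /series /= big_mkord.
Qed.

Definition ecoef (z : C) (n : nat) : C := z ^+ n / n`!%:R.
Lemma nrm_ecoef z n : nrm (ecoef z n) = nrm z ^+ n / n`!%:R.
Proof.
rewrite /ecoef nrmM nrmX nrmV; congr (_ / _).
by rewrite natC nrm_real ger0_norm.
Qed.
Lemma asum_ecoef z : asum (ecoef z).
Proof.
exists (expR (nrm z)); apply: fboundW (fbound_exp (nrm_ge0 z)) => n.
by rewrite nrm_ecoef.
Qed.
Lemma rsum_exp (x : R) : rsum (fun n => x ^+ n / n`!%:R).
Proof.
exists (expR `|x|); apply: fboundW (fbound_exp (normr_ge0 x)) => n.
by rewrite normrM normrX normfV [`|_%:R|]ger0_norm.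
Qed.
Lemma ecoef_real (x : R) n : ecoef x%:C n = (x ^+ n / n`!%:R)%:C.
Proof. by rewrite /ecoef rmorphM rmorphXn fmorphV rmorph_nat. Qed.

Lemma sum_ecoef_real (x : R) : sumC (ecoef x%:C) = (expR x)%:C.
Proof.
rewrite -[RHS](@sumC_nat (fun n => x ^+ n / n`!%:R)); last 2 first.
- exact: rsum_exp.
- exact: (@is_cvg_series_exp_coeff R x).
by apply: eq_sumC => n; rewrite ecoef_real.
Qed.

Lemma iX (n : nat) : ('i%C : C) ^+ n =
  ((~~ odd n)%:R * (-1) ^+ n./2 : R) +i* ((odd n)%:R * (-1) ^+ n.-1./2 : R).
Proof.
suff H k : ('i%C : C) ^+ k.*2 = ((-1) ^+ k : R)%:C.
  rewrite -{1}(odd_double_half n) exprD H.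
  case: (odd n) (odd_double_half n) => hn /=; rewrite ?mul0r ?mul1r.
    rewrite expr1 -{2}hn /= doubleK.
    by apply: complex_ext; rewrite ?ReM ?ImM /=; ring.
  by rewrite ?expr0 ?mul1r.
rewrite -muln2 mulnC exprM; elim: k => [|k IH]; first by rewrite !expr0.
rewrite exprS [in RHS]exprS IH expr2.
by apply: complex_ext; rewrite !(ReM, ImM) /=; ring.
Qed.

Lemma sum_ecoef_imag (x : R) : sumC (ecoef ('i%C * x%:C)) = cos x +i* sin x.
Proof.
have hc : rsum (cos_coeff x).
  apply: rsumW (rsum_exp x) => n; rewrite /cos_coeff /= -mulrA normrM ler_piMl//.
  by rewrite normrM normrX normrN1 expr1n mulr1; case: (odd n); rewrite ?normr0 ?normr1.
have hs : rsum (sin_coeff x).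
  apply: rsumW (rsum_exp x) => n; rewrite /sin_coeff /= -mulrA normrM ler_piMl//.
  by rewrite normrM normrX normrN1 expr1n mulr1; case: (odd n); rewrite ?normr0 ?normr1.
have Ec : sumC (fun n => (cos_coeff x n)%:C) = (cos x)%:C.
  apply: sumC_nat => //; have := @is_cvg_series_cos_coeff R x.
  by rewrite [in X in _ -> X]unlock.
have Es : sumC (fun n => (sin_coeff x n)%:C) = (sin x)%:C.
  apply: sumC_nat => //; have := @is_cvg_series_sin_coeff R x.
  by rewrite [in X in _ -> X]unlock.
have e n : ecoef ('i%C * x%:C) n = cos_coeff x n +i* sin_coeff x n.
  rewrite /ecoef exprMn -mulrA -/(ecoef x%:C n) ecoef_real iX.
  by apply: complex_ext; rewrite ?ReM ?ImM /= /cos_coeff /sin_coeff /= mulr0 ?subr0 ?add0r !mulrA.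
move: Ec Es; rewrite /sumC => -[Ec _] [Es _].
rewrite -Ec -Es; apply: complex_ext => /=; apply: eq_sumR => n; by rewrite e.
Qed.

(** The known real series of the exponential, cosine and sine are joined by the Cauchy product,
    pairs being reindexed by their sum and first component. *)
Lemma sum_ecoef (z : C) : sumC (ecoef z) = cexp z.
Proof.
set x := (complex.Re z)%:C; set y := ('i%C * (complex.Im z)%:C : C).
have -> : z = x + y by rewrite /x /y; case: z {x y} => a b; simpc.
have -> : cexp (x + y) = sumC (ecoef x) * sumC (ecoef y).
  rewrite cexpD /x sum_ecoef_real /y sum_ecoef_imag cexp_real; congr (_ * _).
  rewrite /cexp ReM ImM /= !mul0r mulr0 subr0 expR0 mul1r add0r.
  by rewrite mul1r.
rewrite sumC_mul; try exact: asum_ecoef.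
set F := fun p : nat * nat => _.
have hF : asum F by apply: asum_mul; exact: asum_ecoef.
pose Gf (p : nat * nat) : C := if (p.2 <= p.1)%N then ecoef x p.2 * ecoef y (p.1 - p.2) else 0.
pose phi (p : nat * nat) := (p.1 + p.2, p.1)%N.
pose psi (p : nat * nat) := (p.2, p.1 - p.2)%N.
have c1 : cancel phi psi by move=> [a b]; rewrite /phi /psi /= addKn.
have c2 p : Gf p != 0 -> phi (psi p) = p.
  case: p => a b; rewrite /Gf /phi /psi /=; case: leqP => [h _|_]; last by rewrite eqxx.
  by rewrite subnKC.
have EG p : Gf (phi p) = F p by rewrite /Gf /phi /F /= leq_addr addKn.
have hG : asum Gf.
  apply: (asum_inj_sup c1 c2); apply: asumWC hF => p; by rewrite EG.
have -> : sumC F = sumC Gf.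
  rewrite (@sumC_inj _ _ _ phi Gf); last 2 first.
  - exact: can_inj c1.
  - by move=> p /c2 <-; exists (psi p).
  by apply: eq_sumC => p; rewrite EG.
rewrite sumC_pair//; apply: eq_sumC => n.
rewrite (@sumC_finite _ _ (index_iota 0 n.+1)); last 2 first.
- exact: iota_uniq.
- by move=> k; rewrite mem_index_iota /= ltnS /Gf /= => /negbTE ->.
rewrite big_mkord /ecoef [x + y]addrC exprDn mulr_suml; apply: eq_bigr => k _.
rewrite /Gf /= -ltnS ltn_ord /ecoef.
have kn : (k <= n)%N by rewrite -ltnS.
have f1 : (k`!%:R : C) != 0 by rewrite pnatr_eq0 -lt0n fact_gt0.
have f2 : ((n - k)`!%:R : C) != 0 by rewrite pnatr_eq0 -lt0n fact_gt0.
have f3 : (n`!%:R : C) != 0 by rewrite pnatr_eq0 -lt0n fact_gt0.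
have := bin_fact kn => /(congr1 (fun m : nat => m%:R : C)); rewrite !natrM => hb.
have hbin : ('C(n, k)%:R : C) = n`!%:R / (k`!%:R * (n - k)`!%:R).
  by apply: (canRL (mulfK _)) => //; rewrite mulf_neq0.
rewrite -[_ *+ 'C(n, k)]mulr_natr hbin; field.
by rewrite f1 f2 f3.
Qed.

(** The tail is the series shifted by two, and (n+2)! is at least n!. *)
Lemma cexp_taylor (u : C) : nrm (cexp u - 1 - u) <= nrm u ^+ 2 * expR (nrm u).
Proof.
pose h n : C := if (n < 2)%N then 0 else ecoef u n.
pose l n : C := if (n < 2)%N then ecoef u n else 0.
have al : asum l.
  by apply: asumWC (asum_ecoef u) => n; rewrite /l; case: ifP => // _; rewrite nrm0 nrm_ge0.
have ah : asum h.
  by apply: asumWC (asum_ecoef u) => n; rewrite /h; case: ifP => // _; rewrite nrm0 nrm_ge0.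
have -> : cexp u - 1 - u = sumC h.
  have -> : sumC h = sumC (ecoef u) - sumC l.
    rewrite -sumCB//; last exact: asum_ecoef.
    by apply: eq_sumC => n; rewrite /h /l; case: ifP; rewrite ?subrr ?subr0.
  rewrite sum_ecoef (@sumC_finite _ _ [:: 0%N; 1%N])//; last first.
    by move=> n; rewrite !inE negb_or /l; case: n => [|[|n]].
  by rewrite !big_cons big_nil /l /= /ecoef /= !divr1 expr0 expr1; ring.
apply: (@nrm_sumC_le _ _ _ (fun n => nrm (h n))) => //.
apply: (@fbound_inj_sup _ _ _ (fun n => n.+2) (fun n => n.-2)).
  by case=> [|[|n]]// /eqP[]; exact: nrm0.
apply: (@fboundW _ _ _ (fun n => nrm u ^+ 2 * (nrm u ^+ n / n`!%:R))); last first.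
  by apply: fboundZ; [exact: sqr_ge0|exact: fbound_exp (nrm_ge0 u)].
move=> n; rewrite /h /= nrm_ecoef.
have -> : nrm u ^+ n.+2 / (n.+2)`!%:R = nrm u ^+ 2 * (nrm u ^+ n / (n.+2)`!%:R).
  by rewrite !exprS expr0 mulr1 !mulrA.
rewrite ler_wpM2l ?sqr_ge0// ler_wpM2l ?exprn_ge0 ?nrm_ge0//.
rewrite lef_pV2 ?posrE ?ltr0n ?fact_gt0// ler_nat !factS mulnA.
by rewrite leq_pmull.
Qed.

(** Half of the quadratic term absorbs the linear one by completing the square; exp(-y) <= 1/(1+y)
    turns the other half into the summable weight [wt]. *)
Lemma gauss_le (c b : R) : 0 < c -> exists2 A, 0 <= A &
  forall x : R, expR (- c * x ^+ 2 + b * `|x|) <= A / (1 + x ^+ 2).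
Proof.
move=> c0; pose K := b ^+ 2 / (2 * c).
exists (expR K * (1 + 2 / c)); first by rewrite mulr_ge0 ?expR_ge0// addr_ge0// divr_ge0// ltW.
move=> x; have x2 : 0 <= x ^+ 2 by exact: sqr_ge0.
have p1 : 0 < 1 + x ^+ 2 by lra.
have p2 : 0 < 1 + c / 2 * x ^+ 2 by have := mulr_ge0 (ltW c0) x2; lra.
apply: (@le_trans _ _ (expR K * expR (- (c / 2 * x ^+ 2)))).
  rewrite -expRD ler_expR.
  have E : K - b * `|x| + c / 2 * x ^+ 2 = c / 2 * (`|x| - b / c) ^+ 2.
    rewrite -(real_normK (num_real x)) /K; field; by rewrite gt_eqF.
  have : 0 <= c / 2 * (`|x| - b / c) ^+ 2 by rewrite mulr_ge0 ?sqr_ge0// divr_ge0// ltW.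
  by rewrite -E; lra.
rewrite -[leRHS]mulrA ler_wpM2l ?expR_ge0// expRN.
apply: (@le_trans _ _ (1 + c / 2 * x ^+ 2)^-1).
  by rewrite lef_pV2 ?posrE ?expR_gt0// expR_ge1Dx.
rewrite ler_pdivlMr// mulrC ler_pdivrMr//.
have -> : (1 + 2 / c) * (1 + c / 2 * x ^+ 2) = 1 + c / 2 * x ^+ 2 + 2 / c + x ^+ 2.
  by field; rewrite gt_eqF.
by have := mulr_ge0 (ltW c0) x2; have : 0 <= 2 / c; [rewrite divr_ge0// ltW|lra].
Qed.

Definition wt (x : R) : R := (1 + x ^+ 2)^-1.
Lemma wt_ge0 x : 0 <= wt x.
Proof. by rewrite invr_ge0 addr_ge0// sqr_ge0. Qed.
(** Comparison with the telescoping series of 4/((n+1)(n+2)), whose sums are at most 4; the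
    constructors [Posz] and [Negz] each contribute once. *)
Lemma fbound_wt : fbound (fun q : int => wt q%:~R) 8.
Proof.
pose phi (p : bool * nat) : int := if p.1 then Posz p.2 else Negz p.2.
pose psi (q : int) : bool * nat := match q with Posz n => (true, n) | Negz n => (false, n) end.
apply: (@fbound_inj_sup _ _ _ phi psi); first by case.
pose v (n : nat) : R := 4 / (n.+1%:R * n.+2%:R).
have v0 n : 0 <= v n by rewrite divr_ge0// mulr_ge0.
have hv : fbound v 4.
  apply: fbound_nat => // N.
  suff -> : \sum_(n < N) v n = 4 * (1 - N.+1%:R^-1).
    have : 0 <= (N.+1%:R : R)^-1 by rewrite invr_ge0.
    by move: (_^-1) => y y0; lra.
  elim: N => [|N IH]; first by rewrite big_ord0 invr1 subrr mulr0.
  rewrite big_ord_recr /= IH /v -(natr1 N.+1).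
  have p : (N.+1%:R : R) != 0 by rewrite pnatr_eq0.
  have p' : (N.+1%:R + 1 : R) != 0 by rewrite natr1 pnatr_eq0.
  by move: (N.+1%:R : R) p p' => y p p'; field; rewrite p p'.
have wv n : wt n%:R <= v n.
  rewrite /wt /v ler_pdivlMr ?mulr_gt0// mulrC ler_pdivrMr; last first.
    by rewrite ltr_pwDl// sqr_ge0.
  rewrite -(natr1 n.+1) -(natr1 n); have : 0 <= (n%:R : R) by [].
  by move: (n%:R : R) => x x0; nra.
have wS n : wt n.+1%:R <= wt n%:R.
  rewrite /wt lef_pV2 ?posrE ?ltr_pwDl ?sqr_ge0// lerD2l lerXn2r ?nnegrE//.
  by rewrite ler_nat.
have h2 : fbound (fun _ : bool => 1 : R) 2.
  have := @fbound_finType R bool (fun _ => 1); rewrite big_bool; exact.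
have := fbound_mul (fun _ => ler01) v0 h2 hv.
rewrite (_ : 2 * 4 = 8); last by ring.
apply: fboundW => -[[] n] /=; rewrite mul1r /phi /=; first by rewrite -pmulrn.
rewrite NegzE mulrNz -pmulrn /wt sqrrN; exact: le_trans (wS n) (wv n).
Qed.

Lemma fbound_prod (w : int -> R) S n : (forall q, 0 <= w q) -> fbound w S ->
  fbound (fun k : 'cV[int]_n => \prod_i w (k i ord0)) (S ^+ n).
Proof.
move=> w0 hw; elim: n => [|n IH].
  move=> s us; have [->|[x ->]] : s = [::] \/ exists x, s = [:: x].
    case: s us => [|x [|y s]]; [by left|by right; exists x|].
    by rewrite /= inE [x]flatmx0 [y]flatmx0 eqxx.
  - by rewrite big_nil.
  - by rewrite big_seq1 big_ord0 expr0.
pose phi (p : int * 'cV[int]_n) : 'cV[int]_(1 + n) := col_mx (p.1%:M) p.2.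
pose psi (k : 'cV[int]_(1 + n)) := (k ord0 ord0, dsubmx k).
have c2 k : phi (psi k) = k.
  rewrite /phi /psi /= -[RHS]vsubmxK; congr col_mx.
  apply/matrixP => i j; rewrite !ord1 !mxE eqxx mulr1n; congr (k _ _).
  exact: val_inj.
apply: (@fbound_inj_sup _ _ _ phi psi); first by move=> k _; exact: c2.
have := fbound_mul w0 _ hw IH; rewrite -exprS.
move=> h; apply: fboundW (h _) => [[q k]|k]; last by apply: prodr_ge0.
rewrite /= big_ord_recl /phi /= !mxE; case: splitP => [j _|j]; last by [].
rewrite !ord1 mxE eqxx mulr1n ler_wpM2l// le_eqVlt; apply/orP; left; apply/eqP.
apply: eq_bigr => i _; congr w; rewrite mxE; case: splitP => [i'|i' /= e].
  by rewrite ord1.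
congr (k _ _); apply: val_inj; move: e; rewrite /= /bump /= => /eqP.
by rewrite eqSS => /eqP.
Qed.

Lemma geo_sum (N : nat) (j : int) : (0 < N)%N ->
  \sum_(r < N) epi (2 * (j%:~R * r%:R / N%:R) : C) = if (N%:Z %| j)%Z then N%:R else 0.
Proof.
move=> N0; pose zt : C := epi (2 * (j%:~R / N%:R)).
have NC : (N%:R : C) != 0 by rewrite pnatr_eq0 -lt0n.
have E r : epi (2 * (j%:~R * r%:R / N%:R) : C) = zt ^+ r.
  by rewrite -epiMn; congr epi; ring.
under eq_bigr do rewrite E.
have zN : zt ^+ N = 1.
  rewrite -epiMn -[RHS](epi_int j); congr epi; field; exact: NC.
case: ifPn => [/dvdzP[q jE]|ndvd].
  have -> : zt = 1.
    rewrite /zt jE -[RHS](epi_int q); congr epi; rewrite intrM -pmulrn; field; exact: NC.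
  under eq_bigr do rewrite expr1n.
  by rewrite sumr_const card_ord.
(* With r the nonzero residue of j and th = pi r/N in ]0, pi[, the real part of [zt] is 1 - 2
   sin(th)^2 < 1. *)
have z1 : zt != 1.
  pose r := `|(j %% N)%Z|%N.
  have rE : (j %% N)%Z = r%:Z by rewrite /r gez0_abs// modz_ge0// -lt0n.
  have jE := divz_eq j N.
  have r0 : (0 < r)%N.
    rewrite lt0n; apply: contra ndvd => /eqP r0; apply/dvdzP; exists (j %/ N)%Z.
    by rewrite {1}jE rE r0 addr0.
  have rN : (r < N)%N by rewrite -ltz_nat -rE ltz_pmod// ltz_nat.
  have -> : zt = epi (((2 * (r%:R / N%:R)) : R)%:C).
    have Ej : (j%:~R : C) = (j %/ N)%Z%:~R * N%:R + r%:R.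
      by rewrite {1}jE intrD intrM rE.
    rewrite /zt Ej [(_ * _ + _) / _]mulrDl mulfK// mulrDr epiD epi_int mul1r.
    by congr epi; rewrite !rmorphM fmorphV !rmorph_nat.
  rewrite epi_real eq_complex /= negb_and; apply/orP; left.
  set th := pi * (r%:R / N%:R) : R.
  have -> : pi * (2 * (r%:R / N%:R)) = th *+ 2 :> R by rewrite /th -mulr_natl; ring.
  rewrite cos_mulr2n cos2sin2.
  have : 0 < sin th.
    apply: sin_gt0_pi; rewrite mulr_gt0 ?pi_gt0 ?divr_gt0 ?ltr0n//=.
    by rewrite -[ltRHS]mulr1 ltr_pM2l ?pi_gt0// ltr_pdivrMr ?ltr0n// mul1r ltr_nat.
  move=> s0; rewrite lt_eqF// mulrnBl -mulr_natr.
  have := exprn_gt0 2 s0; move: (sin th ^+ 2) => x x0.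
  by rewrite -mulr_natr; lra.
have : (zt - 1) * \sum_(r < N) zt ^+ r = 0 by rewrite -subrX1 zN subrr.
by move/eqP; rewrite mulf_eq0 subr_eq0 (negbTE z1) /= => /eqP.
Qed.

(** Averaging over the N-torsion points of the torus leaves the coefficients with all indices
    divisible by N; as N grows only the index 0 remains, by [tannery]. This replaces integration
    over the torus. *)
Lemma fourier0 n (a : 'cV[int]_n -> C) : asum a ->
  (forall x : 'I_n -> R, sumC (fun k => a k * epi (2 * \sum_i (k i ord0)%:~R * (x i)%:C)) = 0) ->
  a 0 = 0.
Proof.
move=> ha h.
have step N : (0 < N)%N ->
    sumC (fun k : 'cV[int]_n => if [forall i, (N%:Z %| k i ord0)%Z] then a k else 0) = 0.
  move=> N0; have NC : (N%:R : C) != 0 by rewrite pnatr_eq0 -lt0n.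
  have e k : \sum_(j : {ffun 'I_n -> 'I_N})
      a k * epi (2 * \sum_i (k i ord0)%:~R * ((j i)%:R / N%:R : R)%:C) =
      N%:R ^+ n * (if [forall i, (N%:Z %| k i ord0)%Z] then a k else 0).
    rewrite -mulr_sumr.
    rewrite (eq_bigr (fun j : {ffun 'I_n -> 'I_N} => \prod_i
       epi (2 * ((k i ord0)%:~R * (j i)%:R / N%:R : C)))); last first.
      move=> j _; rewrite mulr_sumr epi_sum; apply: eq_bigr => i _; congr epi.
      by rewrite rmorphM fmorphV !rmorph_nat; ring.
    rewrite -(bigA_distr_bigA (fun i (r : 'I_N) => epi (2 * ((k i ord0)%:~R * r%:R / N%:R : C)))).
    case: ifPn => [/forallP hk|]; last first.
      rewrite negb_forall => /existsP[i hi]; rewrite mulr0 (bigD1 i)//= geo_sum//.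
      by rewrite (negbTE hi) mul0r mulr0.
    rewrite (eq_bigr (fun _ => N%:R)); last by move=> i _; rewrite geo_sum// hk.
    by rewrite prodr_const card_ord mulrC.
  have aj (j : {ffun 'I_n -> 'I_N}) :
     asum (fun k => a k * epi (2 * \sum_i (k i ord0)%:~R * ((j i)%:R / N%:R : R)%:C)).
    apply: asumWC ha => k; rewrite nrmM nrm_epi.
    set y := complex.Im _; suff -> : y = 0 by rewrite mulr0 expR0 mulr1.
    rewrite /y ImM Im_sum big1 ?mulr0 ?add0r; last first.
      move=> i _; rewrite ImM /= mulr0 add0r.
      by rewrite intC /= mul0r.
    by rewrite natC /= mul0r.
  have : \sum_(j : {ffun 'I_n -> 'I_N}) sumC (fun k =>
     a k * epi (2 * \sum_i (k i ord0)%:~R * ((j i)%:R / N%:R : R)%:C)) = 0.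
    by apply: big1 => j _; exact: h.
  have sw (s : seq {ffun 'I_n -> 'I_N}) : \sum_(j <- s) sumC (fun k =>
     a k * epi (2 * \sum_i (k i ord0)%:~R * ((j i)%:R / N%:R : R)%:C)) =
     sumC (fun k => \sum_(j <- s)
     a k * epi (2 * \sum_i (k i ord0)%:~R * ((j i)%:R / N%:R : R)%:C)) /\
     asum (fun k => \sum_(j <- s)
     a k * epi (2 * \sum_i (k i ord0)%:~R * ((j i)%:R / N%:R : R)%:C)).
    elim: s => [|j s [IH1 IH2]].
      rewrite big_nil; split; last by exists 0 => t _; rewrite big1// => k _; rewrite big_nil nrm0.
      by rewrite -[LHS](@sumC0 R 'cV[int]_n); apply: eq_sumC => k; rewrite big_nil.
    split; last by apply: asumWC (asumD (aj j) IH2) => k; rewrite big_cons.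
    by rewrite big_cons IH1 -sumCD//; apply: eq_sumC => k; rewrite big_cons.
  rewrite (sw _).1; under eq_sumC do rewrite e.
  rewrite sumCZ; last first.
    by apply: asumWC ha => k; case: ifP => // _; rewrite nrm0 nrm_ge0.
  by move=> /eqP; rewrite mulf_eq0 expf_eq0 (negbTE NC) andbF /= => /eqP.
have := @tannery R _ (fun N (k : 'cV[int]_n) => if [forall i, (N.+1%:Z %| k i ord0)%Z] then a k else 0)
  (fun k : 'cV[int]_n => if k == 0 then a k else 0) (fun k => nrm (a k)).
move=> /(_ _ (asum_nrm ha)) H.
have L : limC (fun N => sumC (fun k : 'cV[int]_n => if [forall i, (N.+1%:Z %| k i ord0)%Z] then a k else 0))
   (sumC (fun k : 'cV[int]_n => if k == 0 then a k else 0)).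
  apply: H => [N k|k]; first by case: ifP => // _; rewrite nrm0 nrm_ge0.
  case: (eqVneq k 0) => [->|k0].
    apply: (@limC_ext _ (fun=> a 0)); last exact: limC_cst.
    by move=> N; case: ifPn => // /negP[]; apply/forallP => i; rewrite mxE dvdz0.
  have [i ki] : exists i, k i ord0 != 0.
    apply/existsP; apply: contraNT k0; rewrite negb_exists => /forallP H0.
    by apply/eqP/matrixP => i j; rewrite ord1 mxE; apply/eqP/negPn/H0.
  move=> e e0; exists `|k i ord0|%N => N hN.
  case: ifPn => [/forallP/(_ i)|_]; last by rewrite subrr nrm0.
  move=> /dvdzP[q kE]; move: ki hN; rewrite kE.
  rewrite mulf_eq0 negb_or => /andP[q0 _]; rewrite abszM /= => hN.
  have : (0 < `|q|)%N by rewrite absz_gt0.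
  by nia.
have Z : limC (fun N => sumC (fun k : 'cV[int]_n =>
    if [forall i, (N.+1%:Z %| k i ord0)%Z] then a k else 0)) 0.
  by apply: (@limC_ext _ (fun=> 0)); [move=> N; rewrite step|exact: limC_cst].
have := limC_unique L Z.
rewrite (@sumC_finite _ _ [:: 0])//; last by move=> k; rewrite inE => /negbTE ->.
by rewrite big_seq1 eqxx.
Qed.
End Exponential.

(** * Poisson summation *)
Section Poisson.
Variable R : realType.
Local Notation C := R[i].

(** If the sine were below its chord at x, the mean value theorem would give a cosine below 2/pi
    before x and one above 2/pi after x, although cosine decreases. *)
Lemma jordan (x : R) : 0 <= x <= pi / 2 -> 2 / pi * x <= sin x.
Proof.
move=> /andP[x0 x1]; rewrite leNgt; apply/negP => hlt.
have p0 := pi_gt0 R.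
have pn : pi != 0 :> R by rewrite gt_eqF.
have e1 : 2 / pi * (pi / 2) = 1 :> R by rewrite mulrA divfK// divff.
have [xe0|xn0] := eqVneq x 0; first by move: hlt; rewrite xe0 mulr0 sin0 ltxx.
have [xe1|xn1] := eqVneq x (pi / 2).
  by move: hlt; rewrite xe1 sin_pihalf e1 ltxx.
have xp : 0 < x by rewrite lt_neqAle eq_sym xn0.
have xl : x < pi / 2 by rewrite lt_neqAle xn1.
have [a /[!in_itv]/= /andP[a0 ax]] := @MVT R sin cos 0 x xp
   (fun y _ => is_derive_sin y) (continuous_subspaceT (@continuous_sin R)).
rewrite sin0 !subr0 => ea.
have [b /[!in_itv]/= /andP[bx bl]] := @MVT R sin cos x (pi / 2) xl
   (fun y _ => is_derive_sin y) (continuous_subspaceT (@continuous_sin R)).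
rewrite sin_pihalf => eb.
have ca : cos a < 2 / pi by move: hlt; rewrite ea ltr_pM2r.
have cb : 2 / pi < cos b.
  have h : 0 < pi / 2 - x by rewrite subr_gt0.
  by rewrite -(ltr_pM2r h) -eb mulrBr e1 ltrD2l ltrN2.
have : cos b < cos a.
  rewrite ltr_cos ?in_itv /=; first exact: lt_trans ax bx.
  - by apply/andP; split; lra.
  - by apply/andP; split; lra.
by move=> h; have := lt_trans (lt_trans ca cb) h; rewrite ltxx.
Qed.

Lemma wt_shift (y x : R) : 0 <= x <= 1 -> wt (y + x) <= 3 * wt y.
Proof.
move=> /andP[x0 x1].
have p1 : 0 < 1 + y ^+ 2 by rewrite ltr_pwDl// sqr_ge0.
have p2 : 0 < 1 + (y + x) ^+ 2 by rewrite ltr_pwDl// sqr_ge0.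
suff : wt (y + x) <= 3 / (1 + y ^+ 2) by [].
rewrite ler_pdivlMr// /wt mulrC ler_pdivrMr//.
have x2 : x ^+ 2 <= 1 by rewrite expr_le1.
by have := sqr_ge0 (y + 2 * x); have := sqr_ge0 (y + x); lra.
Qed.

(** Riemann sums of [wt], bounded uniformly in N. Division writes j/N = q + r/N with r/N in [0, 1[;
    [wt_shift] costs the factor 3 and [fbound_wt] gives 8. *)
Lemma riem (N : nat) : (0 < N)%N ->
  fbound (fun j : int => N%:R^-1 * wt (j%:~R / N%:R : R)) 24.
Proof.
move=> N0; have NR : (0 : R) < N%:R by rewrite ltr0n.
have NZ : N%:Z != 0 by rewrite eqz_nat -lt0n.
case: N N0 NR NZ => // N _ NR NZ.
pose phi (p : int * 'I_N.+1) : int := p.1 * N.+1%:Z + p.2%:Z.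
pose psi (j : int) : int * 'I_N.+1 := ((j %/ N.+1%:Z)%Z, inord `|(j %% N.+1%:Z)%Z|).
have c2 j : phi (psi j) = j.
  rewrite /phi /psi /= inordK; last first.
    by rewrite -ltz_nat gez0_abs ?modz_ge0// ltz_pmod.
  by rewrite gez0_abs ?modz_ge0// -divz_eq.
apply: (@fbound_inj_sup _ _ _ phi psi); first by move=> j _; exact: c2.
have h1 := @fboundZ _ _ 3 _ _ (ler0n _ _) (@fbound_wt R).
have h2 : fbound (fun _ : 'I_N.+1 => N.+1%:R^-1 : R) 1.
  have := @fbound_finType R 'I_N.+1 (fun _ => N.+1%:R^-1).
  rewrite sumr_const card_ord -[_^-1 *+ _]mulr_natr mulVf ?gt_eqF//; apply=> _.
  by rewrite invr_ge0 ltW.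
have := fbound_mul _ _ h1 h2; rewrite (_ : 3 * 8 * 1 = 24); last by ring.
move=> h; apply: fboundW (h _ _) => [[q r]|q|r]; last 2 first.
- by rewrite mulr_ge0 ?wt_ge0.
- by rewrite invr_ge0 ltW.
rewrite /= mulrC; apply: ler_wpM2r; first by rewrite invr_ge0 ltW.
rewrite (_ : (phi (q, r))%:~R / N.+1%:R = q%:~R + r%:R / N.+1%:R :> R); last first.
  by rewrite /phi /= intrD intrM -!pmulrn mulrDl mulfK// gt_eqF.
set x := r%:R / N.+1%:R; set y := q%:~R.
have x0 : 0 <= x by rewrite divr_ge0// ltW.
have x1 : x <= 1 by rewrite ler_pdivrMr// mul1r ler_nat ltnW.
by apply: wt_shift; rewrite x0.
Qed.

(** * Riemann sums of a Gaussian on horizontal lines *)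

Section fixed.
Variable t : C.
Hypothesis ht : 0 < complex.Im t.
Let u := t^-1.
Let a : R := pi * nrm u.

Lemma t_neq0 : t != 0.
Proof. by apply: contraTneq ht => ->; rewrite ltxx. Qed.
Lemma Im_u : complex.Im u < 0.
Proof.
rewrite /u; case: t ht => x y /= y0; rewrite {1}/GRing.inv /=.
by rewrite oppr_lt0 divr_gt0// ltr_wpDl ?sqr_ge0// exprn_gt0.
Qed.
Lemma a_ge0 : 0 <= a. Proof. by rewrite mulr_ge0 ?pi_ge0 ?nrm_ge0. Qed.

(** The Gaussian exp(-pi i x^2/t), which decays along horizontal lines because Im(1/t) < 0; [ds] is
    its derivative. *)
Definition gs (x : C) : C := epi (- (x ^+ 2 * u)).
Definition ds (x : C) : C := ((0 +i* pi) * (- (2 * x * u))) * gs x.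
(** A single majorant for the Gaussian, its derivative and its second-order Taylor remainder; the
    exponential factor absorbs the powers of |x| that these produce. *)
Definition gg (x : C) : R := 2 * nrm (gs x) * expR (3 * a * (2 * nrm x + 1)).

Lemma nrm_ipi : nrm (0 +i* pi : C) = pi.
Proof. by rewrite /= expr0n add0r sqrtr_sqr ger0_norm// pi_ge0. Qed.
Lemma nrm_nat n : nrm (n%:R : C) = n%:R.
Proof. by rewrite natC nrm_real ger0_norm. Qed.
Lemma gg_factor x (b : R) : b <= 2 * expR (3 * a * (2 * nrm x + 1)) -> b * nrm (gs x) <= gg x.
Proof. by move=> h; rewrite /gg mulrAC ler_wpM2r ?nrm_ge0. Qed.
Lemma le_expR3 x (b : R) : b <= 3 * a * (2 * nrm x + 1) -> b <= expR (3 * a * (2 * nrm x + 1)).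
Proof.
move=> h; apply: (le_trans h); apply: le_trans (expR_ge1Dx _); by rewrite lerDr.
Qed.
Lemma gs_le x : nrm (gs x) <= gg x.
Proof.
rewrite -[leLHS]mul1r; apply: gg_factor.
have : 1 <= expR (3 * a * (2 * nrm x + 1)).
  rewrite -[leLHS]expR0 ler_expR; apply: mulr_ge0; first by rewrite mulr_ge0// a_ge0.
  by have := nrm_ge0 x; lra.
by lra.
Qed.
Lemma ds_le x : nrm (ds x) <= gg x.
Proof.
rewrite /ds nrmM; apply: gg_factor.
rewrite nrmM nrm_ipi nrmN !nrmM nrm_nat.
have -> : pi * (2 * nrm x * nrm u) = 2 * (a * nrm x) by rewrite /a; ring.
rewrite ler_pM2l//; apply: le_expR3.
have := a_ge0; have := mulr_ge0 a_ge0 (nrm_ge0 x).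
by move: (a) (nrm x) => A X; nra.
Qed.

Lemma taylor_gs x w : nrm w <= 1 -> nrm (gs (x + w) - gs x - w * ds x) <= nrm w ^+ 2 * gg x.
Proof.
move=> w1; set U : C := (0 +i* pi) * (- ((2 * x * w + w ^+ 2) * u)).
have E : gs (x + w) = gs x * cexp U.
  by rewrite /gs /U -/(epi _) -epiD; congr epi; ring.
have -> : gs (x + w) - gs x - w * ds x =
   gs x * ((cexp U - 1 - U) + (0 +i* pi) * (- (w ^+ 2 * u))).
  by rewrite E /ds /U; ring.
rewrite nrmM mulrC.
have a0 := a_ge0; have x0 := nrm_ge0 x; have wp := nrm_ge0 w.
pose y := 2 * nrm x + 1.
have y1 : 1 <= y by rewrite /y; lra.
have hU : nrm U <= a * y * nrm w.
  rewrite /U nrmM nrm_ipi nrmN nrmM /a /y -!mulrA ler_wpM2l ?pi_ge0// mulrC.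
  rewrite ler_wpM2l ?nrm_ge0//; apply: (le_trans (nrmD _ _)).
  rewrite !nrmM nrm_nat.
  have : nrm w ^+ 2 <= nrm w by rewrite expr2 ler_piMl.
  by lra.
have ay0 : 0 <= a * y by rewrite mulr_ge0//; lra.
have hU1 : nrm U <= a * y by apply: le_trans hU _; rewrite ler_piMr.
have h1 : nrm (cexp U - 1 - U) <= nrm w ^+ 2 * expR (3 * (a * y)).
  apply: (le_trans (cexp_taylor U)).
  apply: (@le_trans _ _ ((a * y * nrm w) ^+ 2 * expR (a * y))).
    apply: ler_pM => //; rewrite ?sqr_ge0 ?expR_ge0 ?ler_expR//.
    by rewrite lerXn2r ?nnegrE ?nrm_ge0// mulr_ge0.
  rewrite exprMn mulrAC mulrC ler_wpM2l ?sqr_ge0//.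
  have -> : 3 * (a * y) = a * y + a * y + a * y by ring.
  rewrite !expRD ler_wpM2r ?expR_ge0// expr2.
  have h : a * y <= expR (a * y) by apply: le_trans (expR_ge1Dx _); rewrite lerDr.
  by apply: ler_pM.
have h2 : nrm ((0 +i* pi) * (- (w ^+ 2 * u))) <= nrm w ^+ 2 * expR (3 * (a * y)).
  rewrite nrmM nrm_ipi nrmN nrmM nrmX.
  have -> : pi * (nrm w ^+ 2 * nrm u) = nrm w ^+ 2 * a by rewrite /a; ring.
  rewrite ler_wpM2l ?sqr_ge0//.
  apply: (@le_trans _ _ (3 * (a * y))); last by apply: le_trans (expR_ge1Dx _); rewrite lerDr.
  have : a <= a * y by rewrite ler_peMr.
  by lra.
have -> : nrm w ^+ 2 * gg x = (nrm w ^+ 2 * expR (3 * (a * y)) + nrm w ^+ 2 * expR (3 * (a * y))) * nrm (gs x).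
  by rewrite /gg /y -[3 * a * _]mulrA; ring.
rewrite ler_wpM2r ?nrm_ge0//; apply: (le_trans (nrmD _ _)).
exact: lerD.
Qed.

(** The majorant exceeds the Gaussian only by a factor exponential in |x|, which the quadratic decay
    along the line absorbs through [gauss_le]; the constant is uniform for |s| <= S. *)
Lemma gs_line (S : R) : 0 <= S -> exists2 A, 0 <= A & forall s, nrm s <= S ->
  forall xi : R, gg (s + xi%:C) <= A * wt xi.
Proof.
move=> S0; pose c0 := - complex.Im u.
have c00 : 0 < c0 by rewrite oppr_gt0 Im_u.
pose b := 2 * pi * S * nrm u + 6 * a; pose K := pi * S ^+ 2 * nrm u + 3 * a * (2 * S + 1).
have [A0 A00 hA] := gauss_le b (mulr_gt0 (pi_gt0 R) c00).
exists (2 * expR K * A0); first by rewrite !mulr_ge0 ?expR_ge0.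
move=> s hs xi; rewrite /gg nrm_epi ImN mulrNN -[2 * _ * expR (3 * _ * _)]mulrA.
rewrite -[2 * expR K * A0 * _]mulrA -[2 * expR K * _]mulrA ler_pM2l// -expRD.
apply: (@le_trans _ _ (expR K * expR (- (pi * c0) * xi ^+ 2 + b * `|xi|))); last first.
  by rewrite ler_wpM2l ?expR_ge0//; exact: hA.
rewrite -expRD ler_expR.
have n1 : nrm (s + xi%:C) <= S + `|xi|.
  by apply: (le_trans (nrmD _ _)); rewrite nrm_real lerD2r.
have i1 : complex.Im ((s + xi%:C) ^+ 2 * u) <= S ^+ 2 * nrm u + 2 * `|xi| * (S * nrm u) - c0 * xi ^+ 2.
  have -> : (s + xi%:C) ^+ 2 * u = s ^+ 2 * u + (2 * xi)%:C * (s * u) + (xi ^+ 2)%:C * u.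
    by rewrite rmorphM rmorphXn rmorph_nat /=; ring.
  rewrite !ImD.
  have j1 : complex.Im (s ^+ 2 * u) <= S ^+ 2 * nrm u.
    apply: (le_trans (ler_norm _)); apply: (le_trans (nrm_Im _)).
    by rewrite nrmM nrmX ler_wpM2r ?nrm_ge0// lerXn2r ?nnegrE ?nrm_ge0.
  have j2 : complex.Im ((2 * xi)%:C * (s * u)) <= 2 * `|xi| * (S * nrm u).
    apply: (le_trans (ler_norm _)); apply: (le_trans (nrm_Im _)).
    rewrite nrmM nrm_real normrM ger0_norm// ler_wpM2l ?mulr_ge0//.
    by rewrite nrmM ler_wpM2r ?nrm_ge0.
  have j3 : complex.Im ((xi ^+ 2)%:C * u) = - c0 * xi ^+ 2.
    by rewrite ImM /= mul0r addr0 /c0 opprK mulrC.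
  by rewrite j3; lra.
set X := nrm (s + xi%:C) in n1 *; set I := complex.Im _ in i1 *.
have h1 := ler_wpM2l (pi_ge0 R) i1.
have h2 : 3 * a * (2 * X + 1) <= 3 * a * (2 * (S + `|xi|) + 1).
  by apply: ler_wpM2l; [rewrite mulr_ge0 ?a_ge0|lra].
move: h1 h2; rewrite /K /b.
by move: (nrm u) (a) (pi : R) (c0) (I) (X) `|xi| => *; lra.
Qed.

Section N.
Variables (N : nat) (S A : R).
Hypothesis N0 : (0 < N)%N.
Hypothesis A0 : 0 <= A.
Hypothesis hA : forall s, nrm s <= S -> forall xi : R, gg (s + xi%:C) <= A * wt xi.

Definition xj (s : C) (j : int) : C := s + (j%:~R / N%:R : R)%:C.
Definition mean (f : int -> C) : C := N%:R^-1 * sumC f.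

Lemma NR : (0 : R) < N%:R. Proof. by rewrite ltr0n. Qed.

Lemma asum_line s (f : int -> C) B : 0 <= B -> nrm s <= S ->
  (forall j, nrm (f j) <= B * gg (xj s j)) -> asum f /\ nrm (mean f) <= B * (24 * A).
Proof.
move=> B0 hs hf.
have h := fboundZ (mulr_ge0 (mulr_ge0 B0 A0) (ltW NR)) (riem N0).
have h2 : forall j, nrm (f j) <= B * A * N%:R * (N%:R^-1 * wt (j%:~R / N%:R)).
  move=> j; rewrite mulrA mulfK ?gt_eqF ?NR// -mulrA; apply: (le_trans (hf j)).
  by rewrite ler_wpM2l// hA.
split; first by exists (B * A * N%:R * 24); exact: fboundW h2 h.
rewrite /mean nrmM nrmV nrm_nat mulrC ler_pdivrMr ?NR//.
apply: le_trans (nrm_sumC_le h2 h) _.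
by rewrite le_eqVlt; apply/orP; left; apply/eqP; ring.
Qed.

Lemma asum_gs s : nrm s <= S -> asum (fun j => gs (xj s j)).
Proof.
move=> hs; have [j|h _] := @asum_line s (fun j => gs (xj s j)) 1 ler01 hs; last exact: h.
by rewrite mul1r gs_le.
Qed.

(** The Riemann sum of mesh 1/N for the integral of the Gaussian over the horizontal line through
    s. *)
Definition IN (s : C) : C := mean (fun j => gs (xj s j)).

Lemma nrm_IN s : nrm s <= S -> nrm (IN s) <= 24 * A.
Proof.
move=> hs; have [j|_] := @asum_line s (fun j => gs (xj s j)) 1 ler01 hs; last by rewrite mul1r.
by rewrite mul1r gs_le.
Qed.

Lemma xjS s j : xj s (j + 1) = xj s j + (N%:R^-1 : R)%:C.
Proof. by rewrite /xj intrD mulrDl mul1r rmorphD addrA. Qed.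
Lemma sum_shift (f : int -> C) : sumC (fun j => f (j + 1)) = sumC f.
Proof.
rewrite [RHS](@sumC_inj _ _ _ (fun j : int => j + 1))//; first exact: addIr.
by move=> j _; exists (j - 1); rewrite subrK.
Qed.
Lemma nrm_Ninv : nrm ((N%:R^-1 : R)%:C : C) = N%:R^-1.
Proof. by rewrite nrm_real ger0_norm// invr_ge0 ltW// NR. Qed.
Lemma Ninv_le1 : (N%:R^-1 : R) <= 1.
Proof. by rewrite invf_le1 ?NR// ler1n. Qed.

(** Discrete form of moving a contour. The linear term of the difference is w times the mean of
    [ds]. Translation by 1/N permutes the nodes and leaves the sum unchanged, which shows by a
    second Taylor expansion that this mean is O(1/N). *)
Lemma step s w : nrm s <= S -> nrm (s + w) <= S -> nrm w <= 1 ->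
  nrm (IN (s + w) - IN s) <= 24 * A * (nrm w ^+ 2 + nrm w / N%:R).
Proof.
move=> hs hsw w1.
have as1 := asum_gs hs; have as2 := asum_gs hsw.
have [|asd _] := @asum_line s (fun j => ds (xj s j)) 1 ler01 hs.
  by move=> j; rewrite mul1r ds_le.
have xw j : xj (s + w) j = xj s j + w by rewrite /xj addrAC.
pose r1 j := gs (xj s j + w) - gs (xj s j) - w * ds (xj s j).
have [j|ar1 br1] := @asum_line s r1 (nrm w ^+ 2) (sqr_ge0 _) hs; first exact: taylor_gs.
pose iN : C := (N%:R^-1 : R)%:C.
have iNE : iN = N%:R^-1 by rewrite /iN fmorphV rmorph_nat.
pose r2 j := gs (xj s j + iN) - gs (xj s j) - iN * ds (xj s j).
have r2E j : nrm (r2 j) <= N%:R^-1 ^+ 2 * gg (xj s j).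
  by have := @taylor_gs (xj s j) iN; rewrite nrm_Ninv; apply; exact: Ninv_le1.
have [||ar2 br2] := @asum_line s (fun j => N%:R * r2 j) N%:R^-1 _ hs.
- by rewrite invr_ge0 ltW// NR.
- move=> j; rewrite nrmM nrm_nat -ler_pdivlMl ?NR//.
  by apply: le_trans (r2E j) _; rewrite expr2 -mulrA.
have NC : (N%:R : C) != 0 by rewrite pnatr_eq0 -lt0n.
have ar2' : asum r2.
  apply: asumWC (asumZ N%:R^-1 ar2) => j; by rewrite mulKf.
have E2 : sumC (fun j => ds (xj s j)) = - sumC (fun j => N%:R * r2 j).
  have Z : sumC (fun j => gs (xj s j + iN) - gs (xj s j)) = 0.
    rewrite sumCB//; last first.
      have := asum_inj (phi := fun j : int => j + 1) (@addIr int 1) as1.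
      by apply: asumWC => j; rewrite xjS.
    rewrite -[X in X - _](_ : sumC (fun j => gs (xj s (j + 1))) = _); last first.
      by apply: eq_sumC => j; rewrite xjS.
    by rewrite (sum_shift (fun j => gs (xj s j))) subrr.
  have E : sumC r2 = - (iN * sumC (fun j => ds (xj s j))).
    rewrite -sumCZ// -[RHS]add0r -Z -sumCB//; last exact: asumZ.
    apply: asumWC (asumD ar2' (asumZ iN asd)) => j.
    by rewrite /r2 subrK.
  rewrite sumCZ// E mulrN opprK iNE mulrA divff// mul1r//.
have -> : IN (s + w) - IN s = mean r1 + w * mean (fun j => ds (xj s j)).
  rewrite /IN /mean mulrCA -mulrDr -mulrBr; congr (_ * _).
  rewrite -sumCB// -sumCZ// -sumCD//; last exact: asumZ.
  by apply: eq_sumC => j; rewrite xw /r1 subrK.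
apply: (le_trans (nrmD _ _)).
have -> : mean (fun j => ds (xj s j)) = - mean (fun j => N%:R * r2 j).
  by rewrite /mean E2 mulrN.
rewrite [nrm (w * _)]nrmM nrmN.
have h2 : nrm w * nrm (mean (fun j => N%:R * r2 j)) <= nrm w * (N%:R^-1 * (24 * A)).
  by rewrite ler_wpM2l ?nrm_ge0.
have -> : 24 * A * (nrm w ^+ 2 + nrm w / N%:R) = nrm w ^+ 2 * (24 * A) + nrm w * (N%:R^-1 * (24 * A)).
  by ring.
exact: lerD.
Qed.

(** Summation by parts twice: taking second differences at step 1/N multiplies the Fourier
    coefficient by 2 cos - 2, while [taylor_gs] makes the second difference of the Gaussian
    O(1/N^2). *)
Lemma mean_decay (k : int) s (c : C) : nrm s <= S ->
  c = mean (fun j => gs (xj s j) * epi (2 * (- (j * k))%:~R / N%:R)) ->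
  nrm c * `|2 - 2 * cos (pi * (2 * k%:~R / N%:R))| <= 48 * A / N%:R ^+ 2.
Proof.
move=> hs cE.
pose ep (j : int) : C := epi (2 * (- (j * k))%:~R / N%:R).
have nep j : nrm (ep j) = 1.
  rewrite /ep (_ : 2 * _ / _ = (2 * (- (j * k))%:~R / N%:R : R)%:C); last first.
    by rewrite !rmorphM fmorphV rmorph_int !rmorph_nat.
  by rewrite nrm_epi /= mulr0 expR0.
have a1 := asum_gs hs.
pose f0 j := gs (xj s j) * ep j.
have af0 : asum f0 by apply: asumWC a1 => j; rewrite nrmM nep mulr1.
pose om : C := epi (2 * k%:~R / N%:R).
pose iN : C := (N%:R^-1 : R)%:C.
pose fp j := gs (xj s j + iN) * ep j; pose fm j := gs (xj s j - iN) * ep j.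
have e1 j : ep j = om * ep (j + 1).
  rewrite /ep /om -epiD; congr epi.
  have -> : - ((j + 1) * k) = - (j * k) + - k by ring.
  by rewrite intrD (mulrNz _ k); ring.
have afp : asum fp.
  have := asum_inj (phi := fun j : int => j + 1) (@addIr int 1) a1.
  by apply: asumWC => j; rewrite /fp nrmM nep mulr1 xjS.
have sp : sumC fp = om * sumC f0.
  rewrite -(sum_shift f0) -sumCZ; last exact: asum_inj (@addIr int 1) af0.
  by apply: eq_sumC => j; rewrite /fp /f0 e1 xjS; ring.
have om0 : om != 0 by exact: epi_neq0.
have e2 j : fm (j + 1) = om^-1 * f0 j.
  by rewrite /fm /f0 xjS addrK (e1 j) [RHS]mulrCA [om^-1 * (om * _)]mulrA mulVf// mul1r.
have afm : asum fm.
  have : asum (fun j => fm (j + 1)).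
    by apply: asumWC (asumZ om^-1 af0) => j; rewrite e2.
  apply: (@asum_inj_sup _ _ _ _ (fun j : int => j - 1)) => [j|j _].
    by rewrite addrK.
  by rewrite subrK.
have sm : sumC fm = om^-1 * sumC f0.
  by rewrite -(sum_shift fm) -sumCZ//; apply: eq_sumC => j; rewrite e2.
pose D j := (fp j + fm j) + (-2) * f0 j.
have sD : sumC D = (om + om^-1 - 2) * sumC f0.
  rewrite /D sumCD; [|exact: asumD|exact: asumZ].
  by rewrite sumCD// sumCZ// sp sm; ring.
have [||aD bD] := @asum_line s D (2 * N%:R^-1 ^+ 2) _ hs.
- by rewrite mulr_ge0// sqr_ge0.
- move=> j; have -> : D j = ((gs (xj s j + iN) - gs (xj s j) - iN * ds (xj s j)) +
     (gs (xj s j + - iN) - gs (xj s j) - (- iN) * ds (xj s j))) * ep j.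
    by rewrite /D /fp /fm /f0; ring.
  rewrite nrmM nep mulr1; apply: (le_trans (nrmD _ _)).
  have h1 := @taylor_gs (xj s j) iN; have h2 := @taylor_gs (xj s j) (- iN).
  rewrite nrm_Ninv in h1; rewrite nrmN nrm_Ninv in h2.
  by have := h1 Ninv_le1; have := h2 Ninv_le1; lra.
have -> : nrm c * `|2 - 2 * cos (pi * (2 * k%:~R / N%:R))| = nrm (mean D).
  have -> : mean D = (om + om^-1 - 2) * c by rewrite cE /mean sD mulrCA.
  rewrite nrmM [RHS]mulrC; congr (_ * _).
  rewrite /om (_ : 2 * k%:~R / N%:R = (2 * k%:~R / N%:R : R)%:C); last first.
    by rewrite !rmorphM fmorphV rmorph_int !rmorph_nat.
  rewrite -epiN -rmorphN !epi_real mulrN cosN sinN.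
  set th := pi * _; rewrite (_ : _ + _ - 2 = (2 * cos th - 2)%:C); last first.
    by rewrite natC; apply: complex_ext; rewrite /=; ring.
  by rewrite nrm_real distrC.
apply: (le_trans bD); rewrite le_eqVlt; apply/orP; left; apply/eqP.
by rewrite exprVn; ring.
Qed.

End N.

(** The path from 0 to s is cut into P steps, each costing O(1/P^2 + 1/(PN)) by [step]. Taking P a
    multiple of N, at least |s|, makes the total O(1/N) and every step at most 1. *)
Lemma IN_lim (s : C) : exists2 B, 0 <= B & forall N, (0 < N)%N ->
  nrm (IN N s - IN N 0) <= B / N%:R.
Proof.
have [A A0 hA] := gs_line (nrm_ge0 s).
pose P0 := (Num.truncn (nrm s)).+1.
have P00 : nrm s <= P0%:R by apply/ltW; exact: truncnS_gt.
exists (24 * A * (nrm s ^+ 2 + nrm s)).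
  by rewrite !mulr_ge0// addr_ge0 ?sqr_ge0 ?nrm_ge0.
move=> N N0; have NR0 : (0 : R) < N%:R by rewrite ltr0n.
pose P := (N * P0)%N.
have PR : (0 : R) < P%:R by rewrite ltr0n muln_gt0 N0.
have PC : (P%:R : C) != 0 by rewrite pnatr_eq0 -lt0n muln_gt0 N0.
pose w : C := s / P%:R.
have wE : nrm w = nrm s / P%:R by rewrite /w nrmM nrmV nrm_nat.
have sP : nrm s <= P%:R.
  by apply: (le_trans P00); rewrite ler_nat leq_pmull.
have w1 : nrm w <= 1 by rewrite wE ler_pdivrMr// mul1r.
have hk k : (k <= P)%N -> nrm (k%:R * w) <= nrm s.
  move=> kP; rewrite nrmM nrm_nat wE mulrCA ler_piMr ?nrm_ge0//.
  by rewrite ler_pdivrMr// mul1r ler_nat.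
have ind k : (k <= P)%N -> nrm (IN N (k%:R * w) - IN N 0) <=
    k%:R * (24 * A * (nrm w ^+ 2 + nrm w / N%:R)).
  elim: k => [|k IH] kP; first by rewrite !mul0r subrr nrm0.
  have -> : k.+1%:R * w = k%:R * w + w by rewrite -natr1 mulrDl mul1r.
  have hk' : nrm (k%:R * w + w) <= nrm s.
    by rewrite -[X in _ + X]mul1r -mulrDl natr1; exact: hk.
  have h := @step N (nrm s) A N0 A0 hA (k%:R * w) w (hk _ (ltnW kP)) hk' w1.
  have := nrmD (IN N (k%:R * w + w) - IN N (k%:R * w)) (IN N (k%:R * w) - IN N 0).
  rewrite (_ : _ - _ + _ = IN N (k%:R * w + w) - IN N 0); last by rewrite addrA subrK.
  move=> h'; apply: (le_trans h'); rewrite -natr1 mulrDl mul1r addrC lerD//.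
  exact: IH (ltnW kP).
have := ind P (leqnn _); rewrite (_ : P%:R * w = s); last by rewrite /w mulrC divfK.
move=> h; apply: (le_trans h); rewrite wE.
have -> : P%:R * (24 * A * ((nrm s / P%:R) ^+ 2 + nrm s / P%:R / N%:R)) =
   24 * A * (nrm s ^+ 2 / P%:R + nrm s / N%:R).
  by field; rewrite !gt_eqF.
rewrite -[leRHS]mulrA ler_wpM2l ?mulr_ge0// [leRHS]mulrDl lerD2r ler_wpM2l ?sqr_ge0//.
by rewrite lef_pV2 ?posrE// ler_nat leq_pmulr.
Qed.

Definition th1 (z : C) : C := sumC (fun k : int => epi (k%:~R ^+ 2 * t + 2 * (k%:~R * z))).
Definition pg (z : C) : C := sumC (fun n : int => gs (z + n%:~R)).

Lemma th1_le (z : C) : exists2 A, 0 <= A &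
  forall k : int, nrm (epi (k%:~R ^+ 2 * t + 2 * (k%:~R * z))) <= A * wt k%:~R.
Proof.
have [A A0 hA] := gauss_le (2 * pi * nrm z) (mulr_gt0 (pi_gt0 R) ht).
exists A => // k; rewrite nrm_epi; apply: le_trans (hA _); rewrite ler_expR.
rewrite ImD ImM intC natC -rmorphXn /= mul0r addr0 !ImM /= !mul0r !addr0.
have : - (k%:~R * complex.Im z) <= nrm z * `|k%:~R|.
  apply: (le_trans (ler_norm _)); rewrite normrN normrM mulrC.
  by rewrite ler_wpM2r// nrm_Im.
move=> /(ler_wpM2l (pi_ge0 R)); lra.
Qed.
Lemma asum_th1 (z : C) : asum (fun k : int => epi (k%:~R ^+ 2 * t + 2 * (k%:~R * z))).
Proof.
have [A A0 hA] := th1_le z; exists (A * 8).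
exact: fboundW hA (fboundZ A0 (@fbound_wt R)).
Qed.

(** Otherwise [fourier0] on real z would annihilate the constant coefficient, which is 1. *)
Lemma th1_neq0 : exists z, th1 z != 0.
Proof.
apply: contrapT => /forallNP h.
pose a0 (k : 'cV[int]_1) : C := epi ((k ord0 ord0)%:~R ^+ 2 * t).
pose phi (k : int) : 'cV[int]_1 := const_mx k.
have c1 : cancel phi (fun k => k ord0 ord0) by move=> k; rewrite /phi mxE.
have c2 (k : 'cV[int]_1) : phi (k ord0 ord0) = k.
  by apply/matrixP => i j; rewrite !ord1 mxE.
have ha : asum a0.
  apply: (asum_inj_sup c1) => //; apply: asumWC (asum_th1 0) => k.
  by rewrite /a0 /phi mxE mulr0 mulr0 addr0.
have := fourier0 ha _; rewrite /a0 mxE expr0n mul0r epi0 => /(_ _)/eqP.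
rewrite oner_eq0 => H; suff : false by []; apply: H => x.
transitivity (th1 (x ord0)%:C); last by apply/eqP/negPn/negP; exact: h.
rewrite /th1 (@sumC_inj _ _ _ phi).
- by apply: eq_sumC => k; rewrite big_ord1 -epiD /phi !mxE.
- exact: can_inj c1.
- by move=> k _; exists (k ord0 ord0).
Qed.

(** Discrete Fourier inversion expresses [pg z] through the Riemann sums on the lines through z + k
    t; each is asymptotic to the one through 0 by [IN_lim], and [dec] dominates them. *)
Lemma pg_lim z : limC (fun M => pg z - th1 z * IN M.*2.+1 0) 0.
Proof.
have [A A0 hA] := gs_line (nrm_ge0 z).
have [A' A0' hA'] := gs_line (lexx (0 : R)).
have [B B0 hB] := th1_le z.
pose e (k : int) : C := epi (k%:~R ^+ 2 * t + 2 * (k%:~R * z)).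
pose f (M : nat) (k : int) : C := if (`|k| <= M)%N then e k * IN M.*2.+1 (z + k%:~R * t) else 0.
have tu : t * u = 1 by rewrite /u divff// t_neq0.
(* Completing the square: the k-th discrete Fourier coefficient at z is a Riemann sum on the line
   moved to z + k t. *)
have fE M (k : int) : e k * IN M.*2.+1 (z + k%:~R * t) =
    mean M.*2.+1 (fun j => gs (xj M.*2.+1 z j) * epi (2 * (- (j * k))%:~R / M.*2.+1%:R)).
  rewrite /IN /mean mulrCA; congr (_ * _).
  have [S1 S10 hS1] := gs_line (nrm_ge0 (z + k%:~R * t)).
  rewrite -sumCZ; last exact: (asum_gs _ S10 hS1).
  apply: eq_sumC => j; rewrite /e /gs -!epiD; congr epi.
  rewrite /xj rmorphM fmorphV rmorph_nat rmorph_int mulrNz intrM.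
  set K := k%:~R; set J := j%:~R; set iN := (_%:R)^-1.
  have -> : (z + K * t + J * iN) ^+ 2 * u = (z + J * iN) ^+ 2 * u + 2 * (K * (z + J * iN)) * (t * u) + K ^+ 2 * t * (t * u).
    by ring.
  by rewrite tu; ring.
(* For |k| <= M and N = 2M+1 the angle pi |k|/N stays in [0, pi/2], where [jordan] bounds the factor
   2 - 2 cos of [mean_decay] below by 16 k^2/N^2. *)
have dec M k : nrm (f M k) <= 24 * A * wt k%:~R.
  rewrite /f; case: leqP => hk; last by rewrite nrm0 !mulr_ge0 ?wt_ge0.
  have N0 : (0 < M.*2.+1)%N by [].
  have NR0 : (0 : R) < M.*2.+1%:R by rewrite ltr0n.
  have [->|k0] := eqVneq k 0.
    rewrite /e !mul0r mulr0 addr0 addr0 expr0n mul0r epi0 mul1r /wt expr0n addr0 invr1 mulr1.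
    exact: (nrm_IN N0 A0 hA).
  have := @mean_decay M.*2.+1 (nrm z) A N0 A0 hA k z _ (lexx _) (fE M k).
  set c := nrm _ => hc.
  pose y : R := `|k|%N%:R.
  have y1 : 1 <= y by rewrite ler1n absz_gt0.
  have yE : y = `|k%:~R| by rewrite /y -intr_norm -abszE.
  have yk : y ^+ 2 = (k%:~R : R) ^+ 2 by rewrite yE real_normK// num_real.
  have sn : 2 / pi * (pi * (y / M.*2.+1%:R)) <= sin (pi * (y / M.*2.+1%:R)).
    apply: jordan; rewrite mulr_ge0 ?pi_ge0 ?divr_ge0 ?ler0n ?(ltW NR0)//=.
    rewrite ler_wpM2l ?pi_ge0// ler_pdivrMr// mulrC ler_pdivlMr// -natrM ler_nat.
    by rewrite muln2 -leq_double in hk *; apply: leq_trans hk _.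
  have cs : cos (pi * (2 * k%:~R / M.*2.+1%:R)) = 1 - 2 * sin (pi * (y / M.*2.+1%:R)) ^+ 2.
    rewrite -cos_norm normrM (ger0_norm (pi_ge0 R)) !normrM normfV.
    rewrite (ger0_norm (ltW NR0)) -yE ger0_norm//.
    have -> : pi * (2 * y / M.*2.+1%:R) = (pi * (y / M.*2.+1%:R)) *+ 2.
      by rewrite -mulr_natl; ring.
    by rewrite cos_mulr2n cos2sin2 -mulr_natr; ring.
  move: hc; rewrite cs.
  set sn2 := sin _ in sn *.
  have -> : 2 - 2 * (1 - 2 * sn2 ^+ 2) = 4 * sn2 ^+ 2 by ring.
  rewrite ger0_norm; last by rewrite mulr_ge0 ?sqr_ge0.
  have sn' : 2 * y / M.*2.+1%:R <= sn2.
    by apply: le_trans sn; rewrite [leRHS]mulrA divfK ?gt_eqF ?pi_gt0// mulrA.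
  have q0 : 0 <= 2 * y / M.*2.+1%:R by rewrite !mulr_ge0 ?invr_ge0 ?(ltW NR0) ?ler0n.
  have sq : (2 * y / M.*2.+1%:R) ^+ 2 <= sn2 ^+ 2 by rewrite lerXn2r ?nnegrE// (le_trans q0).
  move=> hc; have c0 : 0 <= c by exact: nrm_ge0.
  have : c * (4 * (2 * y / M.*2.+1%:R) ^+ 2) <= 48 * A / M.*2.+1%:R ^+ 2.
    by apply: le_trans hc; rewrite ler_wpM2l// ler_wpM2l.
  have -> : c * (4 * (2 * y / M.*2.+1%:R) ^+ 2) = (16 * c * y ^+ 2) / M.*2.+1%:R ^+ 2.
    by field; rewrite gt_eqF.
  rewrite ler_pM2r ?invr_gt0 ?exprn_gt0// => h16.
  have p1 : 0 < 1 + (k%:~R : R) ^+ 2 by rewrite ltr_pwDl// sqr_ge0.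
  suff : c <= 24 * A / (1 + (k%:~R : R) ^+ 2) by [].
  rewrite ler_pdivlMr// -yk.
  have : 1 <= y ^+ 2 by rewrite expr_ge1.
  by move: (y ^+ 2) h16 => Y h16 Y1; nra.
(* The k with |k| <= M represent each residue modulo N once; by [geo_sum] only the nodes j divisible
   by N survive, that is, the integer translates. *)
have fsum M : sumC (f M) = pg z.
  pose N := M.*2.+1.
  have NC : (N%:R : C) != 0 by rewrite pnatr_eq0.
  pose s := [seq i%:Z - M%:Z | i <- iota 0 N].
  have us : uniq s by rewrite map_inj_uniq ?iota_uniq// => x y /addIr[].
  have ins (k : int) : (k \in s) = (`|k| <= M)%N.
    apply/mapP/idP => [[i hi ->]|hk]; first by move: hi; rewrite mem_iota /N; lia.
    by exists (absz (k + M%:Z)); rewrite ?mem_iota /N; lia.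
  rewrite (@sumC_finite _ _ s)//; last by move=> k; rewrite ins /f => /negbTE ->.
  have ag := asum_gs (erefl : (0 < N)%N) A0 hA (lexx _).
  rewrite (eq_big_seq (fun k => mean N (fun j => gs (xj N z j) * epi (2 * (- (j * k))%:~R / N%:R)))); last first.
    by move=> k; rewrite ins /f => ->; exact: fE.
  have nep (x : int) : nrm (epi (2 * x%:~R / N%:R : C)) = 1.
    rewrite (_ : 2 * _ / _ = (2 * x%:~R / N%:R : R)%:C); last first.
      by rewrite !rmorphM fmorphV rmorph_int !rmorph_nat.
    by rewrite nrm_epi /= mulr0 expR0.
  have sw (q : seq int) : \sum_(k <- q) mean N (fun j => gs (xj N z j) * epi (2 * (- (j * k))%:~R / N%:R)) =
      mean N (fun j => \sum_(k <- q) gs (xj N z j) * epi (2 * (- (j * k))%:~R / N%:R)) /\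
      asum (fun j => \sum_(k <- q) gs (xj N z j) * epi (2 * (- (j * k))%:~R / N%:R)).
    elim: q => [|k q [IH1 IH2]].
      rewrite big_nil; split; last by exists 0 => r _; rewrite big1// => k _; rewrite big_nil nrm0.
      rewrite /mean (_ : (fun j : int => _) = (fun=> 0)) ?sumC0 ?mulr0//.
      by apply: funext => j; rewrite big_nil.
    have ak : asum (fun j => gs (xj N z j) * epi (2 * (- (j * k))%:~R / N%:R)).
      by apply: asumWC ag => j; rewrite nrmM nep mulr1.
    split; last by apply: asumWC (asumD ak IH2) => j; rewrite big_cons.
    rewrite big_cons IH1 /mean -mulrDr -sumCD//; congr (_ * _).
    by apply: eq_sumC => j; rewrite big_cons.
  rewrite (sw s).1 /mean.
  have inner (j : int) : \sum_(k <- s) gs (xj N z j) * epi (2 * (- (j * k))%:~R / N%:R) =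
      N%:R * (if (N%:Z %| j)%Z then gs (xj N z j) else 0).
    rewrite -mulr_sumr big_map -[iota 0 N]/(index_iota 0 N) big_mkord.
    rewrite (eq_bigr (fun i : 'I_N => epi (2 * (j * M%:Z)%:~R / N%:R) *
        epi (2 * ((- j)%:~R * i%:R / N%:R)))); last first.
      move=> i _; rewrite -epiD; congr epi; rewrite -[i%:R]/((i%:Z)%:~R) .
      have -> : - (j * (i%:Z - M%:Z)) = j * M%:Z + (- j) * i%:Z by ring.
      by rewrite intrD !intrM; ring.
    rewrite -mulr_sumr geo_sum// rpredN; case: ifPn => [/dvdzP[q ->]|_]; last by rewrite !mulr0.
    rewrite (_ : 2 * _ / _ = 2 * (q * M%:Z)%:~R); last first.
      rewrite !intrM -[N%:~R]/(N%:R); field; exact: NC.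
    by rewrite epi_int mul1r mulrC.
  have nz : asum (fun j => if (N%:Z %| j)%Z then gs (xj N z j) else 0).
    by apply: asumWC ag => j; case: ifP => // _; rewrite nrm0 nrm_ge0.
  rewrite (eq_sumC inner) sumCZ// mulKf//.
  have NZ : N%:Z != 0 by [].
  rewrite (@sumC_inj _ _ _ (fun q : int => q * N%:Z)); last 2 first.
  - exact: mulIf.
  - by move=> j; case: ifP => [/dvdzP[q ->] _|_]; [exists q|rewrite eqxx].
  apply: eq_sumC => q; rewrite dvdz_mull// /xj; congr (gs (_ + _)).
  by rewrite rmorphM fmorphV rmorph_nat rmorph_int intrM -[N%:~R]/(N%:R) mulfK.
have aI M : asum (fun k => e k * IN M.*2.+1 0).
  by apply: asumWC (asumZ (IN M.*2.+1 0) (asum_th1 z)) => k; rewrite mulrC.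
have af M : asum (f M).
  exists (24 * A * 8); apply: fboundW (fboundZ _ (@fbound_wt R)) => [k|]; first exact: dec.
  by rewrite mulr_ge0.
apply: (@limC_ext _ (fun M => sumC (fun k => f M k - e k * IN M.*2.+1 0))).
  move=> M; rewrite sumCB// fsum; congr (_ - _).
  by rewrite mulrC -sumCZ; [apply: eq_sumC => k; rewrite mulrC|exact: asum_th1].
rewrite -[X in limC _ X](@sumC0 R int).
apply: (@tannery _ _ _ _ (fun k => (24 * A + 24 * A' * B) * wt k%:~R)).
- move=> M k; apply: (le_trans (nrmB _ _)); rewrite mulrDl lerD//.
  rewrite nrmM mulrC -[leRHS]mulrA; apply: ler_pM; rewrite ?nrm_ge0//; last exact: hB.
  by apply: (nrm_IN (ltn0Sn _) A0' hA'); rewrite nrm0.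
- exists ((24 * A + 24 * A' * B) * 8).
  have c0 : 0 <= 24 * A + 24 * A' * B by rewrite addr_ge0 ?mulr_ge0.
  apply: fboundW (fboundZ c0 (@fbound_wt R)) => k.
  by rewrite ger0_norm// mulr_ge0// wt_ge0.
move=> k; have [D D0 hD] := IN_lim (z + k%:~R * t).
have L : limC (fun M => e k * (IN M.*2.+1 (z + k%:~R * t) - IN M.*2.+1 0)) (e k * 0).
  apply: limCZ; apply: (@limC_bound0 _ _ D) => M.
  apply: le_trans (hD _ _) _ => //; rewrite ler_wpM2l// lef_pV2 ?posrE ?ltr0n//.
  by rewrite ler_nat ltnS -addnn leq_addr.
rewrite mulr0 in L => eps eps0.
have [M0 hM0] := L eps eps0; exists (maxn M0 `|k|) => M; rewrite geq_max => /andP[h1 h2].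
by rewrite /f h2 -mulrBr; exact: hM0.
Qed.

End fixed.

Lemma pg_th1 (t : C) (z : C) : 0 < complex.Im t ->
  pg t z = epi (- (z ^+ 2 / t)) * th1 (- t^-1) (- (z / t)).
Proof.
move=> ht; have hu : 0 < complex.Im (- t^-1) by rewrite ImN oppr_gt0 Im_u.
rewrite /th1 -sumCZ; last exact: asum_th1.
by apply: eq_sumC => n; rewrite /gs -epiD; congr epi; ring.
Qed.

(* Discrete Fourier coefficients of level N replace the integrals; they converge
   and are O(k^-2) uniformly in N, so Tannery's theorem passes to the limit. *)
Theorem poisson1 (t : C) : 0 < complex.Im t -> exists2 c : C, c != 0 &
  forall z, th1 t z = c * pg t z.
Proof.
move=> ht; have hu : 0 < complex.Im (- t^-1) by rewrite ImN oppr_gt0 Im_u.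
have [z0 hz0] := th1_neq0 ht.
have L0 := pg_lim ht z0.
(* The Riemann sum [IN t N 0] is not shown to converge: it is eliminated between z and the fixed
   point z0. *)
have L z : limC (fun M => th1 t z0 * pg t z - th1 t z * (th1 t z0 * IN t M.*2.+1 0)) 0.
  have := limCZ (th1 t z0) (pg_lim ht z); rewrite mulr0; apply: limC_ext => M.
  by ring.
have E z : th1 t z0 * pg t z = th1 t z * pg t z0.
  have := limCD (L z) (limCZ (- th1 t z) L0); rewrite mulr0 addr0 => H.
  apply/eqP; rewrite -subr_eq0; apply/eqP.
  apply: (@limC_unique _ (fun=> th1 t z0 * pg t z - th1 t z * pg t z0)); first exact: limC_cst.
  by apply: limC_ext H => M; ring.
have [z1 hz1] := th1_neq0 hu.
(* By [pg_th1] the value of [pg] at z2 is a nonzero factor times the theta function of -1/t at z1;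
   hence [pg] is not identically zero and c is nonzero. *)
pose z2 := - (z1 * t).
have p2 : pg t z2 != 0.
  rewrite pg_th1// mulf_neq0 ?epi_neq0// /z2.
  by rewrite mulNr opprK mulfK// t_neq0.
have pz0 : pg t z0 != 0.
  apply/eqP => p0; have := E z2; rewrite p0 mulr0 => /eqP.
  by rewrite mulf_eq0 (negbTE hz0) (negbTE p2).
exists (th1 t z0 / pg t z0); first by rewrite mulf_neq0 ?invr_eq0.
by move=> z; rewrite mulrAC E mulfK.
Qed.
End Poisson.

(** * Theta series *)
Section Theta.
Variable R : realType.
Local Notation C := R[i].

Lemma cvg_sumR (T : Type) (F : set_system T) {FF : Filter F} (I : Type) (s : seq I)
    (f : I -> T -> R) (l : I -> R) : (forall i, f i x @[x --> F] --> l i) ->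
  (\sum_(i <- s) f i x) @[x --> F] --> \sum_(i <- s) l i.
Proof.
move=> h; elim: s => [|i s IH].
  rewrite big_nil (_ : (fun x => _) = (fun=> 0)); first exact: cvg_cst.
  by apply: funext => x; rewrite big_nil.
rewrite big_cons (_ : (fun x => _) = (fun x => f i x + \sum_(j <- s) f j x)).
  exact: cvgD.
by apply: funext => x; rewrite big_cons.
Qed.

Section forms.
Variable g : nat.
Implicit Types (k x : 'cV[R]_g) (tau : 'M[C]_g) (z : 'cV[C]_g) (Y : 'M[R]_g).

Definition qf (K : pzRingType) (A : 'M[K]_g) (v : 'cV[K]_g) : K := (v^T *m A *m v) ord0 ord0.
Definition lf (K : pzRingType) (v w : 'cV[K]_g) : K := (v^T *m w) ord0 ord0.

Lemma qfE (K : pzRingType) (A : 'M[K]_g) v : qf A v = \sum_i \sum_j v i ord0 * A i j * v j ord0.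
Proof.
rewrite /qf mxE exchange_big; apply: eq_bigr => j _; rewrite mxE mulr_suml.
by apply: eq_bigr => i _; rewrite mxE.
Qed.
Lemma lfE (K : pzRingType) (v w : 'cV[K]_g) : lf v w = \sum_i v i ord0 * w i ord0.
Proof. by rewrite /lf mxE; apply: eq_bigr => i _; rewrite mxE. Qed.

Lemma Im_qf tau k : complex.Im (qf tau (mxC k)) = qf (map_mx (@complex.Im R) tau) k.
Proof.
rewrite !qfE Im_sum; apply: eq_bigr => i _; rewrite Im_sum; apply: eq_bigr => j _.
by rewrite !mxE !ImM !ReM /=; ring.
Qed.
Lemma Im_lf k z : complex.Im (lf (mxC k) z) = \sum_i k i ord0 * complex.Im (z i ord0).
Proof.
by rewrite lfE Im_sum; apply: eq_bigr => i _; rewrite mxE ImM /=; ring.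
Qed.

Lemma qfZ (K : comPzRingType) (A : 'M[K]_g) v c : qf A (c *: v) = c ^+ 2 * qf A v.
Proof.
rewrite !qfE mulr_sumr; apply: eq_bigr => i _; rewrite mulr_sumr; apply: eq_bigr => j _.
by rewrite !mxE; ring.
Qed.

Lemma qf_continuous Y : continuous (fun v : 'rV[R]_g => \sum_i \sum_j v ord0 i * Y i j * v ord0 j).
Proof.
move=> v; apply: (@cvg_sumR _ _ (nbhs_filter v)) => i.
apply: (@cvg_sumR _ _ (nbhs_filter v)) => j.
apply: cvgM; last exact: coord_continuous.
apply: cvgM; first exact: coord_continuous.
exact: cvg_cst.
Qed.

(** On each face v_i = 1 of the cube the form has a positive minimum by compactness, and dividing x
    by its largest coordinate puts it on such a face. *)
Lemma posdef_lb Y : posdef Y -> exists2 c : R, 0 < c & forall x, c * \sum_i x i ord0 ^+ 2 <= qf Y x.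
Proof.
move=> [_ pY].
pose f (v : 'rV[R]_g) := \sum_i \sum_j v ord0 i * Y i j * v ord0 j.
pose A (i : 'I_g) : set 'rV[R]_g :=
  [set v | forall j, (if j == i then [set 1] else `[-1, 1]%classic) (v ord0 j)].
have cA i : compact (A i).
  apply: (@rV_compact R g (fun j => if j == i then [set 1] else `[-1, 1]%classic)) => j.
  case: ifP => _; last exact: segment_compact.
  exact: compact_set1.
have A0 i : A i !=set0.
  exists (const_mx 1) => j; rewrite mxE; case: ifP => //= _.
  by rewrite in_itv /= lexx andbT; lra.
have ex i : exists ci, 0 < ci /\ forall v, A i v -> ci <= f v.
  have [v vA hv] := compact_EVT_min (A0 i) (cA i) (continuous_subspaceT (@qf_continuous Y)).
  exists (f v); split; last by move=> w hw; apply: hv; rewrite inE.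
  have -> : f v = qf Y v^T by rewrite qfE; apply: eq_bigr => j _; apply: eq_bigr => l _; rewrite !mxE.
  apply: pY; apply/eqP => v0; move: vA; rewrite inE => /(_ i); rewrite eqxx /=.
  have -> : v = 0 by rewrite -[v]trmxK v0 trmx0.
  by rewrite mxE => /esym/eqP; rewrite oner_eq0.
have [c hc] := choice ex.
have [cm cm0 cmi] : exists2 cm, 0 < cm & forall i, cm <= c i.
  suff : forall s : seq 'I_g, exists2 cm, 0 < cm & forall i, i \in s -> cm <= c i.
    by move=> /(_ (enum 'I_g))[cm cm0 h]; exists cm => // i; rewrite h ?mem_enum.
  elim=> [|i s [cm cm0 h]]; first by exists 1.
  exists (Num.min cm (c i)); first by rewrite lt_min cm0 (hc i).1.
  by move=> j; rewrite inE ge_min => /orP[/eqP ->|/h ->]; rewrite ?lexx ?orbT.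
(* The sum of the squares is at most g times the largest one; g.+1 keeps the denominator nonzero. *)
exists (cm / g.+1%:R); first by rewrite divr_gt0.
move=> x; have [->|x0] := eqVneq x 0.
  rewrite qfE big1 ?mulr0; last by move=> i _; rewrite mxE expr0n.
  by rewrite sumr_ge0// => i _; rewrite sumr_ge0// => j _; rewrite !mxE mulr0.
have [i0 xi0] : exists i, x i ord0 != 0.
  apply/existsP; apply: contraNT x0; rewrite negb_exists => /forallP H0.
  by apply/eqP/matrixP => i j; rewrite ord1 mxE; apply/eqP/negPn/H0.
pose i := [arg max_(i > i0) `|x i ord0|]%O.
have im j : `|x j ord0| <= `|x i ord0|.
  by rewrite /i; case: arg_maxP => // l _; apply.
have xi : x i ord0 != 0 by rewrite -normr_gt0 (lt_le_trans _ (im i0))// normr_gt0.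
have Ai : A i ((x i ord0)^-1 *: x^T).
  move=> j; rewrite !mxE; case: eqP => [->|_] /=; first by rewrite mulVf.
  by rewrite in_itv /= -ler_norml normrM normfV mulrC ler_pdivrMr ?normr_gt0// mul1r.
have h := (hc i).2 _ Ai.
have fE : f ((x i ord0)^-1 *: x^T) = (x i ord0) ^- 2 * qf Y x.
  rewrite /f qfE mulr_sumr; apply: eq_bigr => j _; rewrite mulr_sumr; apply: eq_bigr => l _.
  by rewrite !mxE -exprVn; ring.
have xi2 : 0 < x i ord0 ^+ 2 by rewrite lt_neqAle sqr_ge0 eq_sym sqrf_eq0 xi.
have h2 : cm * x i ord0 ^+ 2 <= qf Y x.
  by rewrite mulrC -ler_pdivlMl// -fE (le_trans (cmi i)).
apply: le_trans h2; rewrite -mulrA ler_pM2l// mulrC ler_pdivrMr//.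
apply: (@le_trans _ _ (\sum_(j < g) x i ord0 ^+ 2)).
  apply: ler_sum => j _; rewrite -(real_normK (num_real (x j ord0))) -(real_normK (num_real (x i ord0))).
  by rewrite lerXn2r ?nnegrE.
by rewrite sumr_const card_ord -[_ *+ _]mulr_natr ler_wpM2l ?(ltW xi2)// ler_nat.
Qed.

Lemma posdef_ge0 Y x : posdef Y -> 0 <= qf Y x.
Proof.
move=> [_ h]; have [->|x0] := eqVneq x 0; last exact: ltW (h _ x0).
by rewrite qfE sumr_ge0// => i _; rewrite sumr_ge0// => j _; rewrite !mxE mulr0.
Qed.

Definition tterm tau z k : C := epi (qf tau (mxC k) + 2 * lf (mxC k) z).

Lemma tterm_le tau z : siegel_space tau -> exists c b : R, 0 < c /\
  forall k, nrm (tterm tau z k) <= \prod_i expR (- c * k i ord0 ^+ 2 + b * `|k i ord0|).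
Proof.
move=> [_ pY]; have [c c0 hc] := posdef_lb pY.
exists (pi * c), (2 * pi * \sum_i `|complex.Im (z i ord0)|); split; first by rewrite mulr_gt0 ?pi_gt0.
move=> k; rewrite nrm_epi -expR_sum ler_expR ImD Im_qf natC ImM /= mul0r addr0 Im_lf.
rewrite big_split /= -!mulr_sumr.
have h1 := ler_wpM2l (pi_ge0 R) (hc k).
have h2 : - (\sum_i k i ord0 * complex.Im (z i ord0)) <=
    (\sum_i `|complex.Im (z i ord0)|) * \sum_i `|k i ord0|.
  rewrite -sumrN mulr_sumr; apply: ler_sum => i _.
  apply: (le_trans (ler_norm _)); rewrite normrN normrM mulrC ler_wpM2r//.
  by rewrite (bigD1 i)//= lerDl sumr_ge0.
have := ler_wpM2l (pi_ge0 R) h2.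
move: (\sum_i k i ord0 ^+ 2) (\sum_i `|complex.Im (z i ord0)|) (\sum_i `|k i ord0|) h1.
by move: (\sum_i _) (qf _ _) (pi : R) => *; lra.
Qed.

Definition intv k : Prop := exists n : 'cV[int]_g, k = map_mx intr n.
(* Schwartz-Bruhat functions of level L: supported in (1/L)Z^g, periodic mod LZ^g. *)
Definition SB (L : nat) (a : 'cV[R]_g -> C) : Prop :=
  (forall k, a k != 0 -> intv (L%:R *: k)) /\
  (forall k n, intv n -> a (k + L%:R *: n) = a k).
(** The index runs over all real vectors and the support of [a] cuts out a lattice, so that linear
    substitutions do not change the index type. *)
Definition Theta (a : 'cV[R]_g -> C) (u : 'cV[C]_g * 'M[C]_g) : C :=
  sumC (fun k => a k * tterm u.2 u.1 k).

Lemma intvD k k' : intv k -> intv k' -> intv (k + k').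
Proof.
move=> [n ->] [n' ->]; exists (n + n'); apply/matrixP => i j.
by rewrite !mxE intrD.
Qed.
Lemma intvN k : intv k -> intv (- k).
Proof. by move=> [n ->]; exists (- n); apply/matrixP => i j; rewrite !mxE mulrNz. Qed.
Lemma intvZ (m : int) k : intv k -> intv (m%:~R *: k).
Proof. by move=> [n ->]; exists (m *: n); apply/matrixP => i j; rewrite !mxE intrM. Qed.
Lemma intvZn (m : nat) k : intv k -> intv (m%:R *: k).
Proof. exact: (@intvZ m). Qed.
Lemma intvM (A : 'M[int]_g) k : intv k -> intv (map_mx intr A *m k).
Proof. by move=> [n ->]; exists (A *m n); rewrite map_mxM. Qed.
Lemma intv_coord k : (forall i, exists n : int, k i ord0 = n%:~R) -> intv k.
Proof.
move=> /choice[f hf]; exists (\col_i f i); apply/matrixP => i j.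
by rewrite ord1 !mxE hf.
Qed.

Definition ofZ (L : nat) (n : 'cV[int]_g) : 'cV[R]_g := L%:R^-1 *: map_mx intr n.
Definition toZ (L : nat) (k : 'cV[R]_g) : 'cV[int]_g :=
  map_mx (fun x : R => Num.floor (L%:R * x)) k.
Lemma ofZK L : (0 < L)%N -> cancel (ofZ L) (toZ L).
Proof.
move=> L0 n; apply/matrixP => i j; rewrite !mxE mulrA mulfV ?mul1r ?pnatr_eq0 -?lt0n//.
exact: intrKfloor.
Qed.
Lemma toZK L k : (0 < L)%N -> intv (L%:R *: k) -> ofZ L (toZ L k) = k.
Proof.
move=> L0 [n /matrixP hn]; apply/matrixP => i j; have e := hn i j; rewrite !mxE in e.
by rewrite !mxE e intrKfloor -e mulKf// pnatr_eq0 -lt0n.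
Qed.

(** The group (1/L)Z^g modulo L Z^g is finite, with representatives r/L for coordinates r < L^2. *)
Lemma SB_bounded L a : (0 < L)%N -> SB L a -> exists2 b, 0 <= b & forall k, nrm (a k) <= b.
Proof.
move=> L0 [h1 h2].
pose b := \sum_(r : {ffun 'I_g -> 'I_(L * L)}) nrm (a (ofZ L (\col_i (r i)%:Z))).
have b0 : 0 <= b by apply: sumr_ge0 => r _; exact: nrm_ge0.
exists b => // k; have [->|ak] := eqVneq (a k) 0; first by rewrite nrm0.
have [n hn] := h1 _ ak.
have LL : (0 < L * L)%N by rewrite muln_gt0 L0.
have LZ : (L * L)%N%:Z != 0 by rewrite eqz_nat -lt0n.
have rlt i : (`|(n i ord0 %% (L * L)%N%:Z)%Z| < L * L)%N.
  by rewrite -ltz_nat gez0_abs ?modz_ge0// ltz_pmod// ltz_nat.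
pose r : {ffun 'I_g -> 'I_(L * L)} := [ffun i => Ordinal (rlt i)].
pose q : 'cV[int]_g := \col_i (n i ord0 %/ (L * L)%N%:Z)%Z.
have kE : k = ofZ L (\col_i (r i)%:Z) + L%:R *: map_mx intr q.
  have LR : (L%:R : R) != 0 by rewrite pnatr_eq0 -lt0n.
  apply: (scalerI LR); rewrite hn; apply/matrixP => i j; rewrite !mxE ffunE /= ord1.
  rewrite {1}(divz_eq (n i ord0) (L * L)%N%:Z) gez0_abs ?modz_ge0//.
  rewrite intrD intrM -[(L * L)%N%:~R]/((L * L)%N%:R) natrM; field.
  exact: LR.
rewrite kE h2; last by exists q.
by rewrite /b (bigD1 r)//= lerDl sumr_ge0// => j _; exact: nrm_ge0.
Qed.

Lemma asum_lattice L tau z : (0 < L)%N -> siegel_space tau ->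
  asum (fun n : 'cV[int]_g => tterm tau z (ofZ L n)).
Proof.
move=> L0 ht; have [c [b [c0 h]]] := tterm_le z ht.
have LR : (0 : R) < L%:R by rewrite ltr0n.
have [A A0 hA] := gauss_le (b / L%:R) (divr_gt0 c0 (exprn_gt0 2 LR)).
have [||M hM] := @asumW R _ (fun n : 'cV[int]_g => tterm tau z (ofZ L n))
   (fun n => \prod_i (A * wt (n i ord0)%:~R)); last by exists M.
- move=> n; apply: (le_trans (h _)); apply: ler_prod => i _; rewrite expR_ge0 /=.
  apply: le_trans (hA _); rewrite ler_expR !mxE normrM normfV (ger0_norm (ltW LR)).
  rewrite le_eqVlt; apply/orP; left; apply/eqP; field.
  by rewrite gt_eqF.
- exists ((A * 8) ^+ g).
  have := @fbound_prod R (fun q => A * wt q%:~R) (A * 8) g.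
  move=> H; apply: fboundW (H _ _) => [n|q|].
  + by rewrite ger0_norm// prodr_ge0// => i _; rewrite mulr_ge0 ?wt_ge0.
  + by rewrite mulr_ge0 ?wt_ge0.
  + exact: fboundZ A0 (@fbound_wt R).
Qed.

Lemma asum_Theta L a u : (0 < L)%N -> SB L a -> siegel_space u.2 ->
  asum (fun k => a k * tterm u.2 u.1 k).
Proof.
move=> L0 ha ht; have [b b0 hb] := SB_bounded L0 ha.
apply: (asum_inj_sup (ofZK L0)).
  move=> k hk; apply: toZK => //; apply: ha.1; apply: contraNneq hk => ->.
  by rewrite mul0r.
apply: (@asumW _ _ _ (fun n => b * nrm (tterm u.2 u.1 (ofZ L n)))).
  by move=> n; rewrite nrmM ler_wpM2r ?nrm_ge0.
by apply: rsumZ; apply: asum_nrm; exact: asum_lattice.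
Qed.

Lemma Theta_lattice L a u : (0 < L)%N -> SB L a ->
  Theta a u = sumC (fun n : 'cV[int]_g => a (ofZ L n) * tterm u.2 u.1 (ofZ L n)).
Proof.
move=> L0 ha; rewrite /Theta (@sumC_inj _ _ _ (ofZ L))//; first exact: can_inj (ofZK L0).
move=> k hk; exists (toZ L k); rewrite toZK//; apply: ha.1; apply: contraNneq hk => ->.
by rewrite mul0r.
Qed.

Lemma SB_mul L m a : SB L a -> SB (L * m) a.
Proof.
move=> [h1 h2]; split=> [k /h1 hk|k n hn].
  by rewrite natrM mulrC -scalerA; exact: intvZn.
by rewrite natrM -scalerA h2//; exact: intvZn.
Qed.

Definition ind (c k : 'cV[R]_g) : C := if `[< intv (k - c) >] then 1 else 0.

Lemma SB_ind L c : (0 < L)%N -> intv (L%:R *: c) -> SB L (ind c).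
Proof.
move=> L0 hc; split=> [k|k n hn].
  rewrite /ind; case: asboolP => [h _|]; last by rewrite eqxx.
  by rewrite -[k](subrK c) scalerDr; apply: intvD => //; exact: intvZn.
rewrite /ind; congr (if _ then _ else _); apply/asboolP/asboolP => h.
  have -> : k - c = (k + L%:R *: n - c) + - (L%:R *: n).
    by apply/matrixP => i j; rewrite !mxE; ring.
  apply: intvD => //.
  by apply: intvN; exact: intvZn.
by rewrite addrAC; apply: intvD => //; exact: intvZn.
Qed.

Lemma mxCD m n (A B : 'M[R]_(m, n)) : mxC (A + B) = mxC A + mxC B.
Proof. by apply/matrixP => i j; rewrite !mxE rmorphD. Qed.
Lemma mxC_int m n (A : 'M[int]_(m, n)) : mxC (map_mx intr A : 'M[R]_(m, n)) = map_mx intr A.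
Proof. by apply/matrixP => i j; rewrite !mxE rmorph_int. Qed.

Lemma lfD (K : comPzRingType) (v w z : 'cV[K]_g) : lf (v + w) z = lf v z + lf w z.
Proof. by rewrite /lf linearD mulmxDl mxE. Qed.
Lemma lfDr (K : comPzRingType) (v w z : 'cV[K]_g) : lf v (w + z) = lf v w + lf v z.
Proof. by rewrite /lf mulmxDr mxE. Qed.
Lemma lfC (K : comPzRingType) (v w : 'cV[K]_g) : lf v w = lf w v.
Proof. by rewrite !lfE; apply: eq_bigr => i _; rewrite mulrC. Qed.

Lemma qf_lf (K : pzRingType) (A : 'M[K]_g) v : qf A v = lf v (A *m v).
Proof. by rewrite /qf /lf mulmxA. Qed.
Lemma lf_sym (K : comPzRingType) (A : 'M[K]_g) v w : A^T = A -> lf w (A *m v) = lf v (A *m w).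
Proof. by move=> sA; rewrite lfC /lf trmx_mul sA mulmxA. Qed.
Lemma qfD (K : comPzRingType) (A : 'M[K]_g) v w : A^T = A ->
  qf A (v + w) = qf A v + qf A w + 2 * lf v (A *m w).
Proof.
move=> sA; rewrite !qf_lf mulmxDr lfDr !lfD (@lf_sym _ A v w sA); ring.
Qed.
Lemma theta_term_asum z tau : siegel_space tau ->
  asum (fun n : 'cV[int]_g => tterm tau z (map_mx intr n)).
Proof.
move=> ht; apply: asumWC (asum_lattice z (ltn0Sn 0) ht) => n.
by rewrite /ofZ invr1 scale1r.
Qed.

(** A characteristic only translates the lattice: the prefactor of [theta_char] completes the
    quadratic form from n to c + n. *)
Lemma theta_char_Theta c z tau : siegel_space tau ->
  theta_char c 0 z tau = Theta (ind c) (z, tau).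
Proof.
move=> ht; have [sy _] := ht; rewrite /theta_char /theta /Theta.
have -> : mxC (0 : 'cV[R]_g) = 0 by apply/matrixP => i j; rewrite !mxE.
rewrite !addr0 -sumCZ; last first.
  apply: asumWC (theta_term_asum (z + tau *m mxC c) ht) => n.
  by rewrite /tterm /qf /lf mxC_int.
rewrite [RHS](@sumC_inj _ _ _ (fun n : 'cV[int]_g => c + map_mx intr n)); last 2 first.
- by move=> n n' /addrI/matrixP h; apply/matrixP => i j; have := h i j; rewrite !mxE => /intr_inj.
- move=> k; rewrite /ind; case: asboolP => [[n hn] _|]; last by rewrite mul0r eqxx.
  by exists n; rewrite -hn addrC subrK.
apply: eq_sumC => n; rewrite /ind; case: asboolP => [_|[]]; last first.
  by rewrite addrAC subrr add0r; exists n.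
rewrite mul1r /tterm -epiD; congr epi; rewrite mxCD mxC_int qfD// lfD.
rewrite -[(_^T *m tau *m _) _ _]/(qf tau (mxC c)) -[((mxC c)^T *m z) _ _]/(lf _ _).
rewrite -[((map_mx intr n)^T *m tau *m _) _ _]/(qf tau (map_mx intr n)).
rewrite -[((map_mx intr n)^T *m _) _ _]/(lf _ _) lfDr.
have -> : lf (mxC c) (tau *m map_mx intr n) = lf (map_mx intr n) (tau *m mxC c).
  exact: lf_sym.
by ring.
Qed.
End forms.
End Theta.

(** * The action of the symplectic group on theta series *)
Section Weil.
Variable R : realType.
Local Notation C := R[i].

(** * Poisson summation with periodic coefficients *)

Section PoissonLevel.
Variables (L : nat) (L0 : (0 < L)%N).

Lemma LC0 : (L%:R : C) != 0. Proof. by rewrite pnatr_eq0 -lt0n. Qed.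
Lemma LRn0 : (L%:R : R) != 0. Proof. by rewrite pnatr_eq0 -lt0n. Qed.

Definition isint (x : R) : Prop := exists n : int, x = n%:~R.
(* The finite Fourier transform on (1/L)Z modulo LZ. *)
Definition hat (b : R -> C) (y : R) : C :=
  if `[< isint (L%:R * y) >]
  then \sum_(r < L * L) b (r%:R / L%:R) * epi (- (2 * (r%:R / L%:R * y)%:C)) else 0.

Lemma asum_hat (b : R -> C) (t w : C) (B : R) : 0 < complex.Im t -> (forall y, nrm (b y) <= B) ->
  (forall y, b y != 0 -> isint (L%:R * y)) ->
  asum (fun y : R => b y * epi (y%:C ^+ 2 * t + 2 * (y%:C * w))).
Proof.
move=> ht hB hb.
have tL : 0 < complex.Im (t / L%:R ^+ 2).
  rewrite -natrX natC -fmorphV ImM /= mulr0 add0r mulr_gt0// invr_gt0.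
  by rewrite ltr0n expn_gt0 L0.
apply: (@asum_inj_sup _ _ _ (fun n : int => n%:~R / L%:R : R) (fun y => Num.floor (L%:R * y))).
- by move=> n; rewrite mulrC divfK ?LRn0// intrKfloor.
- move=> y hy; have [|n hn] := hb y; first by apply: contraNneq hy => ->; rewrite mul0r.
  by rewrite hn intrKfloor -hn mulrC mulKf ?LRn0.
have B0 : 0 <= B by apply: le_trans (hB 0); exact: nrm_ge0.
apply: (@asumW _ _ _ (fun n : int => B * nrm (epi (n%:~R ^+ 2 * (t / L%:R ^+ 2) + 2 * (n%:~R * (w / L%:R)))))).
  move=> n; rewrite nrmM; apply: ler_pM; rewrite ?nrm_ge0//.
  rewrite le_eqVlt; apply/orP; left; apply/eqP; congr (nrm (epi _)).
  by rewrite rmorphM fmorphV rmorph_nat rmorph_int; field; exact: LC0.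
by apply: rsumZ; apply: asum_nrm; exact: asum_th1.
Qed.

(** Writing y = r/L + L n reduces each residue class to [poisson1] at L^2 t, and the phases of the
    classes recombine into [hat b]. The constant is that of [poisson1], hence the same for all b and
    w. *)
Lemma poissonL (t : C) : 0 < complex.Im t -> exists2 c : C, c != 0 &
  forall (b : R -> C) (w : C), (forall y, b y != 0 -> isint (L%:R * y)) ->
   (forall y (n : int), b (y + L%:R * n%:~R) = b y) ->
   sumC (fun y : R => b y * epi (y%:C ^+ 2 * t + 2 * (y%:C * w))) =
   c * sumC (fun y : R => hat b y * epi (- ((w + y%:C) ^+ 2 / t))).
Proof.
move=> ht.
have LL0 : (0 < L * L)%N by rewrite muln_gt0 L0.
have tL : 0 < complex.Im (L%:R ^+ 2 * t).
  by rewrite -natrX natC ImM /= mul0r addr0 mulr_gt0// ltr0n expn_gt0 L0.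
have [c c0 hc] := poisson1 tL; exists c => // b w hs hp.
have t0 := t_neq0 ht.
pose f (y : R) : C := b y * epi (y%:C ^+ 2 * t + 2 * (y%:C * w)).
have LZ : (L * L)%N%:Z != 0 by rewrite eqz_nat -lt0n.
pose B := \sum_(r < L * L) nrm (b (r%:R / L%:R)).
have bmod (n : int) : b (n%:~R / L%:R) = b (`|(n %% (L * L)%N%:Z)%Z|%:R / L%:R).
  set r := `|_|%N; pose q := (n %/ (L * L)%N%:Z)%Z.
  have nE : n = q * (L * L)%N%:Z + r%:Z by rewrite /r gez0_abs ?modz_ge0// -divz_eq.
  have nR : (n%:~R : R) = q%:~R * (L%:R * L%:R) + r%:R.
    by rewrite -natrM [in LHS]nE intrD intrM.
  rewrite -(hp (r%:R / L%:R) q); congr b; rewrite nR; field; exact: LRn0.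
have hB y : nrm (b y) <= B.
  have B0 : 0 <= B by apply: sumr_ge0 => r _; exact: nrm_ge0.
  have [->|/hs[n hn]] := eqVneq (b y) 0; first by rewrite nrm0.
  have -> : y = n%:~R / L%:R by rewrite -hn mulrC mulKf ?LRn0.
  rewrite bmod; set r := `|_|%N.
  have rlt : (r < L * L)%N by rewrite -ltz_nat gez0_abs ?modz_ge0// ltz_pmod// ltz_nat.
  rewrite /B (bigD1 (Ordinal rlt))//= lerDl sumr_ge0// => i _; exact: nrm_ge0.
have af : asum f := asum_hat w ht hB hs.
pose phi (p : 'I_(L * L) * int) : R := p.1%:R / L%:R + L%:R * p.2%:~R.
have phiE p : L%:R * phi p = ((p.1%:Z + (L * L)%N%:Z * p.2)%:~R : R).
  rewrite /phi intrD intrM -[(L * L)%N%:~R]/((L * L)%N%:R) natrM -[p.1%:~R]/(p.1%:R).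
  field; exact: LRn0.
have inj : injective phi.
  move=> [r n] [r' n'] /(congr1 (fun y => L%:R * y)); rewrite !phiE /= => /intr_inj.
  have := ltn_ord r; have := ltn_ord r'.
  move=> h h' e; have e1 : n = n' by move: (L * L)%N LL0 LZ r r' h h' e => M; nia.
  by rewrite e1 in e *; congr (_, _); apply: val_inj; move: e => /addIr[].
have sup y : f y != 0 -> exists p, y = phi p.
  move=> fy; have [|n hn] := hs y; first by apply: contraNneq fy => b0; rewrite /f b0 mul0r.
  have rlt : (`|(n %% (L * L)%N%:Z)%Z| < L * L)%N.
    by rewrite -ltz_nat gez0_abs ?modz_ge0// ltz_pmod// ltz_nat.
  exists (Ordinal rlt, (n %/ (L * L)%N%:Z)%Z); apply: (mulfI LRn0).
  by rewrite phiE hn /= gez0_abs ?modz_ge0// addrC mulrC -divz_eq.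
rewrite (sumC_inj inj sup) sumC_pair; last exact: asum_inj inj af.
rewrite sumC_finType.
pose h (r : nat) (m : int) : C := b (r%:R / L%:R) * (epi (- (2 * (r%:R / L%:R * (m%:~R / L%:R))%:C)) *
   epi (- ((w + (m%:~R / L%:R)%:C) ^+ 2 / t))).
have uE : (- (L%:R ^+ 2 * t)^-1) = - t^-1 / L%:R ^+ 2 by field; rewrite t0 LC0.
have apg (z : C) : asum (fun n : int => epi (- ((z + n%:~R) ^+ 2 / (L%:R ^+ 2 * t)))).
  have hu : 0 < complex.Im (- (L%:R ^+ 2 * t)^-1) by rewrite ImN oppr_gt0 Im_u.
  apply: asumWC (asumZ (epi (- (z ^+ 2 / (L%:R ^+ 2 * t)))) (asum_th1 hu (- (z / (L%:R ^+ 2 * t))))) => n.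
  rewrite -epiD le_eqVlt; apply/orP; left; apply/eqP; congr (nrm (epi _)); ring.
have ah r : asum (h r).
  apply: asumWC (asumZ (b (r%:R / L%:R) * epi ((r%:R / L%:R)%:C ^+ 2 * t + 2 * ((r%:R / L%:R)%:C * w)))
     (apg (L%:R * w + (r%:R)%:C * t))) => m.
  rewrite /h -[in leRHS]mulrA -!epiD le_eqVlt; apply/orP; left; apply/eqP; congr (nrm (_ * epi _)).
  rewrite !(rmorphM, fmorphV, rmorph_nat, rmorph_int); field; by rewrite t0 LC0.
have inner (r : 'I_(L * L)) : sumC (fun n : int => f (phi (r, n))) = c * sumC (h r).
  set y0 : R := r%:R / L%:R.
  pose z0 : C := L%:R * w + L%:R * y0%:C * t.
  have e1 n : f (phi (r, n)) = (b y0 * epi (y0%:C ^+ 2 * t + 2 * (y0%:C * w))) *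
      epi (n%:~R ^+ 2 * (L%:R ^+ 2 * t) + 2 * (n%:~R * z0)).
    rewrite /f /phi /= hp -mulrA -epiD -/y0; congr (_ * epi _).
    by rewrite (rmorphD (real_complex R) y0) (rmorphM (real_complex R) L%:R) rmorph_nat rmorph_int /z0; ring.
  rewrite (eq_sumC e1) sumCZ; last exact: asum_th1.
  rewrite -[sumC _]/(th1 (L%:R ^+ 2 * t) z0) hc mulrCA /pg; congr (_ * _).
  rewrite -sumCZ; last exact: apg.
  apply: eq_sumC => m; rewrite /h /gs -/y0 -mulrA -!epiD; congr (_ * epi _).
  rewrite /z0 !(rmorphM, fmorphV, rmorph_nat, rmorph_int); field; by rewrite t0 LC0.
under eq_bigr do rewrite inner.
rewrite -mulr_sumr; congr (_ * _).
have swap (s : seq 'I_(L * L)) : \sum_(r <- s) sumC (h r) = sumC (fun m => \sum_(r <- s) h r m) /\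
    asum (fun m => \sum_(r <- s) h r m).
  elim: s => [|r s [IH1 IH2]].
    rewrite big_nil; split; last by exists 0 => q _; rewrite big1// => k _; rewrite big_nil nrm0.
    by rewrite -[LHS](@sumC0 R int); apply: eq_sumC => j; rewrite big_nil.
  split; last by apply: asumWC (asumD (ah r) IH2) => m; rewrite big_cons.
  by rewrite big_cons IH1 -sumCD//; apply: eq_sumC => m; rewrite big_cons.
rewrite (swap _).1 [RHS](@sumC_inj _ _ _ (fun m : int => m%:~R / L%:R : R)).
- apply: eq_sumC => m; rewrite /hat.
  case: asboolP => [_|[]]; last by exists m; rewrite mulrC divfK ?LRn0.
  by rewrite mulr_suml; apply: eq_bigr => r _; rewrite /h mulrA.
- by move=> m m' /(mulIf (invr_neq0 LRn0))/intr_inj.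
- move=> y; rewrite /hat; case: asboolP => [[m hm] _|]; last by rewrite mul0r eqxx.
  by exists m; rewrite -hm mulrC mulKf ?LRn0.
Qed.
End PoissonLevel.

(** * Generators of the symplectic group acting on theta series *)

Section good.
Variable g : nat.
Local Notation pt := ('cV[C]_g * 'M[C]_g)%type.

(* [relM M u u'] is u' = M.u for the action (z, tau) |->
   (t(C tau + D)^-1 z, (A tau + B)(C tau + D)^-1), written without inverses. *)
Definition relM (M : 'M[R]_(g + g)) (u u' : pt) : Prop :=
  u'.2 *m (mxC (dlsubmx M) *m u.2 + mxC (drsubmx M)) =
    mxC (ulsubmx M) *m u.2 + mxC (ursubmx M) /\
  (mxC (dlsubmx M) *m u.2 + mxC (drsubmx M))^T *m u'.1 = u.1.

(* The automorphy factor [kappa] is the same for all coefficient functions, hence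
   disappears in projective space. *)
Definition good (M : 'M[R]_(g + g)) : Prop := forall L, (0 < L)%N ->
  exists (L' : nat) (T : ('cV[R]_g -> C) -> ('cV[R]_g -> C)), (0 < L')%N /\
  (forall a, SB L a -> SB L' (T a)) /\
  forall u : pt, siegel_space u.2 -> exists (u' : pt) (kappa : C),
    [/\ siegel_space u'.2, kappa != 0, relM M u u' &
        forall a, SB L a -> Theta a u = kappa * Theta (T a) u'].

Lemma mxCM m n p (A : 'M[R]_(m, n)) (B : 'M[R]_(n, p)) : mxC (A *m B) = mxC A *m mxC B.
Proof. exact: map_mxM. Qed.
Lemma mxCT m n (A : 'M[R]_(m, n)) : mxC A^T = (mxC A)^T.
Proof. by rewrite /mxC map_trmx. Qed.
Lemma mxC1 n : mxC (1%:M : 'M[R]_n) = 1%:M.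
Proof. exact: map_mx1. Qed.
Lemma mxC0 m n : mxC (0 : 'M[R]_(m, n)) = 0.
Proof. exact: map_mx0. Qed.

Lemma relM_comp M1 M2 u u' u'' : relM M1 u u' -> relM M2 u' u'' -> relM (M2 *m M1) u u''.
Proof.
move=> [h1 h2] [h3 h4]; rewrite /relM -[M2]submxK -[M1]submxK mulmx_block.
rewrite !(block_mxKul, block_mxKur, block_mxKdl, block_mxKdr).
set A2 := ulsubmx M2 in h3 *; set B2 := ursubmx M2 in h3 *.
set C2 := dlsubmx M2 in h3 h4 *; set D2 := drsubmx M2 in h3 h4 *.
set A1 := ulsubmx M1 in h1 *; set B1 := ursubmx M1 in h1 *.
set C1 := dlsubmx M1 in h1 h2 *; set D1 := drsubmx M1 in h1 h2 *.
have e (X2 Y2 : 'M[R]_g) : mxC (X2 *m A1 + Y2 *m C1) *m u.2 + mxC (X2 *m B1 + Y2 *m D1) =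
    (mxC X2 *m u'.2 + mxC Y2) *m (mxC C1 *m u.2 + mxC D1).
  rewrite mulmxDl -mulmxA h1 !mxCD !mxCM mulmxDl mulmxDr mulmxDr -!mulmxA.
  by rewrite addrACA.
rewrite !e; split; first by rewrite mulmxA h3.
by rewrite trmx_mul -mulmxA h4 h2.
Qed.

Lemma good_comp M1 M2 : good M1 -> good M2 -> good (M2 *m M1).
Proof.
move=> G1 G2 L L0; have [L1 [T1 [L10 [S1 H1]]]] := G1 L L0.
have [L2 [T2 [L20 [S2 H2]]]] := G2 L1 L10.
exists L2, (fun a => T2 (T1 a)); split=> //; split=> [a /S1/S2//|u hu].
have [u' [k1 [hu' k10 r1 E1]]] := H1 u hu.
have [u'' [k2 [hu'' k20 r2 E2]]] := H2 u' hu'.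
exists u'', (k1 * k2); split; [exact: hu''|by rewrite mulf_neq0|exact: relM_comp r1 r2|].
by move=> a ha; rewrite (E1 a ha) (E2 _ (S1 a ha)) mulrA.
Qed.

Lemma rat_den m n (A : 'M[rat]_(m, n)) : exists2 d : nat, (0 < d)%N &
  exists N : 'M[int]_(m, n), d%:R *: map_mx (@ratr R) A = map_mx intr N.
Proof.
pose dd : int := \prod_i \prod_j denq (A i j).
have dd0 : 0 < dd by apply: prodr_gt0 => i _; apply: prodr_gt0 => j _; exact: denq_gt0.
exists `|dd|%N; first by rewrite absz_gt0 gt_eqF.
have ex i j : exists n : int, dd = denq (A i j) * n.
  rewrite /dd (bigD1 i)//= (bigD1 j)//= -!mulrA.
  by exists ((\prod_(j0 | j0 != j) denq (A i j0)) * \prod_(i0 | i0 != i) \prod_j0 denq (A i0 j0)).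
have [f hf] := choice (fun p : 'I_m * 'I_n => ex p.1 p.2).
exists (\matrix_(i, j) (numq (A i j) * f (i, j))); apply/matrixP => i j; rewrite !mxE.
have -> : (`|dd|%N%:R : R) = dd%:~R by rewrite -[in RHS](gtz0_abs dd0).
rewrite (hf (i, j)) /= !intrM /ratr.
have : ((denq (A i j))%:~R : R) != 0 by rewrite intr_eq0 denq_neq0.
by move=> h; field.
Qed.

Lemma lf_int (v w : 'cV[R]_g) : intv v -> intv w -> exists n : int, lf v w = n%:~R.
Proof.
move=> [n ->] [m ->]; exists (lf n m); rewrite !lfE rmorph_sum; apply: eq_bigr => i _.
by rewrite !mxE rmorphM.
Qed.
Lemma lfZl (K : comPzRingType) (v w : 'cV[K]_g) c : lf (c *: v) w = c * lf v w.
Proof. by rewrite !lfE mulr_sumr; apply: eq_bigr => i _; rewrite mxE mulrA. Qed.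
Lemma lfZr (K : comPzRingType) (v w : 'cV[K]_g) c : lf v (c *: w) = c * lf v w.
Proof. by rewrite lfC lfZl lfC. Qed.
Lemma qf_mxC (B : 'M[R]_g) k : qf (mxC B) (mxC k) = (qf B k)%:C.
Proof.
rewrite !qfE rmorph_sum; apply: eq_bigr => i _; rewrite rmorph_sum; apply: eq_bigr => j _.
by rewrite !mxE !rmorphM.
Qed.
Lemma qf_addA (K : comPzRingType) (A B : 'M[K]_g) v : qf (A + B) v = qf A v + qf B v.
Proof. by rewrite /qf mulmxDr mulmxDl mxE. Qed.

Definition blT (K : pzRingType) (B : 'M[K]_g) : 'M[K]_(g + g) := block_mx 1%:M B 0 1%:M.
Definition blU (K : fieldType) (U : 'M[K]_g) : 'M[K]_(g + g) := block_mx U 0 0 (invmx U)^T.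

(** A translation of tau multiplies the coefficient at k by exp(-pi i B[k]). If m is a denominator
    of B, periods in 2mL change B[k] by even integers, which fixes the new level. *)
Lemma good_T (B : 'M[rat]_g) : B^T = B -> good (blT (map_mx ratr B)).
Proof.
move=> sB; set Br : 'M[R]_g := map_mx ratr B.
have sBr : Br^T = Br by rewrite /Br map_trmx sB.
have [m m0 [N hN]] := rat_den B; rewrite -/Br in hN.
move=> L L0; exists (L * (2 * m))%N, (fun a k => a k * epi (- (qf Br k)%:C)).
split; first by rewrite !muln_gt0 L0.
split=> [a ha|u hu].
  have ha' := SB_mul (2 * m) ha; split=> [k hk|k n hn].
    by apply: ha'.1; apply: contraNneq hk => ->; rewrite mul0r.
  rewrite ha'.2//; have [->|ak] := eqVneq (a k) 0; first by rewrite !mul0r.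
  have kL := ha.1 _ ak.
  set P : R := (L * (2 * m))%N%:R.
  have PE : P = L%:R * (2 * m%:R) by rewrite /P !natrM.
  have [p1 hp1] : exists q : int, qf Br (P *: n) = (2 * q%:~R).
    have [q hq] := lf_int hn (intvM N hn).
    exists ((L ^ 2 * 2 * m)%N%:Z * q); rewrite qfZ qf_lf PE.
    have -> : Br *m n = m%:R^-1 *: (map_mx intr N *m n).
      by rewrite -hN -scalemxAl scalerA mulVf ?scale1r// pnatr_eq0 -lt0n.
    rewrite lfZr hq intrM -[(L ^ 2 * 2 * m)%N%:~R]/((L ^ 2 * 2 * m)%N%:R) !natrM ?natrX.
    by field; rewrite pnatr_eq0 -lt0n.
  have [p2 hp2] : exists q : int, lf k (Br *m (P *: n)) = q%:~R.
    have [q hq] := lf_int kL (intvM N hn).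
    exists (2 * q); rewrite -scalemxAr lfZr PE.
    have -> : Br *m n = m%:R^-1 *: (map_mx intr N *m n).
      by rewrite -hN -scalemxAl scalerA mulVf ?scale1r// pnatr_eq0 -lt0n.
    rewrite lfZr intrM -hq lfZl; field.
    by rewrite pnatr_eq0 -lt0n.
  congr (_ * _); rewrite qfD// hp1 hp2 -addrA [(_ + (2 * _ + _))%:C]rmorphD opprD epiD.
  rewrite -mulrDr -intrD rmorphM rmorph_nat rmorph_int.
  by rewrite -[X in _ * epi X]mulrN -mulrNz epi_int mulr1.
exists (u.1, u.2 + mxC Br), 1; split.
- have [s1 [s2 s3]] := hu; split => /=.
    by rewrite /symmetric_mx linearD /= s1 -mxCT sBr.
  rewrite (_ : map_mx _ _ = map_mx (@complex.Im R) u.2) //.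
  by apply/matrixP => i j; rewrite !mxE ImD /= addr0.
- exact: oner_neq0.
- rewrite /relM /blT !(block_mxKul, block_mxKur, block_mxKdl, block_mxKdr) /= mxC0 !mxC1.
  by rewrite mul0mx add0r trmx1 !mul1mx mulmx1.
- move=> a ha; rewrite mul1r; apply: eq_sumC => k /=; rewrite -mulrA /tterm -epiD.
  by congr (_ * epi _); rewrite qf_addA qf_mxC; ring.
Qed.

(** A linear substitution of the index. The denominator m of U is needed for the periods, the
    denominator m' of its inverse for the support. *)
Lemma good_U (U : 'M[rat]_g) : U \in unitmx -> good (blU (map_mx ratr U)).
Proof.
move=> uU; set Ur : 'M[R]_g := map_mx ratr U.
have uUr : Ur \in unitmx by rewrite map_unitmx.
have [m m0 [N hN]] := rat_den U; rewrite -/Ur in hN.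
have [m' m0' [N' hN']] := rat_den (invmx U); rewrite map_invmx -/Ur in hN'.
have hNT : m%:R *: Ur^T = map_mx intr N^T.
  by rewrite -map_trmx -hN; apply/matrixP => i j; rewrite !mxE.
have hNT' : m'%:R *: (invmx Ur)^T = map_mx intr N'^T.
  by rewrite -map_trmx -hN'; apply/matrixP => i j; rewrite !mxE.
move=> L L0; exists (L * (m * m'))%N, (fun a k => a (Ur^T *m k)).
split; first by rewrite !muln_gt0 L0 m0.
split=> [a ha|u hu].
  split=> [k /ha.1 hk|k n hn].
    have -> : (L * (m * m'))%N%:R *: k = m%:R *: (map_mx intr N'^T *m (L%:R *: (Ur^T *m k))).
      rewrite -hNT' -scalemxAl -scalemxAr mulmxA -trmx_mul mulmxV// trmx1 mul1mx.
      by rewrite !scalerA !natrM; congr (_ *: _); ring.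
    by apply: intvZn; exact: intvM.
  rewrite mulmxDr -scalemxAr.
  have -> : (L * (m * m'))%N%:R *: (Ur^T *m n) = L%:R *: (m'%:R *: (map_mx intr N^T *m n)).
    by rewrite -hNT -scalemxAl !scalerA !natrM; congr (_ *: _); ring.
  by apply: ha.2; apply: intvZn; exact: intvM.
exists (mxC Ur *m u.1, mxC Ur *m u.2 *m (mxC Ur)^T), 1; split.
- have [s1 [s2 s3]] := hu; split => /=.
    by rewrite /symmetric_mx !trmx_mul trmxK s1 mulmxA.
  have sy : symmetric_mx (map_mx (@complex.Im R) (mxC Ur *m u.2 *m (mxC Ur)^T)).
    by rewrite /symmetric_mx map_trmx !trmx_mul trmxK s1 mulmxA.
  split=> // x x0; rewrite -/(qf _ _) -Im_qf.
  have -> : qf (mxC Ur *m u.2 *m (mxC Ur)^T) (mxC x) = qf u.2 (mxC (Ur^T *m x)).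
    by rewrite /qf mxCM mxCT trmx_mul trmxK !mulmxA.
  rewrite Im_qf; apply: s3; apply: contraNneq x0 => h.
  by rewrite -[x](mulKmx (_ : Ur^T \in unitmx)) ?unitmx_tr// h mulmx0.
- exact: oner_neq0.
- rewrite /relM /blU !(block_mxKul, block_mxKur, block_mxKdl, block_mxKdr) /= !mxC0.
  rewrite mul0mx add0r addr0 -!mulmxA -mxCT -mxCM -trmx_mul mulVmx// trmx1 mxC1 mulmx1.
  by split=> //; rewrite -mxCT trmxK mulmxA -mxCM mulVmx// mxC1 mul1mx.
- move=> a ha; rewrite mul1r /Theta.
  rewrite (@sumC_inj _ _ _ (fun k => Ur^T *m k)); last 2 first.
  + by move=> k k' /(congr1 (mulmx (invmx Ur^T))); rewrite !mulKmx ?unitmx_tr.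
  + by move=> k _; exists (invmx Ur^T *m k); rewrite mulKVmx ?unitmx_tr.
  apply: eq_sumC => k; rewrite /tterm /=.
  have -> : qf u.2 (mxC (Ur^T *m k)) = qf (mxC Ur *m u.2 *m (mxC Ur)^T) (mxC k).
    by rewrite /qf mxCM mxCT trmx_mul trmxK !mulmxA.
  have -> : lf (mxC (Ur^T *m k)) u.1 = lf (mxC k) (mxC Ur *m u.1).
    by rewrite /lf mxCM mxCT trmx_mul trmxK !mulmxA.
  by [].
Qed.

Definition Ei (K : pzRingType) (i : 'I_g) : 'M[K]_g := delta_mx i i.
Definition Pi (K : pzRingType) (i : 'I_g) : 'M[K]_g := 1%:M - Ei K i.
Definition ei (K : pzRingType) (i : 'I_g) : 'cV[K]_g := delta_mx i ord0.
Definition blJ (K : pzRingType) (i : 'I_g) : 'M[K]_(g + g) :=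
  block_mx (Pi K i) (Ei K i) (- Ei K i) (Pi K i).

Section Ji.
Variable i : 'I_g.
Lemma EiE (K : pzRingType) : Ei K i = ei K i *m (ei K i)^T.
Proof. by rewrite /Ei /ei trmx_delta mul_delta_mx. Qed.
Lemma ei_lf (K : pzRingType) (v : 'cV[K]_g) : (ei K i)^T *m v = (v i ord0)%:M.
Proof.
rewrite /ei trmx_delta -rowE; apply/matrixP => a b; rewrite !ord1 !mxE.
by rewrite eqxx mulr1n.
Qed.
Lemma lf_ei (K : comPzRingType) (v : 'cV[K]_g) : lf (ei K i) v = v i ord0.
Proof. by rewrite /lf ei_lf mxE eqxx mulr1n. Qed.
Lemma PiT (K : pzRingType) : (Pi K i)^T = Pi K i.
Proof. by rewrite /Pi linearB /= trmx1 /Ei trmx_delta. Qed.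
Lemma Pi_ei (K : pzRingType) : Pi K i *m ei K i = 0.
Proof. by rewrite /Pi mulmxBl mul1mx /Ei /ei mul_delta_mx subrr. Qed.
Lemma Pi_coord (K : pzRingType) (v : 'cV[K]_g) j : (Pi K i *m v) j ord0 = if j == i then 0 else v j ord0.
Proof.
rewrite /Pi mulmxBl mul1mx EiE -mulmxA ei_lf !mxE big_ord1 !mxE !eqxx andbT mulr1n.
by case: eqP => [->|_]; rewrite ?mul1r ?subrr// mul0r subr0.
Qed.

Variable u : pt.
Hypothesis hu : siegel_space u.2.
Let tau := u.2.
Let z := u.1.
Let t := tau i i.
Let zi := z i ord0.
(* The inversion in the i-th coordinate alone, where the one-dimensional Poisson
   formula applies. *)
Definition Jr : 'cV[C]_g := ei C i + Pi C i *m tau *m ei C i.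
Definition Jtau : 'M[C]_g := Pi C i *m tau *m Pi C i - t^-1 *: (Jr *m Jr^T).
Definition Jz : 'cV[C]_g := Pi C i *m z - (zi / t) *: Jr.

Lemma tauT : tau^T = tau. Proof. by case: hu. Qed.
Lemma Yt : posdef (map_mx (@complex.Im R) tau). Proof. by case: hu. Qed.
Lemma Im_t : 0 < complex.Im t.
Proof.
have [_ /(_ (ei R i))] := Yt; rewrite -/(qf _ _) qf_lf lf_ei.
have -> : (map_mx (@complex.Im R) tau *m ei R i) i ord0 = complex.Im t.
  rewrite mxE (bigD1 i)//= big1 ?addr0; last by move=> j /negbTE ji; rewrite !mxE ji mulr0.
  by rewrite !mxE !eqxx mulr1.
apply; apply/eqP => /matrixP/(_ i ord0); rewrite !mxE !eqxx => /eqP.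
by rewrite oner_eq0.
Qed.
Lemma tn0 : t != 0. Proof. exact: t_neq0 Im_t. Qed.

Lemma Jr_lf (k0 : 'cV[C]_g) (y : C) : k0 i ord0 = 0 ->
  lf Jr (k0 + y *: ei C i) = y + (tau *m k0) i ord0.
Proof.
move=> k0i; have Pk : Pi C i *m (k0 + y *: ei C i) = k0.
  rewrite mulmxDr -scalemxAr Pi_ei scaler0 addr0; apply/matrixP => j b.
  by rewrite ord1 Pi_coord; case: eqP => [->|//].
rewrite /Jr lfD lf_ei; congr (_ + _); first by rewrite !mxE k0i !eqxx mulr1 add0r.
rewrite /lf !trmx_mul PiT tauT -!mulmxA Pk -/(lf (ei C i) _) lf_ei//.
Qed.
Lemma Pk0 (k0 : 'cV[C]_g) (y : C) : k0 i ord0 = 0 -> Pi C i *m (k0 + y *: ei C i) = k0.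
Proof.
move=> k0i; rewrite mulmxDr -scalemxAr Pi_ei scaler0 addr0; apply/matrixP => j b.
by rewrite ord1 Pi_coord; case: eqP => [->|//].
Qed.

Lemma Jtau_qf (k0 : 'cV[C]_g) (y : C) : k0 i ord0 = 0 ->
  qf Jtau (k0 + y *: ei C i) = qf tau k0 - (y + (tau *m k0) i ord0) ^+ 2 / t.
Proof.
move=> k0i; set k := k0 + _.
have -> : qf Jtau k = qf tau (Pi C i *m k) - t^-1 * (lf Jr k * lf Jr k).
  rewrite /qf /Jtau mulmxBr mulmxBl mxE [X in _ + X]mxE; congr (_ - _).
    by rewrite trmx_mul PiT !mulmxA.
  rewrite -scalemxAr -scalemxAl mxE; congr (_ * _).
  have -> : k^T *m (Jr *m Jr^T) *m k = (k^T *m Jr) *m (Jr^T *m k) by rewrite !mulmxA.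
  by rewrite mxE big_ord1 -/(lf k Jr) -/(lf Jr k) [lf k Jr]lfC.
by rewrite Pk0// Jr_lf//; congr (_ - _); rewrite -expr2 mulrC.
Qed.
Lemma Jz_lf (k0 : 'cV[C]_g) (y : C) : k0 i ord0 = 0 ->
  lf (k0 + y *: ei C i) Jz = lf k0 z - zi / t * (y + (tau *m k0) i ord0).
Proof.
move=> k0i; rewrite /Jz lfDr -scaleNr lfZr mulNr; congr (_ - _ * _); last first.
  by rewrite lfC Jr_lf.
by rewrite /lf mulmxA -[_^T *m Pi C i]trmxK trmx_mul trmxK PiT Pk0.
Qed.

Lemma Jtau_sym : Jtau^T = Jtau.
Proof.
rewrite /Jtau linearB /= linearZ /= !trmx_mul trmxK PiT tauT mulmxA.
by [].
Qed.

Lemma k_split (K : comPzRingType) (k : 'cV[K]_g) :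
  k = Pi K i *m k + k i ord0 *: ei K i /\ (Pi K i *m k) i ord0 = 0.
Proof.
split; last by rewrite Pi_coord eqxx.
apply/matrixP => j b; rewrite ord1 mxE Pi_coord !mxE eqxx andbT.
by case: eqP => [->|_]; rewrite ?add0r ?mulr1// mulr0 addr0.
Qed.
Lemma mxC_ei : mxC (ei R i) = ei C i.
Proof. by apply/matrixP => a b; rewrite !mxE rmorph_nat. Qed.
Lemma mxCZ m n (c : R) (A : 'M[R]_(m, n)) : mxC (c *: A) = c%:C *: mxC A.
Proof. by apply/matrixP => a b; rewrite !mxE rmorphM. Qed.

(** For k = k0 + x e_i, completing the square with p + iq = -(x + beta)/t shows that Im(Jtau) at k
    is the sum of the values of Im(tau) at k0 + p e_i and at q e_i; both vanish only for k = 0. *)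
Lemma Jtau_siegel : siegel_space Jtau.
Proof.
split; first exact: Jtau_sym.
split; first by rewrite /symmetric_mx map_trmx Jtau_sym.
move=> k kn0; rewrite -/(qf _ _) -Im_qf.
have [kE k0i] := k_split k; set k0 := Pi R i *m k in kE k0i; set x := k i ord0 in kE.
have k0iC : (mxC k0) i ord0 = 0 by rewrite mxE k0i.
rewrite kE mxCD mxCZ mxC_ei Jtau_qf//.
set beta := (tau *m mxC k0) i ord0.
pose xt : C := - (x%:C + beta) / t.
pose p := complex.Re xt; pose q := complex.Im xt.
set Y := map_mx (@complex.Im R) tau.
have sY : Y^T = Y by rewrite /Y map_trmx tauT.
have Imb : complex.Im beta = (Y *m k0) i ord0.
  rewrite /beta !mxE Im_sum; apply: eq_bigr => j _; rewrite !mxE ImM /= mulr0 add0r//.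
have Yii : Y i i = complex.Im t by rewrite mxE.
have qe (c : R) : qf Y (c *: ei R i) = c ^+ 2 * complex.Im t.
  rewrite qfZ qf_lf lf_ei; congr (_ * _).
  rewrite mxE (bigD1 i)//= big1 ?addr0; last by move=> j /negbTE ji; rewrite !mxE ji mulr0.
  by rewrite !mxE !eqxx mulr1.
have vR : qf Y (k0 + p *: ei R i) = complex.Im (qf tau (mxC k0)) + p ^+ 2 * complex.Im t + 2 * p * complex.Im beta.
  rewrite qfD// qe Im_qf; congr (_ + _); rewrite -scalemxAr lfZr -lf_sym// lf_ei -Imb.
  by rewrite mulrA.
have vI : qf Y (q *: ei R i) = q ^+ 2 * complex.Im t by exact: qe.
have E : complex.Im (qf tau (mxC k0) - (x%:C + beta) ^+ 2 / t) =
    qf Y (k0 + p *: ei R i) + qf Y (q *: ei R i).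
  rewrite vR vI ImD ImN.
  have hb : beta = - x%:C - xt * t by rewrite /xt divfK ?tn0//; ring.
  have -> : (x%:C + beta) ^+ 2 / t = xt ^+ 2 * t.
    by rewrite hb; field; exact: tn0.
  have -> : complex.Im beta = - complex.Im (xt * t) by rewrite hb ImD !ImN /= oppr0 add0r.
  have key (v s : C) : - complex.Im (v ^+ 2 * s) = complex.Re v ^+ 2 * complex.Im s +
      2 * complex.Re v * - complex.Im (v * s) + complex.Im v ^+ 2 * complex.Im s.
    by case: v => v1 v2; case: s => s1 s2; rewrite expr2 !(ImM, ReM) /=; ring.
  by rewrite key -/p -/q !addrA.
rewrite E; have pY := Yt; rewrite -/Y in pY.
have h1 := posdef_ge0 (k0 + p *: ei R i) pY; have h2 := posdef_ge0 (q *: ei R i) pY.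
have [v0|v0] := eqVneq (k0 + p *: ei R i) 0; last first.
  by rewrite ltr_pwDl//; exact: pY.2.
rewrite ltr_wpDl//; apply: pY.2.
have p0 : p = 0.
  by move/matrixP: v0 => /(_ i ord0); rewrite mxE k0i add0r !mxE !eqxx mulr1.
have k00 : k0 = 0 by move: v0; rewrite p0 scale0r addr0.
have b0 : beta = 0 by rewrite /beta k00 mxC0 mulmx0 mxE.
have xn0 : x != 0.
  by apply: contraNneq kn0 => x0; rewrite kE k00 x0 scale0r addr0.
apply/eqP => /matrixP/(_ i ord0); rewrite !mxE !eqxx mulr1 => q0.
have : xt == 0 by rewrite eq_complex -/p -/q p0 q0 eqxx.
rewrite /xt b0 addr0 mulf_eq0 oppr_eq0 invr_eq0 (negbTE tn0) orbF.
by rewrite eq_complex /= (negbTE xn0).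
Qed.

(** Everything follows from P e_i = 0, e_i^T tau e_i = t and the fact that [Jr] has i-th coordinate
    1. *)
Lemma relM_J : relM (blJ R i) u (Jz, Jtau).
Proof.
rewrite /relM /blJ !(block_mxKul, block_mxKur, block_mxKdl, block_mxKdr) /=.
have cE : mxC (Ei R i) = Ei C i by apply/matrixP => a b; rewrite !mxE rmorph_nat.
have cP : mxC (Pi R i) = Pi C i.
  by apply/matrixP => a b; rewrite !mxE rmorphB !rmorph_nat.
have cN : mxC (- Ei R i) = - Ei C i.
  by apply/matrixP => a b; rewrite !mxE rmorphN rmorph_nat.
rewrite cE cP cN -/tau -/z.
have sc (v : 'cV[C]_g) (w : 'rV[C]_g) (c : C) : v *m (c%:M *m w) = c *: (v *m w).
  by rewrite mul_scalar_mx scalemxAr.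
have Jri : Jr i ord0 = 1.
  by rewrite /Jr mxE -mulmxA Pi_coord eqxx addr0 !mxE !eqxx.
have JrE : Jr^T *m ei C i = 1%:M.
  by rewrite -[LHS]trmxK trmx_mul trmxK ei_lf Jri trmx1.
have PP : Pi C i *m Pi C i = Pi C i.
  by rewrite {1}/Pi mulmxBl mul1mx EiE -mulmxA -[_^T *m Pi C i]trmxK trmx_mul trmxK PiT Pi_ei trmx0 mulmx0 subr0.
have JrP : Jr^T *m Pi C i = (ei C i)^T *m tau *m Pi C i.
  have -> : Jr^T = (ei C i)^T + (ei C i)^T *m tau *m Pi C i.
    by rewrite /Jr raddfD /= !trmx_mul PiT tauT mulmxA.
  have eP : (ei C i)^T *m Pi C i = 0 by rewrite -[LHS]trmxK trmx_mul trmxK PiT Pi_ei trmx0.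
  by rewrite mulmxDl eP add0r -[_ *m Pi C i *m Pi C i]mulmxA PP.
have PE : Pi C i *m Ei C i = 0 by rewrite EiE mulmxA Pi_ei mul0mx.
have tt0 : (ei C i)^T *m tau *m ei C i = t%:M.
  rewrite -mulmxA ei_lf; congr (_%:M).
  rewrite mxE (bigD1 i)//= big1 ?addr0; last by move=> j /negbTE ji; rewrite !mxE ji mulr0.
  by rewrite !mxE !eqxx mulr1.
split.
  have e1 : Jtau *m Ei C i = - (t^-1 *: (Jr *m (ei C i)^T)).
    rewrite /Jtau mulmxBl -!mulmxA PE !mulmx0 sub0r -scalemxAl -mulmxA EiE; congr (- (_ *: _)).
    by rewrite (mulmxA Jr^T) JrE mul1mx.
  have e2 : Jtau *m Pi C i = Pi C i *m tau *m Pi C i - t^-1 *: (Jr *m ((ei C i)^T *m tau *m Pi C i)).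
    by rewrite /Jtau mulmxBl -!mulmxA PP -scalemxAl -mulmxA JrP !mulmxA.
  have e3 : (ei C i)^T *m tau *m Pi C i = (ei C i)^T *m tau - t *: (ei C i)^T.
    by rewrite /Pi mulmxBr mulmx1 EiE mulmxA tt0 mul_scalar_mx.
  have L1 : Jtau *m (- Ei C i *m tau) = t^-1 *: (Jr *m ((ei C i)^T *m tau)).
    by rewrite mulNmx mulmxN mulmxA e1 mulNmx opprK -scalemxAl -mulmxA.
  have L2 : Jtau *m Pi C i = Pi C i *m tau *m Pi C i - t^-1 *: (Jr *m ((ei C i)^T *m tau)) + Jr *m (ei C i)^T.
    rewrite e2 e3 [Jr *m (_ - _)]mulmxBr scalerBr -scalemxAr scalerA mulVf ?tn0// scale1r opprB.
    by rewrite addrA addrAC.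
  rewrite mulmxDr L1 L2.
  have cc (X Y Z : 'M[C]_g) : X + (Y - X + Z) = Y + Z by rewrite addrA [X + _]addrC subrK.
  rewrite cc.
  have -> : Pi C i *m tau *m Pi C i = Pi C i *m tau - Pi C i *m tau *m Ei C i.
    by rewrite {2}/Pi mulmxBr mulmx1.
  have -> : Jr *m (ei C i)^T = Ei C i + Pi C i *m tau *m Ei C i.
    by rewrite /Jr mulmxDl EiE !mulmxA.
  by rewrite [Ei C i + _]addrC addrA subrK.
have EP : Ei C i *m Pi C i = 0.
  by rewrite EiE -mulmxA -[_^T *m Pi C i]trmxK trmx_mul trmxK PiT Pi_ei trmx0 mulmx0.
have PJ : Pi C i *m Jr = Pi C i *m tau *m ei C i by rewrite /Jr mulmxDr Pi_ei add0r !mulmxA PP.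
have EJ : Ei C i *m Jr = ei C i by rewrite EiE -mulmxA ei_lf Jri mulmx1.
have h1 : Pi C i *m Jz = Pi C i *m z - (zi / t) *: (Pi C i *m tau *m ei C i).
  by rewrite /Jz mulmxBr -scalemxAr PJ mulmxA PP.
have h2 : Ei C i *m Jz = - ((zi / t) *: ei C i).
  by rewrite /Jz mulmxBr -scalemxAr EJ mulmxA EP mul0mx sub0r.
have Pt : Pi C i *m tau *m ei C i = tau *m ei C i - t *: ei C i.
  rewrite /Pi mulmxBl mul1mx mulmxBl EiE; congr (_ - _).
  by rewrite -!mulmxA (mulmxA _ tau) tt0 mul_mx_scalar.
have TT : (- Ei C i *m tau + Pi C i)^T = Pi C i - tau *m Ei C i.
  by rewrite linearD /= PiT mulNmx linearN /= trmx_mul tauT /Ei trmx_delta addrC.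
rewrite TT mulmxBl -mulmxA h1 h2 mulmxN -scalemxAr opprK Pt scalerBr scalerA.
rewrite divfK ?tn0// opprB addrA subrK.
exact: esym (k_split z).1.
Qed.
End Ji.

(** Vectors with vanishing i-th coordinate index the lines parallel to e_i; the other k0 receive the
    value 0, which avoids a subtype. *)
Lemma sum_coord i (f : 'cV[R]_g -> C) : asum f ->
  sumC f = sumC (fun k0 : 'cV[R]_g =>
    if k0 i ord0 == 0 then sumC (fun x : R => f (k0 + x *: ei R i)) else 0).
Proof.
move=> hf; pose phi (k : 'cV[R]_g) := (Pi R i *m k, k i ord0).
pose psi (p : 'cV[R]_g * R) := p.1 + p.2 *: ei R i.
have c1 : cancel phi psi by move=> k; rewrite /psi /phi /= -(k_split i k).1.
pose F (p : 'cV[R]_g * R) : C := if p.1 i ord0 == 0 then f (psi p) else 0.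
have c2 p : F p != 0 -> phi (psi p) = p.
  case: p => k0 x; rewrite /F /phi /psi /=; case: (eqVneq (k0 i ord0) 0) => [h _|_]; last by rewrite eqxx.
  congr (_, _); last by rewrite !mxE h !eqxx mulr1 add0r.
  rewrite mulmxDr -scalemxAr Pi_ei scaler0 addr0; apply/matrixP => j b.
  by rewrite ord1 Pi_coord; case: eqP => [->|//].
have EF k : F (phi k) = f k by rewrite /F c1 /phi /= (k_split i k).2 eqxx.
have aF : asum F by apply: (asum_inj_sup c1 c2); apply: asumWC hf => k; rewrite EF.
have -> : sumC f = sumC F.
  rewrite (@sumC_inj _ _ _ phi F); last 2 first.
  - exact: can_inj c1.
  - by move=> p /c2 <-; exists (psi p).
  by apply: eq_sumC => k; rewrite EF.
rewrite sumC_pair//; apply: eq_sumC => k0; rewrite /F /=; case: eqP => // _.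
exact: sumC0.
Qed.

(** With the other coordinates k0 fixed, the inner sum is one-dimensional with parameter t = tau_ii
    and argument z_i + (tau k0)_i. Its constant depends on t alone, hence comes out of the sum over
    k0. [T] is the finite Fourier transform in the i-th coordinate and preserves the level. *)
Lemma good_J i : good (blJ R i).
Proof.
move=> L L0.
pose T (a : 'cV[R]_g -> C) (k : 'cV[R]_g) : C :=
  hat L (fun x => a (Pi R i *m k + x *: ei R i)) (k i ord0).
have LRn : (L%:R : R) != 0 by rewrite pnatr_eq0 -lt0n.
have TSB a : SB L a -> SB L (T a).
  move=> [ha1 ha2]; split=> [k|k n hn].
    rewrite /T /hat; case: asboolP => [hk|]; last by rewrite eqxx.
    move=> hsum; have [r hr] : exists r : 'I_(L * L), a (Pi R i *m k + (r%:R / L%:R) *: ei R i) != 0.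
      apply/existsP; apply: contraNT hsum; rewrite negb_exists => /forallP h.
      by rewrite big1// => r _; rewrite (eqP (negPn (h r))) mul0r.
    have [n hn] := ha1 _ hr; apply: intv_coord => j; rewrite mxE.
    have [->|ji] := eqVneq j i; first exact: hk.
    exists (n j ord0); have /matrixP/(_ j ord0) := hn.
    by rewrite [RHS]mxE => <-; rewrite mxE mxE Pi_coord (negbTE ji) !mxE (negbTE ji) mulr0 addr0.
  have [nn hnn] := hn; have [ni hni] : exists q : int, n i ord0 = q%:~R by exists (nn i ord0); rewrite hnn mxE.
  rewrite /T /hat; have -> : isint (L%:R * (k + L%:R *: n) i ord0) = isint (L%:R * k i ord0).
    apply/propext; rewrite !mxE hni mulrDr; split=> -[q hq].
      by exists (q - (L * L)%N%:Z * ni); rewrite intrD mulrNz intrM -hq -[(L * L)%N%:~R]/((L * L)%N%:R) natrM; ring.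
    by exists (q + (L * L)%N%:Z * ni); rewrite intrD intrM -hq -[(L * L)%N%:~R]/((L * L)%N%:R) natrM; ring.
  case: asboolP => // hk; apply: eq_bigr => r _; congr (_ * _).
    rewrite mulmxDr -scalemxAr -addrA [L%:R *: _ + _]addrC addrA ha2//.
    apply: intv_coord => j; rewrite Pi_coord; case: eqP => _; first by exists 0.
    by exists (nn j ord0); rewrite hnn mxE.
  rewrite !mxE hni mulrDr rmorphD mulrDr opprD epiD -[RHS]mulr1; congr (_ * _).
  rewrite -[RHS](epi_int R (- (r%:Z * ni))); congr epi.
  rewrite mulrNz intrM -[r%:~R]/(r%:R) !(rmorphM, fmorphV, rmorph_nat, rmorph_int); field.
  by rewrite pnatr_eq0 -lt0n.
exists L, T; split=> //; split=> // u hu.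
have [c c0 hc] := poissonL L0 (Im_t i hu).
pose zi := u.1 i ord0; pose t := u.2 i i.
exists (Jz i u, Jtau i u), (c * epi (- (zi ^+ 2 / t))); split.
- exact: Jtau_siegel.
- by rewrite mulf_neq0 ?epi_neq0.
- exact: relM_J.
move=> a ha; have [ha1 ha2] := ha.
have tT := tauT hu.
have isTa := TSB a ha.
have aF := @asum_Theta _ _ _ _ (Jz i u, Jtau i u) L0 isTa (Jtau_siegel i hu).
have aF' := asum_Theta L0 ha hu.
rewrite /Theta -sumCZ// (sum_coord i aF') (sum_coord i (asumZ _ aF)).
apply: eq_sumC => k0; case: eqP => [k0i|//].
have k0iC : (mxC k0) i ord0 = 0 by rewrite mxE k0i.
have kE x : mxC (k0 + x *: ei R i) = mxC k0 + x%:C *: ei C i by rewrite mxCD mxCZ mxC_ei.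
pose rho : C := (u.2 *m mxC k0) i ord0.
pose Q0 : C := qf u.2 (mxC k0) + 2 * lf (mxC k0) u.1.
pose w : C := zi + rho.
pose b (x : R) : C := a (k0 + x *: ei R i).
have inj : injective (fun x : R => k0 + x *: ei R i).
  by move=> x y /addrI/matrixP/(_ i ord0); rewrite !mxE !eqxx !mulr1.
have hb1 y : b y != 0 -> isint (L%:R * y).
  move=> /ha1[n /matrixP/(_ i ord0)]; rewrite !mxE k0i !eqxx mulr1 add0r => ->.
  by exists (n i ord0).
have hb2 y (n : int) : b (y + L%:R * n%:~R) = b y.
  rewrite /b scalerDl -scalerA addrA ha2//; apply: intv_coord => j; rewrite !mxE.
  by case: (j == i); [exists n; rewrite mulr1|exists 0; rewrite mulr0].
pose f (x : R) : C := b x * epi (x%:C ^+ 2 * t + 2 * (x%:C * w)).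
pose h (y : R) : C := hat L b y * epi (- ((w + y%:C) ^+ 2 / t)).
have te : (u.2 *m ei C i) i ord0 = t.
  rewrite mxE (bigD1 i)//= big1 ?addr0; last by move=> j /negbTE ji; rewrite !mxE ji mulr0.
  by rewrite !mxE !eqxx mulr1.
have E1 x : a (k0 + x *: ei R i) * tterm u.2 u.1 (k0 + x *: ei R i) = epi Q0 * f x.
  rewrite /f -/(b x) [RHS]mulrCA -epiD /tterm kE; congr (_ * epi _).
  have q1 : qf u.2 (ei C i) = t by rewrite qf_lf lf_ei te.
  have q2 : lf (mxC k0) (u.2 *m (x%:C *: ei C i)) = x%:C * rho.
    by rewrite -scalemxAr lfZr (lf_sym _ _ tT) lf_ei.
  rewrite qfD// qfZ q1 q2 lfD lfZl lf_ei /Q0 /w /zi.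
  by ring.
have Th x : T a (k0 + x *: ei R i) = hat L b x.
  rewrite /T !mxE k0i !eqxx mulr1 add0r; congr (hat L _ _); apply: funext => y.
  rewrite mulmxDr -scalemxAr Pi_ei scaler0 addr0; congr (a (_ + _)).
  by apply/matrixP => j q; rewrite ord1 Pi_coord; case: eqP => [->|//].
have E2 x : c * epi (- (zi ^+ 2 / t)) *
    (T a (k0 + x *: ei R i) * tterm (Jtau i u) (Jz i u) (k0 + x *: ei R i)) = (epi Q0 * c) * h x.
  rewrite Th /h /tterm kE Jtau_qf// Jz_lf// -/zi -/t -/rho.
  have -> : c * epi (- (zi ^+ 2 / t)) * (hat L b x * epi (qf u.2 (mxC k0) -
      (x%:C + rho) ^+ 2 / t + 2 * (lf (mxC k0) u.1 - zi / t * (x%:C + rho)))) =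
     c * hat L b x * (epi (- (zi ^+ 2 / t)) * epi (qf u.2 (mxC k0) -
      (x%:C + rho) ^+ 2 / t + 2 * (lf (mxC k0) u.1 - zi / t * (x%:C + rho)))) by ring.
  have -> : epi Q0 * c * (hat L b x * epi (- ((w + x%:C) ^+ 2 / t))) =
     c * hat L b x * (epi Q0 * epi (- ((w + x%:C) ^+ 2 / t))) by ring.
  by rewrite -!epiD; congr (_ * epi _); rewrite /Q0 /w; ring.
have af : asum f.
  have := asumZ (epi Q0)^-1 (asum_inj inj aF'); apply: asumWC => x /=.
  by rewrite E1 mulKf// epi_neq0.
have ah : asum h.
  have := asumZ (epi Q0 * c)^-1 (asumZ (c * epi (- (zi ^+ 2 / t))) (asum_inj inj aF)); apply: asumWC => x /=.
  by rewrite E2 mulKf// mulf_neq0// epi_neq0.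
rewrite (eq_sumC E1) (eq_sumC E2) !sumCZ// -mulrA; congr (_ * _).
exact: hc.
Qed.

Definition rowE (K : pzRingType) (E : {set 'I_g}) : 'rV[K]_g := \row_j (j \in E)%:R.
(** Simultaneous inversion in the coordinates of E; [Jmx] is reached by adding the coordinates one
    at a time. *)
Definition blJE (K : pzRingType) (E : {set 'I_g}) : 'M[K]_(g + g) :=
  block_mx (diag_mx (const_mx 1 - rowE K E)) (diag_mx (rowE K E))
           (- diag_mx (rowE K E)) (diag_mx (const_mx 1 - rowE K E)).

Lemma blJ_diag (K : pzRingType) i : blJ K i = blJE K [set i].
Proof.
have e : Ei K i = diag_mx (rowE K [set i]).
  apply/matrixP => a b; rewrite !mxE inE; case: (eqVneq a b) => [<-|ab].
    by rewrite mulr1n; case: eqP.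
  rewrite mulr0n; case: eqP => // ai; case: eqP => // bi; by move: ab; rewrite ai bi eqxx.
have p : Pi K i = diag_mx (const_mx 1 - rowE K [set i]).
  rewrite /Pi e linearB /=; congr (_ - _).
  by apply/matrixP => a b; rewrite !mxE.
by rewrite /blJ e p.
Qed.

Lemma blJE_mul (K : comPzRingType) i (E : {set 'I_g}) : i \notin E ->
  blJE K (i |: E) = blJE K [set i]%SET *m blJE K E.
Proof.
move=> iE; rewrite /blJE mulmx_block !mulNmx !mulmxN !mulmx_diag.
have d (j : 'I_g) : (j \in i |: E)%:R = (j \in [set i]%SET)%:R + (j \in E)%:R :> K.
  by rewrite in_setU1 !finset.in_set1; have [->|_] := eqVneq j i; rewrite ?(negbTE iE) /= ?addr0 ?add0r.
have m (j : 'I_g) : (j \in [set i]%SET)%:R * (j \in E)%:R = 0 :> K.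
  by rewrite finset.in_set1; have [->|_] := eqVneq j i; rewrite ?(negbTE iE) ?mulr0 ?mul0r.
congr block_mx.
- rewrite -linearB /=; congr diag_mx; apply/rowP => j; rewrite !mxE d; ring.
- rewrite -linearD /=; congr diag_mx; apply/rowP => j; rewrite !mxE d.
  move: (m j); move: (j \in [set i]%SET)%:R (j \in E)%:R => x y e.
  by transitivity (x + y - 2 * (x * y)); [rewrite e mulr0 subr0|ring].
- rewrite -!linearN -linearD /=; congr diag_mx; apply/rowP => j; rewrite !mxE d.
  move: (m j); move: (j \in [set i]%SET)%:R (j \in E)%:R => x y e.
  by transitivity (- (x + y) + 2 * (x * y)); [rewrite e mulr0 addr0|ring].
- rewrite -linearN -linearD /=; congr diag_mx; apply/rowP => j; rewrite !mxE d; ring.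
Qed.

Lemma good_1 : good 1%:M.
Proof.
have := @good_T 0; rewrite trmx0 => /(_ erefl); rewrite /blT map_mx0 -scalar_mx_block.
by [].
Qed.

Lemma good_JE (s : seq 'I_g) : uniq s -> good (blJE R [set j in s]).
Proof.
elim: s => [|i s IH] /=.
  move=> _; suff -> : blJE R [set j in [::]] = 1%:M by exact: good_1.
  have r0 : rowE R [set j in [::]] = 0 by apply/rowP => j; rewrite !mxE inE.
  rewrite /blJE r0 subr0 linear0 oppr0 (_ : diag_mx (const_mx 1) = 1%:M) -?scalar_mx_block//.
  by apply/matrixP => a b; rewrite !mxE.
move=> /andP[ns us]; rewrite set_cons blJE_mul ?inE// -blJ_diag.
exact: good_comp (IH us) (good_J i).
Qed.

Lemma good_Jmx : good (Jmx R g).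
Proof.
have := good_JE (enum_uniq 'I_g); suff -> : blJE R [set j in enum 'I_g] = Jmx R g by [].
have r1 : rowE R [set j in enum 'I_g] = const_mx 1 by apply/rowP => j; rewrite !mxE inE mem_enum.
have d1 : diag_mx (const_mx 1 : 'rV[R]_g) = 1%:M by apply/matrixP => a b; rewrite !mxE.
by rewrite /blJE r1 subrr linear0 d1.
Qed.
End good.
End Weil.

(** * Factorization of symplectic matrices *)

Section SymplecticRational.
Variable g : nat.

Lemma Jmx_sq (K : pzRingType) : Jmx K g *m Jmx K g = - 1%:M.
Proof.
rewrite /Jmx mulmx_block !(mul0mx, mulmx0, mul1mx, mulmx1, addr0, add0r).
by rewrite (scalar_mx_block _ _ 1) opp_block_mx oppr0.
Qed.

Definition Spinv (K : pzRingType) (M : 'M[K]_(g + g)) : 'M[K]_(g + g) :=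
  block_mx (drsubmx M)^T (- (ursubmx M)^T) (- (dlsubmx M)^T) (ulsubmx M)^T.

Lemma SpinvE (K : pzRingType) (M : 'M[K]_(g + g)) : - (Jmx K g *m M^T *m Jmx K g) = Spinv M.
Proof.
rewrite -[M in LHS]submxK tr_block_mx /Jmx !mulmx_block.
rewrite !(mul0mx, mulmx0, mul1mx, mulmx1, addr0, add0r, mulNmx, mulmxN).
by rewrite opp_block_mx !opprK.
Qed.

Lemma Sp_inv (K : comUnitRingType) (M : 'M[K]_(g + g)) : Sp M -> M *m Spinv M = 1%:M /\ Spinv M *m M = 1%:M.
Proof.
move=> h; have e : M *m Spinv M = 1%:M.
  by rewrite -SpinvE mulmxN !mulmxA h Jmx_sq opprK.
by split=> //; exact: mulmx1C.
Qed.

Lemma Sp_block (K : comUnitRingType) (M : 'M[K]_(g + g)) : Sp M ->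
  let A := ulsubmx M in let B := ursubmx M in let C := dlsubmx M in let D := drsubmx M in
  [/\ A^T *m C = C^T *m A, A^T *m D - C^T *m B = 1%:M & A *m B^T = B *m A^T].
Proof.
move=> /Sp_inv[]; rewrite -{1}[M]submxK /Spinv mulmx_block (scalar_mx_block _ _ 1).
move=> /eq_block_mx[_ e1 _ _]; rewrite -[X in _ *m X = _]submxK mulmx_block.
move=> /eq_block_mx[_ _ e2 e3]; split.
- by move: e2; rewrite mulNmx addrC => /subr0_eq.
- by rewrite -[RHS]e3 mulNmx addrC.
- by move: e1; rewrite mulmxN addrC => /subr0_eq.
Qed.

Lemma Sp_mul (K : comPzRingType) (M1 M2 : 'M[K]_(g + g)) : Sp M1 -> Sp M2 -> Sp (M1 *m M2).
Proof. by rewrite /Sp /= => h1 h2; rewrite trmx_mul !mulmxA -[M1 *m M2 *m _]mulmxA -[M1 *m _ *m M2^T]mulmxA h2 h1. Qed.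

Lemma Sp_Spinv (K : comUnitRingType) (M : 'M[K]_(g + g)) : Sp M -> Sp (Spinv M).
Proof.
move=> h; have [h1 h2] := Sp_inv h; rewrite /Sp /= -{1}h !mulmxA h2 mul1mx.
by rewrite -mulmxA -trmx_mul h2 trmx1 mulmx1.
Qed.

Lemma Sp_blT (K : comPzRingType) (B : 'M[K]_g) : B^T = B -> Sp (blT B).
Proof.
move=> sB; rewrite /Sp /= /blT /Jmx tr_block_mx sB trmx0 !trmx1 !mulmx_block.
rewrite !(mul0mx, mulmx0, mul1mx, mulmx1, addr0, add0r, mulNmx, mulmxN).
by rewrite addrC subrr.
Qed.

Lemma Sp_blU (K : fieldType) (U : 'M[K]_g) : U \in unitmx -> Sp (blU U).
Proof.
move=> uU; rewrite /Sp /= /blU /Jmx tr_block_mx trmxK !trmx0 !mulmx_block.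
rewrite !(mul0mx, mulmx0, mul1mx, mulmx1, addr0, add0r, mulNmx, mulmxN).
by rewrite oppr0 -trmx_mul mulmxV// trmx1.
Qed.

Lemma blU_mul (K : fieldType) (U V : 'M[K]_g) : U \in unitmx -> V \in unitmx ->
  blU U *m blU V = blU (U *m V).
Proof.
move=> uU uV; rewrite /blU !mulmx_block !(mul0mx, mulmx0, addr0, add0r) -trmx_mul.
congr (block_mx _ _ _ _^T); apply: (can_inj (mulKmx (_ : U *m V \in unitmx))).
  by rewrite unitmx_mul uU.
by rewrite mulmxV ?unitmx_mul ?uU// -mulmxA mulKVmx// mulmxV.
Qed.

(** Conjugation by J exchanges upper and lower unipotent matrices; the cube of J is its inverse, so
    that the lower one is a product of generators. *)
Lemma low_blT (K : comPzRingType) (X : 'M[K]_g) :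
  Jmx K g *m blT (- X) *m (Jmx K g *m Jmx K g *m Jmx K g) = block_mx 1%:M 0 X 1%:M.
Proof.
rewrite Jmx_sq mulNmx mul1mx mulmxN /blT /Jmx !mulmx_block.
rewrite !(mul0mx, mulmx0, mul1mx, mulmx1, addr0, add0r, mulNmx, mulmxN) opp_block_mx.
by rewrite !opprK oppr0.
Qed.

(** Block Gauss elimination; the symplectic relations make X and Z symmetric and determine the last
    diagonal block. *)
Lemma Sp_factor (K : fieldType) (M : 'M[K]_(g + g)) : Sp M -> ulsubmx M \in unitmx ->
  let A := ulsubmx M in let X := dlsubmx M *m invmx A in let Z := invmx A *m ursubmx M in
  [/\ X^T = X, Z^T = Z & M = block_mx 1%:M 0 X 1%:M *m blU A *m blT Z].
Proof.
move=> hM uA A X Z; have [e1 e2 e3] := Sp_block hM; rewrite -/A in e1 e2 e3.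
have uAT : A^T \in unitmx by rewrite unitmx_tr.
have XE : X = invmx A^T *m (dlsubmx M)^T.
  apply: (can_inj (mulKmx uAT)); rewrite mulKVmx// /X mulmxA e1 -mulmxA mulmxV//.
  by rewrite mulmx1.
have ZE : Z = (ursubmx M)^T *m invmx A^T.
  apply: (can_inj (mulmxK uAT)); rewrite mulmxKV// /Z -mulmxA -e3 mulKmx//.
split.
- by rewrite /X trmx_mul trmx_inv -XE.
- by rewrite /Z trmx_mul trmx_inv -ZE.
rewrite -[LHS]submxK /blU /blT !mulmx_block.
rewrite !(mul0mx, mulmx0, mul1mx, mulmx1, addr0, add0r) -/A.
congr block_mx.
- by rewrite /Z mulKVmx.
- by rewrite /X mulmxKV.
- rewrite /Z /X mulmxKV// mulmxA -/X XE trmx_inv.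
  apply: (can_inj (mulKmx uAT)); rewrite mulmxDr -[invmx A^T *m _ *m _]mulmxA mulKVmx// mulmxV//.
  by rewrite -e2 addrC subrK.
Qed.
End SymplecticRational.

(** * Theta series under rational symplectic matrices *)

Section GoodSp.
Variable R : realType.
Local Notation C := R[i].
Variable g : nat.

Lemma lf_self0 (w : 'cV[R]_g) : lf w w <= 0 -> w = 0.
Proof.
rewrite lfE => h; apply/matrixP => i j; rewrite ord1 mxE; apply/eqP.
have h0 k : 0 <= w k ord0 * w k ord0 by rewrite -expr2 sqr_ge0.
have : \sum_i w i ord0 * w i ord0 == 0 by rewrite eq_le h sumr_ge0.
rewrite psumr_eq0 => [/allP/(_ i)|//]; rewrite mem_index_enum => /(_ isT).
by rewrite mulf_eq0 orbb.
Qed.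

(* det(A + sB) is a polynomial in s that does not vanish at s = i. *)
Lemma exists_shift (A B : 'M[rat]_g) : A^T *m B = B^T *m A ->
  (forall v : 'cV[R]_g, map_mx ratr A *m v = 0 -> map_mx ratr B *m v = 0 -> v = 0) ->
  exists s : nat, A + s%:R *: B \in unitmx.
Proof.
move=> sAB inj; pose P : 'M[{poly rat}]_g := map_mx polyC A + 'X *: map_mx polyC B.
pose p := \det P.
have ev (s : rat) : p.[s] = \det (A + s *: B).
  rewrite -[p.[s]]/(horner_eval s p) -det_map_mx; congr (\det _); apply/matrixP => i j.
  by rewrite !mxE /= /horner_eval !hornerE.
case: (pselect (exists s : nat, p.[s%:R] != 0)) => [[s hs]|nex].
  by exists s; rewrite unitmxE unitfE -ev.
exfalso; have p0 : p = 0.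
  apply: (@roots_geq_poly_eq0 _ _ [seq (i%:R : rat) | i <- iota 0 (size p)]).
  - apply/allP => x /mapP[i _ ->]; rewrite rootE; apply: contraT => h.
    by case: nex; exists i.
  - by rewrite map_inj_uniq ?iota_uniq// => i j /eqP; rewrite eqr_nat => /eqP.
  - by rewrite size_map size_iota.
pose Ar : 'M[R]_g := map_mx ratr A; pose Br : 'M[R]_g := map_mx ratr B.
have d1 : \det (map_mx (map_poly (ratr : rat -> C)) P) = 0 by rewrite det_map_mx -/p p0 rmorph0.
have d2 : \det (map_mx (horner_eval ('i%C : C)) (map_mx (map_poly (ratr : rat -> C)) P)) = 0.
  by rewrite det_map_mx d1 rmorph0.
have QE : map_mx (horner_eval ('i%C : C)) (map_mx (map_poly (ratr : rat -> C)) P) = mxC Ar + 'i%C *: mxC Br.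
  apply/matrixP => i j; rewrite !mxE rmorphD rmorphM /= !map_polyC map_polyX /=.
  by rewrite /horner_eval hornerD hornerC hornerM hornerX hornerC -!(fmorph_rat (real_complex R)).
rewrite QE in d2.
have /det0P[v v0 hv] : \det (mxC Ar + 'i%C *: mxC Br)^T == 0 by rewrite det_tr d2.
have hw : (mxC Ar + 'i%C *: mxC Br) *m v^T = 0.
  by rewrite -[LHS]trmxK trmx_mul trmxK hv trmx0.
pose x : 'cV[R]_g := map_mx (@complex.Re R) v^T; pose y : 'cV[R]_g := map_mx (@complex.Im R) v^T.
(* A kernel vector x + iy of A + iB satisfies Ax = By and Bx = -Ay. By the symmetry of A^T B, both
   |Ax|^2 + |Bx|^2 and |Ay|^2 + |By|^2 vanish, so x = y = 0. *)
have e1 : Ar *m x = Br *m y.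
  apply/matrixP => i j; rewrite (ord1 j); have /matrixP/(_ i ord0)/(congr1 (@complex.Re R)) := hw.
  rewrite !mxE Re_sum => h; apply/eqP; rewrite -subr_eq0 -sumrB -[X in _ == X]h; apply/eqP/eq_bigr => k _.
  by rewrite !mxE ReM ReD ImD ReM ImM /=; ring.
have e2 : Br *m x = - (Ar *m y).
  apply/matrixP => i j; rewrite (ord1 j); have /matrixP/(_ i ord0)/(congr1 (@complex.Im R)) := hw.
  rewrite !mxE Im_sum => h; apply/eqP; rewrite -subr_eq0 opprK -big_split -[X in _ == X]h; apply/eqP/eq_bigr => k _.
  by rewrite !mxE ImM ReD ImD ReM ImM /=; ring.
have sABr : Ar^T *m Br = Br^T *m Ar by rewrite /Ar /Br !map_trmx -!map_mxM sAB.
have sw (a b : 'cV[R]_g) : lf (Ar *m a) (Br *m b) = lf (Br *m a) (Ar *m b).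
  by rewrite /lf !trmx_mul !mulmxA -[_ *m Ar^T *m _]mulmxA sABr !mulmxA.
have lfN (a b : 'cV[R]_g) : lf a (- b) = - lf a b by rewrite /lf mulmxN mxE.
have lf_ge (a : 'cV[R]_g) : 0 <= lf a a.
  by rewrite lfE sumr_ge0// => k _; rewrite -expr2 sqr_ge0.
have zero (a : 'cV[R]_g) : lf (Ar *m a) (Ar *m a) + lf (Br *m a) (Br *m a) = 0 -> a = 0.
  move=> h; have hA := lf_ge (Ar *m a); have hB := lf_ge (Br *m a).
  by apply: inj; apply: lf_self0; lra.
have x0 : x = 0.
  apply: zero; rewrite {2}e1 {2}e2 lfN sw.
  by rewrite subrr.
have y0 : y = 0.
  apply: zero; have -> : lf (Ar *m y) (Ar *m y) = - lf (Ar *m y) (Br *m x).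
    by rewrite e2 lfN opprK.
  by rewrite -{2}e1 sw addrC subrr.
case/eqP: v0; apply/matrixP => i j; rewrite ord1 [RHS]mxE.
apply: complex_ext.
  by have /matrixP/(_ j ord0) := x0; rewrite !mxE.
by have /matrixP/(_ j ord0) := y0; rewrite !mxE.
Qed.

Lemma map_blT (B : 'M[rat]_g) : map_mx (@ratr R) (blT B) = blT (map_mx ratr B).
Proof. by rewrite /blT map_block_mx map_mx0 !map_mx1. Qed.
Lemma map_blU (U : 'M[rat]_g) : map_mx (@ratr R) (blU U) = blU (map_mx ratr U).
Proof. by rewrite /blU map_block_mx !map_mx0 -map_trmx map_invmx. Qed.
Lemma map_Jmx : map_mx (@ratr R) (Jmx rat g) = Jmx R g.
Proof. by rewrite /Jmx map_block_mx !map_mx0 map_mxN !map_mx1. Qed.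

(** When the upper left block A is invertible, Gauss elimination gives a product of generators. In
    general a translation by an integer scalar s replaces A by A + sC, which is invertible for some
    s by [exists_shift]. *)
Theorem good_Sp (M : 'M[rat]_(g + g)) : Sp M -> good (map_mx (@ratr R) M).
Proof.
have first (N : 'M[rat]_(g + g)) : Sp N -> ulsubmx N \in unitmx -> good (map_mx (@ratr R) N).
  move=> hN uA; have [sX sZ ->] := Sp_factor hN uA.
  rewrite !map_mxM -low_blT !map_mxM map_Jmx !map_blT map_blU.
  have gJ := @good_Jmx R g.
  apply: good_comp; first exact: good_T.
  apply: good_comp; first exact: good_U.
  apply: good_comp; first exact: good_comp gJ (good_comp gJ gJ).
  apply: good_comp gJ.
  by apply: good_T; rewrite raddfN /= sX.
move=> hM; have [e1 e2 _] := Sp_block hM.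
have [v hA hB|s hs] := @exists_shift (ulsubmx M) (dlsubmx M) e1.
  have e3 : (map_mx (@ratr R) (ulsubmx M)^T) *m map_mx ratr (drsubmx M) -
     (map_mx (@ratr R) (dlsubmx M)^T) *m map_mx ratr (ursubmx M) = 1%:M.
    by rewrite -!map_mxM -map_mxB e2 map_mx1.
  rewrite -[v]mul1mx -trmx1 -e3 raddfB /= !trmx_mul -!map_trmx !trmxK mulmxBl -!mulmxA hA hB.
  by rewrite !mulmx0 subrr.
have sS (c : rat) : (c%:M : 'M[rat]_g)^T = c%:M by rewrite tr_scalar_mx.
pose M1 := blT (s%:R%:M) *m M.
have hM1 : Sp M1 by apply: Sp_mul hM; apply: Sp_blT.
have ul : ulsubmx M1 = ulsubmx M + s%:R *: dlsubmx M.
  by rewrite /M1 /blT -{1}[M]submxK mulmx_block block_mxKul mul1mx mul_scalar_mx.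
have -> : M = blT (- s%:R)%:M *m M1.
  rewrite /M1 mulmxA; have -> : blT (- s%:R)%:M *m blT (s%:R%:M) = 1%:M :> 'M[rat]_(g + g).
    rewrite /blT mulmx_block !(mul0mx, mulmx0, mul1mx, mulmx1, addr0, add0r).
    by rewrite -raddfD /= subrr raddf0 -scalar_mx_block.
  by rewrite mul1mx.
rewrite map_mxM; apply: good_comp; first by apply: first; rewrite ?ul.
by rewrite map_blT; apply: good_T.
Qed.

(** [good] at level 1 provides, for every z, a solution w of (C tau + D)^T w = z; applied to the
    basis vectors this is a right inverse. *)
Lemma good_unit (M : 'M[R]_(g + g)) tau : good M -> siegel_space tau ->
  mxC (dlsubmx M) *m tau + mxC (drsubmx M) \in unitmx.
Proof.
move=> gM ht; have [L' [T [_ [_ h]]]] := gM 1%N isT.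
set Q := _ + _.
have ex (j : 'I_g) : exists w : 'cV[C]_g, Q^T *m w = delta_mx j ord0.
  by have [u' [k [_ _ [_ hr] _]]] := h (delta_mx j ord0, tau) ht; exists u'.1.
have [w hw] := choice ex.
have e : Q^T *m (\matrix_(i, j) w j i ord0) = 1%:M.
  apply/matrixP => i j; have /matrixP/(_ i ord0) := hw j.
  rewrite !mxE eqxx andbT => <-.
  by apply: eq_bigr => k _; congr (_ * _); rewrite mxE.
by have [] := mulmx1_unit e; rewrite unitmx_tr.
Qed.

Lemma relM1 (u u' : 'cV[C]_g * 'M[C]_g) : relM 1%:M u u' -> u' = u.
Proof.
rewrite /relM (scalar_mx_block _ _ 1) !(block_mxKul, block_mxKur, block_mxKdl, block_mxKdr).
rewrite !mxC1 !mxC0 mul0mx add0r addr0 trmx1 mulmx1 !mul1mx.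
by case: u u' => [z t] [z' t'] /= [-> ->].
Qed.

Lemma relM_unique (M : 'M[R]_(g + g)) (u u' u'' : 'cV[C]_g * 'M[C]_g) :
  good M -> siegel_space u.2 -> relM M u u' -> relM M u u'' -> u' = u''.
Proof.
move=> gM hu [h1 h2] [h3 h4]; have uQ := good_unit gM hu.
have e1 : u'.2 = u''.2 by apply: (can_inj (mulmxK uQ)); rewrite h1 h3.
have e2 : u'.1 = u''.1.
  by rewrite -unitmx_tr in uQ; apply: (can_inj (mulKmx uQ)); rewrite h2 h4.
by case: u' u'' e1 e2 {h1 h2 h3 h4} => [? ?] [? ?] /= -> ->.
Qed.
End GoodSp.

(** * No common zero *)
Section Nonvanishing.
Variable R : realType.
Local Notation C := R[i].

(** For small positive s the first nonzero term dominates the others, whose sum is at most s^(m0+1)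
    M. *)
Lemma first_coef (A : nat -> C) (M : R) : fbound (fun m => nrm (A m)) M ->
  (exists s : R, sumC (fun m => A m * s%:C ^+ m) != 0) ->
  exists2 dl : R, 0 < dl & forall s : R, 0 < s < dl -> sumC (fun m => A m * s%:C ^+ m) != 0.
Proof.
move=> hM [s0 hs0]; have M0 := fbound_ge0 hM.
have ex : exists m, A m != 0.
  apply: contrapT => nex; case/eqP: hs0; rewrite -[RHS](@sumC0 R nat).
  apply: eq_sumC => m; have [->|h] := eqVneq (A m) 0; first by rewrite mul0r.
  by case: nex; exists m.
case: (ex_minnP ex) => m0 Am0 hmin; have A0 : 0 < nrm (A m0) by rewrite nrm_gt0.
have M1 : 0 < M + 1 by lra.
exists (Num.min 1 (nrm (A m0) / (M + 1))).
  by rewrite lt_min ltr01 divr_gt0.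
move=> s /andP[s0'] ; rewrite lt_min => /andP[s1 s2]; apply/eqP => h0.
have ns : nrm (s%:C : C) = s by rewrite nrm_real gtr0_norm.
pose f (m : nat) : C := A m * s%:C ^+ m.
pose f1 m : C := if m == m0 then f m else 0.
pose f2 m : C := if m == m0 then 0 else f m.
have af2b m : nrm (f2 m) <= s ^+ m0.+1 * nrm (A m).
  rewrite /f2; have [->|mn] := eqVneq m m0; first by rewrite nrm0 mulr_ge0 ?nrm_ge0 ?exprn_ge0 ?ltW.
  have [hA|/hmin hm] := eqVneq (A m) 0.
    by rewrite /f hA mul0r nrm0 mulr0.
  rewrite /f nrmM nrmX ns mulrC ler_wpM2r ?nrm_ge0//.
  by rewrite ler_wiXn2l ?ltW// ltn_neqAle eq_sym mn.
have bf2 : fbound (fun m => s ^+ m0.+1 * nrm (A m)) (s ^+ m0.+1 * M).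
  by apply: fboundZ => //; rewrite exprn_ge0 ?ltW.
have af2 : asum f2 by exists (s ^+ m0.+1 * M); exact: fboundW bf2.
have f1n m : m \notin [:: m0] -> f1 m = 0 by rewrite inE /f1 => /negbTE ->.
have af1 : asum f1 := @asum_finite R _ [:: m0] f1 isT f1n.
have e : sumC f = f m0 + sumC f2.
  rewrite -[f m0]/(f m0) (_ : f m0 = sumC f1); last first.
    by rewrite (@sumC_finite R _ [:: m0] f1 isT f1n) big_seq1 /f1 eqxx.
  rewrite -sumCD//; apply: eq_sumC => m; rewrite /f1 /f2.
  by case: eqP; rewrite ?addr0 ?add0r.
have e2 : f m0 = - sumC f2 by apply/eqP; rewrite -addr_eq0 -e; apply/eqP; exact: h0.
have : nrm (f m0) <= s ^+ m0.+1 * M by rewrite e2 nrmN; exact: nrm_sumC_le bf2.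
rewrite /f nrmM nrmX ns exprS mulrC -mulrA mulrCA ler_pM2l ?exprn_gt0// => h.
have : s * (M + 1) < nrm (A m0) by rewrite -ltr_pdivlMr.
by move: h; rewrite mulrDr mulr1 => h; lra.
Qed.

Variable g : nat.

Lemma theta_tterm z (tau : 'M[C]_g) : theta z tau = sumC (fun n => tterm tau z (map_mx intr n)).
Proof. by apply: eq_sumC => n; rewrite /tterm mxC_int. Qed.

Lemma expR_4 (x y : R) : expR (`|x| + `|y|) <=
  expR (x + y) + expR (x - y) + (expR (- x + y) + expR (- x - y)).
Proof.
have h1 := expR_ge0 (x + y); have h2 := expR_ge0 (x - y).
have h3 := expR_ge0 (- x + y); have h4 := expR_ge0 (- x - y).
by case: (ger0P x); case: (ger0P y) => _ _; lra.
Qed.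

(** Expansion of each exponential in powers of s gives a double series. Its absolute convergence
    needs the sum of |c_n| exp(|W_n|), which is controlled by the theta series at four complex
    points of the line. *)
Lemma theta_line (sg : 'M[C]_g) (w v : 'cV[C]_g) : siegel_space sg ->
  exists (A : nat -> C) (M : R), fbound (fun m => nrm (A m)) M /\
    forall s : R, 0 <= s <= 1 -> theta (w + s%:C *: v) sg = sumC (fun m => A m * s%:C ^+ m).
Proof.
move=> hsg; pose kk (n : 'cV[int]_g) : 'cV[R]_g := map_mx intr n.
pose c n : C := tterm sg w (kk n).
pose W n : C := (0 +i* pi) * (2 * lf (mxC (kk n)) v).
have tE (al : C) n : tterm sg (w + al *: v) (kk n) = c n * cexp (al * W n).
  rewrite /tterm lfDr lfZr /c /tterm mulrDr addrA epiD; congr (_ * _).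
  by rewrite /epi /W; congr cexp; ring.
pose F (p : 'cV[int]_g * nat) : C := c p.1 * ecoef (W p.1) p.2.
have rs : rsum (fun n => nrm (c n) * expR (nrm (W n))).
  have at_ (al : C) : rsum (fun n => nrm (c n) * expR (complex.Re (al * W n))).
    have [M hM] := theta_term_asum (w + al *: v) hsg; exists M; apply: fboundW hM => n.
    rewrite ger0_norm ?mulr_ge0 ?nrm_ge0 ?expR_ge0// -nrm_cexp -(nrmM (c n)) -tE.
    exact: lexx.
  (* The multipliers 1-i, 1+i, -1-i and -1+i give the real parts x+y, x-y, -x+y and -x-y of
     [expR_4]. *)
  have rs4 := rsumD (rsumD (at_ (1 +i* -1)) (at_ (1 +i* 1))) (rsumD (at_ (-1 +i* -1)) (at_ (-1 +i* 1))).
  apply: (rsumW _ rs4) => n; have c0 := nrm_ge0 (c n).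
  move: (nrm (c n)) (W n) c0 => cn Wn c0.
  have e4 := expR_4 (complex.Re Wn) (complex.Im Wn).
  have e5 : expR (nrm Wn) <= expR (`|complex.Re Wn| + `|complex.Im Wn|).
    by rewrite ler_expR nrm_le_ReIm.
  rewrite !ReM /= !(mul1r, mulN1r, opprK) -!mulrDr !normrM (ger0_norm c0) ler_wpM2l//.
  rewrite !ger0_norm ?addr_ge0 ?expR_ge0//; apply: (le_trans e5); lra.
have [M hM] := rs.
have aF : asum F.
  exists M; apply: fbound_pair => [p|n|]; first exact: nrm_ge0.
    exists (nrm (c n) * expR (nrm (W n))).
    apply: fboundW (fboundZ (nrm_ge0 (c n)) (fbound_exp (nrm_ge0 (W n)))) => m.
    by rewrite /F nrmM nrm_ecoef.
  apply: fboundW hM => n; rewrite ger0_norm ?mulr_ge0 ?nrm_ge0 ?expR_ge0//.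
  apply: tsum_le => [m|]; first exact: nrm_ge0.
  apply: fboundW (fboundZ (nrm_ge0 (c n)) (fbound_exp (nrm_ge0 (W n)))) => m.
  by rewrite /F nrmM nrm_ecoef.
pose A m : C := sumC (fun n => F (n, m)).
have sw : injective (fun p : nat * 'cV[int]_g => (p.2, p.1)) by move=> [? ?] [? ?] [-> ->].
have aFs : asum (fun p : nat * 'cV[int]_g => F (p.2, p.1)) := asum_inj sw aF.
have [M' hM'] := asum_outer aFs.
exists A, M'; split; first exact: hM'.
move=> s /andP[s0 s1]; rewrite theta_tterm.
have eC (al : C) n : tterm sg (w + al *: v) (kk n) = sumC (fun m => c n * ecoef (al * W n) m).
  by rewrite tE -sum_ecoef -sumCZ//; exact: asum_ecoef.
rewrite (eq_sumC (eC s%:C)) sumC_swap; last first.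
  apply: asumWC aF => p; rewrite /F !(nrmM (c _)) !nrm_ecoef ler_wpM2l ?nrm_ge0// ler_wpM2r ?invr_ge0 ?ler0n//.
  rewrite nrmM exprMn nrm_real ger0_norm// -[leRHS]mul1r ler_wpM2r ?exprn_ge0 ?nrm_ge0//.
  by rewrite exprn_ile1.
apply: eq_sumC => m; rewrite mulrC -sumCZ; last exact: (asum_slice m aFs).
apply: eq_sumC => n; rewrite /F /= /ecoef exprMn; ring.
Qed.

(** Otherwise [fourier0] on real z would annihilate the constant coefficient, which is an
    exponential. *)
Lemma theta_neq0 (sg : 'M[C]_g) : siegel_space sg -> exists w, theta w sg != 0.
Proof.
move=> hs; apply: contrapT => nex.
have h : (tterm sg 0 (map_mx intr (0 : 'cV[int]_g)) : C) = 0.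
  apply: (@fourier0 R g (fun n => tterm sg 0 (map_mx intr n))); first exact: theta_term_asum.
  move=> x; apply: contrapT => hx; apply: nex.
  exists (\col_i (x i)%:C); apply/eqP; rewrite theta_tterm => h; apply: hx.
  rewrite -[RHS]h; apply: eq_sumC => n; rewrite /tterm -epiD; congr epi.
  rewrite -addrA; congr (_ + _); rewrite -mulrDr; congr (2 * _).
  rewrite {1}/lf mulmx0 mxE add0r lfE; apply: eq_bigr => i _; rewrite !mxE rmorph_int.
  by [].
move: h; rewrite /tterm map_mx0 => /eqP; apply/negP; exact: epi_neq0.
Qed.

Lemma siegel_scale (c : R) (sg : 'M[C]_g) : 0 < c -> siegel_space sg -> siegel_space (c%:C *: sg).
Proof.
move=> c0 [s1 [s2 s3]]; split; first by rewrite /symmetric_mx linearZ /= s1.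
have e : map_mx (@complex.Im R) (c%:C *: sg) = c *: map_mx (@complex.Im R) sg.
  by apply/matrixP => i j; rewrite !mxE ImM /= mul0r addr0.
rewrite e; split; first by rewrite /symmetric_mx linearZ /= s2.
by move=> x x0; rewrite -scalemxAr -scalemxAl mxE mulr_gt0// s3.
Qed.

Lemma Theta_ind (c : 'cV[R]_g) z tau : Theta (ind c) (z, tau) =
  sumC (fun n : 'cV[int]_g => tterm tau z (c + map_mx intr n)).
Proof.
rewrite /Theta (@sumC_inj _ _ _ (fun n : 'cV[int]_g => c + map_mx intr n)); last 2 first.
- by move=> n n' /addrI/matrixP h; apply/matrixP => i j; have := h i j; rewrite !mxE => /intr_inj.
- move=> k; rewrite /ind; case: asboolP => [[n hn] _|]; last by rewrite mul0r eqxx.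
  by exists n; rewrite -hn addrC subrK.
apply: eq_sumC => n; rewrite /ind; case: asboolP => [_|[]]; last first.
  by rewrite addrAC subrr add0r; exists n.
by rewrite mul1r.
Qed.

Lemma qf_scale (K : comPzRingType) c (A : 'M[K]_g) v : qf (c *: A) v = c * qf A v.
Proof. by rewrite /qf -scalemxAr -scalemxAl mxE. Qed.

(* Substituting p = q + l decouples the quadratic forms, the q-sum becoming a
   theta series with characteristic l/n. *)
Lemma theta_product (N : nat) (sg : 'M[C]_g) (x a : 'cV[C]_g) : (0 < N)%N -> siegel_space sg ->
  (forall l : 'cV[int]_g, Theta (ind (N.+1%:R^-1 *: map_mx intr l)) (N.+1%:R *: x, N.+1%:R *: sg) = 0) ->
  theta (x + N%:R *: a) sg * theta (N%:R *: (x - a)) (N%:R *: sg) = 0.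
Proof.
move=> N0 hs h0; have sT : sg^T = sg by case: hs.
have hs' : siegel_space (N%:R *: sg) by rewrite natC; apply: siegel_scale => //; rewrite ltr0n.
have a1 := theta_term_asum (x + N%:R *: a) hs.
have a2 := theta_term_asum (N%:R *: (x - a)) hs'.
rewrite !theta_tterm (sumC_mul a1 a2).
pose phi (p : 'cV[int]_g * 'cV[int]_g) := (p.2 + p.1, p.2).
have inj : injective phi by move=> [l q] [l' q'] [] /[swap] -> /addrI ->.
rewrite (@sumC_inj _ _ _ phi)//; last first.
  by move=> [p q] _; exists (p - q, q); rewrite /phi /= addrC subrK.
rewrite sumC_pair; last exact: (asum_inj inj (asum_mul a1 a2)).
rewrite -[RHS](@sumC0 R 'cV[int]_g); apply: eq_sumC => l.
set n : C := N.+1%:R; have n0 : n != 0 by rewrite pnatr_eq0.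
have nE : n = N%:R + 1 by rewrite /n -natr1.
pose ll : 'cV[R]_g := map_mx intr l.
pose el : C := epi (N%:R / n * qf sg (mxC ll) + 2 * (N%:R * lf (mxC ll) a)).
have aq : asum (fun q : 'cV[int]_g => tterm (n *: sg) (n *: x) (N.+1%:R^-1 *: ll + map_mx intr q)).
  have hsn : siegel_space (n *: sg) by rewrite /n natC; apply: siegel_scale => //; rewrite ltr0n.
  have sbl : SB N.+1 (ind (N.+1%:R^-1 *: ll)).
    by apply: SB_ind => //; exists l; rewrite scalerA mulfV ?scale1r// pnatr_eq0.
  have [B hB] := @asum_Theta R g N.+1 _ (n *: x, n *: sg) isT sbl hsn.
  exists B => s us.
  have := hB [seq N.+1%:R^-1 *: ll + map_mx intr q | q <- s].
  rewrite map_inj_uniq; last first.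
    by move=> q q' /addrI/matrixP h; apply/matrixP => i j; have := h i j; rewrite !mxE => /intr_inj.
  move=> /(_ us); rewrite big_map; apply: le_trans; apply: ler_sum => q _ /=.
  rewrite /ind; case: asboolP => [_|[]]; first by rewrite mul1r.
  by exists q; rewrite addrAC subrr add0r.
have hz : sumC (fun q : 'cV[int]_g => tterm (n *: sg) (n *: x) (N.+1%:R^-1 *: ll + map_mx intr q)) = 0.
  by rewrite -Theta_ind; exact: h0.
rewrite -[RHS](mulr0 el) -[X in _ = _ * X]hz -(sumCZ el aq).
apply: eq_sumC => q; rewrite /phi /= /tterm /el -!epiD; congr epi.
have rq : (map_mx intr (q + l) : 'cV[R]_g) = map_mx intr q + ll.
  by apply/matrixP => i j; rewrite !mxE intrD.
rewrite rq !mxCD mxCZ fmorphV rmorph_nat -/n.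
set Q := mxC (map_mx intr q); set L := mxC ll.
have snT : (n *: sg)^T = n *: sg by rewrite linearZ /= sT.
rewrite !qfD// !qf_scale qfZ !(lfD, lfDr, lfZr, lfZl) -!scalemxAl !lfZr.
rewrite [lf L (sg *m Q)](lf_sym _ _ sT) -scaleN1r lfZr.
rewrite nE; have n1 : N%:R + 1 != 0 :> C by rewrite -nE.
by field.
Qed.
End Nonvanishing.

(** * The map to projective space is well defined *)

Section NonvanishingChar.
Variable R : realType.
Local Notation C := R[i].

Lemma Dmx_unit n (d : 'I_n -> nat) : polarization_type d -> Dmx R d \in unitmx.
Proof.
move=> [dp _]; rewrite unitmxE unitfE /Dmx det_diag; apply/prodf_neq0 => i _.
by rewrite mxE pnatr_eq0 -lt0n.
Qed.

(** With n = d_1, all l/n lie in D^-1 Z^g because d_1 divides every d_i; a common zero would make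
    the product of [theta_product] vanish for all a. On a suitable segment of values of a each
    factor is a nonzero power series, so neither vanishes for small positive parameters. *)
Lemma some_theta_neq0 (g : nat) (d : 'I_g.+1 -> nat) (N : nat) (c : 'I_N.+1 -> 'cV[R]_g.+1)
    (z : 'cV[C]_g.+1) (tau : 'M[C]_g.+1) :
  polarization_type d -> char_reps d c -> (2 <= d ord0)%N -> siegel_space tau ->
  exists i, theta_char (c i) 0 z tau != 0.
Proof.
move=> hd [_ hc] d2 ht; apply: contrapT => nex.
have all0 i : theta_char (c i) 0 z tau = 0.
  by apply: contrapT => /eqP h; apply: nex; exists i.
have [K K0 nE] : exists2 K, (0 < K)%N & d ord0 = K.+1 by case: (d ord0) d2 => [//|[//|K]] _; exists K.+1.
have n0 : (K.+1%:R : C) != 0 by rewrite pnatr_eq0.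
have n0R : (K.+1%:R : R) != 0 by rewrite pnatr_eq0.
pose sg := (K.+1%:R^-1 : C) *: tau; pose x := (K.+1%:R^-1 : C) *: z.
have hs : siegel_space sg.
  by rewrite /sg natC -fmorphV; apply: siegel_scale => //; rewrite invr_gt0 ltr0n.
have hs' : siegel_space (K%:R *: sg) by rewrite natC; apply: siegel_scale => //; rewrite ltr0n.
have zE : K.+1%:R *: x = z by rewrite /x scalerA mulfV ?scale1r.
have tE : K.+1%:R *: sg = tau by rewrite /sg scalerA mulfV ?scale1r.
have vanish (l : 'cV[int]_g.+1) : Theta (ind (K.+1%:R^-1 *: map_mx intr l)) (K.+1%:R *: x, K.+1%:R *: sg) = 0.
  rewrite zE tE; set y := _ *: _.
  have [] := hc y.
    exists (\col_i ((d i %/ K.+1)%N%:Z * l i ord0)) => //.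
    apply: (can_inj (mulKmx (Dmx_unit hd))); rewrite mulKVmx ?Dmx_unit//.
    apply/matrixP => i j; rewrite /Dmx mul_diag_mx !mxE ord1 intrM.
    have /dvdnP[q hq] : (K.+1 %| d i)%N by rewrite -nE; apply: hd.2.
    rewrite hq mulnK// -[q%:~R]/(q%:R) natrM -mulrA.
    by rewrite mulVKf// [j]ord1.
  move=> i [[k hk] _]; rewrite -[RHS](all0 i) theta_char_Theta//; apply: eq_sumC => v.
  congr (_ * _); rewrite /ind; congr (if _ then _ else _); apply/asboolP/asboolP => h.
    by rewrite -[v](subrK y) -addrA; apply: intvD => //; exists k.
  have -> : v - y = (v - c i) - (y - c i) by rewrite opprB addrA subrK.
  by apply: intvD => //; apply: intvN; exists k.
have prod0 a := theta_product a K0 hs vanish.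
have [w1 h1] := theta_neq0 hs; have [w2 h2] := theta_neq0 hs'.
have K0C : (K%:R : C) != 0 by rewrite pnatr_eq0 -lt0n.
(* [a1] turns the first factor into theta at w1, [a2] the second one into theta at w2; so each
   factor is nonzero at one end of the segment. *)
pose a1 := (K%:R^-1 : C) *: (w1 - x); pose a2 := x - (K%:R^-1 : C) *: w2.
pose v := (K%:R : C) *: (a2 - a1).
have e1 (s : R) : x + K%:R *: (a1 + s%:C *: (a2 - a1)) = w1 + s%:C *: v.
  rewrite scalerDr /a1 scalerA mulfV// scale1r addrA -/a1 [x + _]addrC subrK; congr (_ + _).
  by rewrite /v !scalerA mulrC.
pose w3 := K%:R *: (x - a1).
have e2 (s : R) : K%:R *: (x - (a1 + s%:C *: (a2 - a1))) = w3 + s%:C *: (- v).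
  rewrite opprD addrA scalerDr /w3; congr (_ + _).
  by rewrite /v !scalerN !scalerA mulrC.
have e3 : w3 + 1%:C *: (- v) = w2.
  rewrite /w3 /v scale1r -[- (K%:R *: _)]scalerN -scalerDr /a2.
  have -> : x - a1 - (x - K%:R^-1 *: w2 - a1) = K%:R^-1 *: w2.
    by apply/matrixP => i j; rewrite !mxE; ring.
  by rewrite scalerA mulfV// scale1r.
have [A1 [M1 [b1 f1]]] := theta_line w1 v hs.
have [A2 [M2 [b2 f2]]] := theta_line w3 (- v) hs'.
have [|dl1 dl10 hd1] := first_coef b1.
  by exists 0; rewrite -f1 ?lexx ?ler01// scale0r addr0.
have [|dl2 dl20 hd2] := first_coef b2.
  by exists 1; rewrite -f2 ?lexx ?ler01// e3.
pose s : R := Num.min 1 (Num.min dl1 dl2) / 2.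
have m0 : 0 < Num.min 1 (Num.min dl1 dl2) by rewrite !lt_min ltr01 dl10 dl20.
have [m1 [m2 m3]] : Num.min 1 (Num.min dl1 dl2) <= 1 /\ Num.min 1 (Num.min dl1 dl2) <= dl1 /\
    Num.min 1 (Num.min dl1 dl2) <= dl2.
  by rewrite !ge_min !lexx !orbT.
have s0 : 0 < s by rewrite /s divr_gt0.
have s1 : 0 <= s <= 1 by rewrite (ltW s0) /s; lra.
have := prod0 (a1 + s%:C *: (a2 - a1)); rewrite e1 e2 f1// f2// => /eqP.
rewrite mulf_eq0 => /orP[]; apply/negP; [apply: hd1|apply: hd2]; rewrite s0 /s; lra.
Qed.
End NonvanishingChar.

(** * Reduction theory *)
Section Minkowski.
Variable R : realType.
Local Notation C := R[i].
Variable g' : nat.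
Local Notation g := g'.+1.
Implicit Types (Y : 'M[R]_g) (v w : 'cV[R]_g).

Definition bl Y v w : R := lf v (Y *m w).

Lemma blDl Y v v' w : bl Y (v + v') w = bl Y v w + bl Y v' w.
Proof. exact: lfD. Qed.
Lemma blDr Y v w w' : bl Y v (w + w') = bl Y v w + bl Y v w'.
Proof. by rewrite /bl mulmxDr lfDr. Qed.
Lemma blZl Y c v w : bl Y (c *: v) w = c * bl Y v w.
Proof. exact: lfZl. Qed.
Lemma blZr Y c v w : bl Y v (c *: w) = c * bl Y v w.
Proof. by rewrite /bl -scalemxAr lfZr. Qed.
Lemma blC Y v w : Y^T = Y -> bl Y v w = bl Y w v.
Proof. by move=> sY; rewrite /bl (lf_sym _ _ sY). Qed.
Lemma bl_suml Y (I : Type) (s : seq I) (P : pred I) (f : I -> 'cV[R]_g) w :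
  bl Y (\sum_(i <- s | P i) f i) w = \sum_(i <- s | P i) bl Y (f i) w.
Proof.
apply: (big_morph (fun v => bl Y v w)) => [x y|]; first exact: blDl.
by rewrite -(scale0r (0 : 'cV[R]_g)) blZl mul0r.
Qed.
Lemma blE Y v w : bl Y v w = \sum_i \sum_j v i ord0 * Y i j * w j ord0.
Proof.
rewrite /bl lfE; apply: eq_bigr => i _; rewrite mxE mulr_sumr; apply: eq_bigr => j _.
by rewrite mulrA.
Qed.
Lemma bl_ei Y i w : bl Y (ei R i) w = (Y *m w) i ord0.
Proof. exact: lf_ei. Qed.
Lemma bl_ee Y i j : bl Y (ei R i) (ei R j) = Y i j.
Proof. by rewrite bl_ei /ei -colE mxE. Qed.
Lemma qf_bl Y v : qf Y v = bl Y v v. Proof. exact: qf_lf. Qed.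
Lemma qf_bl2 Y v w : Y^T = Y -> qf Y (v + w) = qf Y v + qf Y w + 2 * bl Y v w.
Proof. exact: qfD. Qed.

Lemma qf_add2 Y v w : posdef Y -> qf Y (v + w) <= 2 * qf Y v + 2 * qf Y w.
Proof.
move=> pY; have [sY _] := pY; have := posdef_ge0 (v + (-1) *: w) pY.
rewrite !qf_bl2// qfZ blZr sqrrN expr1n mul1r => h; lra.
Qed.

(** Positivity in the plane of e_i and e_j bounds each cross term by the mean of the two diagonal
    ones. *)
Lemma qf_diag Y v : posdef Y -> qf Y v <= g%:R * \sum_i v i ord0 ^+ 2 * Y i i.
Proof.
move=> pY; have [sY _] := pY.
have h i j : v i ord0 * Y i j * v j ord0 <= (v i ord0 ^+ 2 * Y i i + v j ord0 ^+ 2 * Y j j) / 2.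
  have := posdef_ge0 (v i ord0 *: ei R i + (- v j ord0) *: ei R j) pY.
  rewrite qf_bl2// !qfZ !qf_bl blZl blZr !bl_ee sqrrN => H; rewrite ler_pdivlMr//.
  by move: H; move: (Y i i) (Y j j) (Y i j) (v i ord0) (v j ord0) => a b c x y; lra.
rewrite qf_bl blE; apply: (le_trans (ler_sum _ (fun i _ => ler_sum _ (fun j _ => h i j)))).
rewrite (eq_bigr (fun i => g%:R * (v i ord0 ^+ 2 * Y i i) / 2 + (\sum_j v j ord0 ^+ 2 * Y j j) / 2)); last first.
  move=> i _; rewrite -mulr_suml -mulrDl big_split /= sumr_const card_ord -[_ *+ g]mulr_natl.
  by [].
rewrite big_split /= sumr_const card_ord -[_ *+ g]mulr_natl -mulr_suml -mulr_sumr.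
by rewrite le_eqVlt; apply/orP; left; apply/eqP; field.
Qed.

Lemma gcd_big1 (k l : 'I_g) (a : 'cV[int]_g) : (k <= l)%N -> `|a l ord0|%N = 1%N ->
  \big[gcdn/0%N]_(j < g | (k <= j)%N) `|a j ord0|%N = 1%N.
Proof. by move=> kl al; rewrite (bigD1 l)//= al gcd1n. Qed.

Lemma map_delta (i : 'I_g) : map_mx intr (delta_mx i ord0 : 'cV[int]_g) = ei R i.
Proof. by apply/matrixP => a b; rewrite !mxE; case: andb. Qed.

(** * Inequalities for Minkowski reduced forms *)

Section reduced.
Variable Y : 'M[R]_g.
Hypothesis rY : minkowski_reduced Y.
Lemma red_pd : posdef Y. Proof. by case: rY. Qed.
Lemma red_sym : Y^T = Y. Proof. by case: red_pd. Qed.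
Lemma redS i j : Y i j = Y j i. Proof. by rewrite -{1}red_sym mxE. Qed.
Lemma red_min (k : 'I_g) (a : 'cV[int]_g) :
  \big[gcdn/0%N]_(j < g | (k <= j)%N) `|a j ord0|%N = 1%N -> Y k k <= qf Y (map_mx intr a).
Proof. by case: rY => _ h _; exact: h. Qed.
Lemma red_gt0 i : 0 < Y i i.
Proof.
have [_ /(_ (ei R i))] := red_pd; rewrite -/(qf _ _) qf_bl bl_ee; apply.
by apply/eqP => /matrixP/(_ i ord0); rewrite !mxE !eqxx => /eqP; rewrite oner_eq0.
Qed.
Lemma red_mono (k l : 'I_g) : (k <= l)%N -> Y k k <= Y l l.
Proof.
move=> kl; have := @red_min k (delta_mx l ord0).
rewrite (gcd_big1 kl) ?mxE ?eqxx// => /(_ erefl); rewrite map_delta qf_bl bl_ee.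
by [].
Qed.
(** The test vectors are e_j + e_i and e_j - e_i. *)
Lemma red_off (i j : 'I_g) : (i < j)%N -> `|Y i j| <= Y i i.
Proof.
move=> ij; have ji : (j == i) = false by apply/eqP => e; rewrite e ltnn in ij.
have h (e : int) : `|e|%N = 1%N -> Y j j <= Y j j + e%:~R ^+ 2 * Y i i + 2 * (e%:~R * Y i j).
  move=> e1; have := @red_min j (delta_mx j ord0 + e *: delta_mx i ord0).
  rewrite (gcd_big1 (leqnn j)); last by rewrite !mxE !eqxx ji mulr0 addr0.
  move=> /(_ erefl); have -> : map_mx intr (delta_mx j ord0 + e *: delta_mx i ord0) = ei R j + e%:~R *: ei R i.
    by rewrite -!map_delta; apply/matrixP => a b; rewrite !mxE intrD intrM.
  by rewrite (qf_bl2 _ _ red_sym) qfZ !qf_bl blZr !bl_ee (redS j i).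
have := h 1 erefl; have := h (-1) erefl; have := red_gt0 i.
rewrite mulrNz mulr1z; move: (Y i i) (Y i j) (Y j j) => a b c *; rewrite ler_norml.
by apply/andP; split; lra.
Qed.
Lemma red_abs (p k i : 'I_g) : (p <= k)%N -> `|Y p i| <= Y k k.
Proof.
move=> pk; case: (ltngtP p i) => h.
- exact: le_trans (red_off h) (red_mono pk).
- by rewrite redS; apply: le_trans (red_off h) (red_mono (leq_trans (ltnW h) pk)).
- rewrite -(val_inj h : p = i) ger0_norm; last exact: ltW (red_gt0 p).
  exact: red_mono.
Qed.

(** The primitive test vector [a] is split into m v and an error, which [qf_diag] weighs by diagonal
    entries only. The tolerance [e] varies with the coordinate, since large diagonal entries demand
    small errors. *)
Lemma round_le (k : 'I_g) v (a : 'cV[int]_g) (m : nat) (e : 'I_g -> R) :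
  \big[gcdn/0%N]_(j < g | (k <= j)%N) `|a j ord0|%N = 1%N ->
  (forall i, `|(a i ord0)%:~R - m%:R * v i ord0| <= e i) ->
  Y k k <= 2 * m%:R ^+ 2 * qf Y v + 2 * (g%:R * \sum_i e i ^+ 2 * Y i i).
Proof.
move=> /red_min h he; apply: (le_trans h).
have -> : map_mx intr a = m%:R *: v + (map_mx intr a - m%:R *: v) by rewrite addrC subrK.
apply: (le_trans (qf_add2 _ _ red_pd)); rewrite qfZ -mulrA lerD2l ler_pM2l//.
apply: (le_trans (qf_diag _ red_pd)); rewrite ler_pM2l ?ltr0n//.
apply: ler_sum => i _; rewrite ler_wpM2r ?(ltW (red_gt0 i))// !mxE.
rewrite -[leLHS]real_normK ?num_real//; apply: lerXn2r; rewrite ?nnegrE//.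
exact: le_trans (he i).
Qed.
End reduced.

(** j is the last index at which the sequence jumps by a factor above G, or 0 if there is none. *)
Lemma gap (G : R) (y : nat -> R) K : 1 <= G -> (forall i, 0 <= y i) ->
  (forall i j, (i <= j <= K)%N -> y i <= y j) ->
  exists j, [/\ (j <= K)%N, y K <= G ^+ K * y j & forall i, (i < j)%N -> G * y i <= y j].
Proof.
move=> G1 y0; have G0 : 0 <= G by lra.
elim: K => [_|K IH mon]; first by exists 0%N; split=> //; rewrite expr0 mul1r.
have [h|h] := leP (y K.+1) (G * y K).
  have [|j [jK h1 h2]] := IH; first by move=> i j /andP[ij jK]; apply: mon; rewrite ij (leqW jK).
  exists j; split=> //; first exact: leqW.
  by rewrite exprS -mulrA (le_trans h)// ler_wpM2l.
exists K.+1; split=> // [|i iK]; first by rewrite -[leLHS]mul1r ler_wpM2r// exprn_ege1.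
apply: le_trans (ltW h); rewrite ler_wpM2l//.
by apply: mon; rewrite -ltnS iK /= leqnSn.
Qed.

(** Pigeonhole for N^n + 1 multiples in N^n boxes. The approximating integers are differences of
    floors, so that coordinates of v equal to 0 or 1 are met without error. *)
Lemma dirichlet n (v : 'I_n -> R) (N : nat) : (0 < N)%N -> exists m1 m2 : nat,
  [/\ (m1 < m2)%N, (m2 <= N ^ n)%N & forall i,
    `|(Num.floor (m2%:R * v i) - Num.floor (m1%:R * v i))%:~R - (m2 - m1)%N%:R * v i| <= N%:R^-1].
Proof.
case: N => // N _; have N0 : 0 < (N.+1%:R : R) by rewrite ltr0n.
pose fr (x : R) := x - (Num.floor x)%:~R.
have fr0 x : 0 <= fr x by rewrite subr_ge0 floor_le_tmp.
have fr1 x : fr x < 1.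
  by rewrite ltrBlDl -[1]/(1%:~R) -intrD floorD1_gt.
pose bx (x : R) : int := Num.floor (N.+1%:R * fr x).
have bx0 x : 0 <= bx x by rewrite /bx floor_ge0 mulr_ge0// ltW.
have bxN x : (`|bx x| < N.+1)%N.
  rewrite -ltz_nat gez0_abs// -(ltr_int R) (le_lt_trans (floor_le_tmp _))//.
  by rewrite -[ltRHS]mulr1 ltr_pM2l.
pose f (m : 'I_(N.+1 ^ n).+1) : {ffun 'I_n -> 'I_N.+1} := [ffun i => Ordinal (bxN (m%:R * v i))].
have [p [q [pq fpq]]] : exists p q : 'I_(N.+1 ^ n).+1, (p < q)%N /\ f p = f q.
  apply: contrapT => nex; have inj : injective f.
    move=> p q e; apply: val_inj; case: (ltngtP p q) => // h; case: nex; first by exists p, q.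
    by exists q, p.
  by have := leq_card f inj; rewrite card_ffun !card_ord ltnn.
exists p, q; split=> //; first by rewrite -ltnS ltn_ord.
move=> i; have /ffunP/(_ i) := fpq; rewrite !ffunE => /(congr1 val) /= e.
have e1 : bx (p%:R * v i) = bx (q%:R * v i) by rewrite -[LHS]gez0_abs// -[RHS]gez0_abs// e.
have -> : (Num.floor (q%:R * v i) - Num.floor (p%:R * v i))%:~R - (q - p)%N%:R * v i =
   fr (p%:R * v i) - fr (q%:R * v i).
  by rewrite /fr natrB ?(ltnW pq)// intrD mulrNz; ring.
have F x : (bx x)%:~R <= N.+1%:R * fr x < (bx x)%:~R + 1.
  by rewrite floor_le_tmp /= -[1]/(1%:~R) -intrD floorD1_gt.
have := F (p%:R * v i); have := F (q%:R * v i); rewrite e1.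
move: (bx _)%:~R (fr (p%:R * v i)) (fr (q%:R * v i)) => b x y /andP[h1 h2] /andP[h3 h4].
rewrite -[leRHS]mul1r ler_pdivlMr// -[X in _ * X]gtr0_norm// -normrM mulrC mulrBr ler_norml.
by apply/andP; split; lra.
Qed.

Lemma floor_err (x : R) : `|(Num.floor x)%:~R - x| <= 1.
Proof.
have h1 := floor_le_tmp x; have h2 := floorD1_gt x; rewrite intrD in h2.
by rewrite ler_norml; move: h1 h2; rewrite -[1%:~R]/1; move: (Num.floor x)%:~R => f *; apply/andP; split; lra.
Qed.

(* The constants depend on the genus only: below a gap in the diagonal the
   coordinates are rounded, above it they are approximated simultaneously by
   Dirichlet's principle, and primitivity of the upper part is restored by
   dividing by its gcd. *)
Lemma minkowski_lb : exists2 K : R, 0 < K & forall Y, minkowski_reduced Y ->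
  forall (k : 'I_g) v, v k ord0 = 1 -> (forall i : 'I_g, (k < i)%N -> v i ord0 = 0) ->
  Y k k <= K * qf Y v.
Proof.
(* [Gn] makes the error term of [round_le] at most Y_jj/8 after the factor g times a sum of g terms;
   N is so large that 1/N^2 compensates the growth Gn^g of the diagonal above the gap. The remaining
   3/4 of Y_jj explains the factor 3 of [K1]. *)
pose Gn := (8 * g ^ 2)%N; pose N := (Gn ^ g.+1)%N.
have G1 : (1 <= (Gn%:R : R)) by rewrite ler1n muln_gt0 /= expn_gt0.
have G0 : 0 < (Gn%:R : R) by lra.
have N0 : (0 < N)%N by rewrite expn_gt0 muln_gt0 expn_gt0.
have NR : (1 : R) <= N%:R by rewrite ler1n.
pose K1 : R := 3 * (N ^ g)%N%:R ^+ 2.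
have K10 : 0 <= K1 by rewrite mulr_ge0// sqr_ge0.
exists (2 + 2 * (g%:R * (g%:R * (Gn%:R ^+ g * K1)))).
  by rewrite ltr_pwDl// mulr_ge0// mulr_ge0 ?ler0n// mulr_ge0 ?ler0n// mulr_ge0// exprn_ge0 ?ltW.
move=> Y rY k v vk vi; have q0 : 0 <= qf Y v := posdef_ge0 v (red_pd rY).
have y0 i := ltW (red_gt0 rY i).
pose a0 : 'cV[int]_g := map_mx (fun x : R => Num.floor x) v.
have flr1 : Num.floor (1 : R) = 1 by rewrite -[1]/(1%:~R) intrKfloor.
(* Rounding v down changes only the coordinates below k, so it suffices to bound the Y_ii with i < k
   by a multiple of the form at v. *)
have step1 (T : R) : 0 <= T -> (forall i : 'I_g, (i < k)%N -> Y i i <= T) ->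
    Y k k <= 2 * qf Y v + 2 * (g%:R * (g%:R * T)).
  move=> T0 hT; have := @round_le Y rY k v a0 1%N (fun i => if (i < k)%N then 1 else 0).
  rewrite (gcd_big1 (leqnn k)); last by rewrite mxE vk flr1.
  have he i : `|(a0 i ord0)%:~R - 1%:R * v i ord0| <= (if (i < k)%N then 1 else 0 : R).
    rewrite mxE mul1r; case: ltngtP => h; first exact: floor_err.
      by rewrite vi// (_ : Num.floor (0 : R) = 0) ?subrr ?normr0// -[0 in LHS]/(0%:~R) intrKfloor.
    by rewrite (val_inj h) vk flr1 subrr normr0.
  move=> /(_ erefl he); rewrite expr1n mulr1 => /le_trans; apply; rewrite lerD2l ler_pM2l// ler_pM2l ?ltr0n//.
  rewrite mulr_natl -[X in _ *+ X]card_ord -sumr_const; apply: ler_sum => i _.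
  by case: ifP => h; rewrite ?expr1n ?mul1r ?hT// expr0n mul0r.
suff hT : forall i : 'I_g, (i < k)%N -> Y i i <= Gn%:R ^+ g * K1 * qf Y v.
  apply: le_trans (step1 _ _ hT) _; first by rewrite !mulr_ge0// exprn_ge0 ?ltW.
  by rewrite mulrDl; lra.
move=> i0 i0k; have k0 : (0 < k)%N by apply: leq_ltn_trans i0k.
pose yy n : R := Y (inord n) (inord n).
have inordK' n : (n <= k)%N -> (inord n : 'I_g) = n :> nat by move=> nk; rewrite inordK// (leq_ltn_trans nk).
have k1 : (k.-1 < k)%N by rewrite prednK.
(* Below j the diagonal is smaller by the factor Gn, and rounding to integers is harmless; from j to
   k-1 it is at most Gn^g Y_jj, and errors 1/N suffice. *)
have [||j [jk hj1 hj2]] := @gap Gn%:R yy k.-1 G1.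
- by move=> n; exact: y0.
- move=> i j /andP[ij jk]; apply: (red_mono rY).
  by rewrite !inordK' ?(leq_trans jk (ltnW k1))// (leq_trans ij)// (leq_trans jk (ltnW k1)).
pose jo : 'I_g := inord j.
have joE : jo = j :> nat by rewrite /jo inordK'// (leq_trans jk (ltnW k1)).
have jok : (jo <= k)%N by rewrite joE (leq_trans jk (ltnW k1)).
have yyj : yy j = Y jo jo by [].
have yi (i : 'I_g) : (i <= k)%N -> yy i = Y i i by move=> ik; rewrite /yy inord_val.
have big_i (i : 'I_g) : (i < k)%N -> Y i i <= Gn%:R ^+ g * Y jo jo.
  move=> ik; have h1 : Y i i <= yy k.-1.
    by apply: (red_mono rY); rewrite inordK' ?(ltnW k1)// -ltnS prednK.
  apply: (le_trans h1); apply: (le_trans hj1); rewrite yyj ler_wpM2r//.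
  by rewrite ler_weXn2l// (leq_trans (leq_pred _))// ltnW.
suff hY : Y jo jo <= K1 * qf Y v.
  by apply: (le_trans (big_i _ i0k)); rewrite -mulrA ler_wpM2l// exprn_ge0 ?ltW.
have [m1 [m2 [m12 m2N hn]]] := dirichlet (fun i => v i ord0) N0.
pose nn (i : 'I_g) : int := Num.floor (m2%:R * v i ord0) - Num.floor (m1%:R * v i ord0).
pose m := (m2 - m1)%N; have m0 : (0 < m)%N by rewrite subn_gt0.
have nnk : nn k = m%:Z.
  rewrite /nn vk !mulr1 -[m2%:R]/(m2%:Z%:~R) -[m1%:R]/(m1%:Z%:~R) !intrKfloor /m subzn//.
  exact: ltnW.
have nn0 (i : 'I_g) : (k < i)%N -> nn i = 0 by move=> ki; rewrite /nn vi// !mulr0 subrr.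
pose h := \big[gcdn/0%N]_(i < g | (jo <= i)%N) `|nn i|%N.
have hdiv (i : 'I_g) : (jo <= i)%N -> (h %| `|nn i|)%N.
  by move=> ji; rewrite /h (bigD1 i)//= dvdn_gcdl.
have hm : (h %| m)%N by have := hdiv k jok; rewrite nnk.
have h0 : (0 < h)%N by apply: dvdn_gt0 hm.
pose m' := (m %/ h)%N.
have mE : m = (m' * h)%N by rewrite /m' divnK.
(* From [jo] on, the Dirichlet integers are divided by their gcd [h]. As the k-th of them is m, also
   h divides m, and the multiplier becomes m' = m/h; below [jo] the vector m' v is rounded. *)
pose a : 'cV[int]_g := \col_i if (jo <= i)%N then (nn i %/ h%:Z)%Z else Num.floor (m'%:R * v i ord0).
have aE (i : 'I_g) : (jo <= i)%N -> nn i = a i ord0 * h%:Z.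
  by move=> ji; rewrite mxE ji divzK// dvdzE absz_nat hdiv.
have hR : (0 : R) < h%:R by rewrite ltr0n.
have h1R : (1 : R) <= h%:R by rewrite ler1n.
have gcda : \big[gcdn/0%N]_(i < g | (jo <= i)%N) `|a i ord0|%N = 1%N.
  apply/eqP; rewrite -(eqn_pmul2l h0) muln1; apply/eqP.
  have hE : h = \big[gcdn/0%N]_(i < g | (jo <= i)%N) `|nn i|%N by [].
  rewrite (big_morph (muln h) (muln_gcdr h) (muln0 h)) [RHS]hE; apply: eq_bigr => i ji.
  by rewrite aE// abszM mulnC.
pose e (i : 'I_g) : R := if (i < jo)%N then 1 else if (i < k)%N then N%:R^-1 else 0.
have he i : `|(a i ord0)%:~R - m'%:R * v i ord0| <= e i.
  rewrite /e; case: ltnP => ji.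
    by rewrite mxE leqNgt ji /=; exact: floor_err.
  have ae : (a i ord0)%:~R = (nn i)%:~R / h%:R :> R.
    by rewrite (aE i ji) intrM -[h%:~R]/(h%:R) mulfK ?gt_eqF.
  have m'e : m'%:R = m%:R / h%:R :> R by rewrite mE natrM mulfK ?gt_eqF.
  have -> : (a i ord0)%:~R - m'%:R * v i ord0 = ((nn i)%:~R - m%:R * v i ord0) / h%:R.
    by rewrite ae m'e; field; rewrite gt_eqF.
  rewrite normrM normfV (gtr0_norm hR) ler_pdivrMr//; case: ltngtP => ik.
  - apply: (le_trans (hn i)); rewrite -[leLHS]mulr1 ler_wpM2l// invr_ge0; exact: ler0n.
  - by rewrite nn0// vi// mulr0 subrr normr0 mul0r.
  - have -> : i = k by exact: val_inj.
    by rewrite nnk vk mulr1 subrr normr0 mul0r.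
have := @round_le Y rY jo v a m' e gcda he.
have se : \sum_i e i ^+ 2 * Y i i <= g%:R * (Gn%:R^-1 * Y jo jo).
  rewrite mulr_natl -[X in _ *+ X]card_ord -sumr_const; apply: ler_sum => i _; rewrite /e.
  case: ltnP => ji.
    rewrite expr1n mul1r ler_pdivlMl//.
    have ji' : (i < j)%N by rewrite -joE.
    have := hj2 i ji'; rewrite yyj yi//.
    exact: leq_trans (ltnW ji) jok.
  case: ltnP => ik; last by rewrite expr0n mul0r mulr_ge0// invr_ge0 ltW.
  apply: (le_trans (ler_wpM2l (sqr_ge0 _) (big_i i ik))); rewrite mulrA ler_wpM2r//.
  rewrite exprVn ler_pdivrMl ?exprn_gt0 ?ltr0n// ler_pdivlMr// -exprSr /N natrX -[leLHS]mul1r expr2.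
  by apply: ler_wpM2r; [rewrite exprn_ge0// ltW|exact: exprn_ege1].
have m'N : m'%:R ^+ 2 <= (N ^ g)%N%:R ^+ 2 :> R.
  rewrite lerXn2r ?nnegrE ?ler0n// ler_nat (leq_trans (leq_div _ _))//.
  by rewrite (leq_trans (leq_subr _ _)).
have Gg : g%:R * (g%:R * Gn%:R^-1) = 8^-1 :> R.
  rewrite /Gn natrM natrX; field.
  by rewrite addrC natr1 pnatr_eq0.
move=> H; have := ler_wpM2r q0 m'N => H2.
have g0 : (0 : R) <= g%:R by [].
have H3 : g%:R * \sum_i e i ^+ 2 * Y i i <= 8^-1 * Y jo jo.
  by rewrite -Gg -!mulrA ler_wpM2l.
have H4 : 0 <= (N ^ g)%N%:R ^+ 2 * qf Y v by rewrite mulr_ge0 ?sqr_ge0.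
rewrite /K1; move: H H2 H3 H4; move: (\sum_i _) (_ ^+ 2) (_ ^+ 2) (qf Y v) (Y jo jo) (g%:R : R).
by move=> s p q u w G H H2 H3 H4; lra.
Qed.

(** The coefficient of W_i has numerator at most g B Y_ii, since W_i stops at i and |Y_kp| <= Y_ii
    for p <= i, and denominator at least Y_ii/K by [minkowski_lb]. The bound is thus independent of
    Y. *)
Lemma gram_schmidt (m : nat) : exists2 B : R, 1 <= B & forall Y, minkowski_reduced Y ->
  exists W : 'I_g -> 'cV[R]_g, forall k : 'I_g, (k < m)%N ->
  [/\ W k k ord0 = 1, (forall i : 'I_g, (k < i)%N -> W k i ord0 = 0), (forall i, `|W k i ord0| <= B),
      (forall i : 'I_g, (i < k)%N -> bl Y (W k) (W i) = 0) &
      exists u : 'I_g -> R, ei R k = W k + \sum_(i < g | (i < k)%N) u i *: W i].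
Proof.
have [K K0 hK] := minkowski_lb.
elim: m => [|m [B B1 IH]]; first by exists 1 => // Y _; exists (fun=> 0).
have B0 : 0 <= B by lra.
have gg0 : 0 <= g%:R * B * K by rewrite !mulr_ge0 ?ler0n// ltW.
exists (B + g%:R * (g%:R * B * K * B)) => [|Y rY].
  by rewrite (le_trans B1)// lerDl !mulr_ge0 ?ler0n// ltW.
have BB : B <= B + g%:R * (g%:R * B * K * B) by rewrite lerDl !mulr_ge0 ?ler0n// ltW.
have [W hW] := IH Y rY; have sY := red_sym rY.
have [mg|gm] := ltnP m g; last first.
  exists W => k _; have [h1 h2 h3 h4 h5] := hW k (leq_trans (ltn_ord k) gm).
  by split=> // i; exact: le_trans (h3 i) BB.
pose km := Ordinal mg.
pose u (i : 'I_g) := bl Y (ei R km) (W i) / qf Y (W i).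
pose w := ei R km - \sum_(i < g | (i < km)%N) u i *: W i.
have ub (i : 'I_g) : (i < km)%N -> `|u i| <= g%:R * B * K.
  move=> ik; have [h1 h2 h3 h4 h5] := hW i ik.
  have hq := hK Y rY i (W i) h1 h2; have y0 := red_gt0 rY i.
  have q0 : 0 < qf Y (W i).
    by rewrite -(pmulr_rgt0 _ K0); exact: lt_le_trans hq.
  rewrite /u normrM normfV (gtr0_norm q0) ler_pdivrMr// bl_ei mxE.
  apply: (le_trans (ler_norm_sum _ _ _)).
  have hb p : `|Y km p * W i p ord0| <= Y i i * B.
    rewrite normrM; case: (ltnP i p) => pi; first by rewrite h2// normr0 mulr0 mulr_ge0// ltW.
    by apply: ler_pM => //; rewrite (redS rY); exact: red_abs.
  apply: (le_trans (ler_sum _ (fun p _ => hb p))); rewrite sumr_const card_ord -[_ *+ g]mulr_natl.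
  rewrite -!mulrA ler_wpM2l ?ler0n// mulrC ler_wpM2l//.
have hlt (k : 'I_g) : (k < m.+1)%N -> k != km -> (k < m)%N.
  by rewrite ltnS leq_eqVlt => /orP[/eqP e|//]; rewrite (_ : k = km) ?eqxx//; exact: val_inj.
exists (fun k => if k == km then w else W k) => k km1.
have sumE (c : 'I_g -> R) (P : 'I_g -> bool) : (forall i : 'I_g, P i -> (i < m)%N) ->
    \sum_(i < g | P i) c i *: (if i == km then w else W i) = \sum_(i < g | P i) c i *: W i.
  move=> hP; apply: eq_bigr => i /hP im; case: eqP => // e; by rewrite e /= ltnn in im.
have [->|/(hlt _ km1) kn] := eqVneq k km; last first.
  have [h1 h2 h3 h4 [c h5]] := hW k kn; split=> //.
  - by move=> i; exact: le_trans (h3 i) BB.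
  - move=> i ik; case: eqP => [e|_]; last exact: h4.
    by move: (ltn_trans ik kn); rewrite e ltnn.
  - exists c; rewrite (sumE c (fun i : 'I_g => (i < k)%N))// => i ik.
    exact: ltn_trans ik kn.
have sum0 (i : 'I_g) : (km <= i)%N -> (\sum_(l < g | (l < km)%N) u l *: W l) i ord0 = 0.
  move=> ki; rewrite summxE big1// => l lk; rewrite mxE; have [_ h2 _ _ _] := hW l lk.
  by rewrite h2 ?mulr0//; exact: leq_trans lk ki.
split.
- by rewrite /w mxE [X in _ + X]mxE sum0// oppr0 addr0 mxE !eqxx.
- move=> i ki; rewrite /w mxE [X in _ + X]mxE sum0 ?(ltnW ki)// oppr0 addr0 mxE.
  by rewrite (_ : (i == km) = false)//; apply/eqP => e; rewrite e ltnn in ki.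
- move=> i; rewrite /w mxE [X in _ + X]mxE; apply: (le_trans (ler_normB _ _)); apply: lerD.
    by rewrite mxE; case: andb; rewrite ?normr1 ?normr0// (le_trans _ B1).
  rewrite summxE; apply: (le_trans (ler_norm_sum _ _ _)); rewrite big_mkcond /=.
  rewrite mulr_natl -[X in _ *+ X]card_ord -sumr_const; apply: ler_sum => l _.
  case: ifP => lk; last by rewrite !mulr_ge0 ?ler0n// ltW.
  by rewrite mxE normrM; apply: ler_pM => //; [exact: ub|have [_ _ -> _ _] := hW l lk].
- move=> i ik; case: eqP => [e|_]; first by rewrite e ltnn in ik.
  have q0 : qf Y (W i) != 0.
    have [h1 h2 _ _ _] := hW i ik; have hq := hK Y rY i (W i) h1 h2.
    by rewrite gt_eqF// -(pmulr_rgt0 _ K0); exact: lt_le_trans (red_gt0 rY i) hq.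
  rewrite /w -scaleN1r blDl blZl bl_suml (bigD1 i)//= big1 => [|l /andP[lk li]].
    by rewrite addr0 blZl -qf_bl /u divfK// mulN1r subrr.
  rewrite blZl; suff -> : bl Y (W l) (W i) = 0 by rewrite mulr0.
  case: (ltngtP l i) => h.
  - by rewrite blC//; have [_ _ _ -> //] := hW i ik.
  - by have [_ _ _ -> //] := hW l lk.
  - by rewrite (val_inj h) eqxx in li.
- by exists u; rewrite (sumE u (fun i : 'I_g => (i < km)%N))// /w subrK.
Qed.

(** The Gram-Schmidt basis diagonalizes Y but is real. Its coordinates are uniformly bounded, so
    rounding them to a grid leaves finitely many rational unipotent matrices, at the price of
    off-diagonal entries of the size of the rounding error. *)
Lemma diag_dominant (eta : R) : 0 < eta -> exists (I : finType) (V : I -> 'M[rat]_g) (c0 : R),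
  [/\ 0 < c0, forall f, V f \in unitmx & forall Y, minkowski_reduced Y -> exists f,
    let Y' := (map_mx ratr (V f))^T *m Y *m map_mx ratr (V f) in
    forall k, c0 * Y ord0 ord0 <= Y' k k /\ forall l, l != k -> `|Y' k l| <= eta * Y' k k].
Proof.
move=> eta0; have [K K0 hK] := minkowski_lb; have [B B1 hB] := gram_schmidt g.
(* An error eps makes the off-diagonal entries at most eps g^2 (B+1) Y_kk, and Y_kk <= K Y'_kk; the
   product has to be at most eta Y'_kk. *)
pose eps := Num.min 1 (eta / (g%:R * (g%:R * (B + 1)) * K)).
have gR : 0 < (g%:R : R) by rewrite ltr0n.
have B0 : 0 < B + 1 by lra.
have eps0 : 0 < eps by rewrite lt_min ltr01 divr_gt0// !mulr_gt0.
have eps1 : eps <= 1 by rewrite ge_min lexx.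
pose T := (Num.bound (Num.max 1 eps^-1)).
have hT : Num.max 1 eps^-1 < T%:R by apply: archi_boundP; rewrite le_max ler01.
have T1 : 1 < T%:R :> R by apply: le_lt_trans hT; rewrite le_max lexx.
have T0 : 0 < T%:R :> R by lra.
have Te : T%:R^-1 <= eps.
  by rewrite -[leRHS]invrK lef_pV2 ?posrE ?invr_gt0//; apply: ltW; apply: le_lt_trans hT; rewrite le_max lexx orbT.
pose S0 := Num.bound (T%:R * B + 1).
have hS0 : T%:R * B + 1 < S0%:R by apply: archi_boundP; rewrite addr_ge0// mulr_ge0 ?ltW//; lra.
(* The grid is (1/T)Z; the offset [S0] makes its bounded numerators natural numbers. *)
pose I := {ffun 'I_g * 'I_g -> 'I_(2 * S0).+1}.
pose V (f : I) : 'M[rat]_g := \matrix_(i, k) if i == k then 1 else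
   if (i < k)%N then ((f (i, k))%:R - S0%:R) / T%:R else 0.
exists I, V, K^-1; split; first by rewrite invr_gt0.
  move=> f; rewrite unitmxE unitfE -det_tr det_trig.
    by rewrite big1 ?oner_neq0// => i _; rewrite !mxE eqxx.
  apply/is_trig_mxP => i j ij; rewrite !mxE.
  have -> : (j == i) = false by apply/eqP => e; rewrite e ltnn in ij.
  by rewrite ltnNge (ltnW ij).
move=> Y rY; have [W hW'] := hB Y rY; have hW k := hW' k (ltn_ord k); have sY := red_sym rY.
pose pp (x : R) : nat := absz (Num.floor (T%:R * x) + S0%:Z)%R.
pose f : I := [ffun p => inord (pp (W p.2 p.1 ord0))]; exists f => Y'.
pose vv (k : 'I_g) : 'cV[R]_g := col k (map_mx ratr (V f)).
have Y'E k l : Y' k l = bl Y (vv k) (vv l).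
  rewrite blE exchange_big /= /Y' mxE; apply: eq_bigr => j _; rewrite mxE mulr_suml.
  by apply: eq_bigr => i _; rewrite !mxE.
have gridE (i k : 'I_g) : (i < k)%N -> vv k i ord0 = (Num.floor (T%:R * W k i ord0))%:~R / T%:R.
  move=> ik; rewrite !mxE ik (_ : (i == k) = false); last by apply/eqP => e; rewrite e ltnn in ik.
  rewrite ffunE /= fmorph_div rmorphB /= !rmorph_nat; congr (_ / _).
  have [_ _ /(_ i) hb _ _] := hW k.
  have fl : - S0%:R <= T%:R * W k i ord0 - 1 /\ T%:R * W k i ord0 <= S0%:R.
    move: hb hS0; rewrite ler_norml => /andP[l1 l2] hS.
    have := ler_wpM2l (ltW T0) l1; have := ler_wpM2l (ltW T0) l2; rewrite mulrN => *; split; lra.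
  have f1 := floor_le_tmp (T%:R * W k i ord0); have f2 := floorD1_gt (T%:R * W k i ord0).
  rewrite intrD in f2.
  have f3 : 0 <= Num.floor (T%:R * W k i ord0) + S0%:Z.
    rewrite -(ler_int R) intrD; move: f1 f2 fl; rewrite -[1%:~R]/(1 : R) -[S0%:~R]/(S0%:R).
    by move: (Num.floor _)%:~R => F *; lra.
  have f4 : (pp (W k i ord0) < (2 * S0).+1)%N.
    rewrite ltnS -lez_nat gez0_abs// -(ler_int R) intrD -[(2 * S0)%N%:~R]/((2 * S0)%N%:R) natrM.
    move: f1 f2 fl; rewrite -[S0%:~R]/(S0%:R : R); move: (Num.floor _)%:~R => F *; lra.
  rewrite inordK// -[(pp _)%:R]/((pp (W k i ord0))%:~R) gez0_abs// intrD -[S0%:~R]/(S0%:R).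
  by rewrite addrK.
have vv1 k : vv k k ord0 = 1 by rewrite !mxE eqxx rmorph1.
have vv0 (k i : 'I_g) : (k < i)%N -> vv k i ord0 = 0.
  move=> ki; rewrite !mxE (_ : (i == k) = false); last by apply/eqP => e; rewrite e ltnn in ki.
  by rewrite ltnNge (ltnW ki) /= rmorph0.
have err (k i : 'I_g) : `|vv k i ord0 - W k i ord0| <= eps.
  have [h1 h2 _ _ _] := hW k; case: (ltngtP i k) => ik.
  - rewrite gridE//; apply: le_trans Te; rewrite -[leRHS]mul1r ler_pdivlMr// -[X in _ * X](gtr0_norm T0).
    by rewrite -normrM mulrBl divfK ?gt_eqF// [_ * T%:R]mulrC; exact: floor_err.
  - by rewrite vv0// h2// subrr normr0 ltW.
  - by rewrite (val_inj ik) vv1 h1 subrr normr0 ltW.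
have epsK : eps * (g%:R * (g%:R * (B + 1))) * K <= eta.
  by rewrite -mulrA -ler_pdivlMr ?mulr_gt0// /eps ge_min lexx orbT.
have vvB k i : `|vv k i ord0| <= B + 1.
  have [_ _ /(_ i) h3 _ _] := hW k; have h := err k i.
  rewrite -[vv k i ord0](subrK (W k i ord0)); apply: (le_trans (ler_normD _ _)); lra.
have qlow k : Y k k <= K * Y' k k.
  by rewrite Y'E -qf_bl; apply: hK => // i; exact: vv0.
have off (k l : 'I_g) : (k < l)%N -> `|Y' k l| <= eps * (g%:R * (g%:R * (B + 1))) * Y k k.
  move=> kl; have [h1 h2 _ h4 _] := hW l; rewrite Y'E.
  have -> : vv l = W l + (vv l - W l) by rewrite addrC subrK.
  have o (i : 'I_g) : (i < l)%N -> bl Y (ei R i) (W l) = 0.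
    move=> il; have [_ _ _ _ [u ->]] := hW i; rewrite blDl bl_suml blC// h4// add0r big1// => p pi.
    by rewrite blZl blC// h4 ?mulr0//; exact: ltn_trans pi il.
  (* [vv k] lies in the span of the e_i with i <= k < l, to which W_l is orthogonal; only the
     rounding error of [vv l] contributes. *)
  have -> : bl Y (vv k) (W l + (vv l - W l)) = bl Y (vv k) (vv l - W l).
    rewrite blDr; suff -> : bl Y (vv k) (W l) = 0 by rewrite add0r.
    rewrite {1}[vv k](_ : _ = \sum_i vv k i ord0 *: ei R i); last first.
      apply/matrixP => a b; rewrite summxE (bigD1 a)//= big1 ?addr0 => [|i ia].
        by rewrite [RHS]mxE [X in _ = _ * X]mxE (ord1 b) !eqxx mulr1.
      by rewrite mxE [X in _ * X]mxE eq_sym (negbTE ia) mulr0.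
    rewrite bl_suml big1// => i _; rewrite blZl; case: (ltnP k i) => ki; first by rewrite vv0// mul0r.
    by rewrite o ?mulr0//; exact: leq_ltn_trans ki kl.
  rewrite blE; apply: (le_trans (ler_norm_sum _ _ _)).
  have hb p q : `|vv k p ord0 * Y p q * (vv l - W l) q ord0| <= (B + 1) * Y k k * eps.
    rewrite !normrM; case: (ltnP k p) => kp.
      rewrite vv0// normr0 !mul0r mulr_ge0 ?(ltW eps0)// mulr_ge0 ?(ltW (red_gt0 rY k)) ?(ltW B0)//.
    apply: ler_pM; rewrite ?mulr_ge0//; last by rewrite mxE [X in _ + X]mxE; exact: err.
    by apply: ler_pM => //; exact: red_abs.
  apply: (le_trans (ler_sum _ (fun p _ => le_trans (ler_norm_sum _ _ _) (ler_sum _ (fun q _ => hb p q))))).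
  rewrite !sumr_const !card_ord -[_ *+ g *+ g]mulr_natl -[_ *+ g]mulr_natl.
  rewrite le_eqVlt; apply/orP; left; apply/eqP; ring.
set c := eps * _ in off epsK; have c0 : 0 <= c by rewrite /c !mulr_ge0 ?ler0n ?ltW.
move=> k; split.
  by rewrite ler_pdivrMl//; apply: le_trans (qlow k); apply: (red_mono rY).
have Y'k : 0 <= Y' k k.
  by rewrite -(pmulr_rge0 _ K0); apply: le_trans (qlow k); apply: ltW; exact: (red_gt0 rY).
have last_ (l : 'I_g) : (l <= k)%N -> c * Y l l <= eta * Y' k k.
  move=> lk; apply: (le_trans (ler_wpM2l c0 (le_trans (red_mono rY lk) (qlow k)))).
  by rewrite mulrA ler_wpM2r.
move=> l lk; case: (ltngtP k l) => h.
- exact: le_trans (off _ _ h) (last_ k _).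
- rewrite Y'E blC// -Y'E; exact: le_trans (off _ _ h) (last_ l (ltnW h)).
- by rewrite (val_inj h) eqxx in lk.
Qed.

Lemma half_le_height (x y : R) : - 2^-1 <= x -> x <= 2^-1 -> 0 < y -> 1 <= x ^+ 2 + y ^+ 2 -> 2^-1 <= y.
Proof.
move=> x1 x2 y0 h; rewrite leNgt; apply/negP => y1; nra.
Qed.

(** The inversion in the first coordinate is integral and has det(C tau + D) = -tau_11, whence
    |tau_11| >= 1; its real part is at most 1/2 in absolute value. *)
Lemma siegel_fund_Im (tau : 'M[C]_g) : siegel_fund tau -> 2^-1 <= complex.Im (tau ord0 ord0).
Proof.
move=> [sy rY hRe hdet].
pose M := blJ rat (ord0 : 'I_g).
have PT := PiT (ord0 : 'I_g) rat; have ET : (Ei rat (ord0 : 'I_g))^T = Ei rat ord0.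
  by rewrite /Ei trmx_delta.
have EE : Ei rat (ord0 : 'I_g) *m Ei rat ord0 = Ei rat ord0 by rewrite /Ei mul_delta_mx.
have EP : Ei rat (ord0 : 'I_g) *m Pi rat ord0 = 0 by rewrite /Pi mulmxBr mulmx1 EE subrr.
have PE : Pi rat (ord0 : 'I_g) *m Ei rat ord0 = 0 by rewrite /Pi mulmxBl mul1mx EE subrr.
have PP : Pi rat (ord0 : 'I_g) *m Pi rat ord0 = Pi rat ord0 by rewrite {1}/Pi mulmxBl mul1mx EP subr0.
have hM : SpZ M.
  split.
    rewrite /Sp /= /M /blJ /Jmx tr_block_mx raddfN /= PT ET !mulmx_block.
    rewrite !(mul0mx, mulmx0, mul1mx, mulmx1, addr0, add0r, mulNmx, mulmxN, EE, EP, PE, PP, oppr0, opprK).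
    have e1 : Ei rat (ord0 : 'I_g) + Pi rat ord0 = 1%:M by rewrite addrC /Pi subrK.
    by rewrite -opprD [Pi _ _ + _]addrC e1.
  apply/mxOverP => a b; rewrite /M /blJ /Pi /Ei.
  have dl (i j : 'I_g) : (delta_mx ord0 ord0 : 'M[rat]_g) i j \is a Num.int by rewrite mxE; exact: rpred_nat.
  have d1 (i j : 'I_g) : (1%:M : 'M[rat]_g) i j \is a Num.int by rewrite mxE; exact: rpred_nat.
  rewrite mxE; case: fintype.splitP => i _; rewrite mxE; case: fintype.splitP => j _ //.
  - by rewrite mxE [X in _ + X]mxE rpredB.
  - by rewrite mxE rpredN.
  - by rewrite mxE [X in _ + X]mxE rpredB.
have := hdet M hM; rewrite /M /blJ block_mxKdl block_mxKdr.
set Q := _ + _.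
have QE i j : Q i j = if i == ord0 then - tau ord0 j else (i == j)%:R.
  rewrite /Q; have -> : mxC (map_mx (@ratr R) (- Ei rat ord0)) = - Ei C (ord0 : 'I_g).
    by apply/matrixP => a b; rewrite !mxE !rmorphN !rmorph_nat.
  have -> : mxC (map_mx (@ratr R) (Pi rat ord0)) = Pi C (ord0 : 'I_g).
    by apply/matrixP => a b; rewrite !mxE !rmorphB !rmorph_nat.
  have Et : (Ei C (ord0 : 'I_g) *m tau) i j = if i == ord0 then tau ord0 j else 0.
    rewrite mxE (bigD1 ord0)//= big1 ?addr0 => [|k k0].
      by rewrite mxE eqxx andbT; case: eqP; rewrite ?mul1r ?mul0r.
    by rewrite mxE (negbTE k0) andbF mul0r.
  rewrite mxE mulNmx [X in X + _]mxE Et /Pi [X in _ + X]mxE [X in _ + (_ + X)]mxE /Ei !mxE.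
  case: (eqVneq i ord0) => [->|i0] /=; last by rewrite !oppr0 add0r addr0.
  by rewrite (eq_sym ord0 j) subrr addr0.
have -> : \det Q = - tau ord0 ord0.
  rewrite -det_tr det_trig.
    rewrite (bigD1 ord0)//= mxE QE eqxx big1 ?mulr1// => i i0.
    by rewrite mxE QE (negbTE i0) eqxx.
  apply/is_trig_mxP => i j ij; rewrite mxE QE.
  have j0 : (j == ord0) = false by apply/eqP => e; rewrite e ltn0 in ij.
  by rewrite j0 (_ : (j == i) = false)//; apply/eqP => e; rewrite e ltnn in ij.
have y0 : 0 < complex.Im (tau ord0 ord0) by have := red_gt0 rY ord0; rewrite mxE.
rewrite normrN -[1]/((1 : R)%:C) => h.
have {h} : 1 <= nrm (tau ord0 ord0).
  by move: h; rewrite [`|_|]/(_%:C) lecR.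
move=> h; have := hRe ord0 ord0; rewrite ler_norml => /andP[x1 x2].
have : 1 <= nrm (tau ord0 ord0) ^+ 2 by rewrite expr_ge1// nrm_ge0.
have -> : nrm (tau ord0 ord0) ^+ 2 = complex.Re (tau ord0 ord0) ^+ 2 + complex.Im (tau ord0 ord0) ^+ 2.
  by case: (tau ord0 ord0) => a b /=; rewrite sqr_sqrtr// addr_ge0// sqr_ge0.
by move=> h2; exact: half_le_height x1 x2 y0 h2.
Qed.
End Minkowski.

(** * Definability of theta series on a cell *)
Section CoreDefinable.
Variable R : realType.
Local Notation C := R[i].

Lemma sin_small (e : R) : 0 < e -> exists2 d : R, 0 < d & forall x : R, `|x| < d -> `|sin x| <= e.
Proof.
move=> e0; have h : sin x @[x --> (0 : R)] --> (0 : R).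
  by rewrite -[X in _ --> X](@sin0 R); exact: continuous_sin.
have /nbhs_ballP[d /= d0 hd] : \forall x \near (0 : R), `|sin x| <= e by apply: (cvgr0_norm_le _ h).
by exists d => // x xd; apply: hd; rewrite /ball /= sub0r normrN.
Qed.

Lemma cis_restricted :
  restricted_analytic (cube_restr (fun x : 'rV[R]_1 => cos (x ord0 ord0))) /\
  restricted_analytic (cube_restr (fun x : 'rV[R]_1 => sin (x ord0 ord0))).
Proof.
pose f (x : 'rV[R]_1) : C := cexp ('i%C * (x ord0 ord0)%:C).
have fE x : f x = cos (x ord0 ord0) +i* sin (x ord0 ord0).
  by rewrite /f -sum_ecoef sum_ecoef_imag.
have [|h1 h2] := @ps_restricted R 1 f 1 ltr01.
  move=> p _; exists 1, (expR (nrm ('i%C : C) * (`|p ord0 ord0| + 1))); split=> //.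
  pose F (n : nat) (x : 'rV[R]_1) : C := ('i%C * (x ord0 ord0)%:C) ^+ n * n`!%:R^-1.
  have b0 : 0 <= nrm ('i%C : C) * (`|p ord0 ord0| + 1) by rewrite mulr_ge0 ?nrm_ge0// addr_ge0.
  apply: (@ps_sum R 1 nat p 1 f F (fun n => (nrm ('i%C : C) * (`|p ord0 ord0| + 1)) ^+ n / n`!%:R)) => //.
  - move=> n; apply: (ps_le _ (ps_mul ltr01 (ps_exp n ltr01 (ps_mul ltr01 (ps_cst _ 'i%C ltr01) (ps_coord _ ord0 ltr01))) (ps_cst _ (n`!%:R^-1) ltr01))).
    by rewrite nrmV natC nrm_real [`|n`!%:R|]ger0_norm.
  - exact: fbound_exp.
  - by move=> x _; rewrite /f -sum_ecoef.
split.
  have -> : (fun x : 'rV[R]_1 => cos (x ord0 ord0)) = (fun x => complex.Re (f x)).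
    by apply: funext => x; rewrite fE.
  exact: h1.
have -> : (fun x : 'rV[R]_1 => sin (x ord0 ord0)) = (fun x => complex.Im (f x)).
  by apply: funext => x; rewrite fE.
exact: h2.
Qed.

(** The modulus uses the real exponential on the whole line, the phase only cosine and sine on
    [-1, 1]; this is where a small real part of [c] is indispensable. *)
Lemma epi_DC n (c : 'rV[R]_n -> C) : DC c -> exists2 w : 'rV[R]_n -> C, DC w &
  forall x, `|pi * complex.Re (c x)| <= 1 -> w x = epi (c x).
Proof.
move=> [c1 c2]; have [h1 h2] := cis_restricted.
pose ph (x : 'rV[R]_n) : R := pi * complex.Re (c x).
have dph : DF ph by apply: DFM => //; exact: DF_cst.
pose ex (x : 'rV[R]_n) : R := expR (- pi * complex.Im (c x)).
have dex : DF ex by apply: DFexp; apply: DFM => //; exact: DF_cst.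
pose cs (x : 'rV[R]_n) : R := cube_restr (fun x : 'rV[R]_1 => cos (x ord0 ord0)) (\row_(_ < 1) ph x).
pose sn (x : 'rV[R]_n) : R := cube_restr (fun x : 'rV[R]_1 => sin (x ord0 ord0)) (\row_(_ < 1) ph x).
exists (fun x => (ex x * cs x) +i* (ex x * sn x)).
  by apply: DC_mk; apply: DFM => //; apply: (@DF_an R n 1 _ (fun _ => ph)).
move=> x hx; have cu : in_unit_cube (\row_(_ < 1) ph x) by move=> i; rewrite mxE -ler_norml.
rewrite /cs /sn /cube_restr; case: asboolP => // _; rewrite !mxE /epi /cexp /ex /ph.
by apply: complex_ext; rewrite !(ReM, ImM) /=; rewrite !(mul0r, add0r, sub0r, subr0, addr0) ?mulNr.
Qed.

(** Real and imaginary parts are divided by rho_j and rho_j delta, which brings them into the cube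
    of [core_restricted]; [beta] leaves room for a neighbourhood of that cube. *)
Lemma core_DC (J : finType) (K : choiceType) (b : K -> C) (mu : K -> J -> nat) (rho : J -> R)
    (beta delta b0 M : R) n (w : J -> 'rV[R]_n -> C) :
  (forall j, 0 < rho j) -> 0 <= b0 -> (forall k, nrm (b k) <= b0) -> 0 < delta -> 1 + delta < beta ->
  fbound (fun k => \prod_j (rho j * beta) ^+ mu k j) M -> (forall j, DC (w j)) ->
  exists2 G : 'rV[R]_n -> C, DC G & forall x,
    (forall j, `|complex.Re (w j x)| <= rho j /\ `|complex.Im (w j x)| <= rho j * delta) ->
    G x = sumC (fun k => b k * \prod_j w j x ^+ mu k j).
Proof.
move=> r0 b00 hb d0 db hM dw; pose v := #|J|.
pose mu' k (i : 'I_v) := mu k (enum_val i); pose rho' (i : 'I_v) := rho (enum_val i).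
have hM' : fbound (fun k => \prod_(i < v) (rho' i * beta) ^+ mu' k i) M.
  apply: fboundW hM => k; rewrite le_eqVlt; apply/orP; left; apply/eqP.
  by rewrite -(big_enum_val (fun j => (rho j * beta) ^+ mu k j)).
have r0' i : 0 <= rho' i by apply: ltW; exact: r0.
have rp' i : 0 < rho' i by exact: r0.
have [h1 h2] := core_restricted r0' b00 hb (ltW d0) db hM'.
pose F (i : 'I_(v + v)) (x : 'rV[R]_n) : R := match fintype.split i with
  | inl j => complex.Re (w (enum_val j) x) * (rho' j)^-1
  | inr j => complex.Im (w (enum_val j) x) * (rho' j * delta)^-1 end.
have dF i : DF (F i).
  rewrite /F; case: (fintype.split i) => j; apply: DFM; try exact: DF_cst.
    by case: (dw (enum_val j)).
  by case: (dw (enum_val j)).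
eexists; first by apply: DC_mk; [exact: (DF_an h1 dF)|exact: (DF_an h2 dF)].
move=> x hx; set y := \row_i F i x.
have rn j : rho j != 0 by rewrite gt_eqF.
have cu : in_unit_cube y.
  move=> i; rewrite mxE /F -ler_norml; case: (fintype.split i) => j; rewrite normrM normfV.
    by rewrite (gtr0_norm (rp' j)) ler_pdivrMr ?rp'// mul1r; exact: (hx _).1.
  have rd : 0 < rho' j * delta by rewrite mulr_gt0.
  by rewrite (gtr0_norm rd) ler_pdivrMr// mul1r; exact: (hx _).2.
rewrite /cube_restr; case: asboolP => // _.
have cv (j : 'I_v) : core_var rho' delta j y = w (enum_val j) x.
  rewrite /core_var !mxE /F.
  have -> : fintype.split (lshift v j) = inl j by rewrite -[lshift v j]/(unsplit (inl j)) unsplitK.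
  have -> : fintype.split (rshift v j) = inr j by rewrite -[rshift v j]/(unsplit (inr j)) unsplitK.
  have dn : delta != 0 by rewrite gt_eqF.
  have rj : rho' j != 0 by exact: rn.
  move: (rho' j) rj (w _ x) => r rr [a c]; apply: complex_ext; rewrite !(ReM, ImM, ReD, ImD) /=.
    by field; rewrite rr dn.
  by field; rewrite rr dn.
rewrite [LHS](_ : _ = core_sum b mu' rho' delta y); last by case: (core_sum _ _ _ _ _).
apply: eq_sumC => k; congr (_ * _).
by rewrite (big_enum_val (fun j => w j x ^+ mu k j)); apply: eq_bigr => j _; rewrite cv.
Qed.

Lemma max_half (s : R) : s / 2 + Num.max (- s) 0 / 2 + Num.max (- s) 0 / 2 = `|s| / 2.
Proof.
case: (ger0P s) => h; first by rewrite max_r ?oppr_le0//; lra.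
by rewrite max_l ?oppr_ge0 ?(ltW h)//; lra.
Qed.
Lemma max_half_ge0 (s : R) : 0 <= s / 2 + Num.max (- s) 0 / 2.
Proof.
case: (leP 0 s) => h; first by rewrite max_r ?oppr_le0//; lra.
by rewrite max_l ?oppr_ge0 ?(ltW h)//; lra.
Qed.

(** * Theta series as monomial series on one cell *)

Section theta.
Variables (g m : nat).
Hypothesis m0 : (0 < m)%N.
Notation M2 := ((m%:R : C) ^+ 2).

Section pieces.
Variables (x0 : 'M[R]_g) (t : 'M[C]_g).
(* Off-diagonal entries are written T = 2 (P - r) with P and r of nonnegative
   imaginary part, so that n_i n_j T = (n_i + n_j)^2 P + (n_i - n_j)^2 r
   - (n_i^2 + n_j^2)(P + r); the last term is absorbed in the diagonal. *)
Definition oT i j : C := if i == j then 0 else (t i j - (x0 i j)%:C) / M2.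
Definition orr i j : R := Num.max (- complex.Im (oT i j)) 0 / 2.
Definition oP i j : C := oT i j / 2 + (0 +i* orr i j).
Definition oS i j : C := oP i j + (0 +i* orr i j).
Definition oq i : C := (t i i - (x0 i i)%:C) / M2 - \sum_j (oS i j + oS j i).
End pieces.

(** All inequalities are strict, so that cells are open. [e0] and [Bz] come from reduction theory,
    whereas [d], the size of the cell, is chosen later to make the arguments small. *)
Definition tcond (e0 Bz d : R) (x0 : 'M[R]_g) (r0 : 'cV[R]_g) (u : 'cV[C]_g * 'M[C]_g) : Prop :=
  (forall i, \sum_(j | j != i) `|complex.Im (u.2 i j)| < complex.Im (u.2 i i) / 2 /\
     e0 < complex.Im (u.2 i i)) /\
  (forall i, `|complex.Im (u.1 i ord0)| < Bz * complex.Im (u.2 i i)) /\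
  (forall i j, `|complex.Re (u.2 i j) - x0 i j| < d) /\
  (forall i, `|complex.Re (u.1 i ord0) - r0 i ord0| < d).

(** Index set of the variables: the exponentials of [oP] and of i [orr] for every pair, q_i for
    every i, and the two bounded variables zeta_i^(+-1) q_i^K. [lexp] is their logarithm divided by
    pi i. *)
Definition J := (('I_g * 'I_g) * bool + ('I_g + 'I_g * bool))%type.

Lemma sumJ (V : nmodType) (F : J -> V) : \sum_(j : J) F j =
  \sum_i \sum_j (F (inl ((i, j), true)) + F (inl ((i, j), false))) +
  (\sum_i F (inr (inl i)) + \sum_i (F (inr (inr (i, true))) + F (inr (inr (i, false))))).
Proof.
rewrite big_sumType /= big_sumType /=; congr (_ + (_ + _)).
  transitivity (\sum_p \sum_b F (inl (p, b))); first by rewrite pair_bigA /=; apply: eq_bigr => -[].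
  by rewrite [RHS]pair_bigA /=; apply: eq_bigr => -[i j] _; exact: big_bool.
transitivity (\sum_i \sum_b F (inr (inr (i, b)))); first by rewrite pair_bigA /=; apply: eq_bigr => -[].
by apply: eq_bigr => i _; exact: big_bool.
Qed.

Variable K : nat.
(* The shift by K^2 keeps the exponent of q_i nonnegative after zeta_i^(+-1) has
   been replaced by the bounded variable zeta_i^(+-1) q_i^K. *)
Definition expo (n : 'cV[int]_g) (j : J) : nat := match j with
  | inl ((i, l), true) => (absz (n i ord0 + n l ord0)%R ^ 2)%N
  | inl ((i, l), false) => (absz (n i ord0 - n l ord0)%R ^ 2)%N
  | inr (inl i) => (absz (n i ord0) ^ 2 + K ^ 2 - K * absz (n i ord0))%N
  | inr (inr (i, true)) => if 0 <= n i ord0 then absz (n i ord0) else 0%N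
  | inr (inr (i, false)) => if 0 <= n i ord0 then 0%N else absz (n i ord0) end.

Definition lexp (x0 : 'M[R]_g) (r0 : 'cV[R]_g) (u : 'cV[C]_g * 'M[C]_g) (j : J) : C := match j with
  | inl ((i, l), true) => oP x0 u.2 i l
  | inl ((i, l), false) => 0 +i* orr x0 u.2 i l
  | inr (inl i) => oq x0 u.2 i
  | inr (inr (i, true)) => K%:R * oq x0 u.2 i + 2 * ((u.1 i ord0 - (r0 i ord0)%:C) / m%:R)
  | inr (inr (i, false)) => K%:R * oq x0 u.2 i - 2 * ((u.1 i ord0 - (r0 i ord0)%:C) / m%:R) end.

Lemma sqabs (V : pzRingType) (a : int) : ((absz a ^ 2)%N%:R : V) = a%:~R ^+ 2.
Proof.
rewrite natrX; case: a => a //=.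
by rewrite NegzE mulrNz sqrrN.
Qed.

Lemma expo_q (V : pzRingType) (n : 'cV[int]_g) i :
  ((absz (n i ord0) ^ 2 + K ^ 2 - K * absz (n i ord0))%N%:R : V) =
  (n i ord0)%:~R ^+ 2 + K%:R ^+ 2 - K%:R * (absz (n i ord0))%:R.
Proof.
rewrite natrB; first by rewrite natrD sqabs natrX natrM.
move: (absz _) => a; nia.
Qed.

(** A term of the theta series, recentred at (x0, r0) and multiplied by the common factor [kap], is
    a single monomial in the variables of [J]. *)
Lemma expo_sum (x0 : 'M[R]_g) (r0 : 'cV[R]_g) u (n : 'cV[int]_g) :
  \sum_(j : J) (expo n j)%:R * lexp x0 r0 u j =
  K%:R ^+ 2 * \sum_i oq x0 u.2 i + (qf (M2^-1 *: (u.2 - mxC x0)) (map_mx intr n) +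
    2 * lf (map_mx intr n) ((m%:R : C)^-1 *: (u.1 - mxC r0))).
Proof.
rewrite sumJ /=; set q := oq x0 u.2.
pose N i : C := (n i ord0)%:~R; pose z i : C := (u.1 i ord0 - (r0 i ord0)%:C) / m%:R.
have e1 : \sum_i (absz (n i ord0) ^ 2 + K ^ 2 - K * absz (n i ord0))%N%:R * q i +
   \sum_i ((if 0 <= n i ord0 then absz (n i ord0) else 0%N)%:R * (K%:R * q i + 2 * z i) +
     (if 0 <= n i ord0 then 0%N else absz (n i ord0))%:R * (K%:R * q i - 2 * z i)) =
   \sum_i ((N i ^+ 2 + K%:R ^+ 2) * q i + 2 * (N i * z i)).
  rewrite -big_split /=; apply: eq_bigr => i _; rewrite expo_q -/(N i).
  case: ifP => h.
    have -> : ((absz (n i ord0))%:R : C) = N i by rewrite /N -[in RHS](gez0_abs h).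
    by ring.
  have -> : ((absz (n i ord0))%:R : C) = - N i.
    by rewrite /N -mulrNz -ltz0_abs// ltNge h.
  by ring.
rewrite e1 {e1}; pose P i j := oP x0 u.2 i j; pose r i j : C := 0 +i* orr x0 u.2 i j.
pose T i j := oT x0 u.2 i j.
have e2 : \sum_i \sum_j ((absz (n i ord0 + n j ord0)%R ^ 2)%N%:R * P i j +
     (absz (n i ord0 - n j ord0)%R ^ 2)%N%:R * r i j) =
   \sum_i \sum_j (N i * N j * T i j) + \sum_i N i ^+ 2 * \sum_j (oS x0 u.2 i j + oS x0 u.2 j i).
  have -> : \sum_i N i ^+ 2 * \sum_j (oS x0 u.2 i j + oS x0 u.2 j i) =
     \sum_i \sum_j (N i ^+ 2 + N j ^+ 2) * oS x0 u.2 i j.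
    under eq_bigr do rewrite mulr_sumr.
    under [RHS]eq_bigr do (under eq_bigr do rewrite mulrDl; rewrite big_split /=).
    rewrite [RHS]big_split /= [X in _ = _ + X]exchange_big /= -big_split /=.
    by apply: eq_bigr => i _; rewrite -big_split /=; apply: eq_bigr => j _; rewrite mulrDr.
  rewrite -big_split /=; apply: eq_bigr => i _; rewrite -big_split /=; apply: eq_bigr => j _.
  rewrite !sqabs !intrD mulrNz -/(N i) -/(N j) /oS -/(r i j) -/(P i j).
  have PE : P i j = T i j / 2 + r i j by [].
  by rewrite PE; field.
rewrite e2 {e2}.
have e3 : qf (M2^-1 *: (u.2 - mxC x0)) (map_mx intr n) =
   \sum_i (N i ^+ 2 * ((u.2 i i - (x0 i i)%:C) / M2)) + \sum_i \sum_j N i * N j * T i j.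
  rewrite qfE -big_split /=; apply: eq_bigr => i _; rewrite (bigD1 i)//= [X in _ = _ + X](bigD1 i)//=.
  rewrite {1}/T /oT eqxx mulr0 add0r; congr (_ + _); first by rewrite !mxE /N; ring.
  apply: eq_bigr => j ji; rewrite !mxE /T /oT eq_sym (negbTE ji) /N; ring.
have e4 : lf (map_mx intr n) ((m%:R : C)^-1 *: (u.1 - mxC r0)) = \sum_i N i * z i.
  by rewrite lfE; apply: eq_bigr => i _; rewrite !mxE /N /z; ring.
rewrite e3 e4 [\sum_i (_ * q i + _)]big_split /= -!mulr_sumr.
have e5 : \sum_i (N i ^+ 2 + K%:R ^+ 2) * q i = \sum_i (N i ^+ 2 * ((u.2 i i - (x0 i i)%:C) / M2)) -
    \sum_i N i ^+ 2 * \sum_j (oS x0 u.2 i j + oS x0 u.2 j i) + K%:R ^+ 2 * \sum_i q i.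
  rewrite mulr_sumr -sumrB -big_split /=; apply: eq_bigr => i _; rewrite mulrDl /q {1}/oq; ring.
rewrite e5; ring.
Qed.

(** Up to the factor 1/m^2, Im q_i is Im(tau_ii) minus the absolute off-diagonal row sum, hence at
    least half of Im(tau_ii). The condition K >= 4 Bz m lets K Im q_i outweigh 2 Im(z_i)/m, which
    bounds the variables containing zeta_i^(+-1). *)
Lemma tcond_bounds (e0 Bz d : R) x0 r0 u : u.2^T = u.2 -> 0 < e0 -> 0 <= Bz -> 4 * Bz * m%:R <= K%:R ->
  tcond e0 Bz d x0 r0 u -> forall j : J,
  (if j is inr (inl _) then e0 / (2 * m%:R ^+ 2) else 0) <= complex.Im (lexp x0 r0 u j) /\
  `|complex.Re (lexp x0 r0 u j)| <= ((K%:R + 1) * (g%:R + 1) + 2) * d.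
Proof.
move=> sy e00 Bz0 hK [h1 [h2 [h3 h4]]].
have sy' i j : u.2 i j = u.2 j i by rewrite -{1}sy mxE.
clear sy.
have mR : (1 : R) <= m%:R by rewrite ler1n.
have mR0 : (0 : R) < m%:R by rewrite ltr0n.
have m2R : (1 : R) <= m%:R ^+ 2 by rewrite exprn_ege1.
have m2R0 : (0 : R) < m%:R ^+ 2 by lra.
pose k2 : R := (m%:R ^+ 2)^-1; have k20 : 0 < k2 by rewrite invr_gt0.
have k21 : k2 <= 1 by rewrite invf_le1.
have M2E : True -> M2^-1 = k2%:C by move=> _; rewrite natC -rmorphXn -fmorphV.
have mE : True -> (m%:R : C)^-1 = ((m%:R : R)^-1)%:C by move=> _; rewrite natC -fmorphV.
have RI (c : C) (a k : R) : complex.Re ((c - a%:C) * k%:C) = (complex.Re c - a) * k /\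
    complex.Im ((c - a%:C) * k%:C) = complex.Im c * k.
  by rewrite ReM ImM !ReD !ImD !ReN !ImN /= oppr0 addr0 !mulr0 subr0 add0r.
pose y i j : R := complex.Im (u.2 i j) * k2.
have ImT i j : complex.Im (oT x0 u.2 i j) = if i == j then 0 else y i j.
  by rewrite /oT; case: eqP => // _; rewrite (M2E I) (RI _ _ _).2.
have d0 (i : 'I_g) : i == i -> 0 <= d by move=> _; apply: le_trans (ltW (h3 i i)).
have ReTii i j : `|complex.Re ((u.2 i j - (x0 i j)%:C) / M2)| <= d.
  rewrite (M2E I) (RI _ _ _).1 normrM (ger0_norm (ltW k20)) -[leRHS]mulr1.
  by apply: ler_pM => //; [exact: ltW|exact: ltW].
have ReT i j : `|complex.Re (oT x0 u.2 i j)| <= d.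
  by rewrite /oT; case: eqP => _; [rewrite normr0; exact: (d0 i (eqxx i))|exact: ReTii].
have half (c : C) : complex.Re (c / 2) = complex.Re c / 2 /\ complex.Im (c / 2) = complex.Im c / 2.
  have -> : (2 : C)^-1 = ((2 : R)^-1)%:C by rewrite natC -fmorphV.
  by rewrite ReM ImM /= !mulr0 subr0 add0r.
have orr0 i j : 0 <= orr x0 u.2 i j by rewrite /orr divr_ge0// le_max lexx orbT.
have ReP i j : complex.Re (oP x0 u.2 i j) = complex.Re (oT x0 u.2 i j) / 2.
  by rewrite /oP ReD (half _).1 /= addr0.
have ImP i j : complex.Im (oP x0 u.2 i j) = complex.Im (oT x0 u.2 i j) / 2 + orr x0 u.2 i j.
  by rewrite /oP ImD (half _).2.
have ReS i j : `|complex.Re (oS x0 u.2 i j)| <= d / 2.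
  by rewrite /oS ReD /= addr0 ReP normrM [`|_^-1|]ger0_norm// ler_wpM2r.
have ImS i j : complex.Im (oS x0 u.2 i j) = `|complex.Im (oT x0 u.2 i j)| / 2.
  by rewrite /oS ImD /= ImP /orr max_half.
have Imq i : complex.Im (oq x0 u.2 i) = y i i - \sum_(j | j != i) `|y i j|.
  rewrite /oq ImD ImN (M2E I) (RI _ _ _).2 Im_sum; congr (_ - _).
  rewrite (bigD1 i)//= ImD !ImS !ImT eqxx normr0 mul0r !add0r; apply: eq_bigr => j ji.
  have yS : y j i = y i j by rewrite /y sy'.
  by rewrite ImD !ImS !ImT (negbTE ji) eq_sym (negbTE ji) yS -splitr.
have Imq2 i : y i i / 2 <= complex.Im (oq x0 u.2 i).
  rewrite Imq; have := (h1 i).1; rewrite -(ltr_pM2r k20) mulr_suml.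
  rewrite (eq_bigr (fun j => `|y i j|)) => [|j _]; last by rewrite /y normrM (ger0_norm (ltW k20)).
  by rewrite mulrAC -/(y i i); move: (\sum_(_ | _) _) (y i i) => a b; lra.
have Req i : `|complex.Re (oq x0 u.2 i)| <= (g%:R + 1) * d.
  rewrite /oq ReD ReN; apply: (le_trans (ler_normB _ _)).
  have : `|complex.Re (\sum_j (oS x0 u.2 i j + oS x0 u.2 j i))| <= g%:R * d.
    rewrite Re_sum; apply: (le_trans (ler_norm_sum _ _ _)).
    rewrite mulr_natl -[X in _ *+ X]card_ord -sumr_const; apply: ler_sum => j _.
    by rewrite ReD; apply: (le_trans (ler_normD _ _)); rewrite [leRHS]splitr; apply: lerD; exact: ReS.
  by move=> h; rewrite [(g%:R + 1) * d]mulrDl mul1r [leLHS]addrC; exact: lerD h (ReTii i i).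
pose zz i : C := (u.1 i ord0 - (r0 i ord0)%:C) / m%:R.
have Rez i : `|complex.Re (zz i)| <= d.
  rewrite /zz (mE I) (RI _ _ _).1 normrM -[leRHS]mulr1; apply: ler_pM => //; first exact: ltW.
  by rewrite ger0_norm ?invr_ge0 ?ler0n// invf_le1.
have Imz i : `|complex.Im (zz i)| <= Bz * m%:R * y i i.
  rewrite /zz (mE I) (RI _ _ _).2 normrM [`|_^-1|]ger0_norm ?invr_ge0 ?ler0n//.
  rewrite ler_pdivrMr// /y /k2 expr2 invfM.
  have -> : Bz * m%:R * (complex.Im (u.2 i i) * (m%:R^-1 * m%:R^-1)) * m%:R = Bz * complex.Im (u.2 i i).
    by field; rewrite gt_eqF.
  exact: ltW.
have y0 i : e0 * k2 <= y i i by rewrite /y ler_pM2r//; exact: ltW (h1 i).2.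
have yp i : 0 <= y i i by apply: le_trans (y0 i); rewrite mulr_ge0// ltW.
have two (c : C) : complex.Re (2 * c) = 2 * complex.Re c /\ complex.Im (2 * c) = 2 * complex.Im c.
  by rewrite natC ReM ImM /= !mul0r subr0 addr0.
have Kc (c : C) : complex.Re (K%:R * c) = K%:R * complex.Re c /\ complex.Im (K%:R * c) = K%:R * complex.Im c.
  by rewrite natC ReM ImM /= !mul0r subr0 addr0.
have K0 : 0 <= (K%:R : R) by [].
have g0 : 0 <= (g%:R : R) by [].
have big (i : 'I_g) (s : R) : s <= (K%:R * (g%:R + 1) + 2) * d -> s <= ((K%:R + 1) * (g%:R + 1) + 2) * d.
  move=> h; apply: (le_trans h); rewrite ler_wpM2r ?(d0 i (eqxx i))//; lra.
have KR i : `|K%:R * complex.Re (oq x0 u.2 i)| <= K%:R * ((g%:R + 1) * d).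
  by rewrite normrM (ger0_norm K0) ler_wpM2l.
have KI i : 4 * Bz * m%:R * (y i i / 2) <= K%:R * complex.Im (oq x0 u.2 i).
  apply: ler_pM => //; first by rewrite !mulr_ge0.
  by rewrite divr_ge0.
have small (i : 'I_g) (s : R) : s <= (g%:R + 1) * d -> s <= ((K%:R + 1) * (g%:R + 1) + 2) * d.
  move=> h; apply: (le_trans h); rewrite ler_wpM2r ?(d0 i (eqxx i))//.
  have : 0 <= (K%:R : R) * (g%:R + 1) by rewrite mulr_ge0// addr_ge0.
  by rewrite [(K%:R + 1) * _]mulrDl mul1r; move: (K%:R * (g%:R + 1)) => *; lra.
case=> [[[i l] []]|[i|[i []]]] /=.
- split.
    by rewrite ImP /orr max_half_ge0.
  apply: (small i); rewrite ReP normrM [`|_^-1|]ger0_norm//.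
  have gd : 0 <= (g%:R : R) * d by rewrite mulr_ge0// (d0 i (eqxx i)).
  move: (ReT i l) (d0 i (eqxx i)) gd; rewrite mulrDl mul1r; move: `|complex.Re (oT x0 u.2 i l)| (g%:R * d) => s t h h' h''; lra.
- split; first exact: orr0.
  by rewrite normr0 mulr_ge0 ?(d0 i (eqxx i))// addr_ge0// mulr_ge0// addr_ge0.
- split; last by apply: (small i); exact: Req.
  apply: le_trans (Imq2 i); have -> : e0 / (2 * m%:R ^+ 2) = e0 * k2 / 2 by rewrite /k2; field; rewrite gt_eqF.
  by rewrite ler_wpM2r// y0.
- split.
    rewrite ImD (Kc _).2 (two _).2; move: (KI i) (Imz i); rewrite /zz ler_norml.
    by move: (complex.Im (_ / _)) (complex.Im (oq x0 u.2 i)) (y i i) => s q yy h /andP[h' _]; lra.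
  rewrite ReD (Kc _).1 (two _).1; apply: (big i); apply: (le_trans (ler_normD _ _)).
  move: (KR i) (Rez i); rewrite (normrM 2) [`|2|]ger0_norm// /zz.
  by move: `|complex.Re (_ / _)| `|K%:R * complex.Re _| => s t h h'; lra.
- split.
    rewrite ImD ImN (Kc _).2 (two _).2; move: (KI i) (Imz i); rewrite /zz ler_norml.
    by move: (complex.Im (_ / _)) (complex.Im (oq x0 u.2 i)) (y i i) => s q yy h /andP[_ h']; lra.
  rewrite ReD ReN (Kc _).1 (two _).1; apply: (big i); apply: (le_trans (ler_normB _ _)).
  move: (KR i) (Rez i); rewrite (normrM 2) [`|2|]ger0_norm// /zz.
  by move: `|complex.Re (_ / _)| `|K%:R * complex.Re _| => s t h h'; lra.
Qed.

(** The variables of the pairs have no decay of their own, and their exponents add up to 4 g |n|^2.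
    Enlarging all variables by exp(kp) is paid for by the q_i: this choice of kp preserves the decay
    exp(-a n_i^2/2), and [gauss_le] absorbs the terms linear in |n_i|. *)
Lemma expo_fbound (a : R) : 0 < a -> exists kp : R, 0 < kp /\ exists M,
  fbound (fun n : 'cV[int]_g => \prod_(j : J)
    (expR (if j is inr (inl _) then - a else 0) * expR kp) ^+ expo n j) M.
Proof.
move=> a0; pose kp := a / (2 * (4 * g%:R + 1)).
have g0 : 0 <= (g%:R : R) by [].
have kp0 : 0 < kp by rewrite divr_gt0// mulr_gt0// ltr_wpDl// mulr_ge0.
have kpE : kp * (4 * g%:R + 1) = a / 2 by rewrite /kp; field; rewrite gt_eqF// ltr_wpDl// mulr_ge0.
exists kp; split=> //.
have [A A0 hA] := gauss_le (K%:R * a + kp) (divr_gt0 a0 (ltr0Sn R 1)).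
pose w (q : int) : R := A * wt q%:~R.
have w0 q : 0 <= w q by rewrite mulr_ge0// wt_ge0.
have bw : fbound w (A * 8) by apply: fboundZ => //; exact: fbound_wt.
exists ((A * 8) ^+ g); apply: fboundW (fbound_prod w0 bw) => n.
have -> : \prod_(j : J) (expR (if j is inr (inl _) then - a else 0) * expR kp) ^+ expo n j =
   expR (\sum_(j : J) (expo n j)%:R * ((if j is inr (inl _) then - a else 0) + kp)).
  rewrite expR_sum; apply: eq_bigr => j _; rewrite -expRD.
  by rewrite expRM_natl.
have nE i : ((absz (n i ord0))%:R : R) = `|(n i ord0)%:~R| by rewrite -intr_norm.
rewrite sumJ /= (_ : _ + _ = \sum_i ((4 * g%:R * kp) * (n i ord0)%:~R ^+ 2 +
    ((n i ord0)%:~R ^+ 2 + K%:R ^+ 2 - K%:R * `|(n i ord0)%:~R|) * (- a + kp) + `|(n i ord0)%:~R| * kp)).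
  rewrite expR_sum; apply: ler_prod => i _; rewrite expR_ge0 /=.
  apply: le_trans (hA (n i ord0)%:~R); rewrite ler_expR.
  have : 0 <= (K%:R : R) by [].
  have := normr_ge0 ((n i ord0)%:~R : R).
  have := kpE; have : 0 <= kp * (K%:R * `|(n i ord0)%:~R|) by rewrite mulr_ge0 ?(ltW kp0)// mulr_ge0.
  have : 0 <= K%:R ^+ 2 * (a - kp).
    rewrite mulr_ge0 ?sqr_ge0// subr_ge0; have : 0 <= kp * g%:R by rewrite mulr_ge0// ltW.
    have : 4 * (kp * g%:R) + kp = a / 2 by rewrite -kpE; ring.
    by move: (kp * g%:R) => kg *; lra.
  have : (4 * g%:R * kp) = a / 2 - kp by move: kpE; lra.
  move: (n i ord0)%:~R => x -> ; move: (x ^+ 2) `|x| (K%:R : R) => X Y k H1 H2 H3 H4 H5; lra.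
have f1 : \sum_i \sum_j ((absz (n i ord0 + n j ord0)%R ^ 2)%N%:R * (0 + kp) +
     (absz (n i ord0 - n j ord0)%R ^ 2)%N%:R * (0 + kp)) = \sum_i (4 * g%:R * kp) * (n i ord0)%:~R ^+ 2.
  transitivity (\sum_i \sum_j (2 * kp * (n i ord0)%:~R ^+ 2 + 2 * kp * (n j ord0)%:~R ^+ 2)).
    apply: eq_bigr => i _; apply: eq_bigr => j _; rewrite !sqabs !intrD mulrNz add0r.
    move: (_%:~R) (_%:~R) => x y; ring.
  under eq_bigr do rewrite big_split /= sumr_const card_ord -[_ *+ g]mulr_natl.
  rewrite big_split /= sumr_const card_ord -[(\sum_i _) *+ g]mulr_natl mulr_sumr -big_split /=.
  by apply: eq_bigr => i _; move: (_%:~R) => x; ring.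
rewrite f1 -!big_split /=; apply: eq_bigr => i _; rewrite expo_q !nE.
case: ifP => _; rewrite ?nE; move: `|(n i ord0)%:~R : R| ((n i ord0)%:~R : R) => X x; ring.
Qed.

(** The monomial that makes all exponents nonnegative; it depends on the point but not on the
    coefficients, and never vanishes. *)
Definition kap (x0 : 'M[R]_g) (t : 'M[C]_g) : C := epi (K%:R ^+ 2 * \sum_i oq x0 t i).

Lemma lexp_DC x0 r0 n (Z : 'rV[R]_n -> 'cV[C]_g) (T : 'rV[R]_n -> 'M[C]_g) (j : J) : DM Z -> DM T ->
  DC (fun x => lexp x0 r0 (Z x, T x) j).
Proof.
move=> dZ dT; have dT' i l : DC (fun x => oT x0 (T x) i l).
  rewrite /oT; case: eqP => _; first exact: DC_cst.
  by apply: DCM; [apply: DCD; [exact: dT|exact: DC_cst]|exact: DC_cst].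
have dr i l : DF (fun x => orr x0 (T x) i l).
  apply: DFM; last exact: DF_cst.
  by apply: DF_max; [apply: DFN; exact: (dT' i l).2|exact: DF_cst].
have dr' i l : DC (fun x => 0 +i* orr x0 (T x) i l) by apply: DC_mk => //; exact: DF_cst.
have dP i l : DC (fun x => oP x0 (T x) i l).
  by apply: DCD => //; apply: DCM => //; exact: DC_cst.
have dS i l : DC (fun x => oS x0 (T x) i l) by exact: DCD.
have dq i : DC (fun x => oq x0 (T x) i).
  apply: DCD; first by apply: DCM; [apply: DCD; [exact: dT|exact: DC_cst]|exact: DC_cst].
  apply: DCN; apply: DC_sum => l; exact: DCD.
have dz i : DC (fun x => 2 * ((Z x i ord0 - (r0 i ord0)%:C) / m%:R)).
  apply: DCM; first exact: DC_cst.
  by apply: DCM; [apply: DCD; [exact: dZ|exact: DC_cst]|exact: DC_cst].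
have dKq i : DC (fun x => K%:R * oq x0 (T x) i) by apply: DCM => //; exact: DC_cst.
case: j => [[[i l] []]|[i|[i []]]] /=; [exact: dP|exact: dr'|exact: dq|exact: DCD|].
by apply: DCD => //; exact: DCN.
Qed.

Lemma Im_epi (c : C) : complex.Im (epi c) = expR (- pi * complex.Im c) * sin (pi * complex.Re c).
Proof.
rewrite /epi /cexp !(ReM, ImM) /=.
by rewrite !(mul0r, add0r, sub0r, subr0, addr0) ?mulNr.
Qed.

(** Subtracting the real centre changes the coefficients by phases of modulus 1 and leaves variables
    of small argument. The size d depends neither on the centre nor on the coefficients, so finitely
    many cells will suffice. *)
Lemma Theta_DC (e0 Bz : R) : 0 < e0 -> 0 <= Bz -> 4 * Bz * m%:R <= K%:R ->
  exists2 d : R, 0 < d & forall x0 r0 a, SB m a ->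
  forall n (Z : 'rV[R]_n -> 'cV[C]_g) (T : 'rV[R]_n -> 'M[C]_g), DM Z -> DM T ->
  exists2 G : 'rV[R]_n -> C, DC G & forall x, siegel_space (T x) ->
    tcond e0 Bz d x0 r0 (Z x, T x) -> G x = kap x0 (T x) * Theta a (Z x, T x).
Proof.
move=> e00 Bz0 hK; pose a1 := e0 / (2 * m%:R ^+ 2).
have mR0 : (0 : R) < m%:R by rewrite ltr0n.
have a10 : 0 < pi * a1 by rewrite mulr_gt0 ?pi_gt0// divr_gt0// mulr_gt0// exprn_gt0.
have [kp [kp0 [M hM]]] := expo_fbound a10.
have dl0 : 0 < kp / 2 by lra.
have db : 1 + kp / 2 < expR kp.
  by apply: lt_trans (expR_gt1Dx (lt0r_neq0 kp0)); lra.
have [d1 d10 hd1] := sin_small dl0.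
pose c1 : R := (K%:R + 1) * (g%:R + 1) + 2.
have c10 : 0 < c1 by rewrite ltr_wpDl// mulr_ge0// addr_ge0.
have pc : 0 < pi * c1 by rewrite mulr_gt0 ?pi_gt0.
pose dm := Num.min d1 1; have dm0 : 0 < dm by rewrite lt_min d10 ltr01.
have [dm1 dm2] : dm <= d1 /\ dm <= 1 by rewrite !ge_min !lexx orbT.
(* Every phase becomes at most dm/2: below 1 as [epi_DC] requires, and below [d1], where |sin| <=
   kp/2 gives the thin rectangle of [core_DC]. *)
pose d := dm / 2 / (pi * c1).
exists d; first by rewrite divr_gt0//; lra.
move=> x0 r0 a sa n Z T dZ dT.
pose b (k : 'cV[int]_g) : C := a (ofZ R m k) * tterm (mxC x0) (mxC r0) (ofZ R m k).
have [b0 b00 hb0] := SB_bounded m0 sa.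
have hb k : nrm (b k) <= b0.
  rewrite /b nrmM -[leRHS]mulr1; apply: ler_pM; rewrite ?nrm_ge0//.
  rewrite /tterm nrm_epi qf_mxC.
  have -> : lf (mxC (ofZ R m k)) (mxC r0) = (lf (ofZ R m k) r0)%:C.
    rewrite !lfE rmorph_sum; apply: eq_bigr => i _; rewrite rmorphM.
    by congr (_ * _); rewrite [LHS]mxE.
  by rewrite ImD natC ImM /= !mulr0 !mul0r !addr0 mulr0 expR0.
have hw j := epi_DC (lexp_DC x0 r0 j dZ dT).
have [w hw'] := choice (fun j => let: ex_intro2 w h1 h2 := hw j in ex_intro _ w (conj h1 h2)).
pose rho (j : J) : R := expR (if j is inr (inl _) then - (pi * a1) else 0).
have rho0 j : 0 < rho j by exact: expR_gt0.
have [G dG hG] := core_DC rho0 b00 hb dl0 db hM (fun j => (hw' j).1).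
exists G => // x hT hx; have sy : (T x)^T = T x by case: hT.
have bd := tcond_bounds (u := (Z x, T x)) sy e00 Bz0 hK hx.
pose c j := lexp x0 r0 (Z x, T x) j.
have ph j : `|pi * complex.Re (c j)| <= dm / 2.
  rewrite normrM (ger0_norm (pi_ge0 R)); apply: (le_trans (ler_wpM2l (pi_ge0 R) (bd j).2)).
  by rewrite -/c1 mulrA mulrC /d divfK ?gt_eqF.
have we j : w j x = epi (c j).
  by apply: (hw' j).2; apply: (le_trans (ph j)); lra.
have ne j : nrm (epi (c j)) <= rho j.
  rewrite nrm_epi /rho ler_expR; have p0 := pi_gt0 R; move: (bd j).1; rewrite -/(c j).
  move: (complex.Im (c j)) => y; case: j => [_|[i|_]] /= h.
  - by rewrite mulNr oppr_le0 mulr_ge0 ?(ltW p0).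
  - by rewrite mulNr lerN2 ler_pM2l.
  - by rewrite mulNr oppr_le0 mulr_ge0 ?(ltW p0).
rewrite hG => [|j]; last first.
  rewrite we; split; first exact: le_trans (nrm_Re _) (ne j).
  rewrite Im_epi normrM ger0_norm ?expR_ge0// -nrm_epi; apply: ler_pM; rewrite ?nrm_ge0 ?ne//.
  by apply: hd1; apply: (le_lt_trans (ph j)); lra.
rewrite (Theta_lattice _ m0 sa) -sumCZ; last first.
  have aT := @asum_Theta R g m a (Z x, T x) m0 sa hT.
  have inj : injective (fun k : 'cV[int]_g => ofZ R m k).
    by move=> p q /(congr1 (toZ m)); rewrite !ofZK.
  exact: (@asum_inj R _ _ _ (fun k => a k * tterm (T x) (Z x) k) inj aT).
apply: eq_sumC => k.
have -> : \prod_j w j x ^+ expo k j = epi (\sum_j (expo k j)%:R * c j).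
  by rewrite epi_sum; apply: eq_bigr => j _; rewrite epiMn we.
rewrite /c expo_sum epiD /= -/(kap x0 (T x)); move: (kap x0 (T x)) => kk.
rewrite [LHS]mulrCA; congr (kk * _); rewrite /b -[LHS]mulrA; congr (_ * _).
rewrite /tterm -epiD; congr epi.
have kE : mxC (ofZ R m k) = (m%:R : C)^-1 *: map_mx intr k.
  by rewrite /ofZ mxCZ fmorphV rmorph_nat mxC_int.
rewrite kE !qfZ !lfZl lfZr qf_scale.
have -> : qf (T x - mxC x0) (map_mx intr k) = qf (T x) (map_mx intr k) - qf (mxC x0) (map_mx intr k).
  by rewrite qf_addA -scaleN1r qf_scale mulN1r.
have -> : lf (map_mx intr k) (Z x - mxC r0) = lf (map_mx intr k) (Z x) - lf (map_mx intr k) (mxC r0).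
  by rewrite lfDr -[- mxC r0]scaleN1r lfZr mulN1r.
rewrite exprVn; ring.
Qed.
End theta.
End CoreDefinable.

(** * Definable open regions *)
Section Points.
Variable R : realType.
Local Notation C := R[i].

Definition unre p q (x : 'rV[R]_(p * q + p * q)) : 'M[C]_(p, q) :=
  \matrix_(i, j) (vec_mx (lsubmx x) i j +i* vec_mx (rsubmx x) i j).
Lemma realifyK p q (A : 'M[C]_(p, q)) : unre (realify A) = A.
Proof.
apply/matrixP => i j; rewrite mxE /realify row_mxKl row_mxKr !mxvecK !mxE.
by case: (A i j).
Qed.
Lemma unreK p q (x : 'rV[R]_(p * q + p * q)) : realify (unre x) = x.
Proof.
rewrite /realify -[RHS]hsubmxK; congr row_mx; rewrite -[RHS]vec_mxK; congr mxvec;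
  by apply/matrixP => i j; rewrite !mxE.
Qed.

Definition ptof g (x : 'rV[R]_((g * 1 + g * 1) + (g * g + g * g))) : 'cV[C]_g * 'M[C]_g :=
  (unre (lsubmx x), unre (rsubmx x)).
Lemma realify_ptK g (u : 'cV[C]_g * 'M[C]_g) : ptof (realify_pt u) = u.
Proof. by rewrite /ptof /realify_pt row_mxKl row_mxKr !realifyK; case: u. Qed.
Lemma ptofK g (x : 'rV[R]_((g * 1 + g * 1) + (g * g + g * g))) : realify_pt (ptof x) = x.
Proof. by rewrite /ptof /realify_pt /= !unreK hsubmxK. Qed.

Lemma definable_ptsE g (U : set ('cV[C]_g * 'M[C]_g)) :
  definable [set x | U (ptof x)] -> definable_pts U.
Proof.
apply: definable_ext => x; split=> [h|[u hu <-]]; first by exists (ptof x) => //; exact: ptofK.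
by rewrite /= realify_ptK.
Qed.

Lemma DM_unre n p q (h : 'rV[R]_n -> 'rV[R]_(p * q + p * q)) :
  (forall k, DF (fun x => h x ord0 k)) -> DM (fun x => unre (h x)).
Proof.
move=> H i j; split.
  by apply: DF_ext (H (lshift _ (mxvec_index i j))) => x; rewrite !mxE /= ?mxE.
by apply: DF_ext (H (rshift _ (mxvec_index i j))) => x; rewrite !mxE /= ?mxE.
Qed.

Lemma DF_left n m (f : 'rV[R]_n -> R) : DF f -> DF (fun w : 'rV[R]_(n + m) => f (lsubmx w)).
Proof.
move=> hf; apply: (DF_ext _ (DF_comp (F := fun i (w : 'rV[R]_(n + m)) => w ord0 (lshift m i)) hf (fun i => DF_coord _ _))) => w.
by congr f; apply/rowP => i; rewrite !mxE.
Qed.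
Lemma DC_left n m (f : 'rV[R]_n -> C) : DC f -> DC (fun w : 'rV[R]_(n + m) => f (lsubmx w)).
Proof. by move=> [h1 h2]; split; [exact: (DF_left m h1)|exact: (DF_left m h2)]. Qed.

(** * Continuity of coordinate expressions *)

Section continuity.
Variables (n : nat) (p : 'rV[R]_n).
(* A Variant, as convergence would otherwise unfold to a product under apply. *)
Variant CA (f : 'rV[R]_n -> R) : Prop := CA_intro of f x @[x --> p] --> f p.
Lemma CA_ext f h : f =1 h -> CA f -> CA h.
Proof. by move=> /funext ->. Qed.
Lemma CA_cst (c : R) : CA (fun=> c). Proof.
have h : continuous (fun _ : 'rV[R]_n => c) by exact: cst_continuous.
by constructor; exact: (h p).
Qed.
Lemma CA_coord i : CA (fun x => x ord0 i). Proof. by constructor; exact: coord_continuous. Qed.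
Lemma CAD f h : CA f -> CA h -> CA (fun x => f x + h x).
Proof. by move=> [hf] [hh]; constructor; exact: (cvgD hf hh). Qed.
Lemma CAN f : CA f -> CA (fun x => - f x).
Proof. by move=> [hf]; constructor; exact: (cvgN hf). Qed.
Lemma CAM f h : CA f -> CA h -> CA (fun x => f x * h x).
Proof. by move=> [hf] [hh]; constructor; exact: (cvgM hf hh). Qed.
Lemma CAV f : f p != 0 -> CA f -> CA (fun x => (f x)^-1).
Proof. by move=> f0 [hf]; constructor; exact: (cvgV f0 hf). Qed.
Lemma CA_abs f : CA f -> CA (fun x => `|f x|).
Proof. by move=> [hf]; constructor; exact: (cvg_norm hf). Qed.
Lemma near_all (I : finType) (P : I -> 'rV[R]_n -> Prop) :
  (forall i, \forall x \near p, P i x) -> \forall x \near p, forall i, P i x.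
Proof. by move=> h; have := @filter_forall _ I (fun i => [set x | P i x]) (nbhs p) _ h; apply. Qed.
Lemma near_and (P Q : 'rV[R]_n -> Prop) :
  (\forall x \near p, P x) -> (\forall x \near p, Q x) -> \forall x \near p, P x /\ Q x.
Proof. by move=> h1 h2; apply: (@filterI _ _ _ [set x | P x] [set x | Q x]). Qed.
Lemma CA_sum (I : Type) (s : seq I) (P : pred I) (F : I -> 'rV[R]_n -> R) :
  (forall i, CA (F i)) -> CA (fun x => \sum_(i <- s | P i) F i x).
Proof.
move=> hF; elim: s => [|i s IH].
  by apply: CA_ext (CA_cst 0) => x; rewrite big_nil.
apply: (@CA_ext (fun x => (if P i then F i x else 0) + \sum_(j <- s | P j) F j x)).
  by move=> x; rewrite big_cons; case: ifP => //; rewrite add0r.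
by apply: CAD => //; case: (P i) => //; exact: CA_cst.
Qed.
Lemma CA_lt f h : CA f -> CA h -> f p < h p -> \forall x \near p, f x < h x.
Proof.
move=> hf hh lt; have hd : CA (fun x => h x + - f x) by apply: CAD => //; exact: CAN.
case: hd => hd.
have : \forall x \near p, 0 < h x + - f x by apply: (cvgr_gt _ hd); rewrite subr_gt0.
by apply: filterS => x; rewrite subr_gt0.
Qed.

Definition CC (f : 'rV[R]_n -> C) : Prop :=
  CA (fun x => complex.Re (f x)) /\ CA (fun x => complex.Im (f x)).
Lemma CC_ext f h : f =1 h -> CC f -> CC h. Proof. by move=> /funext ->. Qed.
Lemma CC_cst c : CC (fun=> c). Proof. by split; exact: CA_cst. Qed.
Lemma CCD f h : CC f -> CC h -> CC (fun x => f x + h x).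
Proof.
move=> [f1 f2] [h1 h2]; split.
  by apply: CA_ext (CAD f1 h1) => x; rewrite ReD.
by apply: CA_ext (CAD f2 h2) => x; rewrite ImD.
Qed.
Lemma CCM f h : CC f -> CC h -> CC (fun x => f x * h x).
Proof.
move=> [f1 f2] [h1 h2]; split.
  by apply: CA_ext (CAD (CAM f1 h1) (CAN (CAM f2 h2))) => x; rewrite ReM.
by apply: CA_ext (CAD (CAM f1 h2) (CAM f2 h1)) => x; rewrite ImM.
Qed.
Lemma CCV f : f p != 0 -> CC f -> CC (fun x => (f x)^-1).
Proof.
move=> fp [h1 h2].
pose N x := (complex.Re (f x) * complex.Re (f x) + complex.Im (f x) * complex.Im (f x))^-1.
have hN : CA N.
  apply: CAV; last by apply: CAD; exact: CAM.
  apply: contraNneq fp => /eqP; rewrite paddr_eq0 -?expr2 ?sqr_ge0// !sqrf_eq0 => /andP[/eqP a /eqP b].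
  by apply/eqP; apply: complex_ext.
apply: (@CC_ext (fun x => (complex.Re (f x) * N x) +i* (- (complex.Im (f x)) * N x))).
  by move=> x; rewrite /N; case: (f x) => a b; rewrite {2}/GRing.inv/= /N mulNr -!expr2.
by split; apply: CAM => //; exact: CAN.
Qed.
Lemma CC_sum (I : Type) (s : seq I) (P : pred I) (F : I -> 'rV[R]_n -> C) :
  (forall i, CC (F i)) -> CC (fun x => \sum_(i <- s | P i) F i x).
Proof.
move=> hF; split.
  by apply: (CA_ext _ (CA_sum s P (fun i => (hF i).1))) => x; rewrite Re_sum.
by apply: (CA_ext _ (CA_sum s P (fun i => (hF i).2))) => x; rewrite Im_sum.
Qed.
Lemma CC_prod (I : Type) (s : seq I) (P : pred I) (F : I -> 'rV[R]_n -> C) :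
  (forall i, CC (F i)) -> CC (fun x => \prod_(i <- s | P i) F i x).
Proof.
move=> hF; elim: s => [|i s IH].
  by apply: CC_ext (CC_cst 1) => x; rewrite big_nil.
apply: (@CC_ext (fun x => (if P i then F i x else 1) * \prod_(j <- s | P j) F j x)).
  by move=> x; rewrite big_cons; case: ifP => //; rewrite mul1r.
by apply: CCM => //; case: (P i) => //; exact: CC_cst.
Qed.

Definition CM q r (A : 'rV[R]_n -> 'M[C]_(q, r)) : Prop := forall i j, CC (fun x => A x i j).
Lemma CM_mul q r s (A : 'rV[R]_n -> 'M[C]_(q, r)) (B : 'rV[R]_n -> 'M[C]_(r, s)) :
  CM A -> CM B -> CM (fun x => A x *m B x).
Proof.
move=> hA hB i j; apply: (@CC_ext (fun x => \sum_k A x i k * B x k j)).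
  by move=> x; rewrite mxE.
by apply: CC_sum => k; exact: CCM.
Qed.
Lemma CM_add q r (A B : 'rV[R]_n -> 'M[C]_(q, r)) : CM A -> CM B -> CM (fun x => A x + B x).
Proof. by move=> hA hB i j; apply: CC_ext (CCD (hA i j) (hB i j)) => x; rewrite mxE. Qed.
Lemma CM_cst q r (A : 'M[C]_(q, r)) : CM (fun=> A). Proof. by move=> i j; exact: CC_cst. Qed.
Lemma CM_tr q r (A : 'rV[R]_n -> 'M[C]_(q, r)) : CM A -> CM (fun x => (A x)^T).
Proof. by move=> hA i j; apply: CC_ext (hA j i) => x; rewrite mxE. Qed.
Lemma CM_scale q r (c : 'rV[R]_n -> C) (A : 'rV[R]_n -> 'M[C]_(q, r)) :
  CC c -> CM A -> CM (fun x => c x *: A x).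
Proof. by move=> hc hA i j; apply: CC_ext (CCM hc (hA i j)) => x; rewrite mxE. Qed.
Lemma CC_det q (A : 'rV[R]_n -> 'M[C]_q) : CM A -> CC (fun x => \det (A x)).
Proof.
move=> hA; apply: CC_sum => s; apply: CCM; first exact: CC_cst.
by apply: CC_prod => i; exact: hA.
Qed.
Lemma CM_adj q (A : 'rV[R]_n -> 'M[C]_q) : CM A -> CM (fun x => \adj (A x)).
Proof.
move=> hA i j; apply: (@CC_ext (fun x => (-1) ^+ (j + i) * \det (row' j (col' i (A x))))).
  by move=> x; rewrite mxE.
apply: CCM; first exact: CC_cst.
by apply: CC_det => k l; apply: CC_ext (hA (lift j k) (lift i l)) => x; rewrite !mxE.
Qed.
Lemma CM_unre q r (h : 'rV[R]_n -> 'rV[R]_(q * r + q * r)) :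
  (forall k, CA (fun x => h x ord0 k)) -> CM (fun x => unre (h x)).
Proof.
move=> H i j; split.
  by apply: CA_ext (H (lshift _ (mxvec_index i j))) => x; rewrite !mxE /= ?mxE.
by apply: CA_ext (H (rshift _ (mxvec_index i j))) => x; rewrite !mxE /= ?mxE.
Qed.
End continuity.

(** * Charts attached to symplectic matrices *)

Section regions.
Variable g : nat.
Local Notation pt := ('cV[C]_g * 'M[C]_g)%type.
Local Notation dim := ((g * 1 + g * 1) + (g * g + g * g))%N.

Definition den (M : 'M[R]_(g + g)) tau := mxC (dlsubmx M) *m tau + mxC (drsubmx M).
Definition num (M : 'M[R]_(g + g)) tau := mxC (ulsubmx M) *m tau + mxC (ursubmx M).
(** The inverse written with the adjugate is a rational expression in the entries, from which
    definability and continuity can be read off. *)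
Definition dinv M tau := (\det (den M tau))^-1 *: \adj (den M tau).
Definition act M (u : pt) : pt := ((dinv M u.2)^T *m u.1, num M u.2 *m dinv M u.2).

Lemma act_relM M u : good M -> siegel_space u.2 -> relM M u (act M u).
Proof.
move=> gM hu; have := good_unit gM hu; rewrite -/(den M u.2) unitmxE unitfE => dn.
have e : dinv M u.2 *m den M u.2 = 1%:M.
  by rewrite /dinv -scalemxAl mul_adj_mx -mul_scalar_mx -scalar_mxM mulVf.
rewrite /relM -/(den M u.2) -/(num M u.2) /act /=; split; first by rewrite -mulmxA e mulmx1.
by rewrite mulmxA -trmx_mul e trmx1 mul1mx.
Qed.

Lemma DM_ptz : DM (fun x : 'rV[R]_dim => (ptof x).1).
Proof. by apply: DM_unre => k; apply: (DF_ext (f := fun x : 'rV[R]_dim => x ord0 (lshift _ k)) _ (DF_coord _ _)) => x; rewrite mxE. Qed.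
Lemma DM_ptt : DM (fun x : 'rV[R]_dim => (ptof x).2).
Proof. by apply: DM_unre => k; apply: (DF_ext (f := fun x : 'rV[R]_dim => x ord0 (rshift _ k)) _ (DF_coord _ _)) => x; rewrite mxE. Qed.
Lemma CM_ptz p : CM p (fun x : 'rV[R]_dim => (ptof x).1).
Proof. by apply: CM_unre => k; apply: (CA_ext (f := fun x : 'rV[R]_dim => x ord0 (lshift _ k)) _ (CA_coord p _)) => x; rewrite mxE. Qed.
Lemma CM_ptt p : CM p (fun x : 'rV[R]_dim => (ptof x).2).
Proof. by apply: CM_unre => k; apply: (CA_ext (f := fun x : 'rV[R]_dim => x ord0 (rshift _ k)) _ (CA_coord p _)) => x; rewrite mxE. Qed.

Lemma DM_den M : DM (fun x : 'rV[R]_dim => den M (ptof x).2).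
Proof. by apply: DM_add; [apply: DM_mul; [exact: DM_cst|exact: DM_ptt]|exact: DM_cst]. Qed.
Lemma DM_dinv M : DM (fun x : 'rV[R]_dim => dinv M (ptof x).2).
Proof.
apply: DM_scale; last by apply: DM_adj; exact: DM_den.
by apply: DCV; apply: DC_det; exact: DM_den.
Qed.
Lemma DM_actz M : DM (fun x : 'rV[R]_dim => (act M (ptof x)).1).
Proof. by apply: DM_mul; [apply: DM_tr; exact: DM_dinv|exact: DM_ptz]. Qed.
Lemma DM_actt M : DM (fun x : 'rV[R]_dim => (act M (ptof x)).2).
Proof.
apply: DM_mul; last exact: DM_dinv.
by apply: DM_add; [apply: DM_mul; [exact: DM_cst|exact: DM_ptt]|exact: DM_cst].
Qed.
Lemma CM_den M p : CM p (fun x : 'rV[R]_dim => den M (ptof x).2).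
Proof. by apply: CM_add; [apply: CM_mul; [exact: CM_cst|exact: CM_ptt]|exact: CM_cst]. Qed.
Lemma CM_dinv M p : \det (den M (ptof p).2) != 0 -> CM p (fun x : 'rV[R]_dim => dinv M (ptof x).2).
Proof.
move=> dn; apply: CM_scale; last by apply: CM_adj; exact: CM_den.
by apply: CCV => //; apply: CC_det; exact: CM_den.
Qed.
Lemma CM_actz M p : \det (den M (ptof p).2) != 0 -> CM p (fun x : 'rV[R]_dim => (act M (ptof x)).1).
Proof. by move=> dn; apply: CM_mul; [apply: CM_tr; exact: CM_dinv|exact: CM_ptz]. Qed.
Lemma CM_actt M p : \det (den M (ptof p).2) != 0 -> CM p (fun x : 'rV[R]_dim => (act M (ptof x)).2).
Proof.
move=> dn; apply: CM_mul; last exact: CM_dinv.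
by apply: CM_add; [apply: CM_mul; [exact: CM_cst|exact: CM_ptt]|exact: CM_cst].
Qed.

(** Positivity on all nonzero vectors is the complement of a projection along g further real
    coordinates. *)
Lemma definable_siegel n (T : 'rV[R]_n -> 'M[C]_g) : DM T -> definable [set x | siegel_space (T x)].
Proof.
move=> dT.
pose A (w : 'rV[R]_(n + g)) := (exists i, rsubmx w ord0 i <> 0) /\
  (\sum_i \sum_j rsubmx w ord0 i * complex.Im (T (lsubmx w) i j) * rsubmx w ord0 j <= 0).
have dr i : DF (fun w : 'rV[R]_(n + g) => rsubmx w ord0 i).
  by apply: (DF_ext (f := fun w : 'rV[R]_(n + g) => w ord0 (rshift n i)) _ (DF_coord _ _)) => w; rewrite mxE.
have dA : definable A.
  apply: definableI.
    apply: definable_exists => i; apply: definableN; apply: definable_eq => //; exact: DF_cst.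
  apply: definable_le; last exact: DF_cst.
  apply: DF_sum => i; apply: DF_sum => j; apply: DFM => //; apply: DFM => //.
  exact: (DF_left g (dT i j).2).
have dS : definable [set x | forall i j, T x i j = T x j i].
  by apply: definable_forall => i; apply: definable_forall => j; exact: definable_eqC.
apply: definable_ext (definableI dS (definableN (definable_proj dA))) => x; split.
  move=> [s nA]; have sT : (T x)^T = T x by apply/matrixP => i j; rewrite mxE s.
  split=> //; split; first by rewrite /symmetric_mx map_trmx sT.
  move=> v v0; rewrite -/(qf _ _) ltNge; apply/negP => h; apply: nA.
  exists v^T; rewrite /A row_mxKl row_mxKr; split.
    apply: contrapT => nex; case/eqP: v0; apply/matrixP => i j; rewrite ord1 [RHS]mxE.
    by apply: contrapT => vi; apply: nex; exists i; rewrite mxE.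
  apply: le_trans h; rewrite qfE le_eqVlt; apply/orP; left; apply/eqP.
  by apply: eq_bigr => i _; apply: eq_bigr => j _; rewrite !mxE.
move=> [sT [_ pY]]; split=> [i j|[y [[i yi]]]]; first by rewrite -{1}sT mxE.
rewrite row_mxKl row_mxKr in yi * => h.
have y0 : y^T != 0 by apply/eqP => /matrixP/(_ i ord0); rewrite !mxE.
have := pY _ y0; rewrite -/(qf _ _) ltNge => /negP; apply; apply: le_trans h.
rewrite qfE le_eqVlt; apply/orP; left; apply/eqP.
by apply: eq_bigr => k _; apply: eq_bigr => j _; rewrite !mxE.
Qed.

Lemma definable_tcond n (Z : 'rV[R]_n -> 'cV[C]_g) (T : 'rV[R]_n -> 'M[C]_g) e0 Bz d x0 r0 :
  DM Z -> DM T -> definable [set x | tcond e0 Bz d x0 r0 (Z x, T x)].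
Proof.
move=> dZ dT; have c n' (a : R) := @DF_cst R n' a.
apply: definableI.
  apply: definable_forall => i; apply: definableI; apply: definable_lt => //.
  - by apply: DF_sum => j; apply: DF_abs; exact: (dT i j).2.
  - by apply: DFM => //; exact: (dT i i).2.
  - exact: (dT i i).2.
apply: definableI.
  apply: definable_forall => i; apply: definable_lt.
    by apply: DF_abs; exact: (dZ i ord0).2.
  by apply: DFM => //; exact: (dT i i).2.
apply: definableI.
  apply: definable_forall => i; apply: definable_forall => j; apply: definable_lt => //.
  by apply: DF_abs; apply: DFB => //; exact: (dT i j).1.
apply: definable_forall => i; apply: definable_lt => //.
by apply: DF_abs; apply: DFB => //; exact: (dZ i ord0).1.
Qed.

Lemma near_tcond n (p : 'rV[R]_n) (Z : 'rV[R]_n -> 'cV[C]_g) (T : 'rV[R]_n -> 'M[C]_g) e0 Bz d x0 r0 :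
  CM p Z -> CM p T -> tcond e0 Bz d x0 r0 (Z p, T p) ->
  \forall x \near p, tcond e0 Bz d x0 r0 (Z x, T x).
Proof.
move=> cZ cT [h1 [h2 [h3 h4]]]; have c (a : R) := @CA_cst n p a.
apply: near_and.
  apply: near_all => i; apply: near_and; apply: CA_lt => //.
  - by apply: CA_sum => j; apply: CA_abs; exact: (cT i j).2.
  - by apply: CAM => //; exact: (cT i i).2.
  - exact: (h1 i).1.
  - exact: (cT i i).2.
  - exact: (h1 i).2.
apply: near_and.
  apply: near_all => i; apply: CA_lt; last exact: h2.
    by apply: CA_abs; exact: (cZ i ord0).2.
  by apply: CAM => //; exact: (cT i i).2.
apply: near_and.
  apply: near_all => i; apply: near_all => j; apply: CA_lt; last exact: h3.
    by apply: CA_abs; apply: CAD => //; exact: (cT i j).1.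
  exact: c.
apply: near_all => i; apply: CA_lt; last exact: h4.
  by apply: CA_abs; apply: CAD => //; exact: (cZ i ord0).1.
exact: c.
Qed.

Section nice.
Variables (N : nat) (c : 'I_N.+1 -> 'cV[R]_g).

(** The factors [k1] and [k2] may depend on the point in any way: they are invisible in projective
    space, so only the proportional vectors [G1] and [G2] have to be definable. *)
Definition nice (U : set pt) : Prop :=
  [/\ U `<=` @pts_space R g, definable [set x | U (ptof x)], open_in (@pts_space R g) U &
    exists G1 G2 : 'I_N.+1 -> 'rV[R]_dim -> C,
    [/\ forall l, DC (G1 l), forall l, DC (G2 l) &
      forall u, U u -> exists k1 k2 : C,
      [/\ k1 != 0, k2 != 0, forall l, G1 l (realify_pt u) = k1 * theta_char (c l) 0 u.1 u.2 &
          forall l, G2 l (realify_pt u) = k2 * theta_char (c l) 0 0 u.2]]].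

(** The centres are multiples of d/2, a half step that makes the inequality strict. *)
Lemma grid (d Xb : R) : 0 < d -> exists S0 : nat, forall x : R, `|x| <= Xb ->
  exists i : 'I_(2 * S0).+1, `|x - (i%:R - S0%:R) * (d / 2)| < d.
Proof.
move=> d0; have h0 : 0 < d / 2 by lra.
pose S0 := Num.bound (`|Xb| / (d / 2) + 1).
have hS : `|Xb| / (d / 2) + 1 < S0%:R.
  by apply: archi_boundP; rewrite addr_ge0// divr_ge0 ?(ltW h0).
exists S0 => x hx; pose t := x / (d / 2).
have ht : `|t| <= `|Xb| / (d / 2).
  by rewrite /t normrM normfV (gtr0_norm h0) ler_pM2r ?invr_gt0// (le_trans hx)// ler_norm.
have f0 := floor_err t.
have [f1 f2] : - S0%:R <= ((Num.floor t)%:~R : R) /\ ((Num.floor t)%:~R : R) <= S0%:R.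
  move: ht f0 hS; rewrite !ler_norml; move: (`|Xb| / (d / 2)) (Num.floor t)%:~R => a b /andP[? ?] /andP[? ?] ?.
  by split; lra.
have f3 : 0 <= Num.floor t + S0%:Z.
  by rewrite -(ler_int R) intrD -[S0%:~R]/(S0%:R : R); move: (Num.floor t)%:~R f1 => b ?; lra.
have f4 : (absz (Num.floor t + S0%:Z)%R < (2 * S0).+1)%N.
  rewrite ltnS -lez_nat gez0_abs// -(ler_int R) intrD -[(2 * S0)%N%:~R]/((2 * S0)%N%:R : R) natrM.
  by rewrite -[S0%:~R]/(S0%:R : R); move: (Num.floor t)%:~R f2 => b ?; lra.
exists (Ordinal f4) => /=.
have -> : ((absz (Num.floor t + S0%:Z)%R)%:R : R) - S0%:R = (Num.floor t)%:~R.
  by rewrite -[X in X - _]/((absz (Num.floor t + S0%:Z)%R)%:~R : R) gez0_abs// intrD addrK.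
have -> : x - (Num.floor t)%:~R * (d / 2) = - (((Num.floor t)%:~R - t) * (d / 2)).
  by rewrite mulrBl /t divfK ?gt_eqF// opprB.
rewrite normrN normrM (gtr0_norm h0); apply: (@le_lt_trans _ _ (1 * (d / 2))); last by lra.
by rewrite ler_pM2r.
Qed.

(** The image of u under M is cut into cells by grids for the real parts, finitely many because
    these are bounded by [Xb]. On a cell [Theta_DC] applies to the transformed coefficients T(ind
    c_l), whose level is L'. *)
Lemma chart (L : nat) (M : 'M[rat]_(g + g)) (e0 Bz Xb : R) :
  (0 < L)%N -> (forall l, SB L (ind (c l))) -> Sp M -> 0 < e0 -> 0 < Bz ->
  exists (I : finType) (U : I -> set pt), (forall i, nice (U i)) /\
  forall u u1 : pt, siegel_space u.2 -> relM (map_mx ratr M) u u1 ->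
    (forall i, \sum_(j | j != i) `|complex.Im (u1.2 i j)| < complex.Im (u1.2 i i) / 2 /\
       e0 < complex.Im (u1.2 i i)) ->
    (forall i, `|complex.Im (u1.1 i ord0)| < Bz * complex.Im (u1.2 i i)) ->
    (forall i j, `|complex.Re (u1.2 i j)| <= Xb) ->
    (forall i, `|complex.Re (u1.1 i ord0)| <= Xb) -> exists i, U i u.
Proof.
move=> L0 sbc hM e00 Bz0; set Mr : 'M[R]_(g + g) := map_mx ratr M.
have gM : good Mr := good_Sp R hM.
have [L' [T [L'0 [TSB hT]]]] := gM L L0.
pose K := Num.bound (4 * Bz * L'%:R).
have hK : 4 * Bz * L'%:R <= K%:R.
  by apply: ltW; apply: archi_boundP; rewrite !mulr_ge0 ?ler0n ?(ltW Bz0).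
have [d d0 hd] := @Theta_DC R g L' L'0 K e0 Bz e00 (ltW Bz0) hK.
have [S0 hS0] := grid Xb d0.
pose I : finType := ({ffun 'I_g * 'I_g -> 'I_(2 * S0).+1} * {ffun 'I_g -> 'I_(2 * S0).+1})%type.
pose x0 (f : I) : 'M[R]_g := \matrix_(i, j) (((f.1 (i, j))%:R - S0%:R) * (d / 2)).
pose r0 (f : I) : 'cV[R]_g := \col_i (((f.2 i)%:R - S0%:R) * (d / 2)).
pose U (f : I) : set pt := [set u | siegel_space u.2 /\ tcond e0 Bz d (x0 f) (r0 f) (act Mr u)].
have actE u u1 : siegel_space u.2 -> relM Mr u u1 -> act Mr u = u1.
  by move=> hu r; apply: (relM_unique gM hu _ r); exact: act_relM.
exists I, U; split; last first.
  move=> u u1 hu r h1 h2 h3 h4.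
  have [f1 hf1] := choice (fun p : 'I_g * 'I_g => hS0 _ (h3 p.1 p.2)).
  have [f2 hf2] := choice (fun i : 'I_g => hS0 _ (h4 i)).
  exists ([ffun p => f1 p], [ffun i => f2 i]); split=> //; rewrite (actE _ _ hu r).
  split=> //; split=> //; split=> [i j|i]; rewrite mxE ffunE; first exact: (hf1 (i, j)).
  exact: hf2.
move=> f; split; first by move=> u [].
- apply: definableI; first by apply: definable_siegel; exact: DM_ptt.
  apply: (@definable_ext _ _ [set x | tcond e0 Bz d (x0 f) (r0 f) ((act Mr (ptof x)).1, (act Mr (ptof x)).2)]).
    by move=> x; exact: iff_refl.
  by apply: definable_tcond; [exact: DM_actz|exact: DM_actt].
(* The Siegel space is in general not open among all complex matrices, so the open set is the
   interior of an implication. *)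
- pose A : set 'rV[R]_dim := [set x | siegel_space (ptof x).2 -> tcond e0 Bz d (x0 f) (r0 f) (act Mr (ptof x))].
  exists A°; split; first exact: open_interior.
  apply/seteqP; split=> u.
    move=> [hu hc]; split=> //=; have dn : \det (den Mr (ptof (realify_pt u)).2) != 0.
      by rewrite realify_ptK -unitfE -unitmxE; exact: good_unit.
    have hc' : tcond e0 Bz d (x0 f) (r0 f) ((act Mr (ptof (realify_pt u))).1, (act Mr (ptof (realify_pt u))).2).
      by rewrite -surjective_pairing realify_ptK.
    have := near_tcond (CM_actz dn) (CM_actt dn) hc'; apply: filterS => x hx _.
    by move: hx; rewrite -surjective_pairing.
  move=> [hu hA]; have hA' : A (realify_pt u) := interior_subset hA.
  by move: hA'; rewrite /A /mkset realify_ptK => h; split=> //; exact: h.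
have sT l := TSB _ (sbc l).
have ex1 l := hd (x0 f) (r0 f) _ (sT l) _ _ _ (DM_actz Mr) (DM_actt Mr).
(* The action fixes z = 0; the second factor of the map is read at the same tau, with constant
   argument 0 and centre 0. *)
have ex2 l := hd (x0 f) 0 _ (sT l) _ _ _ (@DM_cst R dim g 1 0) (DM_actt Mr).
have [G1 hG1] := choice (fun l => let: ex_intro2 w h1 h2 := ex1 l in ex_intro _ w (conj h1 h2)).
have [G2 hG2] := choice (fun l => let: ex_intro2 w h1 h2 := ex2 l in ex_intro _ w (conj h1 h2)).
exists G1, G2; split=> [l|l|u [hu hc]]; [exact: (hG1 l).1|exact: (hG2 l).1|].
have [u1 [k1 [s1 k10 r1 E1]]] := hT u hu.
have [u2 [k2 [s2 k20 r2 E2]]] := hT (0, u.2) hu.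
have a1 := actE _ _ hu r1; have a2 := actE (0, u.2) _ hu r2.
have kp0 : kap L' K (x0 f) (act Mr u).2 != 0 by exact: epi_neq0.
have hs1 : siegel_space (act Mr u).2 by rewrite a1.
exists (kap L' K (x0 f) (act Mr u).2 / k1), (kap L' K (x0 f) (act Mr u).2 / k2).
split; [by rewrite mulf_neq0// invr_neq0|by rewrite mulf_neq0// invr_neq0| |] => l.
  have [_ H1] := hG1 l; have := H1 (realify_pt u); rewrite realify_ptK => /(_ hs1).
  rewrite -surjective_pairing => /(_ hc) ->.
  have -> : theta_char (c l) 0 u.1 u.2 = k1 * Theta (T (ind (c l))) (act Mr u).
    by rewrite a1 -(E1 _ (sbc l)) (theta_char_Theta (c l) u.1 hu) -surjective_pairing.
  by move: (kap L' K (x0 f) (act Mr u).2) (Theta _ _) => a b; rewrite mulrA divfK.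
have a2' : (0, (act Mr u).2) = u2 by rewrite -a2 /act /= mulmx0.
have hc2 : tcond e0 Bz d (x0 f) 0 (0, (act Mr u).2).
  have [c1 [c2 [c3 c4]]] := hc; split=> //; split=> [i|] /=.
    by rewrite mxE normr0 mulr_gt0//; exact: lt_trans e00 (c1 i).2.
  by split=> [//|i]; rewrite !mxE subrr normr0.
have [_ H2] := hG2 l; have := H2 (realify_pt u); rewrite realify_ptK => /(_ hs1 hc2) ->.
have -> : theta_char (c l) 0 0 u.2 = k2 * Theta (T (ind (c l))) (0, (act Mr u).2).
  by rewrite a2' -(E2 _ (sbc l)) (theta_char_Theta (c l) 0 hu).
by move: (kap L' K (x0 f) (act Mr u).2) (Theta _ _) => a b; rewrite mulrA divfK.
Qed.
End nice.
End regions.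
End Points.

(** * Covering the fundamental set *)
Section Assembly.
Variable R : realType.
Local Notation C := R[i].

(** The equations w_l G_i = G_l eliminate the scalar of homogeneity and are insensitive to the
    common factor k. *)
Lemma proj_chart N (v w : 'rV[C]_N.+1) (G : 'I_N.+1 -> C) (k : C) i : k != 0 ->
  (forall l, G l = k * v ord0 l) ->
  (proj_pt v w /\ w ord0 i = 1) <-> (G i <> 0 /\ forall l, w ord0 l * G i = G l).
Proof.
move=> k0 hG; split=> [[[c c0 ->]]|[Gi hw]].
  rewrite mxE => cv; have vi : v ord0 i != 0.
    by apply: contra_eq_neq cv => ->; rewrite mulr0 eq_sym oner_neq0.
  split=> [|l]; first by rewrite hG; apply/eqP; rewrite mulf_neq0.
  rewrite mxE !hG; transitivity (k * v ord0 l * (c * v ord0 i)); first by ring.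
  by rewrite cv mulr1.
have vi : v ord0 i != 0 by apply/eqP => h; apply: Gi; rewrite hG h mulr0.
have wE l : w ord0 l = (v ord0 i)^-1 * v ord0 l.
  by have := hw l; rewrite !hG mulrCA => /(mulfI k0) <-; rewrite mulrC mulfK.
split; last by rewrite wE mulVf.
by exists (v ord0 i)^-1; [rewrite invr_neq0|apply/rowP => l; rewrite wE mxE].
Qed.

(** The local functions need not agree on overlaps: each describes the graph of the same projective
    map over its piece, and the whole graph is a finite disjunction. *)
Lemma nice_union g N (c : 'I_N.+1 -> 'cV[R]_g) (I : finType) (U : I -> set ('cV[C]_g * 'M[C]_g)) :
  (forall i, nice c (U i)) ->
  (forall (z : 'cV[C]_g) tau, siegel_space tau -> exists l, theta_char (c l) 0 z tau != 0) ->
  [/\ definable_pts [set u | exists i, U i u], open_in (@pts_space R g) [set u | exists i, U i u] &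
      definable_map_to_PP [set u | exists i, U i u] (PhiD c)].
Proof.
move=> hU nz; split.
- by apply: definable_ptsE; apply: definable_exists => i; case: (hU i).
- have ex i : exists O : set 'rV[R]_((g * 1 + g * 1) + (g * g + g * g)),
    open O /\ U i = @pts_space R g `&` [set u | O (realify_pt u)] by case: (hU i).
  have [Om hOm] := choice ex; exists (\bigcup_i Om i); split.
    by apply: bigcup_open => i _; exact: (hOm i).1.
  apply/seteqP; split=> u.
    by move=> [k]; rewrite (hOm k).2 => -[h1 h2]; split=> //; exists k.
  by move=> [h1 [i _ h2]]; exists i; rewrite (hOm i).2.
split.
  move=> u [i Ui]; have hu : siegel_space u.2 by have [h _ _ _] := hU i; exact: h.
  split; [exists (\row_l theta_char (c l) 0 u.1 u.2)|exists (\row_l theta_char (c l) 0 0 u.2)] => //.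
    have [l hl] := nz u.1 u.2 hu; apply: contraNneq hl => /rowP/(_ l).
    by rewrite !mxE => ->.
  have [l hl] := nz 0 u.2 hu; apply: contraNneq hl => /rowP/(_ l).
  by rewrite !mxE => ->.
move=> i j; have ex k : exists G : ('I_N.+1 -> 'rV[R]_((g * 1 + g * 1) + (g * g + g * g)) -> C) *
    ('I_N.+1 -> 'rV[R]_((g * 1 + g * 1) + (g * g + g * g)) -> C),
    [/\ forall l, DC (G.1 l), forall l, DC (G.2 l) &
      forall u, U k u -> exists k1 k2 : C,
      [/\ k1 != 0, k2 != 0, forall l, G.1 l (realify_pt u) = k1 * theta_char (c l) 0 u.1 u.2 &
          forall l, G.2 l (realify_pt u) = k2 * theta_char (c l) 0 0 u.2]].
  by have [_ _ _ [G1 [G2 h]]] := hU k; exists (G1, G2).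
have [G hG] := choice ex.
pose dim := ((g * 1 + g * 1) + (g * g + g * g))%N; pose q := (1 * N.+1 + 1 * N.+1)%N.
pose cond (G : 'I_N.+1 -> 'rV[R]_dim -> C) i (x : 'rV[R]_dim) (w : 'rV[C]_N.+1) :=
  G i x <> 0 /\ forall l, w ord0 l * G i x = G l x.
pose A k (y : 'rV[R]_(dim + (q + q))) := U k (ptof (lsubmx y)) /\
  (cond (G k).1 i (lsubmx y) (unre (lsubmx (rsubmx y))) /\
   cond (G k).2 j (lsubmx y) (unre (rsubmx (rsubmx y)))).
have dw1 : DM (fun y : 'rV[R]_(dim + (q + q)) => unre (lsubmx (rsubmx y)) : 'rV[C]_N.+1).
  apply: DM_unre => k.
  by apply: (DF_ext (f := fun y : 'rV[R]_(dim + (q + q)) => y ord0 (rshift dim (lshift q k))) _ (DF_coord _ _)) => y; rewrite !mxE.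
have dw2 : DM (fun y : 'rV[R]_(dim + (q + q)) => unre (rsubmx (rsubmx y)) : 'rV[C]_N.+1).
  apply: DM_unre => k.
  by apply: (DF_ext (f := fun y : 'rV[R]_(dim + (q + q)) => y ord0 (rshift dim (rshift q k))) _ (DF_coord _ _)) => y; rewrite !mxE.
have dcond (H : 'I_N.+1 -> 'rV[R]_dim -> C) i' (w : 'rV[R]_(dim + (q + q)) -> 'rV[C]_N.+1) :
    (forall l, DC (H l)) -> DM w -> definable [set y | cond H i' (lsubmx y) (w y)].
  move=> dH dw; have dL l : DC (fun y : 'rV[R]_(dim + (q + q)) => H l (lsubmx y)) by exact: DC_left.
  apply: definableI; first by apply: definableN; apply: definable_eqC => //; exact: DC_cst.
  by apply: definable_forall => l; apply: definable_eqC => //; apply: DCM => //; exact: dw.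
have dA : definable [set y | exists k, A k y].
  apply: definable_exists => k; apply: definableI.
    by have [_ h _ _] := hU k; exact: (definable_lift (q + q) h).
  have [h1 h2 _] := hG k; apply: definableI; exact: dcond.
apply: definable_ext dA => y; split.
  move=> [k [Uk [c1 c2]]]; set u := ptof (lsubmx y) in Uk.
  have [_ _ /(_ u Uk)[k1 [k2 [k10 k20 e1 e2]]]] := hG k.
  exists u, (unre (lsubmx (rsubmx y))), (unre (rsubmx (rsubmx y))).
  have ru : realify_pt u = lsubmx y by exact: ptofK.
  rewrite ru in e1 e2; split; first by exists k.
  - apply/(@proj_chart _ _ _ (fun l => (G k).1 l (lsubmx y)) k1) => // l.
    by rewrite mxE.
  - apply/(@proj_chart _ _ _ (fun l => (G k).2 l (lsubmx y)) k2) => // l.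
    by rewrite mxE.
  - by rewrite ru !unreK !hsubmxK.
move=> [u [w [w' [[k Uk] h1 h2 ->]]]]; exists k.
have [_ _ /(_ u Uk)[k1 [k2 [k10 k20 e1 e2]]]] := hG k.
rewrite /A row_mxKl row_mxKr row_mxKl row_mxKr !realifyK realify_ptK; split=> //; split.
- apply/(@proj_chart _ (\row_l theta_char (c l) 0 u.1 u.2) w (fun l => (G k).1 l (realify_pt u)) k1 i k10) => // l.
  by rewrite mxE.
- apply/(@proj_chart _ (\row_l theta_char (c l) 0 0 u.2) w' (fun l => (G k).2 l (realify_pt u)) k2 j k20) => // l.
  by rewrite mxE.
Qed.

Definition nm m n (A : 'M[R]_(m, n)) : R := \sum_i \sum_j `|A i j|.
Lemma nm_ge0 m n (A : 'M[R]_(m, n)) : 0 <= nm A.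
Proof. by apply: sumr_ge0 => i _; exact: sumr_ge0. Qed.
Lemma nm_tr_mul m n (A : 'M[R]_(m, n)) (t : 'cV[R]_m) i : (forall k, 0 <= t k ord0 <= 1) ->
  `|(A^T *m t) i ord0| <= nm A.
Proof.
move=> ht; rewrite mxE; apply: (le_trans (ler_norm_sum _ _ _)); apply: ler_sum => k _.
rewrite mxE normrM; apply: (@le_trans _ _ `|A k i|); last first.
  by rewrite (bigD1 i)//= lerDl sumr_ge0.
have /andP[t0 t1] := ht k.
by rewrite -[leRHS]mulr1 ler_wpM2l// ger0_norm.
Qed.

Lemma Re_mxC g (A B : 'M[R]_g) (T : 'M[C]_g) :
  map_mx (@complex.Re R) (mxC A *m T *m mxC B) = A *m map_mx (@complex.Re R) T *m B.
Proof.
apply/matrixP => i j; rewrite !mxE Re_sum; apply: eq_bigr => k _; rewrite ReM !mxE /= mulr0 subr0.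
rewrite Re_sum; congr (_ * _); apply: eq_bigr => l _; rewrite ReM !mxE /= mul0r subr0//.
Qed.
Lemma Im_mxC g (A B : 'M[R]_g) (T : 'M[C]_g) :
  map_mx (@complex.Im R) (mxC A *m T *m mxC B) = A *m map_mx (@complex.Im R) T *m B.
Proof.
apply/matrixP => i j; rewrite !mxE Im_sum; apply: eq_bigr => k _; rewrite ImM !mxE /= mulr0 add0r.
rewrite Im_sum; congr (_ * _); apply: eq_bigr => l _; rewrite ImM !mxE /= mul0r addr0//.
Qed.

Section cover.
Variables (g' : nat).
Local Notation g := g'.+1.
Variables (d : 'I_g -> nat) (gam : 'M[rat]_(g + g)) (V : 'M[rat]_g).
Hypotheses (hgam : Sp gam) (uV : V \in unitmx).

(* The change of variables to the diagonally dominant chart is the inverse of [covW]. *)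
Definition covW : 'M[rat]_(g + g) := gam *m blU (invmx V^T).
Local Notation Wr := (map_mx (@ratr R) covW).
Local Notation Vr := (map_mx (@ratr R) V).

Definition Pb : R := nm (ulsubmx Wr) + nm (Dmx R d *m dlsubmx Wr) +
  (nm (ursubmx Wr) + nm (Dmx R d *m drsubmx Wr)).

Lemma covW_Sp : Sp covW.
Proof. by apply: Sp_mul => //; apply: Sp_blU; rewrite unitmx_inv unitmx_tr. Qed.

Lemma Pb_ge0 : 0 <= Pb. Proof. by rewrite !addr_ge0 ?nm_ge0. Qed.

(** Lattice coordinates change linearly: from z = tau t + D s one gets u1.1 = u1.2 p + r, with p and
    r linear in t and s through the blocks of W. Since t and s stay in the unit cube, [Pb] is a
    bound. *)
Lemma cover_point (tau0 : 'M[C]_g) (u : 'cV[C]_g * 'M[C]_g) : siegel_fund tau0 ->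
  u.2 = siegel_act (map_mx ratr gam) tau0 -> siegel_space u.2 -> Ebar d u.2 u.1 ->
  exists u1, [/\ relM (map_mx ratr (Spinv covW)) u u1, u1.2 = mxC Vr^T *m tau0 *m mxC Vr &
    exists p r : 'cV[R]_g, [/\ u1.1 = u1.2 *m mxC p + mxC r, forall i, `|p i ord0| <= Pb &
      forall i, `|r i ord0| <= Pb]].
Proof.
move=> [sy rY _ _] e hu [t [s [ht hs zE]]].
have h0 : siegel_space tau0 by split=> //; exact: (red_pd rY).
have gg := good_Sp R hgam; have gW := good_Sp R covW_Sp; have gM := good_Sp R (Sp_Spinv covW_Sp).
have uQ := good_unit gg h0.
set Q := _ + _ in uQ.
(* A preimage of u under gam in the vector variable as well, so that the two actions can be
   composed. *)
have r0 : relM (map_mx ratr gam) (Q^T *m u.1, tau0) u.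
  by split=> //; rewrite e /siegel_act -mulmxA mulVmx// mulmx1.
have [L1 [T1 [_ [_ hM]]]] := gM 1%N isT.
have [u1 [k1 [s1 _ r1 _]]] := hM u hu.
have [L2 [T2 [_ [_ hW]]]] := gW 1%N isT.
have [u2 [k2 [s2 _ r2 _]]] := hW u1 s1.
have [WM MW] := Sp_inv covW_Sp.
have r3 := relM_comp r1 r2; rewrite -map_mxM WM map_mx1 in r3.
have u2E := relM1 r3; rewrite u2E in r2.
have uVT : V^T \in unitmx by rewrite unitmx_tr.
have r4 := relM_comp r0 r1; rewrite -map_mxM in r4.
(* Thus the new matrix is V^T tau0 V, whose imaginary part is the one made dominant. *)
have ME : Spinv covW *m gam = blU V^T.
  have b1 : blU (invmx V^T) *m blU V^T = 1%:M.
    by rewrite blU_mul ?unitmx_inv// mulVmx// /blU invmx1 trmx1 -scalar_mx_block.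
  by rewrite -[LHS]mulmx1 -b1 mulmxA -[_ *m gam *m _]mulmxA -/covW MW mul1mx.
rewrite ME map_blU -map_trmx in r4.
have u1E : u1.2 = mxC Vr^T *m tau0 *m mxC Vr.
  have [+ _] := r4; rewrite /blU !(block_mxKul, block_mxKur, block_mxKdl, block_mxKdr) /= !mxC0.
  have inv : (invmx Vr^T)^T *m Vr = 1%:M by rewrite trmx_inv trmxK mulVmx ?map_unitmx.
  by rewrite mul0mx add0r addr0 => <-; rewrite -mulmxA -mxCM inv mxC1 mulmx1.
exists u1; split=> //.
have [q1 q2] := r2; set A := ulsubmx Wr in q1; set B := ursubmx Wr in q1.
set Cm := dlsubmx Wr in q1 q2; set Dm := drsubmx Wr in q1 q2.
pose tc : 'cV[R]_g := \col_i t i; pose sc : 'cV[R]_g := \col_i s i.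
pose De := Dmx R d.
have DeT : De^T = De by rewrite /De /Dmx tr_diag_mx.
have DC' : Dmx C d = mxC De.
  by apply/matrixP => i j; rewrite !mxE rmorphMn /= rmorph_nat.
have zE' : u.1 = u.2 *m mxC tc + mxC De *m mxC sc.
  rewrite zE DC'; congr (_ + _); apply/matrixP => i j; rewrite summxE mxE; apply: eq_bigr => k _.
    by rewrite !mxE mulrC.
  by rewrite !mxE mulrC.
have uT : u.2^T = u.2 by case: hu.
have u1T : u1.2^T = u1.2 by case: s1.
exists (A^T *m tc + (De *m Cm)^T *m sc), (B^T *m tc + (De *m Dm)^T *m sc); split.
- have trE (X Z : 'M[R]_g) : (mxC X *m u1.2 + mxC Z)^T = u1.2 *m mxC X^T + mxC Z^T.
    by rewrite raddfD /= trmx_mul u1T -!mxCT.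
  have DeE (X : 'M[R]_g) : (De *m X)^T = X^T *m De by rewrite trmx_mul DeT.
  rewrite -q2 zE' mulmxDr mulmxA -{1}uT -trmx_mul q1 mulmxA !trE !DeE !mxCD !mxCM.
  by rewrite mulmxDr !mulmxDl !mulmxA addrACA.
- move=> i; rewrite mxE; apply: (le_trans (ler_normD _ _)); rewrite /Pb ler_wpDr//.
    by rewrite addr_ge0 ?nm_ge0.
  by apply: lerD; apply: nm_tr_mul => k; rewrite mxE.
- move=> i; rewrite mxE; apply: (le_trans (ler_normD _ _)); rewrite /Pb ler_wpDl//.
    by rewrite addr_ge0 ?nm_ge0.
  by apply: lerD; apply: nm_tr_mul => k; rewrite mxE.
Qed.
End cover.

(** Since Im(tau0_11) >= 1/2, the new diagonal entries y are at least c0/2, and the off-diagonal row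
    sums are at most y/4. Hence |Im z| <= (5/4) P y < (2P+1) y; the constants are generous because
    strict inequalities are needed. *)
Lemma cover_bounds g' (tau0 : 'M[C]_g'.+1) (V : 'M[R]_g'.+1) (u1 : 'cV[C]_g'.+1 * 'M[C]_g'.+1)
    (p r : 'cV[R]_g'.+1) (P c0 : R) : 0 <= P -> 0 < c0 -> siegel_fund tau0 ->
  u1.2 = mxC V^T *m tau0 *m mxC V -> u1.1 = u1.2 *m mxC p + mxC r ->
  (forall i, `|p i ord0| <= P) -> (forall i, `|r i ord0| <= P) ->
  (let Y' := V^T *m map_mx (@complex.Im R) tau0 *m V in
   forall k, c0 * (map_mx (@complex.Im R) tau0) ord0 ord0 <= Y' k k /\
     forall l, l != k -> `|Y' k l| <= (4 * g'.+1%:R)^-1 * Y' k k) ->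
  [/\ forall i, \sum_(j | j != i) `|complex.Im (u1.2 i j)| < complex.Im (u1.2 i i) / 2 /\
       c0 / 4 < complex.Im (u1.2 i i),
     forall i, `|complex.Im (u1.1 i ord0)| < (2 * P + 1) * complex.Im (u1.2 i i),
     forall i j, `|complex.Re (u1.2 i j)| <= nm V * nm V + (g'.+1%:R * (nm V * nm V) * P + P) &
     forall i, `|complex.Re (u1.1 i ord0)| <= nm V * nm V + (g'.+1%:R * (nm V * nm V) * P + P)].
Proof.
move=> P0 c00 hf uE zE hp hr /= hY; have [_ _ hRe _] := hf.
have Y0 := siegel_fund_Im hf.
have g0 : 0 < (g'.+1%:R : R) by rewrite ltr0n.
have nV : 0 <= nm V * nm V by rewrite mulr_ge0 ?nm_ge0.
have ImE i j : complex.Im (u1.2 i j) = (V^T *m map_mx (@complex.Im R) tau0 *m V) i j.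
  by rewrite -Im_mxC -uE mxE.
have ReE i j : complex.Re (u1.2 i j) = (V^T *m map_mx (@complex.Re R) tau0 *m V) i j.
  by rewrite -Re_mxC -uE mxE.
pose y i j : R := complex.Im (u1.2 i j); pose x i j : R := complex.Re (u1.2 i j).
have y1 i : c0 / 2 <= y i i.
  rewrite /y ImE; apply: le_trans (hY i).1; rewrite ler_pM2l// mxE; exact: Y0.
have yp i : 0 < y i i by apply: lt_le_trans (y1 i); rewrite divr_gt0.
have off i : \sum_(j | j != i) `|y i j| <= y i i / 4.
  have h j : j != i -> `|y i j| <= (4 * g'.+1%:R)^-1 * y i i by move=> ji; rewrite /y !ImE; exact: (hY i).2.
  apply: (@le_trans _ _ (\sum_(j < g'.+1) (4 * g'.+1%:R)^-1 * y i i)).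
    rewrite big_mkcond /=; apply: ler_sum => j _; case: ifP => [/h//|_].
    by rewrite mulr_ge0 ?(ltW (yp i))// invr_ge0 mulr_ge0// ltW.
  rewrite sumr_const card_ord -[_ *+ _]mulr_natl le_eqVlt; apply/orP; left; apply/eqP.
  by move: (g'.+1%:R) g0 (y i i) => G G0 Y; field; rewrite gt_eqF.
have xb i j : `|x i j| <= nm V * nm V.
  rewrite /x ReE mxE; apply: (le_trans (ler_norm_sum _ _ _)).
  apply: (@le_trans _ _ (\sum_k (\sum_l `|V l i|) * `|V k j|)).
    apply: ler_sum => k _; rewrite normrM ler_wpM2r// mxE.
    apply: (le_trans (ler_norm_sum _ _ _)); apply: ler_sum => l _; rewrite !mxE normrM.
    rewrite -[leRHS]mulr1 ler_wpM2l// (le_trans (hRe l k))// invf_le1//.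
    by rewrite ler1n.
  have hs b : \sum_l `|V l b| <= nm V.
    by apply: ler_sum => l _; rewrite (bigD1 b)//= lerDl sumr_ge0.
  by rewrite -mulr_sumr; apply: ler_pM; rewrite ?sumr_ge0.
have z1 i : complex.Im (u1.1 i ord0) = \sum_j y i j * p j ord0.
  rewrite zE mxE ImD [X in _ + complex.Im X]mxE /= addr0 mxE Im_sum; apply: eq_bigr => j _.
  by rewrite ImM mxE /= mulr0 add0r.
have z2 i : complex.Re (u1.1 i ord0) = \sum_j x i j * p j ord0 + r i ord0.
  rewrite zE mxE ReD [X in _ + complex.Re X]mxE /=; congr (_ + _); rewrite mxE Re_sum; apply: eq_bigr => j _.
  by rewrite ReM mxE /= mulr0 subr0.
have gnP : 0 <= g'.+1%:R * (nm V * nm V) * P by rewrite mulr_ge0// mulr_ge0// ltW.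
split.
- move=> i; have := off i; have := y1 i; have := yp i; rewrite /y.
  move: (complex.Im (u1.2 i i)) (\sum_(j | _) _) => a b ? ? ?; split; lra.
- move=> i; rewrite z1; apply: (@le_lt_trans _ _ (\sum_j `|y i j| * P)).
    apply: (le_trans (ler_norm_sum _ _ _)); apply: ler_sum => j _; rewrite normrM ler_wpM2l//.
  rewrite -mulr_suml (bigD1 i)//= (ger0_norm (ltW (yp i))) -/(y i i).
  have h1 : (y i i + \sum_(j | j != i) `|y i j|) * P <= (y i i + y i i / 4) * P.
    by rewrite ler_wpM2r// lerD2l; exact: off.
  apply: (le_lt_trans h1); have := yp i; have : 0 <= y i i * P by rewrite mulr_ge0// ltW.
  by move: (y i i) => Y H1 H2; lra.
- by move=> i j; apply: (le_trans (xb i j)); rewrite lerDl addr_ge0.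
- move=> i; rewrite z2; apply: (le_trans (ler_normD _ _)).
  have h1 : `|\sum_j x i j * p j ord0| <= g'.+1%:R * (nm V * nm V) * P.
    apply: (le_trans (ler_norm_sum _ _ _)); rewrite -mulrA mulr_natl -[X in _ *+ X]card_ord -sumr_const.
    apply: ler_sum => j _; rewrite normrM; exact: ler_pM.
  by rewrite ler_wpDl//; exact: lerD.
Qed.
End Assembly.

(* The genus is g.+1, so that d_1 = d ord0 exists. *)
Theorem theorem8p10 (R : realType) (g : nat) (d : 'I_g.+1 -> nat)
    (N : nat) (c : 'I_N.+1 -> 'cV[R]_g.+1) (FD : set 'M[R[i]]_g.+1) :
  polarization_type d ->
  char_reps d c ->
  siegel_fund_for d FD ->
  (4 <= d ord0)%N ->
  (2 %| d ord0)%N || (3 %| d ord0)%N ->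
  exists U : set ('cV[R[i]]_g.+1 * 'M[R[i]]_g.+1),
    [/\ definable_pts U,
        open_in (@pts_space R g.+1) U,
        XD d FD `<=` U &
        definable_map_to_PP U (PhiD c)].
Proof.
move=> hd hc [mm [x [[hx _] FDE]]] d4 _.
have nz (z : 'cV[R[i]]_g.+1) tau : siegel_space tau -> exists l, theta_char (c l) 0 z tau != 0.
  by move=> ht; exact: (some_theta_neq0 z hd hc (leq_trans (isT : (2 <= 4)%N) d4) ht).
(* A common multiple of the d_i, so that L c_l is integral and all characteristics share one
   level. *)
pose L := (\prod_i d i)%N; have L0 : (0 < L)%N by rewrite prodn_gt0// => i; exact: hd.1.
have sbc l : SB L (ind (c l)).
  apply: SB_ind => //; have [k _ hk] := hc.1 l; apply: intv_coord => i.
  exists ((\prod_(j | j != i) d j)%N%:Z * k i ord0).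
  have e : (d i)%:R * c l i ord0 = (k i ord0)%:~R.
    have /matrixP/(_ i ord0) : Dmx R d *m c l = map_mx intr k.
      by rewrite -hk mulKVmx// Dmx_unit.
    by rewrite /Dmx mul_diag_mx !mxE.
  rewrite mxE intrM -e mulrA; congr (_ * _).
  by rewrite -[_%:~R]/((\prod_(j | j != i) d j)%N%:R) -natrM /L (bigD1 i)//= mulnC.
(* With g.+1 entries per row, this tolerance keeps the off-diagonal row sum below a quarter of the
   diagonal entry. *)
have eta0 : 0 < (4 * g.+1%:R : R)^-1 by rewrite invr_gt0 mulr_gt0// ltr0n.
have [If [V [c0 [c00 uV hV]]]] := diag_dominant g eta0.
have SpX i : Sp (x i) by case: (hx i).
pose Iw : finType := ('I_mm * If)%type.
pose W (w : Iw) := covW (x w.1) (V w.2).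
have SpW w : Sp (W w) := covW_Sp (SpX w.1) (uV w.2).
pose P (w : Iw) : R := Pb R d (x w.1) (V w.2).
have P0 w : 0 <= P w by exact: Pb_ge0.
pose Xb (w : Iw) : R := nm (map_mx (@ratr R) (V w.2)) * nm (map_mx (@ratr R) (V w.2)) +
  (g.+1%:R * (nm (map_mx (@ratr R) (V w.2)) * nm (map_mx (@ratr R) (V w.2))) * P w + P w).
have e00 : 0 < c0 / 4 by lra.
have B0 w : 0 < 2 * P w + 1 by have := P0 w; move: (P w) => p ?; lra.
have ch w := chart (Xb w) L0 sbc (Sp_Spinv (SpW w)) e00 (B0 w).
(* The index type of the cells varies with w; packing it with the family lets [choice] select both,
   and the total index is a finite sigma type. *)
pose good_chart w (s : {I : finType & I -> set ('cV[R[i]]_g.+1 * 'M[R[i]]_g.+1)}) :=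
  (forall i, nice c (projT2 s i)) /\
  forall u u1, siegel_space u.2 -> relM (map_mx ratr (Spinv (W w))) u u1 ->
    (forall i, \sum_(j | j != i) `|complex.Im (u1.2 i j)| < complex.Im (u1.2 i i) / 2 /\
       c0 / 4 < complex.Im (u1.2 i i)) ->
    (forall i, `|complex.Im (u1.1 i ord0)| < (2 * P w + 1) * complex.Im (u1.2 i i)) ->
    (forall i j, `|complex.Re (u1.2 i j)| <= Xb w) ->
    (forall i, `|complex.Re (u1.1 i ord0)| <= Xb w) -> exists i, projT2 s i u.
have ex w : exists s, good_chart w s.
  by have [I [U h]] := ch w; exists (existT _ I U).
have [F hF] := choice ex.
pose I : finType := {w : Iw & projT1 (F w)}.
pose U (i : I) := projT2 (F (projT1 i)) (projT2 i).
have hU i : nice c (U i) by exact: (hF _).1.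
have [D1 D2 D3] := nice_union hU nz.
exists [set u | exists i, U i u]; split=> //.
move=> u [hu]; rewrite FDE => -[i _ [tau0 ht0 e]] hE.
have [_ rY _ _] := ht0; have [f hf] := hV _ rY.
have [u1 [r1 u1E [p [r [zE hp hr]]]]] := cover_point (SpX i) (uV f) ht0 (esym e) hu hE.
have [b1 b2 b3 b4] := cover_bounds (Pb_ge0 R d (x i) (V f)) c00 ht0 u1E zE hp hr hf.
have [j hj] := (hF (i, f)).2 u u1 hu r1 b1 b2 b3 b4.
by exists (existT _ (i, f) j).
Qed.
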